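(* Assume the Generalized Lindelöf Hypothesis. Let $f = \sum_{n \ge 1} A(n) n^{\frac{k-1}{2}} q^n$ be a weight $k$ holomorphic cuspidal Hecke eigenform on $\mathrm{SL}(2,\mathbb{Z})$, normalized so that $A(1) = 1$. For any $\epsilon > 0$ there is an $X_0 = X_0(f,\epsilon)$ such that for all $X \ge X_0$ the following hold. (i) The sequence $\{A(n) : n = c^2 + d^2,\ (c,d) \in \mathbb{N}^2\}$ has at least one sign change among the indices $n = c^2 + d^2$ with $n \in [X, X + X^{\frac{1}{2}+\epsilon}]$. (ii) This sequence has at least $X^{\frac{1}{2}-\epsilon}$ sign changes in the interval $[X, 2X]$.
   Context: Here $q = e^{2\pi i z}$; the normalized coefficients $A(n)$ are real. The sequence $\{A(n) : n = c^2+d^2\}$ is indexed, in increasing order of $n$, by the positive integers $n$ that are sums of two integer squares ($\mathbb{N}$ includes $0$ here), i.e. those with $r_2(n) > 0$, where $r_2(n) = \#\{(c,d) \in \mathbb{Z}^2 : c^2+d^2 = n\}$. A real sequence has a sign change in an interval if there are two indices in the interval at which its terms are nonzero and of opposite signs. The number of sign changes in an interval is the number of sign changes between successive nonzero terms of the sequence with indices in the interval. The Generalized Lindelöf Hypothesis is the standard conjecture that every automorphic $L$-function $L(s)$ (normalized so that its functional equation relates $s$ and $1-s$), including Rankin–Selberg $L$-functions, satisfies $L(\tfrac12 + it) \ll_\epsilon (1+|t|)^{\epsilon}$ for every $\epsilon > 0$, as $|t| \to \infty$. The $L$-functions relevant here are the meromorphic continuations of $$L(s, f\otimes\theta^2)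 = L(2s,\chi_{-4}) \sum_{n\ge1} \frac{A(n) r_2(n)}{n^s}, \quad L(s, f\otimes f) = \zeta(2s)\sum_{n \ge 1}\frac{A^2(n)}{n^s}, \quad L(s, f\otimes f\otimes\chi_{-4}) = L(2s,\chi_{-4})\sum_{n\ge1}\frac{\chi_{-4}(n)A^2(n)}{n^s},$$ where $\chi_{-4}$ is the nontrivial Dirichlet character modulo $4$. *)

(* Defs.v *)
From Stdlib Require Import Reals ZArith Arith List ClassicalEpsilon.
From Coquelicot Require Import Coquelicot.
Import ListNotations.
Open Scope R_scope.

(** * Complex analysis *)

Definition Cexp (z : C) : C :=
  (exp (Re z) * cos (Im z), exp (Re z) * sin (Im z)).

Definition C_differentiable (f : C -> C) (z : C) : Prop :=
  @ex_derive C_AbsRing C_NormedModule f z.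

Definition holomorphic_at (f : C -> C) (s : C) : Prop :=
  exists r : R, 0 < r /\ forall w : C, Cmod (w - s) < r -> C_differentiable f w.

Definition pole_at (f : C -> C) (s : C) : Prop :=
  exists (r : R) (m : nat) (g : C -> C),
    0 < r /\ (0 < m)%nat /\ holomorphic_at g s /\ g s <> RtoC 0 /\
    forall w : C, 0 < Cmod (w - s) < r -> (f w * (w - s) ^ m)%C = g w.

(** Meromorphic functions are total functions; the value at a pole is
    arbitrary. Removable singularities are not allowed: away from its poles
    such a function has its holomorphic values. *)
Definition meromorphic (f : C -> C) : Prop :=
  forall s : C, holomorphic_at f s \/ pole_at f s.

(** * Modular forms of level one *)

Definition upper_half_plane (z : C) : Prop := 0 < Im z.

Definition qpar (z : C) : C := Cexp (RtoC (2 * PI) * Ci * z)%C.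

(** [f] is the sum of [a n * q ^ n] over [n >= 1]; the value [a 0] is not used. *)
Definition cuspidal_expansion (f : C -> C) (a : nat -> C) : Prop :=
  forall z : C, upper_half_plane z ->
    @is_series C_AbsRing C_NormedModule
      (fun n => (a (S n) * qpar z ^ S n)%C) (f z).

Definition modular_weight (k : nat) (f : C -> C) : Prop :=
  forall a b c d : Z, (a * d - b * c)%Z = 1%Z ->
  forall z : C, upper_half_plane z ->
    f ((RtoC (IZR a) * z + RtoC (IZR b)) / (RtoC (IZR c) * z + RtoC (IZR d)))%C
    = ((RtoC (IZR c) * z + RtoC (IZR d)) ^ k * f z)%C.

Definition cusp_form (k : nat) (f : C -> C) : Prop :=
  (forall z : C, upper_half_plane z -> C_differentiable f z) /\
  modular_weight k f /\
  exists a : nat -> C, cuspidal_expansion f a.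

(** [n ^ (k - 1) * sum over e d = n of d ^ (- k) * sum over 0 <= b < d of
    f ((e z + b) / d)], using [n ^ (k - 1) * d ^ (- k) = e ^ k / n]. *)
Definition hecke_operator (k n : nat) (f : C -> C) (z : C) : C :=
  (/ RtoC (INR n) *
   @sum_n_m C_AbelianMonoid (fun d =>
     if (n mod d =? 0)%nat then
       (RtoC (INR (n / d)) ^ k *
        @sum_n C_AbelianMonoid
          (fun b => f ((RtoC (INR (n / d)) * z + RtoC (INR b)) / RtoC (INR d))%C)
          (pred d))%C
     else RtoC 0) 1 n)%C.

Definition cuspidal_hecke_eigenform (k : nat) (f : C -> C) : Prop :=
  cusp_form k f /\
  (exists z : C, upper_half_plane z /\ f z <> RtoC 0) /\
  forall n : nat, (0 < n)%nat ->
    exists lambda : C, forall z : C, upper_half_plane z ->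
      hecke_operator k n f z = (lambda * f z)%C.

(** [f] is an eigenform with [A 1 = 1] and with expansion
    [sum over n >= 1 of A n * n ^ ((k - 1) / 2) * q ^ n]. *)
Definition normalized_eigenform (k : nat) (f : C -> C) (A : nat -> R) : Prop :=
  cuspidal_hecke_eigenform k f /\
  cuspidal_expansion f
    (fun n => RtoC (A n * Rpower (INR n) ((INR k - 1) / 2))) /\
  A 1%nat = 1.

(** * L-functions *)

Definition chi4 (n : nat) : R :=
  match (n mod 4)%nat with
  | 1%nat => 1
  | 3%nat => -1
  | _ => 0
  end.

(** All integer solutions of [c ^ 2 + d ^ 2 = n] lie in the box [[-n, n]]. *)
Definition r2 (n : nat) : nat :=
  let box := map (fun i => (Z.of_nat i - Z.of_nat n)%Z) (seq 0 (2 * n + 1)) in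
  length (filter (fun p => (fst p * fst p + snd p * snd p =? Z.of_nat n)%Z)
                 (list_prod box box)).

Definition dirichlet_series (a : nat -> R) (s v : C) : Prop :=
  @is_series C_AbsRing C_NormedModule
    (fun n => (RtoC (a (S n)) * Cexp (- (s * RtoC (ln (INR (S n))))))%C) v.

(** [L] is the meromorphic continuation of the product of the Dirichlet series
    of [a] at [2 s] and of [b] at [s], initially given on [Re s > 1]. *)
Definition continuation_of (a b : nat -> R) (L : C -> C) : Prop :=
  meromorphic L /\
  forall s : C, 1 < Re s ->
    exists u v : C,
      dirichlet_series a (RtoC 2 * s)%C u /\ dirichlet_series b s v /\
      L s = (u * v)%C.

Definition lindelof_bound (L : C -> C) : Prop :=
  forall eps : R, 0 < eps ->
    exists M T : R, forall t : R, T <= Rabs t ->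
      Cmod (L (1 / 2, t)) <= M * Rpower (1 + Rabs t) eps.

Definition L_f_theta2 (A : nat -> R) : (C -> C) -> Prop :=
  continuation_of chi4 (fun n => A n * INR (r2 n)).

Definition L_f_f (A : nat -> R) : (C -> C) -> Prop :=
  continuation_of (fun _ => 1) (fun n => A n ^ 2).

Definition L_f_f_chi4 (A : nat -> R) : (C -> C) -> Prop :=
  continuation_of chi4 (fun n => chi4 n * A n ^ 2).

(** The Generalized Lindelöf Hypothesis for the Rankin-Selberg L-functions
    [L(s, f x theta ^ 2)], [L(s, f x f)] and [L(s, f x f x chi4)], for all
    level one eigenforms [f]. *)
Definition generalized_lindelof : Prop :=
  forall (k : nat) (f : C -> C) (A : nat -> R),
    normalized_eigenform k f A ->
    forall L : C -> C,
      L_f_theta2 A L \/ L_f_f A L \/ L_f_f_chi4 A L -> lindelof_bound L.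

(** * Sign changes *)

Definition sum_of_two_squares (n : nat) : Prop :=
  (0 < n)%nat /\ exists c d : nat, n = (c ^ 2 + d ^ 2)%nat.

(** Below, [I] is the set of indices of the sequence [A]. *)

Definition has_sign_change (I : nat -> Prop) (A : nat -> R) (x y : R) : Prop :=
  exists m n : nat,
    (I m /\ x <= INR m <= y) /\ (I n /\ x <= INR n <= y) /\ A m < 0 < A n.

(** The nonzero terms with index in [[x, y]], in increasing order of the index;
    [up y] bounds these indices. *)
Definition nonzero_terms (I : nat -> Prop) (A : nat -> R) (x y : R) : list R :=
  map A
    (filter (fun n =>
       if excluded_middle_informative (I n /\ x <= INR n <= y /\ A n <> 0)
       then true else false)
     (seq 0 (Z.to_nat (up y)))).

Fixpoint count_sign_changes (l : list R) : nat :=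
  match l with
  | u :: ((v :: _) as l') =>
      ((if Rlt_dec (u * v) 0 then 1 else 0) + count_sign_changes l')%nat
  | _ => 0%nat
  end.

Definition nb_sign_changes (I : nat -> Prop) (A : nat -> R) (x y : R) : nat :=
  count_sign_changes (nonzero_terms I A x y).

(* Main.v *)
(** The sequence [A] is multiplicative, and two facts about it drive the proof.
    First, some square [a] has [A a < 0]: otherwise [A n ^ 2] would dominate the number of divisors of [n], against the mean square bound
    coming from the boundedness of [y^(k/2) |f|].
    Second, [A n <> 0] as soon as 3 divides neither [n] nor the sum of the divisors of [n]. For the periods of [f], being complex numbers not all
    zero, admit a functional modulo 3 that respects their integral relations; if [A n = 0] it is killed by the [n]-th Hecke operator,
    and a devissage along the invariant form [X^3 Y - X Y^3] shows that such a functional is Eisenstein, with Hecke eigenvalue the sum of the divisors.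
    In particular [A p <> 0] for the primes [p = 1 mod 12], which are sums of two squares, and [A (j^6) <> 0] for [j] prime to 3.

    Suppose that [A] has constant sign on the sums of two squares in the short interval. The integers [b j1^6 (j^6 p) (j'^6 p')], with [b] in
    [{1, a}] and [p], [p'] in dyadic ranges below [X^(1/2)], are detected there by a Fejer kernel in the logarithm.
    The frequencies with large ordinate are negligible, by van der Corput's method for the sums over [j] and the large sieve for those over [p],
    so that the signed bilinear form is as large as the unsigned one for every choice of [b] and [j1]. Cauchy-Schwarz turns its spectral
    expansion into a measure of mass about 1 on the frequencies whose Fourier transform at [ln (b j1^6)] is about [sgn (A (b j1^6))].
    Averaging the value at [j1^12] over [j1] concentrates this measure on frequencies so small that passing from [b = 1] to [b = a]
    cannot reverse the sign, contradicting [A a < 0].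

    The count over [[X, 2 X]] comes from cutting it into disjoint short intervals. *)

(* About the signs of [A] at primes the analysis knows only multiplicativity, so every sum that is
   estimated is unsigned; signs enter through the positivity of the kernel and Cauchy-Schwarz.
   Resolving an interval of length [X^(1/2+eps)] takes about [X^(1/2-eps)] frequencies. Primes
   slightly larger than that cost the large sieve a factor [X^dl] with [dl] as small as desired, and
   any fixed power saved by the sums over [j] pays for it. The range of [6 ln j] is exactly one
   period of the kernel: at each nonzero frequency the integral of the phase vanishes, and no
   secondary main term survives. All [j] are 1 modulo a large factorial, so that common factors are
   large, hence rare; this provides the coprimality that multiplicativity requires. Sixth powers
   serve twice: they are squares, and their divisor sum is 1 modulo 3 when 3 does not divide [j].
   Modulo 3 the functionals left by the devissage live on the four points of a projective line, few
   enough to be computed by hand. *)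
Require Import Defs.
From Stdlib Require Import Reals ZArith Arith List Lra Lia Psatz ClassicalEpsilon Permutation Znumtheory.
From Coquelicot Require Import Coquelicot.
Import ListNotations.
Open Scope R_scope.

(** * Finite sums *)

Tactic Notation "have" ident(H) ":" lconstr(T) := assert (H : T).
Tactic Notation "have" ident(H) ":" lconstr(T) "by" tactic3(t) := assert (H : T) by t.
Tactic Notation "have" ident(H) ":=" lconstr(p) := pose proof p as H.
Tactic Notation "via" uconstr(x) := etransitivity; [apply x|].

Fixpoint Rsum {A : Type} (l : list A) (f : A -> R) : R :=
  match l with [] => 0 | x :: l' => f x+Rsum l' f end.

Fixpoint Csum {A : Type} (l : list A) (f : A -> C) : C :=
  match l with [] => RtoC 0 | x :: l' => (f x+Csum l' f)%C end.

Section RsumTheory.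

Context {A B : Type}.
Implicit Types (l : list A) (f g : A -> R).

Lemma Rsum_ext l f g : (forall x, In x l -> f x = g x) -> Rsum l f = Rsum l g.
Proof.
induction l as [|a l IH]; intros H; simpl; [easy|]. rewrite (H a) by (left; easy). rewrite IH; [easy|]. intros x Hx; apply H; right; exact Hx.
Qed.

Lemma Rsum_le l f g : (forall x, In x l -> f x <= g x) -> Rsum l f <= Rsum l g.
Proof.
induction l as [|a l IH]; intros H; simpl; [lra|]. apply Rplus_le_compat; [apply H; left; easy|]. apply IH; intros x Hx; apply H; right; exact Hx.
Qed.

Lemma Rsum_nonneg l f : (forall x, In x l -> 0 <= f x) -> 0 <= Rsum l f.
Proof.
induction l as [|a l IH]; intros H; simpl; [lra|]. assert (0 <= f a) by (apply H; left; easy).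
assert (0 <= Rsum l f) by (apply IH; intros x Hx; apply H; right; exact Hx). lra.
Qed.

Lemma Rsum_plus l f g : Rsum l (fun x => f x+g x) = Rsum l f+Rsum l g.
Proof. induction l as [|a l IH]; simpl; [lra|rewrite IH; lra]. Qed.

Lemma Rsum_minus l f g : Rsum l (fun x => f x-g x) = Rsum l f-Rsum l g.
Proof. induction l as [|a l IH]; simpl; [lra|rewrite IH; lra]. Qed.

Lemma Rsum_scal l f c : Rsum l (fun x => c*f x) = c*Rsum l f.
Proof. induction l as [|a l IH]; simpl; [lra|rewrite IH; lra]. Qed.

Lemma Rsum_scal_r l f c : Rsum l (fun x => f x*c) = Rsum l f*c.
Proof. induction l as [|a l IH]; simpl; [lra|rewrite IH; lra]. Qed.

Lemma Rsum_const l c : Rsum l (fun _ => c) = INR (length l)*c.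
Proof.
induction l as [|a l IH]; [simpl; lra|]. change (length (a :: l)) with (S (length l)). rewrite S_INR. simpl. rewrite IH. lra.
Qed.

Lemma Rsum_zero l f : (forall x, In x l -> f x = 0) -> Rsum l f = 0.
Proof.
intros H. rewrite (Rsum_ext l f (fun _ => 0)) by exact H. rewrite Rsum_const. lra.
Qed.

Lemma Rsum_app l1 l2 f : Rsum (l1 ++ l2) f = Rsum l1 f+Rsum l2 f.
Proof. induction l1 as [|a l IH]; simpl; [lra|rewrite IH; lra]. Qed.

Lemma Rsum_perm l1 l2 f : Permutation l1 l2 -> Rsum l1 f = Rsum l2 f.
Proof. induction 1; simpl; lra. Qed.

Lemma Rsum_abs l f : Rabs (Rsum l f) <= Rsum l (fun x => Rabs (f x)).
Proof.
induction l as [|a l IH]; simpl; [rewrite Rabs_R0; lra|]. etransitivity; [apply Rabs_triang|lra].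
Qed.

Lemma Rsum_filter l f (p : A -> bool) :
  Rsum (filter p l) f = Rsum l (fun x => if p x then f x else 0).
Proof.
induction l as [|a l IH]; simpl; [easy|]. destruct (p a); simpl; rewrite IH; lra.
Qed.

Lemma Rsum_map (h : B -> A) (l : list B) f : Rsum (map h l) f = Rsum l (fun x => f (h x)).
Proof. induction l as [|a l IH]; simpl; [easy|rewrite IH; easy]. Qed.

Lemma Rsum_In_le l f x : (forall y, In y l -> 0 <= f y) -> In x l -> f x <= Rsum l f.
Proof.
induction l as [|a l IH]; intros H Hx; [destruct Hx|]. simpl. assert (0 <= f a) by (apply H; left; easy).
assert (0 <= Rsum l f) by (apply Rsum_nonneg; intros y Hy; apply H; right; exact Hy). destruct Hx as [<-|Hx]; [lra|].
assert (f x <= Rsum l f) by (apply IH; [intros y Hy; apply H; right; exact Hy|exact Hx]). lra.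
Qed.

End RsumTheory.

Lemma Rsum_swap {A B} (l : list A) (l' : list B) (f : A -> B -> R) :
  Rsum l (fun x => Rsum l' (fun y => f x y)) = Rsum l' (fun y => Rsum l (fun x => f x y)).
Proof.
induction l as [|a l IH]; simpl.
- symmetry; apply Rsum_zero; easy.
- rewrite IH, <- Rsum_plus. easy.
Qed.

Lemma Rsum_prod {A B} (l : list A) (l' : list B) (f : A*B -> R) :
  Rsum (list_prod l l') f = Rsum l (fun x => Rsum l' (fun y => f (x, y))).
Proof.
induction l as [|a l IH]; simpl; [easy|]. rewrite Rsum_app, IH, Rsum_map. easy.
Qed.

Lemma Rsum_incl {A} (l l' : list A) f :
  NoDup l -> incl l l' -> (forall x, In x l' -> 0 <= f x) -> Rsum l f <= Rsum l' f.
Proof.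
revert l'. induction l as [|a l IH]; intros l' Hn Hi Hf; simpl.
- apply Rsum_nonneg; exact Hf.
- inversion Hn as [|? ? Ha Hn']; subst. destruct (in_split a l') as (l1 & l2 & ->); [apply Hi; left; easy|]. rewrite Rsum_app; simpl.
  assert (Rsum l f <= Rsum (l1 ++ l2) f) as H.
  { apply IH; [exact Hn'| |].
    - intros x Hx. assert (In x (l1 ++ a :: l2)) as H by (apply Hi; right; exact Hx). apply in_app_iff in H. apply in_app_iff.
      destruct H as [H|[H|H]]; [left; exact H| |right; exact H]. subst; contradiction.
    - intros x Hx. apply Hf. apply in_app_iff in Hx. apply in_app_iff. simpl. tauto. }
  rewrite Rsum_app in H. lra.
Qed.

(* The discriminant of [t -> sum (t f-g)^2]. *)
Lemma Rsum_CS {A} (l : list A) (f g : A -> R) :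
  Rsum l (fun x => f x*g x)^2 <= Rsum l (fun x => f x^2)*Rsum l (fun x => g x^2).
Proof.
set (a := Rsum l (fun x => f x^2)). set (b := Rsum l (fun x => f x*g x)). set (c := Rsum l (fun x => g x^2)).
have H : forall t, 0 <= t^2*a-2*t*b+c.
{ intros t. replace (t^2*a-2*t*b+c) with (Rsum l (fun x => (t*f x-g x)^2)).
  - apply Rsum_nonneg; intros; apply pow2_ge_0.
  - unfold a, b, c. rewrite <- !Rsum_scal, <- Rsum_minus, <- Rsum_plus. apply Rsum_ext; intros; ring. }
assert (0 <= a) by (apply Rsum_nonneg; intros; apply pow2_ge_0). assert (0 <= c) by (apply Rsum_nonneg; intros; apply pow2_ge_0). destruct (Req_dec a 0) as [Ha|Ha].
- destruct (Req_dec b 0) as [Hb|Hb]; [rewrite Hb; nra|]. specialize (H ((c+1)/(2*b))). rewrite Ha in H.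
  replace (2*((c+1)/(2*b))*b) with (c+1) in H by (field; exact Hb). lra.
- specialize (H (b/a)). replace ((b/a)^2*a-2*(b/a)*b+c) with (c-b^2/a) in H by (field; exact Ha). assert (b^2/a*a = b^2) by (field; exact Ha). nra.
Qed.

Lemma Rsum_CS_abs {A} (l : list A) (f g : A -> R) a b :
  Rsum l (fun x => f x^2) <= a^2 -> Rsum l (fun x => g x^2) <= b^2 ->
  0 <= a -> 0 <= b -> Rsum l (fun x => f x*g x) <= a*b.
Proof.
intros H1 H2 Ha Hb. apply Rsqr_incr_0_var; [|nra]. unfold Rsqr. have H := Rsum_CS l f g.
assert (0 <= Rsum l (fun x => f x^2)) by (apply Rsum_nonneg; intros; apply pow2_ge_0).
assert (0 <= Rsum l (fun x => g x^2)) by (apply Rsum_nonneg; intros; apply pow2_ge_0). assert (Rsum l (fun x => f x^2)*Rsum l (fun x => g x^2) <= a^2*b^2)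
  by (apply Rmult_le_compat; assumption).
nra.
Qed.

Section CsumTheory.

Context {A B : Type}.
Implicit Types (l : list A) (f g : A -> C).

Lemma Csum_ext l f g : (forall x, In x l -> f x = g x) -> Csum l f = Csum l g.
Proof.
induction l as [|a l IH]; intros H; simpl; [easy|]. rewrite (H a) by (left; easy). rewrite IH; [easy|]. intros x Hx; apply H; right; exact Hx.
Qed.

Lemma Csum_plus l f g : Csum l (fun x => f x+g x)%C = (Csum l f+Csum l g)%C.
Proof. induction l as [|a l IH]; simpl; [ring|rewrite IH; ring]. Qed.

Lemma Csum_minus l f g : Csum l (fun x => f x-g x)%C = (Csum l f-Csum l g)%C.
Proof. induction l as [|a l IH]; simpl; [ring|rewrite IH; ring]. Qed.

Lemma Csum_scal l f c : Csum l (fun x => c*f x)%C = (c*Csum l f)%C.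
Proof. induction l as [|a l IH]; simpl; [ring|rewrite IH; ring]. Qed.

Lemma Csum_scal_r l f c : Csum l (fun x => f x*c)%C = (Csum l f*c)%C.
Proof. induction l as [|a l IH]; simpl; [ring|rewrite IH; ring]. Qed.

Lemma Csum_const l c : Csum l (fun _ => c) = (RtoC (INR (length l))*c)%C.
Proof.
induction l as [|a l IH]; [simpl; ring|]. change (length (a :: l)) with (S (length l)). rewrite S_INR, RtoC_plus. simpl. rewrite IH. ring.
Qed.

Lemma Csum_zero l f : (forall x, In x l -> f x = RtoC 0) -> Csum l f = RtoC 0.
Proof.
intros H. rewrite (Csum_ext l f (fun _ => RtoC 0)) by exact H. rewrite Csum_const. ring.
Qed.

Lemma Csum_app l1 l2 f : Csum (l1 ++ l2) f = (Csum l1 f+Csum l2 f)%C.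
Proof. induction l1 as [|a l IH]; simpl; [ring|rewrite IH; ring]. Qed.

Lemma Csum_perm l1 l2 f : Permutation l1 l2 -> Csum l1 f = Csum l2 f.
Proof.
induction 1; simpl; [easy|rewrite IHPermutation; easy|ring|]. rewrite IHPermutation1; exact IHPermutation2.
Qed.

Lemma Cmod_Csum l f : Cmod (Csum l f) <= Rsum l (fun x => Cmod (f x)).
Proof.
induction l as [|a l IH]; simpl; [rewrite Cmod_0; lra|]. etransitivity; [apply Cmod_triangle|lra].
Qed.

Lemma Csum_map (h : B -> A) (l : list B) f : Csum (map h l) f = Csum l (fun x => f (h x)).
Proof. induction l as [|a l IH]; simpl; [easy|rewrite IH; easy]. Qed.

Lemma Csum_conj l f : Cconj (Csum l f) = Csum l (fun x => Cconj (f x)).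
Proof.
induction l as [|a l IH]; simpl; [unfold Cconj; simpl; rewrite Ropp_0; easy|]. rewrite Cplus_conj, IH. easy.
Qed.

Lemma Csum_RtoC l (f : A -> R) : Csum l (fun x => RtoC (f x)) = RtoC (Rsum l f).
Proof. induction l as [|a l IH]; simpl; [easy|rewrite IH, RtoC_plus; easy]. Qed.

Lemma Re_Csum l f : Re (Csum l f) = Rsum l (fun x => Re (f x)).
Proof. induction l as [|a l IH]; simpl; [easy|rewrite <- IH; easy]. Qed.

Lemma Im_Csum l f : Im (Csum l f) = Rsum l (fun x => Im (f x)).
Proof. induction l as [|a l IH]; simpl; [easy|rewrite <- IH; easy]. Qed.

End CsumTheory.

Lemma Csum_swap {A B} (l : list A) (l' : list B) (f : A -> B -> C) :
  Csum l (fun x => Csum l' (fun y => f x y)) = Csum l' (fun y => Csum l (fun x => f x y)).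
Proof.
induction l as [|a l IH]; simpl.
- symmetry; apply Csum_zero; easy.
- rewrite IH, <- Csum_plus. easy.
Qed.

Lemma Csum_prod {A B} (l : list A) (l' : list B) (f : A*B -> C) :
  Csum (list_prod l l') f = Csum l (fun x => Csum l' (fun y => f (x, y))).
Proof.
induction l as [|a l IH]; simpl; [easy|]. rewrite Csum_app, IH, Csum_map. easy.
Qed.

Lemma Csum_mult {A B} (l : list A) (l' : list B) f g :
  (Csum l f*Csum l' g)%C = Csum l (fun x => Csum l' (fun y => f x*g y)%C).
Proof.
rewrite <- Csum_scal_r. apply Csum_ext; intros x _. rewrite Csum_scal. easy.
Qed.

Lemma Csum_seq_S (n : nat) a f : Csum (seq a (S n)) f = (Csum (seq a n) f+f (a+n)%nat)%C.
Proof. rewrite seq_S, Csum_app. simpl. ring. Qed.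

Lemma Rsum_seq_S (n : nat) a f : Rsum (seq a (S n)) f = Rsum (seq a n) f+f (a+n)%nat.
Proof. rewrite seq_S, Rsum_app. simpl. ring. Qed.

Lemma Csum_seq_shift a b n f :
  Csum (seq (a+b) n) f = Csum (seq a n) (fun i => f (i+b)%nat).
Proof.
revert a. induction n as [|n IH]; intros a; simpl; [easy|]. f_equal. apply (IH (S a)).
Qed.

Lemma Rsum_seq_shift a b n f :
  Rsum (seq (a+b) n) f = Rsum (seq a n) (fun i => f (i+b)%nat).
Proof.
revert a. induction n as [|n IH]; intros a; simpl; [easy|]. f_equal. apply (IH (S a)).
Qed.

Lemma Rsum_telescope (g : nat -> R) a n :
  Rsum (seq a n) (fun i => g (S i)-g i) = g (a+n)%nat-g a.
Proof.
induction n as [|n IH]; [simpl; rewrite Nat.add_0_r; lra|]. rewrite Rsum_seq_S, IH, Nat.add_succ_r. lra.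
Qed.

(** * The unit circle *)

Definition ce (x : R) : C := (cos x, sin x).

Lemma ce_plus x y : ce (x+y) = (ce x*ce y)%C.
Proof. unfold ce, Cmult; simpl. rewrite cos_plus, sin_plus. f_equal; ring. Qed.

Lemma ce_0 : ce 0 = RtoC 1.
Proof. unfold ce, RtoC. rewrite cos_0, sin_0. easy. Qed.

Lemma ce_conj x : Cconj (ce x) = ce (- x).
Proof. unfold ce, Cconj; simpl. rewrite cos_neg, sin_neg. easy. Qed.

Lemma ce_opp x : (ce x*ce (- x))%C = RtoC 1.
Proof. rewrite <- ce_plus, Rplus_opp_r. apply ce_0. Qed.

Lemma Cmod_ce x : Cmod (ce x) = 1.
Proof.
unfold Cmod, ce; simpl. rewrite !Rmult_1_r. replace (cos x*cos x+sin x*sin x) with 1; [apply sqrt_1|]. have H := sin2_cos2 x. unfold Rsqr in H. lra.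
Qed.

Lemma ce_minus x y : ce (x-y) = (ce x*Cconj (ce y))%C.
Proof. rewrite ce_conj, <- ce_plus. easy. Qed.

Lemma ce_pow x n : (ce x^n)%C = ce (INR n*x).
Proof.
induction n as [|n IH]; [simpl; rewrite Rmult_0_l, ce_0; easy|]. rewrite Cpow_S, IH, S_INR, <- ce_plus. f_equal. ring.
Qed.

Lemma ce_2PI_nat n : ce (2*PI*INR n) = RtoC 1.
Proof.
induction n as [|n IH].
- simpl. rewrite Rmult_0_r. apply ce_0.
- rewrite S_INR. replace (2*PI*(INR n+1)) with (2*PI*INR n+2*PI) by ring. have H : ce (2*PI) = RtoC 1 by (unfold ce, RtoC; rewrite cos_2PI, sin_2PI; easy).
  rewrite ce_plus, IH, H. ring.
Qed.

Lemma Cmod_1_ce x : Cmod (1-ce x)^2 = 2-2*cos x.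
Proof.
rewrite Cmod2_alt. unfold ce; simpl. have H := sin2_cos2 x. unfold Rsqr in H. nra.
Qed.

(** The chord has length [2 |sin ((x-y)/2)|]; when the half angle exceeds 1 the trivial bound on the
    sine suffices. *)
Lemma ce_dist x y : Cmod (ce x-ce y) <= Rabs (x-y).
Proof.
apply Rsqr_incr_0_var; [|apply Rabs_pos]. rewrite <- Rsqr_abs. unfold Rsqr. replace (ce x-ce y)%C with (ce y * - (1-ce (x-y)))%C.
2:{ rewrite ce_minus. replace (ce y * - (1-ce x*Cconj (ce y)))%C with
    (ce x*(ce y*Cconj (ce y))-ce y)%C by ring. rewrite ce_conj, ce_opp. ring. }
rewrite Cmod_mult, Cmod_ce, Cmod_opp. replace (1*_*(1*_)) with (Cmod (1-ce (x-y))^2) by ring. rewrite Cmod_1_ce. set (t := x-y).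
replace (cos t) with (1-2*sin (t/2)*sin (t/2)). 2:{ rewrite <- cos_2a_sin. f_equal. field. }
assert (Rabs (sin (t/2)) <= Rabs (t/2)) as H.
{ destruct (Rcase_abs (t/2)) as [Hn|Hp].
  - rewrite (Rabs_left (t/2)) by exact Hn. rewrite <- (Ropp_involutive (t/2)) at 1. rewrite sin_neg, Rabs_Ropp. assert (0 < - (t/2)) by lra.
    pose proof (SIN_bound (- (t/2))). destruct (Rle_dec (- (t/2)) 1).
    + rewrite Rabs_right; [left; apply sin_lt_x; lra|]. apply Rle_ge, sin_ge_0; [lra|pose proof PI2_1; lra].
    + apply Rle_trans with 1; [apply Rabs_le; lra|lra].
  - rewrite (Rabs_right (t/2)) by exact Hp. destruct (Req_dec (t/2) 0) as [->|Hz]; [rewrite sin_0, Rabs_R0; lra|]. pose proof (SIN_bound (t/2)).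
    destruct (Rle_dec (t/2) 1).
    + rewrite Rabs_right; [left; apply sin_lt_x; lra|]. apply Rle_ge, sin_ge_0; [lra|pose proof PI2_1; lra].
    + apply Rle_trans with 1; [apply Rabs_le; lra|lra]. }
pose proof (Rabs_pos (sin (t/2))). assert (Rabs (sin (t/2))*Rabs (sin (t/2)) <= Rabs (t/2)*Rabs (t/2)) as H1
  by (apply Rmult_le_compat; lra).
rewrite <- !Rabs_mult in H1. rewrite !Rabs_right in H1 by nra. nra.
Qed.

Ltac pos :=
  first
  [ assumption
  | lra
  | match goal with
    | |- _ <> 0 => apply Rgt_not_eq; solve [pos]
    | |- _ > 0 => apply Rlt_gt; pos
    | |- _ >= 0 => apply Rle_ge; pos
    | |- 0 < _*_ => apply Rmult_lt_0_compat; pos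
    | |- 0 < _/_ => apply Rdiv_lt_0_compat; pos
    | |- 0 < / _ => apply Rinv_0_lt_compat; pos
    | |- 0 < _^_ => apply pow_lt; pos
    | |- 0 < exp _ => apply exp_pos
    | |- 0 < Rpower _ _ => apply exp_pos
    | |- 0 < sqrt _ => apply sqrt_lt_R0; pos
    | |- 0 < INR _ => apply lt_0_INR; lia
    | |- 0 < _+_ => first [apply Rplus_lt_le_0_compat; solve [pos] | apply Rplus_le_lt_0_compat; solve [pos]]
    | |- 0 <= INR _ => apply pos_INR
    | |- 0 <= Rabs _ => apply Rabs_pos
    | |- 0 <= sqrt _ => apply sqrt_pos
    | |- 0 <= Cmod _ => apply Cmod_ge_0
    | |- 0 <= _^2 => apply pow2_ge_0
    | |- 0 <= _^_ => apply pow_le; pos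
    | |- 0 <= ?x * ?x => apply Rle_0_sqr
    | |- 0 <= _*_ => apply Rmult_le_pos; pos
    | |- 0 <= _/_ => apply Rdiv_le_0_compat; pos
    | |- 0 <= / _ => left; pos
    | |- 0 <= exp _ => left; pos
    | |- 0 <= Rpower _ _ => left; pos
    | |- 0 <= _+_ => apply Rplus_le_le_0_compat; pos
    | |- 0 <= Rsum _ _ => apply Rsum_nonneg; intros; pos
    end ].

Ltac mono :=
  first
  [ assumption
  | lra
  | apply Rle_refl
  | match goal with
    | |- 0 <= _ => pos
    | |- 0 < _ => pos
    | |- _+_ <= _+_ => apply Rplus_le_compat; solve [mono]
    | |- _*_ <= _*_ => first
        [ apply Rmult_le_compat_l; [solve [pos]|solve [mono]]
        | apply Rmult_le_compat_r; [solve [pos]|solve [mono]]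
        | apply Rmult_le_compat; [solve [pos]|solve [pos]|solve [mono]|solve [mono]] ]
    | |- _/_ <= _/_ => unfold Rdiv; mono
    | |- / _ <= / _ => apply Rinv_le_contravar; [solve [pos]|solve [mono]]
    | |- _^_ <= _^_ => apply pow_incr; split; [solve [pos]|solve [mono]]
    | |- INR _ <= INR _ => apply le_INR; lia
    | |- Rsum ?l _ <= Rsum ?l _ => apply Rsum_le; intros; mono
    end ].

Ltac fd := field; repeat split; pos.

Ltac sq :=
  intros; repeat match goal with H : In _ (seq _ _) |- _ => apply in_seq in H end;
  try apply in_seq; lia.

Ltac inr :=
  intros;
  repeat match goal with
  | H : (_ <= _)%nat |- _ => apply le_INR in H
  | H : (_ < _)%nat |- _ => apply lt_INR in H
  end;
  rewrite ?S_INR, ?plus_INR, ?mult_INR in *; simpl INR in *; first [lra | pos | mono | nra].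

Ltac alg :=
  intros;
  first
  [ ring
  | unfold Rdiv; ring
  | unfold Cdiv; ring
  | fd
  | apply injective_projections; simpl; first [ring | fd]
  | f_equal; first [ring | lra | lia | fd] ].

Ltac go :=
  intros; repeat apply conj;
  first
  [ assumption | lra | lia | pos | mono | ring | apply Rabs_le; lra | sq | congruence | easy | alg
  | rewrite Rabs_right; lra | tauto ].

Ltac cancel d :=
  apply Rmult_le_reg_r with d; [pos|]; unfold Rdiv; rewrite Rmult_assoc, Rinv_l by pos.

Ltac lmul := apply Rmult_le_compat_l; [pos|].

Ltac rmul := apply Rmult_le_compat_r; [pos|].

(** * Exponential sums with logarithmic phases *)

(** Up to [PI/3] the derivative is at least 1/2; beyond, the sine itself is at least 1/2 while
    [x <= 2]. *)
Lemma sin_lower x : 0 <= x <= PI/2 -> x/4 <= sin x.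
Proof.
intros [H0 H1]. have HP4 := PI_4. destruct (Rle_dec x (PI/3)) as [H|H].
- destruct (Req_dec x 0) as [->|Hx]; [rewrite sin_0; lra|]. destruct (MVT_cor2 sin cos 0 x) as (c & Hc & Hc').
  + lra.
  + intros; apply derivable_pt_lim_sin.
  + rewrite sin_0 in Hc.
    assert (1/2 <= cos c).
    { rewrite <- cos_PI3. apply cos_decr_1; lra. }
    nra.
- assert (sin (PI/6) <= sin x) by (apply sin_incr_1; lra). rewrite sin_PI6 in H2. lra.
Qed.

Lemma Cmod_1_ce_lower x : Rabs x <= PI -> Rabs x/4 <= Cmod (1-ce x).
Proof.
intros H. apply Rsqr_incr_0_var; [|pos]. unfold Rsqr. replace (Cmod (1-ce x)*Cmod (1-ce x)) with (Cmod (1-ce x)^2) by ring. rewrite Cmod_1_ce.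
have Hc : cos x = 1-2*sin (Rabs x/2)*sin (Rabs x/2).
{ rewrite <- cos_2a_sin. replace (2*(Rabs x/2)) with (Rabs x) by field. unfold Rabs. destruct (Rcase_abs x); [rewrite cos_neg|]; easy. }
rewrite Hc. pose proof (Rabs_pos x). assert (Rabs x/2/4 <= sin (Rabs x/2)) by (apply sin_lower; lra). nra.
Qed.

Definition cot (x : R) : R := cos x/sin x.

Lemma cot_decr x y : 0 < x -> x <= y -> y <= PI/2 -> cot y <= cot x.
Proof.
intros Hx Hxy Hy. assert (0 < sin x) by (apply sin_gt_0; lra). assert (0 < sin y) by (apply sin_gt_0; lra). apply Rminus_le. unfold cot.
replace (cos y/sin y-cos x/sin x) with (- (sin (y-x)/(sin x*sin y))). 2:{ rewrite sin_minus. fd. }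
assert (0 <= sin (y-x)) by (apply sin_ge_0; lra).
assert (0 <= sin (y-x)/(sin x*sin y)).
{ pos. }
lra.
Qed.

Lemma cot_bounds x : 0 < x <= PI/2 -> 0 <= cot x <= 4/x.
Proof.
intros Hx. assert (0 < sin x) by (apply sin_gt_0; lra). assert (0 <= cos x) by (apply cos_ge_0; lra). unfold cot. split; [pos|].
pose proof (sin_lower x ltac:(lra)). pose proof (COS_bound x). apply Rmult_le_reg_r with (sin x*x); [nra|]. replace (cos x/sin x*(sin x*x)) with (cos x*x) by fd.
replace (4/x*(sin x*x)) with (4*sin x) by fd. nra.
Qed.

(* [1/(1-e^(i d))] *)
Definition kcoef (d : R) : C := (1/2, cot (d/2)/2).

Lemma kcoef_spec d : 0 < d <= PI -> ((1-ce d)*kcoef d)%C = RtoC 1.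
Proof.
intros Hd. have Hs : sin (d/2) <> 0 by (apply Rgt_not_eq, sin_gt_0; lra). unfold ce. replace d with (2*(d/2)) at 1 2 by field.
rewrite cos_2a_sin, sin_2a. unfold kcoef, cot, RtoC, Cmult, Cminus, Cplus, Copp; simpl. have H2 := sin2_cos2 (d/2). unfold Rsqr in H2. apply injective_projections; simpl.
- etransitivity; [|exact H2]. fd.
- fd.
Qed.

Lemma Cmod_le_abs x y : Cmod (x, y) <= Rabs x+Rabs y.
Proof.
replace ((x, y) : C) with (RtoC x+RtoC y*Ci)%C.
- via Cmod_triangle. rewrite Cmod_mult, !Cmod_R, Cmod_Ci. lra.
- alg.
Qed.

(* Abel summation against [kcoef], whose imaginary part is monotone. *)
Lemma kusmin_landau (g : nat -> R) a n rho :
  0 < rho <= PI ->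
  (forall i, (a <= i < a+n)%nat -> rho <= g (S i)-g i <= PI) ->
  (forall i, (a <= i)%nat -> (S i < a+n)%nat ->
     g (S (S i))-g (S i) <= g (S i)-g i) ->
  Cmod (Csum (seq a n) (fun i => ce (g i))) <= 12/rho.
Proof.
intros Hrho Hd Hmon. have HP4 := PI_4.
have Hr : 3 <= 12/rho.
{ apply Rmult_le_reg_r with rho; [lra|]. unfold Rdiv. rewrite Rmult_assoc, Rinv_l; lra. }
destruct n as [|n]; [simpl; rewrite Cmod_0; lra|]. set (d := fun i => g (S i)-g i).
have Hcot : forall i, (a <= i < a+S n)%nat -> 0 <= cot (d i/2) <= 8/rho.
{ intros i Hi. specialize (Hd i Hi). fold (d i) in Hd. destruct (cot_bounds (d i/2)) as [H1 H2]; [lra|]. split; [lra|]. via H2. replace (4/(d i/2)) with (8/d i) by fd.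
  mono. }
have Hstep : forall i, (a <= i < a+S n)%nat ->
          (ce (g i)+ce (g (S i))*kcoef (d i))%C = (ce (g i)*kcoef (d i))%C.
{ intros i Hi. specialize (Hd i Hi). have Hk := kcoef_spec (d i) ltac:(unfold d; lra). replace (g (S i)) with (g i+d i) by (unfold d; ring). rewrite ce_plus.
  transitivity (ce (g i)*((1-ce (d i))*kcoef (d i))+ce (g i)*ce (d i)*kcoef (d i))%C.
  - rewrite Hk. ring.
  - ring. }
(* The increments of [kcoef] are purely imaginary and, the differences of [g] being decreasing, all
   of one sign; their moduli therefore telescope. *)
have H : forall m, (m <= n)%nat ->
   Cmod (Csum (seq a (S m)) (fun i => ce (g i))+ce (g (a+S m)%nat)*kcoef (d (a+m)%nat))
   <= 1/2+cot (d (a+m)%nat/2)/2.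
{ induction m as [|m IH]; intros Hm.
  - cbn [seq Csum]. rewrite Nat.add_0_r. rewrite Cplus_0_r. replace (a+1)%nat with (S a) by lia. rewrite Hstep by lia. rewrite Cmod_mult, Cmod_ce, Rmult_1_l.
    unfold kcoef. via Cmod_le_abs. pose proof (Hcot a ltac:(lia)). rewrite !Rabs_right by lra. lra.
  - rewrite Csum_seq_S. replace (a+S (S m))%nat with (S (a+S m)) by lia. replace (Csum (seq a (S m)) (fun i => ce (g i))+ce (g (a+S m)%nat) +
       ce (g (S (a+S m)))*kcoef (d (a+S m)%nat))%C with
      (Csum (seq a (S m)) (fun i => ce (g i))+(ce (g (a+S m)%nat) +
       ce (g (S (a+S m)))*kcoef (d (a+S m)%nat)))%C by ring.
    rewrite Hstep by lia. replace (Csum (seq a (S m)) (fun i => ce (g i))+ce (g (a+S m)%nat)*kcoef (d (a+S m)%nat))%C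
      with ((Csum (seq a (S m)) (fun i => ce (g i))+ce (g (a+S m)%nat)*kcoef (d (a+m)%nat))
         + ce (g (a+S m)%nat)*(kcoef (d (a+S m)%nat)-kcoef (d (a+m)%nat)))%C by ring.
    via Cmod_triangle. specialize (IH ltac:(lia)). rewrite Cmod_mult, Cmod_ce, Rmult_1_l. have Hk : Cmod (kcoef (d (a+S m)%nat)-kcoef (d (a+m)%nat)) <=
       cot (d (a+S m)%nat/2)/2-cot (d (a+m)%nat/2)/2.
    { unfold kcoef, Cminus, Cplus, Copp; simpl. via Cmod_le_abs. replace (1/2 + - (1/2)) with 0 by ring. rewrite Rabs_R0.
      assert (cot (d (a+m)%nat/2) <= cot (d (a+S m)%nat/2)).
      { pose proof (Hd (a+m)%nat ltac:(lia)). pose proof (Hd (a+S m)%nat ltac:(lia)). pose proof (Hmon (a+m)%nat ltac:(lia) ltac:(lia)).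
        replace (a+S m)%nat with (S (a+m)) in * by lia. unfold d in *. apply cot_decr; lra. }
      go. }
    lra. }
specialize (H n (Nat.le_refl _)). set (S0 := Csum (seq a (S n)) (fun i => ce (g i))) in *. replace S0 with ((S0+ce (g (a+S n)%nat)*kcoef (d (a+n)%nat)) -
   ce (g (a+S n)%nat)*kcoef (d (a+n)%nat))%C by ring.
unfold Cminus. via Cmod_triangle. rewrite Cmod_opp, Cmod_mult, Cmod_ce, Rmult_1_l. have Hc := Hcot (a+n)%nat ltac:(lia).
assert (Cmod (kcoef (d (a+n)%nat)) <= 1/2+cot (d (a+n)%nat/2)/2).
{ unfold kcoef. via Cmod_le_abs. rewrite !Rabs_right; lra. }
lra.
Qed.

(** Each positive distance to [p] is attained at most once on either side, hence the factor 2. With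
    truncated subtraction [(x-p)+(p-x)] is the distance. *)
Lemma Rsum_dist (psi : nat -> R) (l : list nat) (p D : nat) :
  (forall m, 0 <= psi m) -> NoDup l ->
  (forall x, In x l -> (x <= p+D)%nat /\ (p <= x+D)%nat) ->
  Rsum l (fun x => psi ((x-p)+(p-x))%nat) <= psi 0%nat+2*Rsum (seq 1 D) psi.
Proof.
intros Hpsi Hn Hl. have Hside : forall (b : nat -> bool) (h : nat -> nat),
  (forall x y, b x = true -> b y = true -> h x = h y -> x = y) ->
  (forall x, In x l -> b x = true -> (1 <= h x <= D)%nat) ->
  Rsum (filter b l) (fun x => psi (h x)) <= Rsum (seq 1 D) psi.
{ intros b h Hinj Hr. rewrite <- (Rsum_map h (filter b l) psi). apply Rsum_incl.
  - apply NoDup_map_NoDup_ForallPairs; [|apply NoDup_filter; exact Hn]. intros x y Hx Hy. apply filter_In in Hx, Hy. apply Hinj; tauto.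
  - intros y (x & <- & Hx)%in_map_iff. apply filter_In in Hx. apply in_seq. specialize (Hr x (proj1 Hx) (proj2 Hx)). lia.
  - auto. }
have H1 := Hside (fun x => x <? p)%nat (fun x => p-x)%nat. have H2 := Hside (fun x => p <? x)%nat (fun x => x-p)%nat.
have H3 : Rsum (filter (fun x => x =? p)%nat l) (fun _ => psi 0%nat) <= Rsum [p] (fun _ => psi 0%nat).
{ apply Rsum_incl; [apply NoDup_filter; exact Hn| |auto]. intros x [_ Hx]%filter_In. apply Nat.eqb_eq in Hx. left; symmetry; exact Hx. }
simpl in H3. have E : Rsum l (fun x => psi ((x-p)+(p-x))%nat) =
  Rsum (filter (fun x => x <? p)%nat l) (fun x => psi (p-x)%nat) +
  Rsum (filter (fun x => p <? x)%nat l) (fun x => psi (x-p)%nat) +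
  Rsum (filter (fun x => x =? p)%nat l) (fun _ => psi 0%nat).
{ rewrite !Rsum_filter, <- !Rsum_plus. apply Rsum_ext; intros x _. destruct (Nat.ltb_spec x p), (Nat.ltb_spec p x), (Nat.eqb_spec x p); try lia.
  - replace (x-p+(p-x))%nat with (p-x)%nat by lia. lra.
  - replace (x-p+(p-x))%nat with (x-p)%nat by lia. lra.
  - replace (x-p+(p-x))%nat with 0%nat by lia. lra. }
rewrite E.
have G1 : Rsum (filter (fun x => x <? p)%nat l) (fun x => psi (p-x)%nat) <= Rsum (seq 1 D) psi.
{ apply H1.
  - intros x y Hx Hy. apply Nat.ltb_lt in Hx, Hy. lia.
  - intros x Hx Hb%Nat.ltb_lt. specialize (Hl x Hx). lia. }
have G2 : Rsum (filter (fun x => p <? x)%nat l) (fun x => psi (x-p)%nat) <= Rsum (seq 1 D) psi.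
{ apply H2.
  - intros x y Hx Hy. apply Nat.ltb_lt in Hx, Hy. lia.
  - intros x Hx Hb%Nat.ltb_lt. specialize (Hl x Hx). lia. }
lra.
Qed.

(** A shift by one removes a term of modulus 1 at one end and adds one at the other. *)
Lemma Csum_shift_bound (z : nat -> C) a n h :
  (forall i, Cmod (z i) = 1) ->
  Cmod (Csum (seq a n) z-Csum (seq a n) (fun i => z (i+h)%nat)) <= 2*INR h.
Proof.
intros Hz. induction h as [|h IH].
- rewrite (Csum_ext _ (fun i => z (i+0)%nat) z) by alg. replace (_-_)%C with (RtoC 0) by ring. rewrite Cmod_0. pos.
- rewrite S_INR. have E : (Csum (seq a n) (fun i => z (i+h)%nat)-Csum (seq a n) (fun i => z (i+S h)%nat))%C
     = (z (a+h)%nat-z (a+n+h)%nat)%C.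
  { clear. induction n as [|n IH]; [simpl; rewrite Nat.add_0_r; ring|]. rewrite !Csum_seq_S. replace (Csum (seq a n) (fun i => z (i+h)%nat)+z (a+n+h)%nat -
      (Csum (seq a n) (fun i => z (i+S h)%nat)+z (a+n+S h)%nat))%C with
      ((Csum (seq a n) (fun i => z (i+h)%nat)-Csum (seq a n) (fun i => z (i+S h)%nat)) +
       z (a+n+h)%nat-z (a+n+S h)%nat)%C by ring.
    rewrite IH. replace (a+S n+h)%nat with (a+n+S h)%nat by lia. ring. }
  replace (Csum (seq a n) z-Csum (seq a n) (fun i => z (i+S h)%nat))%C with
    ((Csum (seq a n) z-Csum (seq a n) (fun i => z (i+h)%nat)) +
     (Csum (seq a n) (fun i => z (i+h)%nat)-Csum (seq a n) (fun i => z (i+S h)%nat)))%C by ring.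
  rewrite E. via Cmod_triangle.
  assert (Cmod (z (a+h)%nat-z (a+n+h)%nat) <= 2).
  { unfold Cminus. via Cmod_triangle. rewrite Cmod_opp, !Hz. lra. }
  lra.
Qed.

Lemma Cmod_Csum_sq {A} (l : list A) (w : A -> C) :
  Cmod (Csum l w)^2 <= INR (length l)*Rsum l (fun x => Cmod (w x)^2).
Proof.
transitivity (Rsum l (fun x => 1*Cmod (w x))^2).
- apply pow_incr. split; [pos|]. rewrite (Rsum_ext l (fun x => 1*Cmod (w x)) (fun x => Cmod (w x))) by alg. apply Cmod_Csum.
- have H := Rsum_CS l (fun _ => 1) (fun x => Cmod (w x)). cbv beta in H. rewrite Rsum_const in H. lra.
Qed.

Lemma Cmod_sq_double {A} (l : list A) (w : A -> C) :
  RtoC (Cmod (Csum l w)^2) = Csum l (fun x => Csum l (fun y => w x*Cconj (w y))%C).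
Proof. rewrite Cmod2_conj, Csum_conj, Csum_mult. auto. Qed.

(** [S0] is compared with the mean of its first [H] translates, and Cauchy-Schwarz is applied to
    this mean. In the expanded square the lag [d] gives the sum of [ce (g (i+d) - g i)] over a
    window that starts at most [H] later, which explains the range of [a']. *)
Lemma van_der_corput (g : nat -> R) a n H (Bd : nat -> R) :
  (1 <= H)%nat -> (forall d, 0 <= Bd d) ->
  (forall d a', (1 <= d < H)%nat -> (a <= a' <= a+H)%nat ->
     Cmod (Csum (seq a' n) (fun i => ce (g (i+d)%nat-g i))) <= Bd d) ->
  Cmod (Csum (seq a n) (fun i => ce (g i)))^2 <=
  8*INR H^2+2*INR n^2/INR H+4*INR n/INR H*Rsum (seq 1 (H-1)) Bd.
Proof.
intros HH HB Hd. set (z := fun i => ce (g i)). set (S0 := Csum (seq a n) z). have Hz : forall i, Cmod (z i) = 1 by (intros; apply Cmod_ce). have HH0 : 1 <= INR H by inr.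
set (y := fun i => Csum (seq 0 H) (fun h => z (i+h)%nat)).
have Hy : Cmod (Csum (seq a n) y-RtoC (INR H)*S0) <= 2*INR H^2.
{ unfold y. rewrite Csum_swap. replace (RtoC (INR H)*S0)%C with (Csum (seq 0 H) (fun _ => S0)). 2:{ rewrite Csum_const, length_seq. auto. }
  rewrite <- Csum_minus. via Cmod_Csum. transitivity (Rsum (seq 0 H) (fun _ => 2*INR H)).
  - apply Rsum_le. intros h Hh%in_seq. rewrite <- Cmod_opp, Copp_minus_distr. unfold S0. etransitivity; [apply Csum_shift_bound; exact Hz|]. mono.
  - rewrite Rsum_const, length_seq. lra. }
(* [b d] bounds the correlation at lag [d]; at lag 0 all terms have modulus 1. *)
set (W := Rsum (seq a n) (fun i => Cmod (y i)^2)). set (b := fun d => match d with 0%nat => INR n | _ => Bd d end).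
have HW : W <= INR H*(INR n+2*Rsum (seq 1 (H-1)) Bd).
{ have E : RtoC W = Csum (seq 0 H) (fun h => Csum (seq 0 H) (fun h' =>
      Csum (seq a n) (fun i => z (i+h)%nat*Cconj (z (i+h')%nat))%C)).
  { unfold W. rewrite <- Csum_RtoC. unfold y. erewrite Csum_ext; [|intros; apply Cmod_sq_double]. rewrite Csum_swap. apply Csum_ext; intros. apply Csum_swap. }
  have HW0 : 0 <= W by (apply Rsum_nonneg; intros; apply pow2_ge_0). rewrite <- (Rabs_right W) by lra. rewrite <- Cmod_R, E. via Cmod_Csum.
  transitivity (Rsum (seq 0 H) (fun _ => INR n+2*Rsum (seq 1 (H-1)) Bd)). 2:{ rewrite Rsum_const, length_seq. lra. }
  apply Rsum_le; intros h Hh%in_seq. via Cmod_Csum. transitivity (Rsum (seq 0 H) (fun h' => b ((h'-h)+(h-h'))%nat)).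
  - apply Rsum_le; intros h' Hh'%in_seq. destruct (Nat.lt_trichotomy h h') as [Hlt|[->|Hlt]].
    + replace ((h'-h)+(h-h'))%nat with (h'-h)%nat by lia. rewrite <- Cmod_conj, Csum_conj.
      replace (b (h'-h)%nat) with (Bd (h'-h)%nat) by (unfold b; destruct (h'-h)%nat eqn:E'; [lia|lra]). etransitivity; [|apply (Hd (h'-h)%nat (a+h)%nat); lia].
      rewrite Csum_seq_shift. apply Req_le. f_equal. apply Csum_ext; intros i _. rewrite Cmult_conj, Cconj_conj. unfold z. rewrite ce_minus, Cmult_comm.
      do 3 f_equal. lia.
    + replace ((h'-h')+(h'-h'))%nat with 0%nat by lia. unfold b. via Cmod_Csum. rewrite (Rsum_ext _ _ (fun _ => 1)).
      * rewrite Rsum_const, length_seq. lra.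
      * intros i _. rewrite Cmod_mult, Cmod_conj, !Hz. ring.
    + replace ((h'-h)+(h-h'))%nat with (h-h')%nat by lia. replace (b (h-h')%nat) with (Bd (h-h')%nat) by (unfold b; destruct (h-h')%nat eqn:E'; [lia|lra]).
      etransitivity; [|apply (Hd (h-h')%nat (a+h')%nat); lia]. rewrite Csum_seq_shift. apply Req_le. f_equal. apply Csum_ext; intros i _.
      unfold z. rewrite ce_minus. do 3 f_equal. lia.
  - etransitivity.
    + apply (Rsum_dist b (seq 0 H) h (H-1)).
      * intros [|m]; [apply pos_INR|apply HB].
      * apply seq_NoDup.
      * sq.
    + apply Rplus_le_compat; [mono|]. apply Req_le. f_equal. apply Rsum_ext. intros x Hx%in_seq. destruct x; [lia|auto]. }
have HS : INR H*Cmod S0 <= 2*INR H^2+Cmod (Csum (seq a n) y).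
{ replace (INR H*Cmod S0) with (Cmod (RtoC (INR H)*S0)). 2:{ rewrite Cmod_mult, Cmod_R, Rabs_right; [lra|lra]. }
  replace (RtoC (INR H)*S0)%C with (- (Csum (seq a n) y-RtoC (INR H)*S0)+Csum (seq a n) y)%C by ring. via Cmod_triangle. rewrite Cmod_opp. lra. }
have HY : Cmod (Csum (seq a n) y)^2 <= INR n*W.
{ have HC := Cmod_Csum_sq (seq a n) y. rewrite length_seq in HC. exact HC. }
set (s := Cmod S0) in *. set (Y := Cmod (Csum (seq a n) y)) in *. assert (0 <= s) by apply Cmod_ge_0. set (B1 := Rsum (seq 1 (H-1)) Bd) in *. pose proof (pos_INR n).
have HK1 : INR H^2*s^2 <= 8*INR H^4+2*Y^2.
{ assert ((INR H*s)^2 <= (2*INR H^2+Y)^2) by mono. pose proof (pow2_ge_0 (2*INR H^2-Y)). nra. }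
have HK2 : Y^2 <= INR n*(INR H*(INR n+2*B1)).
{ nra. }
apply Rmult_le_reg_l with (INR H^2); [nra|]. replace (INR H^2*(8*INR H^2+2*INR n^2/INR H+4*INR n/INR H*B1))
  with (8*INR H^4+2*(INR n*(INR H*(INR n+2*B1)))) by fd.
lra.
Qed.

Lemma exp_mono x y : x <= y -> exp x <= exp y.
Proof. intros [H|H]; [left; apply exp_increasing; exact H|right; rewrite H; easy]. Qed.

Fixpoint fdiff (hs : list R) (phi : R -> R) (x : R) : R :=
  match hs with [] => phi x | h :: l => fdiff l phi (x+h)-fdiff l phi x end.

Definition lsum (hs : list R) : R := fold_right Rplus 0 hs.

Definition lprod (hs : list R) : R := fold_right Rmult 1 hs.

Lemma fdiff_derivable (phi phi' : R -> R) hs :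
  (forall x, 0 <= x -> derivable_pt_lim phi x (phi' x)) -> List.Forall (fun h => 0 < h) hs ->
  forall x, 0 <= x -> derivable_pt_lim (fdiff hs phi) x (fdiff hs phi' x).
Proof.
intros H. induction hs as [|h l IH]; intros Hh x Hx; simpl; [auto|]. inversion Hh; subst. specialize (IH H3).
apply derivable_pt_lim_minus with (f1 := fun x => fdiff l phi (x+h)) (f2 := fdiff l phi);
  [|apply IH; exact Hx].
replace (fdiff l phi' (x+h)) with (fdiff l phi' (x+h)*(1+0)) by ring. apply (derivable_pt_lim_comp (fun x => x+h) (fdiff l phi)).
- apply (derivable_pt_lim_plus (fun x => x) (fun _ => h)).
  + apply derivable_pt_lim_id.
  + apply derivable_pt_lim_const.
- apply IH; lra.
Qed.

Lemma lprod_pos hs : List.Forall (fun h => 0 < h) hs -> 0 < lprod hs.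
Proof. induction 1; simpl; [lra|]. pos. Qed.

(** [phi m] plays the part of an [m]-th derivative. The mean value theorem removes one difference at
    a time, each step producing its length and one more derivative. *)
Lemma fdiff_mvt (phi : nat -> R -> R) :
  (forall m x, 0 <= x -> derivable_pt_lim (phi m) x (phi (S m) x)) ->
  forall hs, List.Forall (fun h => 0 < h) hs -> forall m x, 0 <= x ->
  exists xi, x <= xi <= x+lsum hs /\ fdiff hs (phi m) x = lprod hs*phi (m+length hs)%nat xi.
Proof.
intros H. induction hs as [|h l IH]; intros Hh m x Hx.
- exists x. simpl. rewrite Nat.add_0_r. lra.
- inversion Hh; subst. destruct (MVT_cor2 (fdiff l (phi m)) (fdiff l (phi (S m))) x (x+h)) as (c & Hc & Hc').
  + lra.
  + intros c Hc. apply fdiff_derivable; [auto|assumption|lra].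
  + destruct (IH H3 (S m) c) as (xi & Hxi & E); [lra|]. exists xi. simpl. split; [lra|]. rewrite Hc, E. replace (m+S (length l))%nat with (S m+length l)%nat by lia. ring.
Qed.

(** The [m]-th derivative in [x] of [t ln (q x + r)]. *)
Definition lphi (q r t : R) (m : nat) (x : R) : R :=
  match m with
  | O => t*ln (q*x+r)
  | S m' => t*((-1)^m'*INR (fact m')*q^S m'/(q*x+r)^S m')
  end.

Lemma lphi_derivable q r t m x : 0 < q -> 0 < r -> 0 <= x ->
  derivable_pt_lim (lphi q r t m) x (lphi q r t (S m) x).
Proof.
intros Hq Hr Hx. apply is_derive_Reals. assert (0 < q*x+r) by nra. destruct m as [|m]; unfold lphi.
- auto_derive; [lra|]. simpl. fd.
- auto_derive.
  + pos.
  + replace (fact (S m)) with (S m*fact m)%nat by easy. rewrite mult_INR. rewrite !S_INR. simpl pow. replace (match m with O => 1 | S _ => INR m+1 end) with (INR m+1).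
    2:{ destruct m; simpl; lra. }
    fd.
Qed.

Lemma pow_m1_sq m : (-1)^m*(-1)^m = 1.
Proof. rewrite <- Rpow_mult_distr. replace (-1 * -1) with 1 by ring. apply pow1. Qed.

(** Changing the sign of the phase conjugates the sum. [kusmin_landau] asks for positive decreasing
    increments, whereas the derivatives of the logarithm alternate in sign. *)
Lemma Cmod_Csum_ce_sign m (g : nat -> R) l :
  Cmod (Csum l (fun i => ce ((-1)^m*g i))) = Cmod (Csum l (fun i => ce (g i))).
Proof.
have H : (-1)^m = 1 \/ (-1)^m = -1.
{ pose proof (pow_m1_sq m). nra. }
destruct H as [->| ->].
- f_equal. apply Csum_ext; intros. alg.
- rewrite <- Cmod_conj, Csum_conj. f_equal. apply Csum_ext; intros. rewrite ce_conj. alg.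
Qed.

(** Adjoining a step 1 to [hs] writes an increment of the differenced phase as
    [D / (q xi + r)^(m+1)] up to sign; adjoining two of them gives its second difference, whose sign
    yields monotonicity. [J] and [B J] enclose [q xi + r]. *)
Lemma kusmin_landau_log (q r t J B : R) hs a n :
  1 <= q -> 0 < r -> 0 < t -> 1 <= J -> 1 <= B -> List.Forall (fun h => 0 < h) hs ->
  J <= q*INR a+r -> q*(INR (a+n)+2+lsum hs)+r <= B*J ->
  t*lprod hs*INR (fact (length hs))*q^S (length hs)/J^S (length hs) <= PI ->
  Cmod (Csum (seq a n) (fun i => ce (fdiff hs (lphi q r t 0) (INR i)))) <=
  12*(B*J)^S (length hs)/(t*lprod hs*INR (fact (length hs))*q^S (length hs)).
Proof.
intros Hq Hr Ht HJ HB Hhs Ha Hn Htop. set (m := length hs) in *. have HP : 0 < lprod hs by (apply lprod_pos; exact Hhs).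
have Hf : 0 < INR (fact m) by (apply lt_0_INR, lt_O_fact). have Hqm : 0 < q^S m by pos. set (D := t*lprod hs*INR (fact m)*q^S m) in *.
have HD : 0 < D by (unfold D; apply Rmult_lt_0_compat; [pos|]; assumption).
have Hder : forall k x, 0 <= x -> derivable_pt_lim (lphi q r t k) x (lphi q r t (S k) x).
{ intros; apply lphi_derivable; lra. }
rewrite <- (Cmod_Csum_ce_sign m). replace (12*(B*J)^S m/D) with (12/(D/(B*J)^S m)). 2:{ fd. }
have Hinc : forall i, (a <= i < a+n)%nat ->
   exists xi, INR i <= xi <= INR i+1+lsum hs /\
   (-1)^m*fdiff hs (lphi q r t 0) (INR (S i))-(-1)^m*fdiff hs (lphi q r t 0) (INR i)
     = D/(q*xi+r)^S m.
{ intros i Hi. destruct (fdiff_mvt _ Hder (1 :: hs) ltac:(constructor; [lra|exact Hhs]) 0 (INR i))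
    as (xi & Hxi & E); [pos|].
  exists xi. split; [simpl in Hxi; unfold lsum in *; lra|]. rewrite <- Rmult_minus_distr_l. rewrite S_INR. simpl fdiff in E. rewrite E.
  change (0+length (1%R :: hs))%nat with (S m). unfold lphi. transitivity (((-1)^m*(-1)^m)*(lprod (1 :: hs)*t*INR (fact m)*q^S m/(q*xi+r)^S m)).
  - lra.
  - rewrite pow_m1_sq. unfold D. simpl lprod. lra. }
have Hpos : forall i, (a <= i)%nat -> J <= q*INR i+r.
{ inr. }
have Hup : forall i, (i < a+n)%nat -> q*(INR i+1+1+lsum hs)+r <= B*J.
{ inr. }
apply kusmin_landau.
- split; [pos|]. etransitivity; [|exact Htop]. unfold Rdiv. lmul. apply Rinv_le_contravar; [pos|]. apply pow_incr. nra.
- intros i Hi. destruct (Hinc i Hi) as (xi & Hxi & ->). specialize (Hpos i ltac:(lia)). specialize (Hup i ltac:(lia)). assert (J <= q*xi+r) by nra.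
  assert (q*xi+r <= B*J) by nra. split.
  + mono.
  + etransitivity; [|exact Htop]. mono.
- intros i Hi Hi2. destruct (fdiff_mvt _ Hder (1 :: 1 :: hs) ltac:(repeat (constructor; [lra|]); exact Hhs) 0 (INR i))
    as (xi & Hxi & E); [pos|].
  simpl fdiff in E. apply Rminus_le. rewrite !S_INR. match goal with |- ?X <= 0 => replace X with ((-1)^m*(lprod (1 :: 1 :: hs) *
    lphi q r t (0+length (1 :: 1 :: hs)) xi)) by nra end.
  change (0+length (1%R :: 1%R :: hs))%nat with (S (S m)). unfold lphi. specialize (Hpos i Hi). destruct Hxi as [Hxi _]. clear E Hinc Hder.
  assert (q*INR i <= q*xi) by mono. replace ((-1)^m*(lprod (1 :: 1 :: hs)*(t*((-1)^S m*INR (fact (S m))*q^S (S m)/(q*xi+r)^S (S m)))))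
    with (- (((-1)^m*(-1)^m)*(lprod (1 :: 1 :: hs)*t*(INR (fact (S m))*q^S (S m)/(q*xi+r)^S (S m))))).
  2:{ simpl pow at 5. unfold Rdiv. simpl. ring. }
  rewrite pow_m1_sq. assert (0 < lprod (1 :: 1 :: hs)) by (change (0 < 1*(1*lprod hs)); lra).
  assert (0 <= INR (fact (S m))*q^S (S m)/(q*xi+r)^S (S m)).
  { pos. }
  assert (0 <= lprod (1 :: 1 :: hs)*t) by nra. nra.
Qed.

(** The three summands come from the three terms of [van_der_corput]. *)
Fixpoint vdc_const (c1 : R) (s : nat) : R :=
  match s with O => 1 | S s' => 9+2*c1^2+4*c1*vdc_const c1 s' end.

Lemma vdc_const_ge c1 s : 0 <= c1 -> 1 <= vdc_const c1 s.
Proof. intros H. induction s; simpl; nra. Qed.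

(* Weyl differencing [s] times, followed by the Kusmin-Landau estimate. *)
Lemma vdc_iterate (q r0 t J B c1 k0 : R) (r H : nat) :
  1 <= q -> 0 < r0 -> 0 < t -> 1 <= J -> 1 <= B -> 0 <= c1 -> 0 < k0 <= 1 ->
  (1 <= H)%nat -> / INR H <= k0 -> INR H^2 <= J ->
  t*INR H^r*INR (fact r)*q^S r/J^S r <= PI ->
  forall s hs a n, (s+length hs = r)%nat -> List.Forall (fun h => 1 <= h <= INR H) hs ->
  J <= q*INR a+r0 ->
  q*(INR (a+n)+2*INR s*INR H+INR (length hs)*INR H+2)+r0 <= B*J ->
  INR n <= c1*J ->
  Cmod (Csum (seq a n) (fun i => ce (fdiff hs (lphi q r0 t 0) (INR i)))) <=
  vdc_const c1 s*J*Rpower k0 (/ 2^s) *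
   (1+12*B^S r*J^r/(t*lprod hs)*(Rsum (seq 1 (H-1)) (fun h => / INR h)/INR H)^s/k0).
Proof.
intros Hq Hr0 Ht HJ HB Hc1 Hk0 HH HHk HHJ Htop. have HH0 : 1 <= INR H by inr. set (ell := Rsum (seq 1 (H-1)) (fun h => / INR h)).
have Hell : 0 <= ell.
{ apply Rsum_nonneg. intros x Hx%in_seq. pos. }
induction s as [|s IH]; intros hs a n Hlen Hhs Ha Hn Hn1.
- simpl in Hlen. have Hp : List.Forall (fun h => 0 < h) hs by (eapply List.Forall_impl; [|exact Hhs]; simpl; intros; lra).
  have HP : 0 < lprod hs by (apply lprod_pos; exact Hp).
  have HPH : lprod hs <= INR H^length hs.
  { clear-Hhs HH0. induction Hhs; simpl; [lra|]. unfold lprod in *. apply Rmult_le_compat; try lra. clear-Hhs. induction Hhs; simpl; [lra|]. nra. }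
  have HSH : lsum hs <= INR (length hs)*INR H.
  { clear-Hhs HH0. induction Hhs; simpl length; [simpl; lra|]. rewrite S_INR. simpl. lra. }
  have Hf : 1 <= INR (fact r) by (apply (le_INR 1), lt_O_fact). have Hqm : 1 <= q^S r by (apply pow_R1_Rle; lra). etransitivity.
  + apply (kusmin_landau_log q r0 t J B); try assumption.
    * inr.
    * rewrite Hlen. etransitivity; [|exact Htop]. unfold Rdiv. rmul. rmul. rmul. apply Rmult_le_compat_l; go.
  + rewrite Hlen. simpl vdc_const. simpl (/ 2^0). rewrite Rinv_1, Rpower_1 by lra. simpl ((_/_)^0). rewrite !Rmult_1_r, Rmult_1_l.
    have Hlhs : 12*(B*J)^S r/(t*lprod hs*INR (fact r)*q^S r) <=
      12*B^S r*J^r/(t*lprod hs)*J.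
    { rewrite Rpow_mult_distr. unfold Rdiv. replace (12*B^S r*J^r * / (t*lprod hs)*J) with
        (12*(B^S r*J^S r) * / (t*lprod hs)) by (simpl; ring).
      apply Rmult_le_compat_l.
      - pos.
      - apply Rinv_le_contravar; [nra|]. replace (t*lprod hs*INR (fact r)*q^S r) with (t*lprod hs*(INR (fact r)*q^S r)) by ring. assert (1 <= INR (fact r)*q^S r) by nra.
        assert (0 < t*lprod hs) by nra. nra. }
    via Hlhs. set (E := 12*B^S r*J^r/(t*lprod hs)). replace (J*k0*(1+E/k0)) with (J*k0+E*J) by fd. nra.
- have Hp : List.Forall (fun h => 0 < h) hs by (eapply List.Forall_impl; [|exact Hhs]; simpl; intros; lra). have HP : 0 < lprod hs by (apply lprod_pos; exact Hp).
  set (As := vdc_const c1 s) in *. have HAs : 1 <= As by (apply vdc_const_ge; exact Hc1). set (ks := Rpower k0 (/ 2^s)) in *. set (k' := Rpower k0 (/ 2^S s)).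
  (* Each differencing ends with a square root, so the saving [k0] enters with exponent [1/2^s]. *)
  assert (Hk' : k'^2 = ks).
  { unfold k', ks. rewrite <- Rpower_pow by pos. rewrite Rpower_mult. f_equal. simpl (INR 2). simpl. fd. }
  assert (Hk'0 : 0 < k') by apply exp_pos.
  have Hks : k0 <= ks.
  { unfold ks. rewrite <- (Rpower_1 k0) at 1 by lra. unfold Rpower. apply exp_mono.
    have Hln : ln k0 <= 0.
    { rewrite <- ln_1. destruct (Req_dec k0 1) as [->|]; [lra|]. left; apply ln_increasing; lra. }
    have H2 : 1 <= 2^s by (apply pow_R1_Rle; lra). assert (/ 2^s <= 1) by (rewrite <- Rinv_1; apply Rinv_le_contravar; lra). nra. }
  set (E1 := 12*B^S r*J^r/(t*lprod hs)) in *.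
  have HE1 : 0 <= E1.
  { unfold E1. pos. }
  set (e := ell/INR H) in *. have He : 0 <= e by (apply Rdiv_le_0_compat; lra). set (Bd := fun d => As*J*ks*(1+E1 * / INR d*e^s/k0)).
  have HBd : forall d, (1 <= d)%nat -> 0 <= Bd d.
  { intros d Hd. unfold Bd. pos. }
  have HV := van_der_corput (fun i => fdiff hs (lphi q r0 t 0) (INR i)) a n H
    (fun d => Rabs (Bd d)) HH (fun d => Rabs_pos _). cbv beta in HV.
  have HV0 : forall d a', (1 <= d < H)%nat -> (a <= a' <= a+H)%nat ->
    Cmod (Csum (seq a' n) (fun i => ce (fdiff hs (lphi q r0 t 0) (INR (i+d)) -
        fdiff hs (lphi q r0 t 0) (INR i)))) <= Rabs (Bd d).
  { intros d a' Hd Ha'. rewrite Rabs_right by (apply Rle_ge, HBd; lia). have Hd1 : 1 <= INR d by (apply (le_INR 1); lia). have Hd2 : INR d <= INR H by mono.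
    etransitivity; [|via (IH (INR d :: hs) a' n)].
    - apply Req_le. f_equal. apply Csum_ext; intros i _. simpl. rewrite plus_INR. auto.
    - simpl. lia.
    - auto.
    - assert (INR a <= INR a') by mono. nra.
    - assert (INR a' <= INR a+INR H) by (rewrite <- plus_INR; apply le_INR; lia). change (length (INR d :: hs)) with (S (length hs)). inr.
    - exact Hn1.
    - unfold Bd. apply Req_le. f_equal. f_equal. f_equal. f_equal. unfold E1. simpl lprod. fd. }
  specialize (HV HV0). clear HV0. set (S0 := Cmod (Csum (seq a n) (fun i => ce (fdiff hs (lphi q r0 t 0) (INR i))))) in *.
  have HsumB : Rsum (seq 1 (H-1)) (fun d => Rabs (Bd d)) <= As*J*ks*INR H*(1+E1*e^S s/k0).
  { rewrite (Rsum_ext _ _ (fun d => As*J*ks+As*J*ks*E1*e^s/k0 * / INR d)).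
    - rewrite Rsum_plus, Rsum_const, Rsum_scal, length_seq. fold ell. replace (As*J*ks*INR H*(1+E1*e^S s/k0)) with
        (INR H*(As*J*ks)+As*J*ks*E1*e^s/k0*ell).
      2:{ unfold e. simpl. fd. }
      mono.
    - intros d Hd%in_seq. rewrite Rabs_right by (apply Rle_ge, HBd; lia). unfold Bd. lra. }
  set (Q := E1*e^S s/k0) in *.
  have HQ : 0 <= Q.
  { unfold Q. pos. }
  have Hmain : S0^2 <= (vdc_const c1 (S s))*J^2*ks*(1+Q).
  { via HV. simpl vdc_const. fold As. have Hn0 : 0 <= INR n by apply pos_INR.
    (* From [H k0 >= 1], [H^2 <= J] and [ks >= k0] one gets [J ks >= 1], so [H^2] is absorbed by
       [J^2 ks]. *)
    have T1 : 8*INR H^2 <= 8*J^2*ks.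
    { assert (INR H*k0 >= 1).
      { assert (INR H * / INR H = 1) by fd. nra. }
assert (1 <= J*ks) by nra. nra. }
    have T2 : 2*INR n^2/INR H <= 2*c1^2*J^2*ks.
    { assert (INR n^2 <= (c1*J)^2) by mono. nra. }
    have T3 : 4*INR n/INR H*Rsum (seq 1 (H-1)) (fun d => Rabs (Bd d)) <=
        4*c1*As*J^2*ks*(1+Q).
    { transitivity (4*(c1*J)/INR H*(As*J*ks*INR H*(1+Q))).
      - mono.
      - apply Req_le. fd. }
    assert (0 <= J^2*ks*Q) by pos. nra. }
  rewrite <- Hk' in Hmain. have HA : 1 <= vdc_const c1 (S s) by (apply vdc_const_ge; exact Hc1). set (A' := vdc_const c1 (S s)) in *.
  replace (12*B^S r*J^r/(t*lprod hs)*(ell/INR H)^S s/k0) with Q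
    by easy.
  apply Rsqr_incr_0_var.
  + unfold Rsqr. replace (S0*S0) with (S0^2) by ring. via Hmain. replace (A'*J*k'*(1+Q)*(A'*J*k'*(1+Q))) with
      (A'*J^2*k'^2*(1+Q)*(A'*(1+Q))) by ring.
    rewrite <- (Rmult_1_r (A'*J^2*k'^2*(1+Q))) at 1. lmul; [nra].
  + pos.
Qed.

(** * Asymptotic bookkeeping *)

Definition ev (P : R -> Prop) : Prop := exists x0, forall x, x0 <= x -> P x.

Lemma ev_and P Q : ev P -> ev Q -> ev (fun x => P x /\ Q x).
Proof.
intros [x0 H0] [x1 H1]. exists (Rmax x0 x1). intros x Hx. split; [apply H0|apply H1]; etransitivity; try exact Hx; [apply Rmax_l|apply Rmax_r].
Qed.

Lemma ev_imp (P Q : R -> Prop) : ev P -> (forall x, P x -> Q x) -> ev Q.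
Proof. intros [x0 H0] H. exists x0. auto. Qed.

Lemma ev_ge c : ev (fun x => c <= x).
Proof. exists c. auto. Qed.

Lemma Rp_pos x y : 0 < Rpower x y.
Proof. pos. Qed.

Lemma Rp_pow x y n : Rpower x y^n = Rpower x (y*INR n).
Proof. rewrite <- Rpower_pow by apply Rp_pos. apply Rpower_mult. Qed.

Lemma Rp_le x y z : 1 <= x -> y <= z -> Rpower x y <= Rpower x z.
Proof.
intros Hx H. unfold Rpower. apply exp_mono. assert (0 <= ln x) by (rewrite <- ln_1; destruct (Req_dec x 1) as [->|]; [lra|left; apply ln_increasing; lra]). nra.
Qed.

Lemma Rp_ge1 x y : 1 <= x -> 0 <= y -> 1 <= Rpower x y.
Proof. intros Hx Hy. rewrite <- (Rpower_O x) by lra. apply Rp_le; lra. Qed.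

Lemma Rp_base x y z : 0 < x -> x <= y -> 0 <= z -> Rpower x z <= Rpower y z.
Proof. intros. apply Rle_Rpower_l; lra. Qed.

Lemma Rp_inv x y : Rpower x (- y)*Rpower x y = 1.
Proof. rewrite <- Rpower_plus. replace (- y+y) with 0 by ring. unfold Rpower. rewrite Rmult_0_l. apply exp_0. Qed.

Lemma ev_power c d : 0 < d -> ev (fun x => c <= Rpower x d).
Proof.
intros Hd. set (c' := Rmax c 1). exists (Rpower c' (/ d)). intros x Hx. assert (1 <= c') by apply Rmax_r. apply Rle_trans with c'; [apply Rmax_l|].
replace c' with (Rpower (Rpower c' (/ d)) d).
- apply Rp_base; go.
- rewrite Rpower_mult, Rinv_l by lra. apply Rpower_1; lra.
Qed.

Lemma ln_le_sub1 y : 0 < y -> ln y <= y-1.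
Proof.
intros Hy. have H := exp_ineq1_le (ln y). rewrite exp_ln in H by exact Hy. lra.
Qed.

Lemma ln_le_power d x : 0 < d -> 1 <= x -> ln x <= Rpower x d/d.
Proof.
intros Hd Hx. have H := ln_le_sub1 (Rpower x d) (Rp_pos _ _). unfold Rpower at 1 in H. rewrite ln_exp in H. cancel d. lra.
Qed.

(** Half of the exponent [d] pays for the logarithms, through [ln x <= x^e / e] with [e] small, the
    other half for the constant. *)
Lemma ev_log_power c (r : nat) d : 0 < d -> ev (fun x => c*(1+ln x)^r <= Rpower x d).
Proof.
intros Hd. set (e := d/(2*(INR r+1))). have Hr := pos_INR r. have He : 0 < e by (apply Rdiv_lt_0_compat; lra).
have Her : e*INR r <= d/2.
{ unfold e. apply Rmult_le_reg_r with (2*(INR r+1)); [lra|]. replace (d/(2*(INR r+1))*INR r*(2*(INR r+1))) with (d*INR r) by fd. nra. }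
set (c' := Rabs c*(1 + / e)^r). apply (ev_imp (fun x => 1 <= x /\ c' <= Rpower x (d/2))).
- apply ev_and; [apply ev_ge|apply ev_power; lra].
- intros x [Hx Hc]. have Hl : 0 <= ln x by (rewrite <- ln_1; destruct (Req_dec x 1) as [->|]; [lra|left; apply ln_increasing; lra]).
  have H1 : 1+ln x <= (1 + / e)*Rpower x e.
  { pose proof (ln_le_power e x He Hx). pose proof (Rp_ge1 x e Hx ltac:(lra)). lra. }
  have H2 : (1+ln x)^r <= (1 + / e)^r*Rpower x (d/2).
  { transitivity (((1 + / e)*Rpower x e)^r); [mono|]. rewrite Rpow_mult_distr, Rp_pow. apply Rmult_le_compat_l.
    - pos.
    - apply Rp_le; lra. }
  have H3 : 0 <= (1+ln x)^r by pos.
  transitivity (Rabs c*(1+ln x)^r).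
  { rmul; [apply Rle_abs]. }
  transitivity (c'*Rpower x (d/2)).
  { unfold c'. rewrite Rmult_assoc. mono. }
  replace d with (d/2+d/2) at 2 by field. rewrite Rpower_plus. mono.
Qed.

Lemma harmonic_le n : (1 <= n)%nat -> Rsum (seq 1 n) (fun h => / INR h) <= 1+ln (INR n).
Proof.
intros Hn. induction n as [|n IH]; [lia|]. destruct (Nat.eq_dec n 0) as [->|Hn0].
- simpl. rewrite ln_1. lra.
- rewrite Rsum_seq_S. specialize (IH ltac:(lia)). assert (0 < INR n) by pos.
  have E : ln (INR (1+n))-ln (INR n) >= / INR (1+n).
  { replace (1+n)%nat with (S n) by lia. rewrite S_INR. have HL := ln_le_sub1 (INR n/(INR n+1)) ltac:(apply Rdiv_lt_0_compat; lra). rewrite ln_div in HL by lra.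
    replace (INR n/(INR n+1)-1) with (- / (INR n+1)) in HL by fd. lra. }
  inr.
Qed.

(** * Power saving for sums over arithmetic progressions *)

(** Shifts go up to [J^(1/2)]. After [r] differencings the increments of the phase are at most
    [t J^(r/2) / J^(r+1)] up to constants: the upper bound on [t] makes this at most [PI], and the
    lower bound makes the Kusmin-Landau estimate save [J^(1/4)] up to logarithms, of which
    [k0 = J^(-1/16)] is kept. *)
Lemma vdc_range (q : nat) (L : R) (r : nat) : (1 <= q)%nat -> 0 < L ->
  exists A, 0 <= A /\ ev (fun J => forall r0 t a n,
    0 < r0 <= INR q -> Rpower J (INR r/2+1/4) <= t <= Rpower J (INR r/2+3/4) ->
    J <= INR q*INR a+r0 -> INR q*INR (a+n) <= exp L*J ->
    Cmod (Csum (seq a n) (fun i => ce (t*ln (INR q*INR i+r0)))) <=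
    A*Rpower J (1 - / (16*2^r))).
Proof.
intros Hq HL. have Hq1 : 1 <= INR q by inr. have HeL : 1 <= exp L by (pose proof (exp_ineq1_le L); lra). set (B := 2*exp L). exists (2*vdc_const (exp L) r).
have HA1 : 1 <= vdc_const (exp L) r by (apply vdc_const_ge; lra). split; [lra|]. have Hr := pos_INR r. have Hq0 : 0 <= INR q*(2*INR r+3) by nra.
apply (ev_imp (fun J => ((1 <= J /\ 2 <= Rpower J (7/16)) /\
   (12*B^S r*2^r)*(1+ln J)^r <= Rpower J (3/16)) /\
   (INR (fact r)*INR q^S r <= Rpower J (1/4) /\ INR q*(2*INR r+3) <= Rpower J (1/2)))).
{ repeat apply ev_and; try (apply ev_power; lra); [apply ev_ge|apply ev_log_power; lra]. }
intros J [[[HJ HJ2] HJ3] [HJ4 HJ5]] r0 t a n Hr0 Ht Ha Hn. have Ht0 : 0 < t by (eapply Rlt_le_trans; [apply (Rp_pos J)|apply Ht]). set (x := Rpower J (1/2)) in *.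
have Hxx : x^2 = J.
{ unfold x. rewrite Rp_pow. replace (1/2*INR 2) with 1 by inr. apply Rpower_1; lra. }
have Hx1 : 1 <= x by nra. destruct (nfloor_ex x) as [H [HH1 HH2]]; [lra|].
have HH : (1 <= H)%nat.
{ destruct H; [inr|lia]. }
have HHr : 1 <= INR H by nra. set (k0 := Rpower J (- (1/16))).
have Hk0 : 0 < k0 <= 1.
{ split; [apply Rp_pos|]. rewrite <- (Rpower_O J) by lra. apply Rp_le; lra. }
have Hk1 : k0*Rpower J (1/16) = 1 by apply Rp_inv.
have Hx7 : x = Rpower J (7/16)*Rpower J (1/16).
{ rewrite <- Rpower_plus. unfold x. alg. }
have Hp16 := Rp_pos J (1/16).
have HHk : / INR H <= k0.
{
  apply Rmult_le_reg_r with (INR H); [lra|]. rewrite Rinv_l by lra. nra. }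
have HHJ : INR H^2 <= J by nra.
have HHr2 : INR H^r <= Rpower J (INR r/2).
{ replace (Rpower J (INR r/2)) with (x^r).
  - mono.
  - unfold x. rewrite Rp_pow. alg. }
have HJr : J^r = Rpower J (INR r) by (symmetry; apply Rpower_pow; lra). have Hfact : 0 < INR (fact r) by (apply lt_0_INR, lt_O_fact). have Hqp : 0 < INR q^S r by pos.
have Htop : t*INR H^r*INR (fact r)*INR q^S r/J^S r <= PI.
{ assert (0 < J^S r) by pos. apply Rle_trans with 1; [|pose proof PI2_1; lra]. apply Rmult_le_reg_r with (J^S r); [assumption|].
  replace (t*INR H^r*INR (fact r)*INR q^S r/J^S r*J^S r) with
    (t*INR H^r*(INR (fact r)*INR q^S r)) by fd.
  rewrite Rmult_1_l. rewrite <- (Rpower_pow (S r) J) by lra. replace (INR (S r)) with ((INR r/2+3/4)+INR r/2+1/4) by inr.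
  have Ht2 := proj2 Ht. rewrite Rpower_plus in Ht2. rewrite !Rpower_plus. mono. }
have Hcond : INR q*(INR (a+n)+2*INR r*INR H+0*INR H+2)+r0 <= B*J.
{ unfold B.
  assert (INR q*(2*INR r+3)*INR H <= x*x).
  { mono. }
  assert (INR q*(2*INR r*INR H+3) <= INR q*(2*INR r+3)*INR H) by nra.
nra. }
have Hn1 : INR n <= exp L*J.
{ rewrite plus_INR in Hn. pose proof (pos_INR a). pose proof (pos_INR n). nra. }
have HV := vdc_iterate (INR q) r0 t J B (exp L) k0 r H Hq1 ltac:(lra) Ht0 HJ ltac:(unfold B; lra)
  ltac:(lra) Hk0 HH HHk HHJ Htop r [] a n ltac:(simpl; lia) (List.Forall_nil _) Ha Hcond Hn1.
simpl fdiff in HV. simpl lprod in HV. unfold lprod in HV. simpl fold_right in HV. unfold lphi in HV. via HV. clear HV. set (ell := Rsum (seq 1 (H-1)) (fun h => / INR h)).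
have Hlx : ln (INR H) <= ln J.
{ apply ln_le; [lra|]. nra. }
have HlH : 0 <= ln (INR H) by (rewrite <- ln_1; apply ln_le; lra).
have Hell : 0 <= ell <= 1+ln J.
{ split.
  - apply Rsum_nonneg. intros y Hy%in_seq. pos.
  - destruct (Nat.eq_dec H 1) as [E|E].
    + unfold ell. rewrite E. simpl. lra.
    + unfold ell. etransitivity; [apply harmonic_le; lia|]. assert (ln (INR (H-1)) <= ln (INR H)); [|lra]. apply ln_le; [pos|mono]. }
have Hratio : (ell/INR H)^r <= 2^r*(1+ln J)^r*Rpower J (- (INR r/2)).
{ replace (Rpower J (- (INR r/2))) with ((/ x)^r). 2:{ rewrite pow_inv. unfold x. rewrite Rp_pow. rewrite Rpower_Ropp. do 2 f_equal. field. }
  rewrite <- !Rpow_mult_distr. apply pow_incr. split; [pos|]. unfold Rdiv. replace (2*(1+ln J) * / x) with ((1+ln J)*(2 * / x)) by ring.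
  apply Rmult_le_compat; try lra; [pos|]. apply Rmult_le_reg_r with (INR H*x); [nra|]. replace (/ INR H*(INR H*x)) with x by fd.
  replace (2 * / x*(INR H*x)) with (2*INR H) by fd. lra. }
have HE : 12*B^S r*J^r/(t*1)*(ell/INR H)^r <= k0.
{ have HBp : 0 < B^S r by (apply pow_lt; unfold B; lra). transitivity (12*B^S r*J^r/Rpower J (INR r/2+1/4) *
     (2^r*(1+ln J)^r*Rpower J (- (INR r/2)))).
  - mono.
  - replace (12*B^S r*J^r/Rpower J (INR r/2+1/4) *
     (2^r*(1+ln J)^r*Rpower J (- (INR r/2)))) with
     ((12*B^S r*2^r*(1+ln J)^r)*(J^r * / Rpower J (INR r/2+1/4)*Rpower J (- (INR r/2))))
     by lra.
    rewrite HJr, <- Rpower_Ropp, <- !Rpower_plus. replace (INR r + - (INR r/2+1/4) + - (INR r/2)) with (- (1/4)) by field.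
    transitivity (Rpower J (3/16)*Rpower J (- (1/4))).
    + mono.
    + rewrite <- Rpower_plus. unfold k0. right. alg. }
replace (Rpower J (1 - / (16*2^r))) with (J*Rpower k0 (/ 2^r)). 2:{ unfold k0. rewrite Rpower_mult. rewrite <- (Rpower_1 J) at 1 by lra. rewrite <- Rpower_plus.
    alg. }
have HE2 : 12*B^S r*J^r/(t*1)*(ell/INR H)^r/k0 <= 1.
{ apply Rmult_le_reg_r with k0; [lra|]. unfold Rdiv at 1. rewrite Rmult_assoc, Rinv_l by lra. lra. }
replace (2*vdc_const (exp L) r*(J*Rpower k0 (/ 2^r))) with
  (vdc_const (exp L) r*J*Rpower k0 (/ 2^r)*2) by ring.
mono.
Qed.

(** The ranges of [t] for [r] and [r+1] abut, since [r/2 + 3/4 = (r+1)/2 + 1/4]; the saving of the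
    last one is the weakest. *)
Lemma vdc_all (q : nat) (L : R) (r : nat) : (1 <= q)%nat -> 0 < L ->
  exists A, 0 <= A /\ ev (fun J => forall r0 t a n,
    0 < r0 <= INR q -> Rpower J (1/4) <= t <= Rpower J (INR r/2+3/4) ->
    J <= INR q*INR a+r0 -> INR q*INR (a+n) <= exp L*J ->
    Cmod (Csum (seq a n) (fun i => ce (t*ln (INR q*INR i+r0)))) <=
    A*Rpower J (1 - / (16*2^r))).
Proof.
intros Hq HL. induction r as [|r IH].
- destruct (vdc_range q L 0 Hq HL) as (A & HA & H). exists A. split; [exact HA|]. apply (ev_imp _ _ H). intros J HJ r0 t a n Hr0 Ht. apply HJ; [exact Hr0|].
  replace (INR 0/2+1/4) with (1/4) by inr. exact Ht.
- destruct (vdc_range q L (S r) Hq HL) as (A & HA & H). destruct IH as (A' & HA' & H'). exists (Rmax A A'). split; [etransitivity; [exact HA|apply Rmax_l]|].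
  apply (ev_imp _ _ (ev_and _ _ (ev_and _ _ H H') (ev_ge 1))). intros J [[H1 H2] HJ] r0 t a n Hr0 Ht Ha Hn. destruct (Rle_dec t (Rpower J (INR r/2+3/4))) as [Hle|Hgt].
  + etransitivity; [apply H2; try assumption; lra|]. apply Rmult_le_compat; [exact HA'|pos|apply Rmax_r|]. apply Rp_le; [exact HJ|]. assert (0 < 2^r) by pos.
    assert (/ (16*2^S r) <= / (16*2^r)).
    { apply Rinv_le_contravar; [lra|]. simpl. lra. }
    lra.
  + etransitivity; [apply H1; try assumption|].
    * replace (INR (S r)/2+1/4) with (INR r/2+3/4) by inr. lra.
    * rmul; [apply Rmax_l].
Qed.

Lemma Csum_abel (w : nat -> R) (z : nat -> C) a n S0 :
  (forall i, (a <= i)%nat -> 0 <= w (S i) <= w i) ->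
  (forall m, (m <= n)%nat -> Cmod (Csum (seq a m) z) <= S0) ->
  Cmod (Csum (seq a n) (fun i => RtoC (w i)*z i)%C) <= w a*S0.
Proof.
intros Hw Hz.
have HS0 : 0 <= S0.
{ via Cmod_ge_0. apply (Hz 0%nat). lia. }
destruct n as [|n].
{ simpl. rewrite Cmod_0. destruct (Hw a (Nat.le_refl _)). nra. }
have H : forall m, (m <= n)%nat ->
   Cmod (Csum (seq a (S m)) (fun i => RtoC (w i)*z i)%C-RtoC (w (a+m)%nat)*Csum (seq a (S m)) z)
   <= S0*(w a-w (a+m)%nat).
{ induction m as [|m IH]; intros Hm.
  - cbn [seq Csum]. rewrite Nat.add_0_r. replace (_-_)%C with (RtoC 0) by ring. rewrite Cmod_0. lra.
  - specialize (IH ltac:(lia)). rewrite (Csum_seq_S (S m) a), (Csum_seq_S (S m) a z). replace (a+S m)%nat with (S (a+m)) by lia.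
    set (U := Csum (seq a (S m)) (fun i => RtoC (w i)*z i)%C) in *. set (V := Csum (seq a (S m)) z) in *.
    replace (U+RtoC (w (S (a+m)))*z (S (a+m))-RtoC (w (S (a+m)))*(V+z (S (a+m))))%C
      with ((U-RtoC (w (a+m)%nat)*V)+RtoC (w (a+m)%nat-w (S (a+m)))*V)%C
      by alg.
    via Cmod_triangle. rewrite Cmod_mult, Cmod_R. destruct (Hw (a+m)%nat ltac:(lia)). rewrite Rabs_right by lra. assert (Cmod V <= S0) by eauto. nra. }
specialize (H n (Nat.le_refl _)). set (U := Csum (seq a (S n)) (fun i => RtoC (w i)*z i)%C) in *. set (V := Csum (seq a (S n)) z) in *.
replace U with ((U-RtoC (w (a+n)%nat)*V)+RtoC (w (a+n)%nat)*V)%C by ring. via Cmod_triangle. rewrite Cmod_mult, Cmod_R.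
assert (0 <= w (a+n)%nat).
{ destruct n; [destruct (Hw a (Nat.le_refl _)) as [? ?]; rewrite Nat.add_0_r; lra|]. destruct (Hw (a+n)%nat ltac:(lia)). replace (a+S n)%nat with (S (a+n)) by lia. lra. }
rewrite Rabs_right by lra. assert (Cmod V <= S0) by eauto. nra.
Qed.

Definition ind (P : Prop) : bool := if excluded_middle_informative P then true else false.

Lemma ind_true P : ind P = true <-> P.
Proof. unfold ind. destruct (excluded_middle_informative P); split; intros; auto; go. Qed.

Definition apl (q r : nat) (lo hi : R) : list nat :=
  filter (fun j => ind (lo <= INR j < hi /\ (j mod q = r mod q)%nat)) (seq 1 (Z.to_nat (up hi))).

Lemma In_apl q r lo hi j :
  In j (apl q r lo hi) <-> (1 <= j)%nat /\ lo <= INR j < hi /\ (j mod q = r mod q)%nat.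
Proof.
unfold apl. rewrite filter_In, ind_true, in_seq. split; [tauto|]. intros (H1 & H2 & H3). split; [|tauto]. split; [exact H1|].
apply INR_lt. rewrite plus_INR. simpl (INR 1). assert (hi < IZR (up hi)) by apply archimed.
assert (0 <= up hi)%Z.
{ apply le_IZR. inr. }
rewrite INR_IZR_INZ with (n := Z.to_nat (up hi)), Z2Nat.id by assumption. lra.
Qed.

Lemma NoDup_apl q r lo hi : NoDup (apl q r lo hi).
Proof. apply NoDup_filter, seq_NoDup. Qed.

Lemma least_index (P : nat -> Prop) :
  (exists i, P i) -> (forall i, P i -> P (S i)) -> exists a, forall i, (a <= i)%nat <-> P i.
Proof.
intros Hex Hup. destruct (dec_inh_nat_subset_has_unique_least_element P) as (a & (Ha & Hmin) & _).
- go.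
- exact Hex.
- exists a. intros i. split.
  + intros Hi. induction Hi as [|i Hi IH]; [exact Ha|auto].
  + auto.
Qed.

Lemma ap_index (q r : nat) (lo : R) : (1 <= q)%nat ->
  exists a, forall i, (a <= i)%nat <-> lo <= INR q*INR i+INR r.
Proof.
intros Hq. have Hq1 : 1 <= INR q by inr. apply least_index.
- destruct (nfloor_ex (Rabs lo) (Rabs_pos lo)) as [n [_ Hn]]. exists (S n). rewrite S_INR. pose proof (Rle_abs lo). pose proof (pos_INR r). pose proof (pos_INR n). nra.
- inr.
Qed.

(** Reparametrises the progression by consecutive integers, the form in which exponential sums were
    estimated. *)
Lemma apl_perm (q r : nat) lo hi : (1 <= r <= q)%nat -> lo <= hi ->
  exists a n, Permutation (apl q r lo hi) (map (fun i => q*i+r)%nat (seq a n)) /\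
   (forall i, (a <= i)%nat <-> lo <= INR q*INR i+INR r) /\
   (forall i, (a+n <= i)%nat <-> hi <= INR q*INR i+INR r).
Proof.
intros Hr Hlh. destruct (ap_index q r lo) as [a Ha]; [lia|]. destruct (ap_index q r hi) as [b Hb]; [lia|].
have Hab : (a <= b)%nat.
{ apply Ha. assert (hi <= INR q*INR b+INR r) by (apply Hb; lia). lra. }
exists a, (b-a)%nat. replace (a+(b-a))%nat with b by lia. split; [|auto]. apply NoDup_Permutation; [apply NoDup_apl| |].
- apply NoDup_map_NoDup_ForallPairs; [|apply seq_NoDup]. intros x y _ _ H. nia.
- intros j. rewrite In_apl, in_map_iff. split.
  + intros (H1 & H2 & H3). set (i := (j/q-(r/q))%nat). have E1 := Nat.div_mod_eq j q. have E2 := Nat.div_mod_eq r q.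
    have Hrq : (r/q <= j/q)%nat.
    { nia. }
    have Ej : j = (q*i+r)%nat by nia. exists i. split; [lia|]. apply in_seq. rewrite Ej, plus_INR, mult_INR in H2. assert (a <= i)%nat by (apply Ha; lra).
    assert (~ (b <= i)%nat) by (rewrite Hb; lra). lia.
  + intros (i & <- & Hi). apply in_seq in Hi. split; [lia|]. split.
    * rewrite plus_INR, mult_INR. assert (lo <= INR q*INR i+INR r) by (apply Ha; lia). assert (~ hi <= INR q*INR i+INR r) by (rewrite <- Hb; lia). lra.
    * rewrite Nat.add_comm, Nat.mul_comm, Nat.Div0.mod_add. lia.
Qed.

(* [ce (t ln v)/(i t)], an antiderivative of [ce (t ln v)/v]. *)
Definition Fint (t v : R) : C := (sin (t*ln v)/t, - cos (t*ln v)/t).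

Lemma Fint_taylor1 t v h J : t <> 0 -> 0 < J -> J <= v -> 0 <= h ->
  Cmod (Fint t (v+h)-Fint t v) <= 2*h/J.
Proof.
intros Ht HJ Hv Hh.
destruct (Req_dec h 0) as [->|Hh0].
{ rewrite Rplus_0_r. replace (_-_)%C with (RtoC 0) by ring. rewrite Cmod_0. lra. }
have H : forall (f : R -> R) f', (forall x, 0 < x -> is_derive f x (f' x)) ->
   (forall x, J <= x -> Rabs (f' x) <= / J) -> Rabs (f (v+h)-f v) <= h/J.
{ intros f f' Hd Hb. destruct (MVT_cor2 f f' v (v+h)) as (c & Hc & Hc'); [lra| |].
  - intros c Hc. apply is_derive_Reals, Hd. lra.
  - rewrite Hc, Rabs_mult. replace (v+h-v) with h by ring. rewrite (Rabs_right h) by lra. unfold Rdiv. rewrite Rmult_comm. lmul. apply Hb. lra. }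
unfold Fint, Cminus, Cplus, Copp; simpl. via Cmod_le_abs. replace (2*h/J) with (h/J+h/J) by lra. apply Rplus_le_compat.
- apply (H (fun v => sin (t*ln v)/t) (fun v => cos (t*ln v)/v)).
  + intros x Hx. auto_derive; [exact Hx|]. fd.
  + intros x Hx. unfold Rdiv. rewrite Rabs_mult, (Rabs_right (/ x)). 2:{ pos. }
    rewrite <- (Rmult_1_l (/ J)). apply Rmult_le_compat; [pos| | |].
    * pos.
    * apply Rabs_le. pose proof (COS_bound (t*ln x)). lra.
    * mono.
- apply (H (fun v => - cos (t*ln v)/t) (fun v => sin (t*ln v)/v)).
  + intros x Hx. auto_derive; [exact Hx|]. fd.
  + intros x Hx. unfold Rdiv. rewrite Rabs_mult, (Rabs_right (/ x)). 2:{ pos. }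
    rewrite <- (Rmult_1_l (/ J)). apply Rmult_le_compat; [pos| | |].
    * pos.
    * apply Rabs_le. pose proof (SIN_bound (t*ln x)). lra.
    * mono.
Qed.

(** The mean value theorem is applied twice to each coordinate, as it fails for complex values;
    second derivatives are of size [(1+|t|)/v^2]. *)
Lemma Fint_taylor2 t v h J : t <> 0 -> 0 < J -> J <= v -> 0 <= h ->
  Cmod (Fint t (v+h)-Fint t v-RtoC (h/v)*ce (t*ln v)) <= 2*h^2*(1+Rabs t)/J^2.
Proof.
intros Ht HJ Hv Hh.
destruct (Req_dec h 0) as [->|Hh0].
{ rewrite Rplus_0_r. unfold Rdiv. rewrite Rmult_0_l. replace (_-_-_)%C with (RtoC 0) by ring. rewrite Cmod_0. lra. }
have H : forall (f : R -> R) f' f'', (forall x, 0 < x -> is_derive f x (f' x)) ->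
   (forall x, 0 < x -> is_derive f' x (f'' x)) ->
   (forall x, J <= x -> Rabs (f'' x) <= (1+Rabs t)/J^2) ->
   Rabs (f (v+h)-f v-h*f' v) <= h^2*(1+Rabs t)/J^2.
{ intros f f' f'' Hd Hd2 Hb. destruct (MVT_cor2 f f' v (v+h)) as (c & Hc & Hc'); [lra| |].
  { intros c Hc. apply is_derive_Reals, Hd. lra. }
  destruct (MVT_cor2 f' f'' v c) as (d & He & He'); [lra| |].
  { intros d He. apply is_derive_Reals, Hd2. lra. }
  rewrite Hc. replace (f' c*(v+h-v)-h*f' v) with (h*(f' c-f' v)) by ring. rewrite He, !Rabs_mult, (Rabs_right h), (Rabs_right (c-v)) by lra. specialize (Hb d ltac:(lra)).
  replace (h^2*(1+Rabs t)/J^2) with (h*((1+Rabs t)/J^2*h)) by lra. mono. }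
have HB : forall x a b, J <= x -> Rabs a <= 1 -> Rabs b <= 1 ->
   Rabs ((t*a-b)/x^2) <= (1+Rabs t)/J^2.
{ intros x a b Hx Ha Hb. unfold Rdiv. rewrite Rabs_mult. rewrite (Rabs_right (/ x^2)) by pos. apply Rmult_le_compat; [pos|pos| |mono].
  unfold Rminus. via Rabs_triang. rewrite Rabs_Ropp, Rabs_mult. pose proof (Rabs_pos t). nra. }
have Hc1 : forall y, Rabs (cos y) <= 1 by (intros; apply Rabs_le; pose proof (COS_bound y); lra).
have Hs1 : forall y, Rabs (sin y) <= 1 by (intros; apply Rabs_le; pose proof (SIN_bound y); lra). replace (Fint t (v+h)-Fint t v-RtoC (h/v)*ce (t*ln v))%C with
  ((sin (t*ln (v+h))/t-sin (t*ln v)/t-h*(cos (t*ln v)/v),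
    - cos (t*ln (v+h))/t - - cos (t*ln v)/t-h*(sin (t*ln v)/v)) : C).
2:{ alg. }
via Cmod_le_abs. replace (2*h^2*(1+Rabs t)/J^2) with
  (h^2*(1+Rabs t)/J^2+h^2*(1+Rabs t)/J^2) by lra.
apply Rplus_le_compat.
- apply (H (fun v => sin (t*ln v)/t) (fun v => cos (t*ln v)/v)
    (fun v => (t * - sin (t*ln v)-cos (t*ln v))/v^2)).
  + intros x Hx. auto_derive; [exact Hx|]. fd.
  + intros x Hx. auto_derive; [lra|]. fd.
  + intros x Hx. apply HB; [exact Hx|rewrite Rabs_Ropp; apply Hs1|auto].
- apply (H (fun v => - cos (t*ln v)/t) (fun v => sin (t*ln v)/v)
    (fun v => (t*cos (t*ln v)-sin (t*ln v))/v^2)).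
  + intros x Hx. auto_derive; [exact Hx|]. fd.
  + intros x Hx. auto_derive; [lra|]. fd.
  + auto.
Qed.

Lemma Csum_telescope (g : nat -> C) a n :
  Csum (seq a n) (fun i => g (S i)-g i)%C = (g (a+n)%nat-g a)%C.
Proof.
induction n as [|n IH]; [simpl; rewrite Nat.add_0_r; ring|]. rewrite Csum_seq_S, IH, Nat.add_succ_r. ring.
Qed.

(** Comparison of the sum with the integral of [ce (t ln v)/v], useful while [|t|] is much smaller
    than [J]. The integral itself is the last term, which vanishes when [t L] is a multiple of
    [2 pi]. *)
Lemma apl_small_t (q r : nat) (J L t : R) :
  (1 <= r <= q)%nat -> 0 < L -> INR q < J -> t <> 0 ->
  Cmod (Csum (apl q r J (J*exp L)) (fun j => RtoC (/ INR j)*ce (t*ln (INR j)))%C) <=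
  (2*INR q^2*exp L*(1+Rabs t)+4*INR q)/J+Cmod (1-ce (t*L))/(INR q*Rabs t).
Proof.
intros Hr HL HJ Ht. have Hq1 : 1 <= INR q by (apply (le_INR 1); lia). have HeL : 1 <= exp L by (pose proof (exp_ineq1_le L); lra). have Hrq : INR r <= INR q by mono.
have HJ2 : J <= J*exp L by nra. destruct (apl_perm q r J (J*exp L) Hr HJ2) as (a & n & HP & Ha & Hb). rewrite (Csum_perm _ _ _ HP), Csum_map.
set (v := fun i => INR q*INR i+INR r). have Hv : forall i, INR (q*i+r) = v i by (intros; unfold v; rewrite plus_INR, mult_INR; easy).
have HvS : forall i, v (S i) = v i+INR q by (intros; unfold v; rewrite S_INR; ring).
have Hva : J <= v a < J+INR q.
{ split; [apply Ha; lia|]. destruct a as [|a']; [assert (v 0%nat = INR r) by (unfold v; simpl; ring); lra|].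
  rewrite HvS. assert (~ J <= v a'); [|lra]. unfold v. rewrite <- Ha. lia. }
have Hvb : J*exp L <= v (a+n)%nat < J*exp L+INR q.
{ split; [apply Hb; lia|]. destruct n as [|n'].
  - rewrite Nat.add_0_r. nra.
  - replace (a+S n')%nat with (S (a+n')) by lia. rewrite HvS. assert (~ J*exp L <= v (a+n')%nat); [|lra]. unfold v. rewrite <- Hb. lia. }
have Hn : INR q*INR n <= J*exp L.
{ assert (v (a+n)%nat = v a+INR q*INR n) by (unfold v; rewrite plus_INR; ring). lra. }
have Hvi : forall i, (a <= i)%nat -> J <= v i by (intros i Hi; apply Ha; exact Hi). set (Sm := Csum (seq a n) (fun i => RtoC (/ INR (q*i+r))*ce (t*ln (INR (q*i+r))))%C).
have H1 : Cmod (Fint t (v (a+n)%nat)-Fint t (v a)-RtoC (INR q)*Sm) <=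
   2*INR q^2*(1+Rabs t)/J^2*INR n.
{ rewrite <- (Csum_telescope (fun i => Fint t (v i))). unfold Sm. rewrite <- Csum_scal, <- Csum_minus. via Cmod_Csum.
  transitivity (Rsum (seq a n) (fun _ => 2*INR q^2*(1+Rabs t)/J^2)).
  - apply Rsum_le. intros i Hi%in_seq. rewrite Hv, HvS. specialize (Hvi i ltac:(lia)). etransitivity; [|apply (Fint_taylor2 t (v i) (INR q) J Ht); lra].
    apply Req_le. f_equal. alg.
  - rewrite Rsum_const, length_seq. lra. }
have H2 : Cmod (Fint t (v a)-Fint t J) <= 2*INR q/J.
{ replace (v a) with (J+(v a-J)) by ring. etransitivity; [apply (Fint_taylor1 t J (v a-J) J); lra|]. mono. }
have H3 : Cmod (Fint t (v (a+n)%nat)-Fint t (J*exp L)) <= 2*INR q/J.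
{ replace (v (a+n)%nat) with (J*exp L+(v (a+n)%nat-J*exp L)) by ring. etransitivity; [apply (Fint_taylor1 t (J*exp L) (v (a+n)%nat-J*exp L) J); lra|]. mono. }
have H4 : Cmod (Fint t (J*exp L)-Fint t J) = Cmod (1-ce (t*L))/Rabs t.
{ have EF : forall v, Fint t v = (- (RtoC (/ t)*Ci*ce (t*ln v)))%C.
  { alg. }
  rewrite !EF, ln_mult, ln_exp by lra. replace (t*(ln J+L)) with (t*ln J+t*L) by ring. rewrite ce_plus.
  replace (- (RtoC (/ t)*Ci*(ce (t*ln J)*ce (t*L))) - - (RtoC (/ t)*Ci*ce (t*ln J)))%C
    with (RtoC (/ t)*Ci*ce (t*ln J)*(1-ce (t*L)))%C by ring.
  rewrite !Cmod_mult, Cmod_R, Cmod_Ci, Cmod_ce, Rabs_inv. lra. }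
have H5 : INR q*Cmod Sm <= 2*INR q^2*(1+Rabs t)/J^2*INR n+4*INR q/J+Cmod (1-ce (t*L))/Rabs t.
{ replace (INR q*Cmod Sm) with (Cmod (RtoC (INR q)*Sm)) by (rewrite Cmod_mult, Cmod_R, Rabs_right; lra). replace (RtoC (INR q)*Sm)%C with
    (- (Fint t (v (a+n)%nat)-Fint t (v a)-RtoC (INR q)*Sm) +
     ((Fint t (v (a+n)%nat)-Fint t (J*exp L))+(- (Fint t (v a)-Fint t J)+(Fint t (J*exp L)-Fint t J))))%C by ring.
  via Cmod_triangle. rewrite Cmod_opp. etransitivity; [apply Rplus_le_compat_l, Cmod_triangle|].
  etransitivity; [apply Rplus_le_compat_l, Rplus_le_compat_l, Cmod_triangle|]. rewrite Cmod_opp, H4. lra. }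
have H6 : 2*INR q^2*(1+Rabs t)/J^2*INR n <= 2*INR q*(1+Rabs t)*exp L/J.
{
  replace (2*INR q^2*(1+Rabs t)/J^2*INR n) with
    (2*INR q*(1+Rabs t)/J^2*(INR q*INR n)) by lra.
  replace (2*INR q*(1+Rabs t)*exp L/J) with
    (2*INR q*(1+Rabs t)/J^2*(J*exp L)) by fd.
  mono. }
have Hat : 0 < Rabs t by (apply Rabs_pos_lt; exact Ht). apply Rmult_le_reg_l with (INR q); [lra|].
replace (INR q*((2*INR q^2*exp L*(1+Rabs t)+4*INR q)/J+Cmod (1-ce (t*L))/(INR q*Rabs t)))
  with (INR q*(2*INR q^2*exp L*(1+Rabs t))/J+INR q*(4*INR q)/J+Cmod (1-ce (t*L))/Rabs t)
  by fd.
assert (2*INR q*(1+Rabs t)*exp L/J <= INR q*(2*INR q^2*exp L*(1+Rabs t))/J).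
{ unfold Rdiv. rmul. assert (1 <= INR q^2) by nra. replace (2*INR q*(1+Rabs t)*exp L) with (2*INR q*((1+Rabs t)*exp L)*1) by ring.
  replace (INR q*(2*INR q^2*exp L*(1+Rabs t))) with (2*INR q*((1+Rabs t)*exp L)*INR q^2) by ring. mono. }
assert (4*INR q/J <= INR q*(4*INR q)/J).
{ unfold Rdiv. rmul. nra. }
lra.
Qed.

(** Up to [J^(1/4)] the sum is compared with an integral; larger [t] are treated by van der Corput
    and partial summation. With [2 K] differencings [vdc_all] reaches [J^(K+3/4)], beyond the
    required [J^K]. *)
Lemma apl_exp_sum (q : nat) (L : R) (K : nat) : (1 <= q)%nat -> 0 < L ->
  exists A d, 0 <= A /\ 0 < d /\ ev (fun J => forall r t,
    (1 <= r <= q)%nat -> t <> 0 -> Rabs t <= J^K ->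
    Cmod (Csum (apl q r J (J*exp L)) (fun j => RtoC (/ INR j)*ce (t*ln (INR j)))%C) <=
    A*Rpower J (- d)+Cmod (1-ce (t*L))/(INR q*Rabs t)).
Proof.
intros Hq HL. have Hq1 : 1 <= INR q by inr. have HeL : 1 <= exp L by (pose proof (exp_ineq1_le L); lra). destruct (vdc_all q (L+1) (2*K) Hq ltac:(lra)) as (A & HA & HV).
set (d := / (16*2^(2*K))) in *.
have Hd : 0 < d <= 1/16.
{ assert (1 <= 2^(2*K)) by (apply pow_R1_Rle; lra). unfold d. split; [pos|]. replace (1/16) with (/ 16) by lra. mono. }
set (A2 := 4*INR q^2*exp L+4*INR q). have HA2 : 0 <= A2 by (unfold A2; nra). exists (A+A2), d. split; [lra|]. split; [lra|].
apply (ev_imp _ _ (ev_and _ _ HV (ev_and _ _ (ev_ge 1) (ev_ge (INR q+1))))). intros J (HJV & HJ1 & HJq) r t Hr Ht HtK. have Hp := Rp_pos J (- d).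
have Hat : 0 < Rabs t by (apply Rabs_pos_lt; exact Ht).
have H0 : 0 <= Cmod (1-ce (t*L))/(INR q*Rabs t).
{ pos. }
destruct (Rle_dec (Rabs t) (Rpower J (1/4))) as [Hs|Hb].
- etransitivity; [apply apl_small_t; try assumption; lra|]. apply Rplus_le_compat_r. transitivity (A2*Rpower J (- d)); [|nra].
  have Hj : / J = Rpower J (- (1)).
  { rewrite Rpower_Ropp, Rpower_1 by lra. lra. }
  have H4 : 1 <= Rpower J (1/4) by (apply Rp_ge1; lra). unfold Rdiv. rewrite Hj. transitivity (A2*Rpower J (1/4)*Rpower J (- (1))).
  + rmul. unfold A2. assert (0 <= INR q^2*exp L) by nra. nra.
  + rewrite Rmult_assoc, <- Rpower_plus. lmul. apply Rp_le; lra.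
- transitivity (A*Rpower J (- d)); [|nra]. have HJ2 : J <= J*exp L by nra. destruct (apl_perm q r J (J*exp L) Hr HJ2) as (a & n & HP & Ha & Hbn).
  rewrite (Csum_perm _ _ _ HP), Csum_map. set (v := fun i => INR q*INR i+INR r).
  have Hv : forall i, INR (q*i+r) = v i by (intros; unfold v; rewrite plus_INR, mult_INR; easy). have Hr1 : 1 <= INR r <= INR q by (split; [apply (le_INR 1)|mono]; lia).
  have Hvp : forall i, 1 <= v i by (intros i; unfold v; pose proof (pos_INR i); nra). have Hva : J <= v a by (apply Ha; lia).
  rewrite (Csum_ext _ _ (fun i => RtoC (/ v i)*ce (t*ln (v i)))%C)
    by congruence.
  etransitivity.
  + apply (Csum_abel (fun i => / v i) (fun i => ce (t*ln (v i))) a n (A*Rpower J (1-d))).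
    * intros i _. specialize (Hvp i). have HvS : v (S i) = v i+INR q by (unfold v; rewrite S_INR; ring). go.
    * intros m Hm. replace (Cmod (Csum (seq a m) (fun i => ce (t*ln (v i))))) with
        (Cmod (Csum (seq a m) (fun i => ce (Rabs t*ln (v i))))).
      2:{ unfold Rabs. destruct (Rcase_abs t); [|lra].
          rewrite <- Cmod_conj, Csum_conj. f_equal. apply Csum_ext; intros. rewrite ce_conj. alg. }
      destruct (Nat.eq_dec m 0) as [->|Hm0].
      { simpl. rewrite Cmod_0. pos. }
      apply HJV; try lra.
      -- split; [lra|]. via HtK. rewrite <- (Rpower_pow K J) by lra. apply Rp_le; [lra|]. inr.
      -- exact Hva.
      (* The right end may overshoot [J exp L] by up to one step [q]; this is why [vdc_all] was
         invoked with [L+1]. *)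
      -- have Hlt : ~ J*exp L <= INR q*INR (a+m-1)+INR r by (rewrite <- Hbn; lia). replace (a+m)%nat with (S (a+m-1)) by lia. rewrite S_INR.
         assert (2 <= exp 1) by (pose proof (exp_ineq1_le 1); lra). rewrite exp_plus. nra.
  + replace (1-d) with (1 + - d) by ring. rewrite Rpower_plus, Rpower_1 by lra. transitivity (/ J*(A*(J*Rpower J (- d)))).
    * mono.
    * right. fd.
Qed.

(** An increment of [ln (v i)] lies between [q / v (i+1)] and [q / v i], and rounding the two ends
    costs at most one term. *)
Lemma apl_harmonic (q r : nat) (lo hi : R) : (1 <= r <= q)%nat -> 0 < lo -> lo <= hi ->
  Rabs (Rsum (apl q r lo hi) (fun j => / INR j)-ln (hi/lo)/INR q) <= / lo.
Proof.
intros Hr Hlo Hlh. have Hrq : 1 <= INR r <= INR q by (split; [apply (le_INR 1)|mono]; lia). destruct (apl_perm q r lo hi Hr Hlh) as (a & n & HP & Ha & Hb).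
rewrite (Rsum_perm _ _ _ HP), Rsum_map. set (v := fun i => INR q*INR i+INR r). rewrite (Rsum_ext _ _ (fun i => / v i)).
2:{ intros; unfold v; rewrite plus_INR, mult_INR; easy. }
have HvS : forall i, v (S i) = v i+INR q by (intros; unfold v; rewrite S_INR; ring). have Hvp : forall i, 1 <= v i by (intros i; unfold v; pose proof (pos_INR i); nra).
have Hva : lo <= v a < lo+INR q.
{ split; [apply Ha; lia|]. destruct a as [|a']; [assert (v 0%nat = INR r) by (unfold v; simpl; ring); lra|].
  rewrite HvS. assert (~ lo <= v a'); [|lra]. unfold v. rewrite <- Ha. lia. }
have Hvb : hi <= v (a+n)%nat by (apply Hb; lia). have Hstep : forall i, ln (v (S i))-ln (v i) <= INR q/v i /\
          INR q/v (S i) <= ln (v (S i))-ln (v i).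
{ intros i. specialize (Hvp i). rewrite HvS. split.
  - have H := ln_le_sub1 ((v i+INR q)/v i) ltac:(apply Rdiv_lt_0_compat; lra). rewrite ln_div in H by lra. replace ((v i+INR q)/v i-1) with (INR q/v i) in H by fd. lra.
  - have H := ln_le_sub1 (v i/(v i+INR q)) ltac:(apply Rdiv_lt_0_compat; lra). rewrite ln_div in H by lra.
    replace (v i/(v i+INR q)-1) with (- (INR q/(v i+INR q))) in H by fd. lra. }
rewrite ln_div by lra.
have Hln : ln (lo+INR q) <= ln lo+INR q/lo.
{ have H := ln_le_sub1 ((lo+INR q)/lo) ltac:(apply Rdiv_lt_0_compat; lra). rewrite ln_div in H by lra. replace ((lo+INR q)/lo-1) with (INR q/lo) in H by fd. lra. }
have Hlow : ln (v (a+n)%nat)-ln (v a) <= INR q*Rsum (seq a n) (fun i => / v i).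
{ rewrite <- (Rsum_telescope (fun i => ln (v i))), <- Rsum_scal. apply Rsum_le. intros i _. apply Hstep. }
have H1 : ln hi <= ln (v (a+n)%nat) by (apply ln_le; lra). have H2 : ln (v a) <= ln (lo+INR q) by (apply ln_le; lra).
have Hup : INR q*Rsum (seq a n) (fun i => / v i) <= INR q/lo+(ln hi-ln lo).
{ have Hll : ln lo <= ln hi by (apply ln_le; lra). assert (0 < / lo) by pos. destruct n as [|n]; [simpl; nra|].
  have Hind : INR q*Rsum (seq a (S n)) (fun i => / v i) <= INR q/v a+(ln (v (a+n)%nat)-ln (v a)).
  { clear Hb HP Hvb Hlow H1. induction n as [|n IH].
    - simpl. rewrite Nat.add_0_r. lra.
    - rewrite Rsum_seq_S. replace (a+S n)%nat with (S (a+n)) by lia. destruct (Hstep (a+n)%nat) as [_ Hs]. lra. }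
  assert (v (a+n)%nat < hi).
  { assert (~ hi <= v (a+n)%nat); [|lra]. unfold v. rewrite <- Hb. lia. }
  assert (ln (v (a+n)%nat) <= ln hi) by (apply ln_le; [specialize (Hvp (a+n)%nat)|]; lra). assert (ln lo <= ln (v a)) by (apply ln_le; lra).
  assert (INR q/v a <= INR q/lo).
  { mono. }
  lra. }
set (Sm := Rsum (seq a n) (fun i => / v i)) in *. apply Rabs_le. split; apply Rmult_le_reg_l with (INR q); try lra.
- replace (INR q*(Sm-(ln hi-ln lo)/INR q)) with (INR q*Sm-(ln hi-ln lo)) by fd. lra.
- replace (INR q*(Sm-(ln hi-ln lo)/INR q)) with (INR q*Sm-(ln hi-ln lo)) by fd. lra.
Qed.

(** The gain is uniformity in [lo]: there is no positive integer below 1, so a smaller [lo] can be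
    replaced by 1. *)
Lemma apl_harmonic_crude (q r : nat) (lo L : R) : (1 <= r <= q)%nat -> 0 < lo -> 0 < L ->
  Rsum (apl q r lo (lo*exp L)) (fun j => / INR j) <= L+1.
Proof.
intros Hr Hlo HL. have Hq1 : 1 <= INR q by (apply (le_INR 1); lia). have HeL : 1 < exp L by (pose proof (exp_ineq1 L); lra). destruct (Rle_dec 1 lo) as [H1|H1].
- have H := apl_harmonic q r lo (lo*exp L) Hr Hlo ltac:(nra). apply Rabs_le_between in H. replace (lo*exp L/lo) with (exp L) in H by fd. rewrite ln_exp in H.
  assert (L/INR q <= L).
  { cancel (INR q). nra. }
  assert (/ lo <= 1) by (rewrite <- Rinv_1; apply Rinv_le_contravar; lra). lra.
- transitivity (Rsum (apl q r 1 (1*exp L)) (fun j => / INR j)).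
  + apply Rsum_incl; [apply NoDup_apl| |].
    * intros j Hj%In_apl. apply In_apl. destruct Hj as (Hj & Hj2 & Hj3). split; [exact Hj|]. split; [|exact Hj3]. inr.
    * intros j Hj%In_apl. pos.
  + have H := apl_harmonic q r 1 (1*exp L) Hr Rlt_0_1 ltac:(lra). apply Rabs_le_between in H. replace (1*exp L/1) with (exp L) in H by field. rewrite ln_exp, Rinv_1 in H.
    assert (L/INR q <= L).
    { cancel (INR q). nra. }
    lra.
Qed.

Definition dvdb (g j : nat) : bool := (j mod g =? 0)%nat.

Lemma dvdb_true g j : (1 <= g)%nat -> dvdb g j = true <-> exists i, (j = g*i)%nat.
Proof.
intros Hg. unfold dvdb. rewrite Nat.eqb_eq. split.
- intros H%Nat.Div0.div_exact. eauto.
- intros [i ->]. rewrite Nat.mul_comm. apply Nat.Div0.mod_mul.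
Qed.

(** If one element [g i0] of the progression 1 modulo [q] is a multiple of [g], then [i0] inverts
    [g] modulo [q], and the cofactors are exactly the integers congruent to [i0]. *)
Lemma apl_multiples (q g : nat) lo hi : (1 <= q)%nat -> (1 <= g)%nat ->
  filter (dvdb g) (apl q 1 lo hi) = [] \/
  exists r, (1 <= r <= q)%nat /\
   Permutation (filter (dvdb g) (apl q 1 lo hi)) (map (Nat.mul g) (apl q r (lo/INR g) (hi/INR g))).
Proof.
intros Hq Hg. have Hg1 : 1 <= INR g by inr. destruct (filter (dvdb g) (apl q 1 lo hi)) as [|j0 l] eqn:E; [auto|right].
rewrite <- E. have Hj0 : In j0 (filter (dvdb g) (apl q 1 lo hi)) by (rewrite E; left; easy). apply filter_In in Hj0. destruct Hj0 as [Hj0 Hd0]. apply In_apl in Hj0.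
apply dvdb_true in Hd0; [|exact Hg]. destruct Hd0 as [i0 Ei0]. set (r := match (i0 mod q)%nat with O => q | S k => S k end).
have Hr : (1 <= r <= q)%nat /\ (r mod q = i0 mod q)%nat.
{ unfold r. pose proof (Nat.mod_upper_bound i0 q ltac:(lia)). destruct (i0 mod q)%nat eqn:E0.
  - rewrite Nat.Div0.mod_same. lia.
  - rewrite Nat.mod_small by lia. lia. }
exists r. split; [apply Hr|]. apply NoDup_Permutation.
- apply NoDup_filter, NoDup_apl.
- apply NoDup_map_NoDup_ForallPairs; [|apply NoDup_apl]. intros x y _ _ H. nia.
- intros j. rewrite filter_In, In_apl, dvdb_true, in_map_iff by exact Hg.
  have Hmod : forall i, ((g*i) mod q = 1 mod q)%nat <-> (i mod q = r mod q)%nat.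
  { intros i. rewrite (proj2 Hr). destruct Hj0 as (_ & _ & H0). rewrite Ei0 in H0. split; intros H.
    - rewrite <- (Nat.mul_1_r i), <- Nat.Div0.mul_mod_idemp_r, <- H0, Nat.Div0.mul_mod_idemp_r. replace (i*(g*i0))%nat with (i0*(g*i))%nat by ring.
      rewrite <- Nat.Div0.mul_mod_idemp_r, H, Nat.Div0.mul_mod_idemp_r. alg.
    - rewrite <- Nat.Div0.mul_mod_idemp_r, H, Nat.Div0.mul_mod_idemp_r. exact H0. }
  have Hrange : forall i, (lo <= INR (g*i) < hi <-> lo/INR g <= INR i < hi/INR g).
  { intros i. rewrite mult_INR. replace lo with (INR g*(lo/INR g)) at 1 by fd. replace hi with (INR g*(hi/INR g)) at 1 by fd. nra. }
  split.
  + intros ((H1 & H2 & H3) & i & ->). exists i. split; [lia|]. apply In_apl. split; [lia|]. split; [apply Hrange, H2|apply Hmod, H3].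
  + intros (i & <- & Hi). apply In_apl in Hi. destruct Hi as (H1 & H2 & H3). split; [|eauto]. split; [nia|]. split; [apply Hrange, H2|apply Hmod, H3].
Qed.

(** * Fejer kernels and bilinear forms *)

Definition Fej (N : nat) (x : R) : R := Cmod (Csum (seq 0 N) (fun n => ce (INR n*x)))^2/INR N.

(** The frequency [m-n] is kept as the pair [(m, n)]: the triangular weights of the Fejer kernel
    become multiplicities. *)
Definition pairs (N : nat) : list (nat*nat) := list_prod (seq 0 N) (seq 0 N).

Definition fr (k : nat*nat) : R := INR (fst k)-INR (snd k).

Lemma Fej_nonneg N x : 0 <= Fej N x.
Proof.
unfold Fej. destruct N; [simpl; unfold Rdiv; rewrite Cmod_0; lra|]. pos.
Qed.

Lemma Fej_expand N x : (1 <= N)%nat -> RtoC (Fej N x) = (RtoC (/ INR N)*Csum (pairs N) (fun k => ce (fr k*x)))%C.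
Proof.
intros HN. unfold Fej, pairs. unfold Rdiv. rewrite Rmult_comm, RtoC_mult, Cmod_sq_double, Csum_prod. f_equal. apply Csum_ext; intros m _. apply Csum_ext; intros n _.
rewrite <- ce_minus. unfold fr. simpl. alg.
Qed.

Lemma ce_geom x N : ((1-ce x)*Csum (seq 0 N) (fun n => ce (INR n*x)) = 1-ce (INR N*x))%C.
Proof.
induction N as [|N IH].
- simpl. rewrite Rmult_0_l, ce_0. ring.
- rewrite Csum_seq_S, Cmult_plus_distr_l, IH, S_INR. simpl (0+N)%nat. replace ((INR N+1)*x) with (INR N*x+x) by ring. rewrite ce_plus. ring.
Qed.

Lemma Fej_closed N x : (1 <= N)%nat -> INR N*Fej N x*(2-2*cos x) = 2-2*cos (INR N*x).
Proof.
intros HN. rewrite <- !Cmod_1_ce, <- ce_geom, Cmod_mult. unfold Fej. fd.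
Qed.

Lemma one_minus_cos_lower x : Rabs x <= PI -> x^2/16 <= 2-2*cos x.
Proof.
intros H. rewrite <- Cmod_1_ce. pose proof (Cmod_1_ce_lower x H). pose proof (Rabs_pos x). rewrite <- (pow2_abs x). nra.
Qed.

Lemma one_minus_cos_upper x : 2-2*cos x <= x^2.
Proof.
rewrite <- Cmod_1_ce. rewrite <- (pow2_abs x). apply pow_incr. split; [pos|]. rewrite <- ce_0. via ce_dist. rewrite Rminus_0_l, Rabs_Ropp. lra.
Qed.

Lemma Fej_decay N x : (1 <= N)%nat -> x <> 0 -> Rabs x <= PI -> Fej N x <= 64/(INR N*x^2).
Proof.
intros HN Hx0 Hx. assert (0 < INR N) by pos. have E := Fej_closed N x HN. have HL := one_minus_cos_lower x Hx. have HC := COS_bound (INR N*x). have Hx2 : 0 < x^2 by nra.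
apply Rmult_le_reg_r with (INR N*x^2); [nra|]. replace (64/(INR N*x^2)*(INR N*x^2)) with 64 by fd. nra.
Qed.

Lemma Fej_le N x : (1 <= N)%nat -> Fej N x <= INR N.
Proof.
intros HN. have HN0 : 0 < INR N by pos. unfold Fej. apply Rmult_le_reg_r with (INR N); [exact HN0|]. unfold Rdiv. rewrite Rmult_assoc, Rinv_l, Rmult_1_r by lra.
replace (INR N*INR N) with (INR N^2) by ring. apply pow_incr. split; [pos|]. via Cmod_Csum. rewrite (Rsum_ext _ _ (fun _ => 1)) by (intros; apply Cmod_ce).
rewrite Rsum_const, length_seq. lra.
Qed.

Lemma Fej_periodic N x (z : Z) : Fej N (x+2*PI*IZR z) = Fej N x.
Proof.
unfold Fej. do 3 f_equal. apply Csum_ext. intros n _. replace (INR n*(x+2*PI*IZR z)) with (INR n*x+INR n*(2*PI*IZR z)) by ring. rewrite ce_plus.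
have H : ce (2*PI*IZR z) = RtoC 1.
{ destruct z as [|p|p].
  - rewrite Rmult_0_r. apply ce_0.
  - rewrite <- (positive_nat_Z p), <- INR_IZR_INZ. apply ce_2PI_nat.
  - replace (2*PI*IZR (Z.neg p)) with (- (2*PI*IZR (Z.pos p))). 2:{ change (Z.neg p) with (- Z.pos p)%Z. rewrite opp_IZR. ring. }
    rewrite <- ce_conj. rewrite <- (positive_nat_Z p), <- INR_IZR_INZ, ce_2PI_nat. alg. }
rewrite <- (ce_pow (2*PI*IZR z)), H, Cpow_1_l. ring.
Qed.

(* Averaging over the order removes the zeros of the kernel. *)
Lemma Fej_leak N B x : (1 <= N)%nat -> (1 <= B)%nat -> Rabs x <= PI -> 16/INR B <= Rabs x ->
  Fej N x <= 128/INR N*Rsum (seq B B) (fun b => Fej b x).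
Proof.
intros HN HB Hx HxB. have HN0 : 0 < INR N by pos. have HB0 : 0 < INR B by pos.
have Hax : 0 < Rabs x.
{ assert (0 < 16/INR B) by pos. lra. }
have Hx0 : x <> 0 by (intros ->; rewrite Rabs_R0 in Hax; lra). have Hx2 : 0 < x^2 by nra. etransitivity; [apply Fej_decay; assumption|].
(* Over the orders [B <= b < 2 B] the cosines sum to at most [8/|x| <= B/2], so [2 - 2 cos (b x)] is
   at least 1 on average. *)
have Hcos : Rabs (Rsum (seq B B) (fun b => cos (INR b*x))) <= 8/Rabs x.
{ replace (Rsum (seq B B) (fun b => cos (INR b*x))) with (Re (Csum (seq B B) (fun b => ce (INR b*x))))
    by (rewrite Re_Csum; easy).
  via re_le_Cmod. apply Rmult_le_reg_l with (Rabs x/4); [lra|]. replace (Rabs x/4*(8/Rabs x)) with 2 by fd.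
  transitivity (Cmod (1-ce x)*Cmod (Csum (seq B B) (fun b => ce (INR b*x)))).
  - rmul. apply Cmod_1_ce_lower; exact Hx.
  - rewrite <- Cmod_mult.
    have E : Csum (seq B B) (fun b => ce (INR b*x)) = (ce (INR B*x)*Csum (seq 0 B) (fun n => ce (INR n*x)))%C.
    { change (seq B B) with (seq (0+B) B). rewrite Csum_seq_shift, <- Csum_scal. apply Csum_ext; intros n _. rewrite plus_INR, Rmult_plus_distr_r, ce_plus. ring. }
    rewrite E. replace ((1-ce x)*(ce (INR B*x)*Csum (seq 0 B) (fun n => ce (INR n*x))))%C with
      (ce (INR B*x)*((1-ce x)*Csum (seq 0 B) (fun n => ce (INR n*x))))%C by ring.
    rewrite ce_geom, Cmod_mult, Cmod_ce, Rmult_1_l. unfold Cminus. via Cmod_triangle. rewrite Cmod_opp, Cmod_ce, Cmod_1. lra. }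
have Hlow : INR B <= Rsum (seq B B) (fun b => 2-2*cos (INR b*x)).
{ rewrite Rsum_minus, Rsum_const, Rsum_scal, length_seq. apply Rabs_le_between in Hcos.
  assert (8/Rabs x <= INR B/2).
  { apply Rmult_le_reg_r with (Rabs x); [lra|]. replace (8/Rabs x*Rabs x) with 8 by fd. assert (16/INR B*INR B <= Rabs x*INR B) by mono.
    replace (16/INR B*INR B) with 16 in H by fd. lra. }
  lra. }
have Hsum : Rsum (seq B B) (fun b => 2-2*cos (INR b*x)) <=
   2*INR B*x^2*Rsum (seq B B) (fun b => Fej b x).
{ rewrite <- Rsum_scal. apply Rsum_le. intros b Hb%in_seq. rewrite <- Fej_closed by lia.
  pose proof (one_minus_cos_upper x). pose proof (Fej_nonneg b x). pose proof (COS_bound x).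
  assert (0 <= INR b <= 2*INR B).
  { split; [pos|]. replace 2 with (INR 2) by auto. rewrite <- mult_INR. mono. }
  replace (2*INR B*x^2*Fej b x) with (2*INR B*Fej b x*x^2) by ring. mono. }
set (Sg := Rsum (seq B B) (fun b => Fej b x)) in *.
have H1 : 1 <= 2*x^2*Sg.
{ nra. }
apply Rmult_le_reg_r with (INR N*x^2); [nra|]. replace (64/(INR N*x^2)*(INR N*x^2)) with 64 by fd. replace (128/INR N*Sg*(INR N*x^2)) with (64*(2*x^2*Sg)) by fd. lra.
Qed.

Lemma inv_nat_nonneg j : 0 <= / INR j.
Proof. destruct j; [simpl; rewrite Rinv_0; lra|pos]. Qed.

Definition Mh (l : list nat) (t : R) : C := Csum l (fun j => RtoC (/ INR j)*ce (t*ln (INR j)))%C.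

Definition Zh (l : list nat) (t : R) : C := Csum l (fun p => ce (t*ln (INR p))).

(* A pair [(j, p)] stands for the integer [j^6*p], counted with weight [1/j]. *)
Definition wt (u : nat*nat) : R := / INR (fst u).

(** The logarithm of [j^6 p]; the tactic of the same name is unrelated. *)
Definition pos (u : nat*nat) : R := 6*ln (INR (fst u))+ln (INR (snd u)).

Definition hat (lam : R) (s : nat*nat -> R) (U : list (nat*nat)) (k : R) : C :=
  Csum U (fun u => RtoC (wt u*s u)*ce (k*(pos u/lam)))%C.

(** A signed count of the products of an element of [U] and one of [W]; the kernel selects those
    with [y + pos u + pos w] close to 0 modulo [2 pi lam]. *)
Definition bil (lam : R) (N : nat) (U W : list (nat*nat)) (s1 s2 : nat*nat -> R) (y : R) : R :=
  Rsum U (fun u => Rsum W (fun w =>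
    wt u*s1 u*(wt w*s2 w)*Fej N ((y+pos u+pos w)/lam))).

Definition one (_ : nat*nat) : R := 1.

Lemma hat_prod lam l P k : lam <> 0 ->
  hat lam one (list_prod l P) k = (Mh l (6*k/lam)*Zh P (k/lam))%C.
Proof.
intros Hl. unfold hat, Mh, Zh. rewrite Csum_prod, Csum_mult. apply Csum_ext; intros j _. apply Csum_ext; intros p _. unfold wt, one, pos. simpl. rewrite Rmult_1_r.
rewrite <- Cmult_assoc, <- ce_plus. do 2 f_equal. lra.
Qed.

Lemma bil_fourier lam N U W s1 s2 y : lam <> 0 -> (1 <= N)%nat ->
  RtoC (bil lam N U W s1 s2 y) =
  Csum (pairs N) (fun k => RtoC (/ INR N)*ce (fr k*(y/lam))*hat lam s1 U (fr k)*hat lam s2 W (fr k))%C.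
Proof.
intros Hl HN. unfold bil. rewrite <- Csum_RtoC. transitivity (Csum U (fun u => Csum W (fun w => Csum (pairs N) (fun k =>
   RtoC (/ INR N)*ce (fr k*(y/lam))*(RtoC (wt u*s1 u)*ce (fr k*(pos u/lam))) *
   (RtoC (wt w*s2 w)*ce (fr k*(pos w/lam))))%C))).
- apply Csum_ext; intros u _. rewrite <- Csum_RtoC. apply Csum_ext; intros w _. rewrite RtoC_mult, (Fej_expand N) by exact HN. rewrite Cmult_assoc, <- Csum_scal.
  apply Csum_ext; intros k _. replace (fr k*((y+pos u+pos w)/lam)) with
    (fr k*(y/lam)+(fr k*(pos u/lam)+fr k*(pos w/lam))) by lra.
  rewrite !ce_plus, RtoC_mult. ring.
- erewrite (Csum_ext U); [|intros u _; apply Csum_swap]. cbv beta. rewrite Csum_swap. apply Csum_ext; intros k _.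
  unfold hat. rewrite <- Cmult_assoc, Csum_mult, <- Csum_scal. apply Csum_ext; intros u _. rewrite <- Csum_scal. apply Csum_ext; intros w _. ring.
Qed.

Lemma hat_energy lam N U s : lam <> 0 -> (1 <= N)%nat ->
  / INR N*Rsum (pairs N) (fun k => Cmod (hat lam s U (fr k))^2) =
  Rsum U (fun u => Rsum U (fun v => wt u*s u*(wt v*s v)*Fej N ((pos u-pos v)/lam))).
Proof.
intros Hl HN. apply RtoC_inj. rewrite RtoC_mult, <- !Csum_RtoC, <- Csum_scal. transitivity (Csum (pairs N) (fun k => Csum U (fun u => Csum U (fun v =>
   (RtoC (/ INR N)*(RtoC (wt u*s u)*RtoC (wt v*s v)*ce (fr k*((pos u-pos v)/lam))))%C)))).
- apply Csum_ext; intros k _. unfold hat. rewrite Cmod_sq_double, <- Csum_scal. apply Csum_ext; intros u _. rewrite <- Csum_scal. apply Csum_ext; intros v _.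
  replace (fr k*((pos u-pos v)/lam)) with (fr k*(pos u/lam)-fr k*(pos v/lam)) by lra. rewrite ce_minus, Cmult_conj. alg.
- rewrite Csum_swap. apply Csum_ext; intros u _. rewrite <- Csum_RtoC, Csum_swap. apply Csum_ext; intros v _.
  rewrite (RtoC_mult _ (Fej _ _)), (Fej_expand N) by exact HN. rewrite Cmult_assoc, <- Csum_scal. apply Csum_ext; intros k _. alg.
Qed.

(** On the physical side the energy is a sum of nonnegative kernel values, so inserting signs can
    only decrease it. *)
Lemma hat_energy_sign lam N U s : lam <> 0 -> (1 <= N)%nat -> (forall u, Rabs (s u) <= 1) ->
  / INR N*Rsum (pairs N) (fun k => Cmod (hat lam s U (fr k))^2) <=
  / INR N*Rsum (pairs N) (fun k => Cmod (hat lam one U (fr k))^2).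
Proof.
intros Hl HN Hs. rewrite !hat_energy by assumption.
have Hw : forall u, 0 <= wt u.
{ intros u; apply inv_nat_nonneg. }
apply Rsum_le; intros u _. apply Rsum_le; intros v _. apply Rmult_le_compat_r; [apply Fej_nonneg|].
unfold one. replace (wt u*s u*(wt v*s v)) with (wt u*wt v*(s u*s v)) by ring. replace (wt u*1*(wt v*1)) with (wt u*wt v*1) by ring.
apply Rmult_le_compat_l; [apply Rmult_le_pos; apply Hw|]. via Rle_abs. rewrite Rabs_mult. pose proof (Hs u). pose proof (Hs v). pose proof (Rabs_pos (s u)). nra.
Qed.

Lemma pairs_diag N (f : nat*nat -> R) :
  Rsum (pairs N) f = Rsum (seq 0 N) (fun n => f (n, n)) +
    Rsum (pairs N) (fun k => if (fst k =? snd k)%nat then 0 else f k).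
Proof.
have H : Rsum (pairs N) (fun k => if (fst k =? snd k)%nat then f k else 0) = Rsum (seq 0 N) (fun n => f (n, n)).
{ unfold pairs. rewrite Rsum_prod. apply Rsum_ext. intros m Hm. cbn [fst snd]. apply in_split in Hm as Hs. destruct Hs as (l1 & l2 & E).
  have Hn := seq_NoDup N 0. rewrite E in Hn |- *. apply NoDup_remove_2 in Hn. rewrite Rsum_app. cbn [Rsum]. rewrite Nat.eqb_refl. rewrite !Rsum_zero.
  - ring.
  - intros x Hx. destruct (Nat.eqb_spec m x); [|lra]. subst. exfalso. apply Hn, in_app_iff. tauto.
  - intros x Hx. destruct (Nat.eqb_spec m x); [|lra]. subst. exfalso. apply Hn, in_app_iff. tauto. }
rewrite <- H, <- Rsum_plus. apply Rsum_ext. intros k _. destruct (_ =? _)%nat; lra.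
Qed.

Definition mass (l : list nat) : R := Rsum l (fun j => / INR j).

Definition num (P : list nat) : R := INR (length P).

Lemma Mh_0 l : Mh l 0 = RtoC (mass l).
Proof.
unfold Mh, mass. rewrite <- Csum_RtoC. apply Csum_ext; intros. rewrite Rmult_0_l, ce_0. ring.
Qed.

Lemma Zh_0 l : Zh l 0 = RtoC (num l).
Proof.
unfold Zh, num. rewrite (Csum_ext _ _ (fun _ => RtoC 1)); [rewrite Csum_const; ring|]. intros. rewrite Rmult_0_l. apply ce_0.
Qed.

Lemma mass_nonneg l : 0 <= mass l.
Proof. apply Rsum_nonneg; intros; apply inv_nat_nonneg. Qed.

Lemma Mh_le_mass l t : Cmod (Mh l t) <= mass l.
Proof.
unfold Mh, mass. via Cmod_Csum. apply Rsum_le; intros j _. rewrite Cmod_mult, Cmod_R, Cmod_ce, Rmult_1_r, Rabs_right; [lra|apply Rle_ge, inv_nat_nonneg].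
Qed.

Definition zsum (lam : R) (N : nat) (P : list nat) : R :=
  / INR N*Rsum (pairs N) (fun k => Cmod (Zh P (fr k/lam))^2).

(* The diagonal frequencies give the main term. *)
Lemma bil_unsigned lam N l1 l2 P1 P2 y m V1 V2 : lam <> 0 -> (1 <= N)%nat -> 0 <= m -> 0 <= V1 -> 0 <= V2 ->
  (forall k, In k (pairs N) -> fst k <> snd k ->
     Cmod (Mh l1 (6*fr k/lam))*Cmod (Mh l2 (6*fr k/lam)) <= m) ->
  zsum lam N P1 <= V1^2 -> zsum lam N P2 <= V2^2 ->
  Rabs (bil lam N (list_prod l1 P1) (list_prod l2 P2) one one y-mass l1*num P1*(mass l2*num P2)) <= m*(V1*V2).
Proof.
intros Hl HN Hm HV1 HV2 Hk HZ1 HZ2. have HNi : 0 < / INR N by pos. have E := bil_fourier lam N (list_prod l1 P1) (list_prod l2 P2) one one y Hl HN.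
set (F := fun k => (RtoC (/ INR N)*ce (fr k*(y/lam))*hat lam one (list_prod l1 P1) (fr k) *
    hat lam one (list_prod l2 P2) (fr k))%C) in E.
have ER : bil lam N (list_prod l1 P1) (list_prod l2 P2) one one y = Rsum (pairs N) (fun k => Re (F k)).
{ rewrite <- Re_Csum. unfold F. fold F. rewrite <- E. auto. }
rewrite ER, pairs_diag.
have Hd : Rsum (seq 0 N) (fun n => Re (F (n, n))) = mass l1*num P1*(mass l2*num P2).
{ rewrite (Rsum_ext _ _ (fun _ => / INR N*(mass l1*num P1*(mass l2*num P2)))).
  - rewrite Rsum_const, length_seq. fd.
  - intros n _. unfold F, fr. cbn [fst snd]. replace (INR n-INR n) with 0 by ring. rewrite !hat_prod by exact Hl. rewrite Rmult_0_l, ce_0.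
    replace (6*0/lam) with 0 by lra. replace (0/lam) with 0 by lra. rewrite !Mh_0, !Zh_0, <- !RtoC_mult. simpl. ring. }
rewrite Hd. match goal with |- Rabs (?a + ?b - ?c) <= _ => replace (a+b-c) with b by ring end. via Rsum_abs. transitivity (Rsum (pairs N) (fun k => m * / INR N *
   (Cmod (Zh P1 (fr k/lam))*Cmod (Zh P2 (fr k/lam))))).
- apply Rsum_le. intros k Hin. destruct (Nat.eqb_spec (fst k) (snd k)) as [He|He].
  + rewrite Rabs_R0. pos.
  + via re_le_Cmod. unfold F. rewrite !hat_prod by exact Hl. rewrite !Cmod_mult, Cmod_ce, Cmod_R, (Rabs_right (/ INR N)) by lra.
    replace (/ INR N*1*(Cmod (Mh l1 (6*fr k/lam))*Cmod (Zh P1 (fr k/lam))) *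
      (Cmod (Mh l2 (6*fr k/lam))*Cmod (Zh P2 (fr k/lam)))) with
      (Cmod (Mh l1 (6*fr k/lam))*Cmod (Mh l2 (6*fr k/lam)) *
        (/ INR N*(Cmod (Zh P1 (fr k/lam))*Cmod (Zh P2 (fr k/lam))))) by ring.
    rewrite (Rmult_assoc m). apply Rmult_le_compat_r; [|auto]. pos.
- rewrite Rsum_scal, (Rmult_assoc m). lmul. rewrite <- Rsum_scal. rewrite (Rsum_ext _ _ (fun k => (sqrt (/ INR N)*Cmod (Zh P1 (fr k/lam))) *
      (sqrt (/ INR N)*Cmod (Zh P2 (fr k/lam))))).
  + apply Rsum_CS_abs; try assumption.
    * rewrite (Rsum_ext _ _ (fun k => / INR N*Cmod (Zh P1 (fr k/lam))^2)).
      { rewrite Rsum_scal. exact HZ1. }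
      intros k _. rewrite Rpow_mult_distr, pow2_sqrt by lra. lra.
    * rewrite (Rsum_ext _ _ (fun k => / INR N*Cmod (Zh P2 (fr k/lam))^2)).
      { rewrite Rsum_scal. exact HZ2. }
      intros k _. rewrite Rpow_mult_distr, pow2_sqrt by lra. lra.
  + intros k _. rewrite <- (sqrt_sqrt (/ INR N)) at 1 by lra. ring.
Qed.

(* Large sieve: distinct points of [[Z, 2Z)] are logarithmically spaced by [1/(2 Z)]. *)
Lemma zsum_bound lam N (Z : R) (P : list nat) : 1 <= lam -> (1 <= N)%nat -> 1 <= Z -> NoDup P ->
  (forall p, In p P -> Z <= INR p < 2*Z) ->
  zsum lam N P <= num P*(3*INR N+64*Z*lam).
Proof.
intros Hl HN HZ Hnd HP. have HPI := PI2_1. have HN0 : 0 < INR N by pos.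
have E : zsum lam N P = Rsum P (fun p => Rsum P (fun q => Fej N ((ln (INR p)-ln (INR q))/lam))).
{ unfold zsum. apply RtoC_inj. rewrite RtoC_mult, <- !Csum_RtoC, <- Csum_scal. transitivity (Csum (pairs N) (fun k => Csum P (fun p => Csum P (fun q =>
     (RtoC (/ INR N)*ce (fr k*((ln (INR p)-ln (INR q))/lam)))%C)))).
  - apply Csum_ext; intros k _. unfold Zh. rewrite Cmod_sq_double, <- Csum_scal. apply Csum_ext; intros p _. rewrite <- Csum_scal. apply Csum_ext; intros q _.
    rewrite <- ce_minus. do 2 f_equal. lra.
  - rewrite Csum_swap. apply Csum_ext; intros p _. rewrite <- Csum_RtoC, Csum_swap. apply Csum_ext; intros q _. rewrite Fej_expand, <- Csum_scal by exact HN. auto. }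
rewrite E. clear E.
destruct (nfloor_ex (16*Z*lam/INR N)) as [D0 [HD1 HD2]].
{ pos. }
set (D := S D0). have HD : INR D = INR D0+1 by apply S_INR. have HDp : 0 < INR D by pos. set (Bc := 256*Z^2*lam^2/INR N).
have HBc : 0 < Bc by (unfold Bc; apply Rdiv_lt_0_compat; [|lra]; assert (0 < Z^2) by nra; assert (0 < lam^2) by nra; nra).
(* Up to the distance [D], about [16 Z lam/N], the kernel is bounded by [N]; beyond, its decay
   [Bc/m^2] is majorised by [Bc (1/(m-1) - 1/m)], which telescopes. *)
set (psi := fun m => if (m <=? D)%nat then INR N else Bc*(/ (INR m-1) - / INR m)).
have Hpsi : forall m, 0 <= psi m.
{ intros m. unfold psi. destruct (Nat.leb_spec m D); [lra|]. assert (1 < INR m) by (apply (lt_INR 1); unfold D in *; lia). assert (/ INR m <= / (INR m-1)) by mono. nra. }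
have Hsum : forall n, Rsum (seq 1 n) psi <= INR N*INR D+Bc/INR D.
{ intros n. have HBD : 0 < Bc/INR D by pos.
  have Hc : Rsum (seq 1 n) psi <= if (n <=? D)%nat then INR N*INR n else INR N*INR D+Bc/INR D-Bc/INR n.
  { induction n as [|n IH]; [simpl; lra|]. rewrite Rsum_seq_S. replace (1+n)%nat with (S n) by lia. unfold psi at 2. destruct (Nat.leb_spec (S n) D) as [H1|H1].
    - destruct (Nat.leb_spec n D); [|lia]. inr.
    - rewrite S_INR. replace (INR n+1-1) with (INR n) by ring. destruct (Nat.leb_spec n D) as [H2|H2].
      + assert (n = D) by lia. subst n. lra.
      + lra. }
  destruct (Nat.leb_spec n D) as [H|H].
  - inr.
  - assert (0 <= Bc/INR n) by pos. lra. }
destruct (nfloor_ex Z) as [Zn [HZn1 HZn2]]; [lra|]. unfold num. rewrite <- Rsum_const. apply Rsum_le. intros p Hp. transitivity (Rsum P (fun q => psi ((q-p)+(p-q))%nat)).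
- apply Rsum_le. intros q Hq. set (m := ((q-p)+(p-q))%nat). unfold psi. destruct (Nat.leb_spec m D) as [H|H]; [apply Fej_le; exact HN|].
  have Hm1 : 1 < INR m by (apply (lt_INR 1); unfold D in *; lia). pose proof (HP p Hp) as Hp'. pose proof (HP q Hq) as Hq'.
  have Habs : Rabs (INR p-INR q) = INR m.
  { unfold m. destruct (Nat.le_ge_cases p q).
    - replace (q-p+(p-q))%nat with (q-p)%nat by lia. rewrite minus_INR by lia. apply le_INR in H0. rewrite Rabs_left1 by lra. ring.
    - replace (q-p+(p-q))%nat with (p-q)%nat by lia. rewrite minus_INR by lia. apply le_INR in H0. go. }
  have Hlog : forall a b, Z <= a < 2*Z -> Z <= b <= a -> (a-b)/(2*Z) <= ln a-ln b <= 1.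
  { intros a b Ha Hb. split.
    - have HL := ln_le_sub1 (b/a) ltac:(apply Rdiv_lt_0_compat; lra). rewrite ln_div in HL by lra.
      assert ((a-b)/(2*Z) <= (a-b)/a).
      { mono. }
      replace (b/a-1) with (- ((a-b)/a)) in HL by fd. lra.
    - have HL := ln_le_sub1 (a/b) ltac:(apply Rdiv_lt_0_compat; lra). rewrite ln_div in HL by lra.
      assert (a/b <= 2).
      { cancel b. lra. }
      lra. }
  have Hd : INR m/(2*Z) <= Rabs (ln (INR p)-ln (INR q)) <= 1.
  { rewrite <- Habs. destruct (Rle_dec (INR q) (INR p)).
    - destruct (Hlog (INR p) (INR q)); try lra. assert (0 <= (INR p-INR q)/(2*Z)) by pos. rewrite !Rabs_right by lra. lra.
    - destruct (Hlog (INR q) (INR p)); try lra. assert (0 <= (INR q-INR p)/(2*Z)) by pos. rewrite (Rabs_minus_sym (INR p)), (Rabs_minus_sym (ln (INR p))).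
      rewrite !Rabs_right by lra. lra. }
  set (x := (ln (INR p)-ln (INR q))/lam).
  have Hx : Rabs x = Rabs (ln (INR p)-ln (INR q))/lam.
  { unfold x, Rdiv. rewrite Rabs_mult, (Rabs_right (/ lam)); go. }
  have Hx1 : INR m/(2*Z)/lam <= Rabs x.
  { rewrite Hx. mono. }
  have Hx2 : Rabs x <= 1.
  { rewrite Hx. cancel lam. lra. }
  have Hm0 : 0 < INR m/(2*Z)/lam by pos. have Hx0 : x <> 0 by (intros Ex; rewrite Ex, Rabs_R0 in Hx1; lra). etransitivity; [apply Fej_decay; [exact HN|exact Hx0|lra]|].
  have Hx3 : (INR m/(2*Z)/lam)^2 <= x^2.
  { rewrite <- (pow2_abs x). mono. }
  transitivity (Bc/INR m^2).
  + unfold Bc. replace (256*Z^2*lam^2/INR N/INR m^2) with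
      (64/(INR N*(INR m/(2*Z)/lam)^2)) by fd.
    mono.
  + replace (/ (INR m-1) - / INR m) with (/ ((INR m-1)*INR m)) by fd. unfold Rdiv. mono.
- via (Rsum_dist psi P p (2*Zn+2) Hpsi Hnd).
  + intros q Hq. pose proof (HP p Hp). pose proof (HP q Hq).
    have H2 : INR q <= INR (p+(2*Zn+2)).
    { inr. }
    have H3 : INR p <= INR (q+(2*Zn+2)).
    { inr. }
    apply INR_le in H2, H3. lia.
  + specialize (Hsum (2*Zn+2)%nat). unfold psi at 1. simpl (0 <=? D)%nat.
    have H1 : INR N*INR D <= 16*Z*lam+INR N.
    { rewrite HD. assert (INR N*INR D0 <= INR N*(16*Z*lam/INR N)) by mono. replace (INR N*(16*Z*lam/INR N)) with (16*Z*lam) in H by fd. lra. }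
    have H2 : Bc/INR D <= 16*Z*lam.
    { cancel (INR D). assert (16*Z*lam*(16*Z*lam/INR N) <= 16*Z*lam*INR D) by mono. replace (16*Z*lam*(16*Z*lam/INR N)) with Bc in H by (unfold Bc; field; lra). lra. }
    lra.
Qed.

Lemma Re_RtoC_mult x z : Re (RtoC x*z) = x*Re z.
Proof. unfold Re, RtoC, Cmult; simpl. ring. Qed.

(** The left side is [2 (Im z)^2], that is [2 (|z| - e Re z)(|z| + e Re z)]: a number close to the
    ray of sign [e] has a square close to the positive ray, whatever [e] is. *)
Lemma unit_square_gap (z : C) (e : R) : e = 1 \/ e = -1 ->
  Cmod z^2-Re (z^2) <= 4*Cmod z*(Cmod z-e*Re z).
Proof.
intros He. pose proof (re_le_Cmod z) as H%Rabs_le_between. have E := Cmod2_alt z.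
have E2 : Re (z^2) = Re z^2-Im z^2.
{ destruct z as [x y]. unfold Re, Im. simpl. ring. }
nra.
Qed.

(* If a measure [g] of total mass about one has Fourier transform about [eps j] at each [y j], then
   squaring the phases removes the signs, so averaging over [j] confines [g] to the frequencies

   where [ce (2 tau y)] does not cancel; there a shift by [al] cannot reverse the sign. *)
Lemma spectral_contradiction {A : Type} (K : list A) (g : A -> C) (tau : A -> R)
   (J1 : list nat) (nu eps be be' y : nat -> R) (al e b : R) :
  0 <= e -> 0 <= b -> e+b <= 1/50 ->
  Rsum K (fun k => Cmod (g k)) <= 1+e ->
  (forall j, In j J1 -> 0 <= nu j) -> Rsum J1 nu = 1 ->
  (forall j, eps j = 1 \/ eps j = -1) ->
  (forall j, In j J1 -> 1-e-2*be j <= eps j*Re (Csum K (fun k => g k*ce (tau k*y j))%C)) ->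
  (forall j, In j J1 -> 1-e-2*be' j <= - eps j*Re (Csum K (fun k => g k*ce (tau k*(y j+al)))%C)) ->
  Rsum J1 (fun j => nu j*be j) <= b -> Rsum J1 (fun j => nu j*be' j) <= b ->
  (forall k, In k K -> Cmod (Csum J1 (fun j => RtoC (nu j)*ce (2*tau k*y j))%C) <= 1/2 \/
     Cmod (1-ce (tau k*al)) <= b) ->
  False.
Proof.
intros He Hb Heb Hg Hnu Hnu1 Heps H1 H2 Hbe Hbe' Hk. set (d := fun k j => Cmod (g k)-eps j*Re (g k*ce (tau k*y j))%C).
set (d' := fun k j => Cmod (g k) - - eps j*Re (g k*ce (tau k*(y j+al)))%C).
have Hre : forall k x j, Rabs (eps j*Re (g k*ce x)%C) <= Cmod (g k).
{ intros k x j. rewrite Rabs_mult. have H := re_le_Cmod (g k*ce x). rewrite Cmod_mult, Cmod_ce, Rmult_1_r in H.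
  destruct (Heps j) as [-> | ->]; unfold Rabs at 1; destruct (Rcase_abs _); lra. }
have Hd : forall k j, 0 <= d k j /\ 0 <= d' k j.
{ intros k j. have Ha := Hre k (tau k*y j) j. pose proof (Hre k (tau k*(y j+al)) j) as Hb'. apply Rabs_le_between in Ha, Hb'. unfold d, d'. lra. }
set (D := fun k => Rsum J1 (fun j => nu j*d k j)). set (D' := fun k => Rsum J1 (fun j => nu j*d' k j)).
have HD : forall k, 0 <= D k /\ 0 <= D' k.
{ intros k. split; apply Rsum_nonneg; intros j Hj; apply Rmult_le_pos; try apply Hnu; try apply Hd; exact Hj. }
set (G := Rsum K (fun k => Cmod (g k))) in *. have Htot : forall (sg bb yy : nat -> R),
   (forall j, In j J1 -> 1-e-2*bb j <= sg j*Re (Csum K (fun k => g k*ce (tau k*yy j))%C)) ->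
   Rsum J1 (fun j => nu j*bb j) <= b ->
   Rsum K (fun k => Rsum J1 (fun j => nu j*(Cmod (g k)-sg j*Re (g k*ce (tau k*yy j))%C))) <= 2*(e+b).
{ intros sg bb yy Ha Hbb. rewrite Rsum_swap. transitivity (Rsum J1 (fun j => 2*e*nu j+2*(nu j*bb j))).
  - apply Rsum_le. intros j Hj. rewrite Rsum_scal, Rsum_minus, Rsum_scal, <- Re_Csum. fold G. specialize (Ha j Hj). specialize (Hnu j Hj). nra.
  - rewrite Rsum_plus, !Rsum_scal, Hnu1. lra. }
have HDs : Rsum K D <= 2*(e+b) by eauto. assert (HDs' : Rsum K D' <= 2*(e+b)) by eauto.
(* If the averaged phases cancel, the squared values cannot all be near [|g k|^2], so the defect [D]
   is large; if the shift by [al] is harmless, the values at [y] and [y+al] cannot have opposite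
   signs, so [D + D'] is large. *)
have Hpt : forall k, In k K -> Cmod (g k) <= 8*D k+8*D' k.
{ intros k Hin. destruct (HD k) as [HD1 HD2]. have Hc := Cmod_ge_0 (g k). destruct (Req_dec (Cmod (g k)) 0) as [Hz|Hnz]; [lra|]. destruct (Hk k Hin) as [Hh|Hl].
  - have Hq : Cmod (g k)^2-Re (Csum J1 (fun j => RtoC (nu j)*(g k*ce (tau k*y j))^2)%C)
       <= 4*Cmod (g k)*D k.
    { unfold D. rewrite <- Rsum_scal, Re_Csum. rewrite <- (Rmult_1_r (Cmod (g k)^2)), <- Hnu1, <- Rsum_scal, <- Rsum_minus.
      apply Rsum_le. intros j Hj. rewrite Re_RtoC_mult. have Hu := unit_square_gap (g k*ce (tau k*y j)) (eps j) (Heps j).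
      rewrite !Cmod_mult, Cmod_ce, Rmult_1_r in Hu. unfold d. specialize (Hnu j Hj). nra. }
    have Hs : Re (Csum J1 (fun j => RtoC (nu j)*(g k*ce (tau k*y j))^2)%C) <= Cmod (g k)^2*(1/2).
    { rewrite (Csum_ext _ _ (fun j => g k^2*(RtoC (nu j)*ce (2*tau k*y j)))%C).
      - rewrite Csum_scal. via Rle_abs. via re_le_Cmod. rewrite Cmod_mult, Cmod_pow. mono.
      - intros j _. rewrite Cpow_mult_l, ce_pow. simpl (INR 2). replace ((1+1)*(tau k*y j)) with (2*tau k*y j) by ring. ring. }
    nra.
  - have Hl2 : Cmod (g k) <= D k+D' k.
    { unfold D, D'. rewrite <- Rsum_plus. rewrite <- (Rmult_1_r (Cmod (g k))), <- Hnu1, <- Rsum_scal.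
      apply Rsum_le. intros j Hj. specialize (Hnu j Hj). rewrite <- Rmult_plus_distr_l, Rmult_comm. lmul. unfold d, d'.
      have HH : Rabs (eps j*Re (g k*ce (tau k*y j)*(1-ce (tau k*al)))%C) <= Cmod (g k)*b.
      { rewrite Rabs_mult. assert (Rabs (eps j) = 1) as -> by (destruct (Heps j) as [-> | ->]; unfold Rabs; destruct (Rcase_abs _); lra).
        rewrite Rmult_1_l. via re_le_Cmod. rewrite !Cmod_mult, Cmod_ce, Rmult_1_r. mono. }
      replace (g k*ce (tau k*y j)*(1-ce (tau k*al)))%C with
        (g k*ce (tau k*y j)-g k*ce (tau k*(y j+al)))%C in HH.
      2:{ rewrite Rmult_plus_distr_l, ce_plus. ring. }
      unfold Cminus in HH. rewrite re_plus in HH. replace (Re (- (g k*ce (tau k*(y j+al))))) with (- Re (g k*ce (tau k*(y j+al)))%C) in HH by easy.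
      apply Rabs_le_between in HH. nra. }
    lra. }
(* This gives [G <= 16/25], against [G >= 1 - e - 2 b >= 24/25] below. *)
have HG : G <= 32*(e+b).
{ unfold G. etransitivity; [apply Rsum_le; exact Hpt|]. rewrite Rsum_plus, !Rsum_scal. lra. }
have HG2 : 1-e-2*b <= G.
{ transitivity (Rsum J1 (fun j => nu j*(eps j*Re (Csum K (fun k => g k*ce (tau k*y j))%C)))).
  - transitivity (Rsum J1 (fun j => (1-e)*nu j + -2*(nu j*be j))).
    + rewrite Rsum_plus, !Rsum_scal, Hnu1. lra.
    + apply Rsum_le. intros j Hj. specialize (H1 j Hj). specialize (Hnu j Hj). nra.
  - transitivity (Rsum J1 (fun j => nu j*G)).
    + apply Rsum_le. intros j Hj. apply Rmult_le_compat_l; [auto|]. rewrite Re_Csum, <- Rsum_scal. apply Rsum_le. intros k _.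
      pose proof (Hre k (tau k*y j) j) as Ha%Rabs_le_between. lra.
    + rewrite Rsum_scal_r, Hnu1. lra. }
lra.
Qed.

Lemma wt_nonneg u : 0 <= wt u.
Proof. apply inv_nat_nonneg. Qed.

(** A term on which [gd] fails goes at worst from plus to minus its weight, a loss of twice that
    weight. *)
Lemma bil_sign lam N U W s1 s2 y (gd : nat*nat -> nat*nat -> bool) (e : R) :
  e = 1 \/ e = -1 -> (forall u, Rabs (s1 u) <= 1) -> (forall u, Rabs (s2 u) <= 1) ->
  (forall u w, In u U -> In w W -> gd u w = true -> e*(s1 u*s2 w) = 1) ->
  bil lam N U W one one y-2*Rsum U (fun u => Rsum W (fun w => wt u*wt w *
     (if gd u w then 0 else Fej N ((y+pos u+pos w)/lam)))) <= e*bil lam N U W s1 s2 y.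
Proof.
intros He H1 H2 Hgd. unfold bil. rewrite <- !Rsum_scal, <- Rsum_minus. apply Rsum_le; intros u Hu. rewrite <- !Rsum_scal, <- Rsum_minus.
apply Rsum_le; intros w Hw. unfold one. have HF := Fej_nonneg N ((y+pos u+pos w)/lam). set (F := Fej N ((y+pos u+pos w)/lam)) in *.
have Hww : 0 <= wt u*wt w by (apply Rmult_le_pos; apply wt_nonneg). specialize (Hgd u w Hu Hw). destruct (gd u w).
- specialize (Hgd eq_refl). replace (e*(wt u*s1 u*(wt w*s2 w)*F)) with (wt u*wt w*F*(e*(s1 u*s2 w))) by ring. rewrite Hgd. lra.
- have Hs : -1 <= e*(s1 u*s2 w).
  { assert (Rabs (e*(s1 u*s2 w)) <= 1).
    { rewrite !Rabs_mult. pose proof (H1 u). pose proof (H2 w). pose proof (Rabs_pos (s1 u)). destruct He as [-> | ->]; unfold Rabs at 1; destruct (Rcase_abs _); nra. }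
    apply Rabs_le_between in H. lra. }
  replace (e*(wt u*s1 u*(wt w*s2 w)*F)) with (wt u*wt w*F*(e*(s1 u*s2 w))) by ring. assert (0 <= wt u*wt w*F) by pos. nra.
Qed.

Definition fsel (b : nat -> bool) (u : nat*nat) : R := if b (fst u) then 1 else 0.

Lemma bil_filter lam N l P l' P' b b' y :
  Rsum (list_prod l P) (fun u => Rsum (list_prod l' P') (fun w => wt u*wt w *
     (fsel b u*fsel b' w*Fej N ((y+pos u+pos w)/lam)))) =
  bil lam N (list_prod (filter b l) P) (list_prod (filter b' l') P') one one y.
Proof.
unfold bil. rewrite !Rsum_prod, Rsum_filter. apply Rsum_ext; intros j _. destruct (b j) eqn:Eb.
- apply Rsum_ext; intros p _. rewrite !Rsum_prod, Rsum_filter. apply Rsum_ext; intros j' _. destruct (b' j') eqn:Eb'.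
  + apply Rsum_ext; intros p' _. unfold fsel, one. cbn [fst]. rewrite Eb, Eb'. ring.
  + apply Rsum_zero; intros p' _. unfold fsel. cbn [fst]. rewrite Eb'. ring.
- apply Rsum_zero; intros p _. rewrite Rsum_prod. apply Rsum_zero; intros j' _. apply Rsum_zero; intros p' _. unfold fsel. cbn [fst]. rewrite Eb. ring.
Qed.

Lemma filter_all {A} (l : list A) : filter (fun _ => true) l = l.
Proof. induction l; simpl; congruence. Qed.

Definition far (B : nat) (z : R) : Prop :=
  exists (x : R) (n : Z), z = x+2*PI*IZR n /\ Rabs x <= PI /\ 16/INR B <= Rabs x.

Lemma Fej_far N B z : (1 <= N)%nat -> (1 <= B)%nat -> far B z ->
  Fej N z <= 128/INR N*Rsum (seq B B) (fun b => Fej b z).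
Proof.
intros HN HB (x & n & -> & Hx1 & Hx2). rewrite Fej_periodic. rewrite (Rsum_ext _ _ (fun b => Fej b x)) by (intros; apply Fej_periodic). apply Fej_leak; assumption.
Qed.

(** A union bound over the ways a pair can be bad: it lies outside the window, [u] is in the top
    slice, [u] and [w] share a factor from [G], or one of them has a factor from [G1], which will be
    the factors of [j1]. Each class is majorised by an unsigned form on sublists, the first one by
    kernels of lower order [b]. *)
Lemma bad_pairs lam N B l P1 P2 y (gd : nat*nat -> nat*nat -> bool) (top : nat -> bool) (G G1 : list nat) :
  (1 <= N)%nat -> (1 <= B)%nat ->
  (forall u w, In u (list_prod l P1) -> In w (list_prod l P2) -> gd u w = false ->
     far B ((y+pos u+pos w)/lam) \/ top (fst u) = true \/
     (exists g, In g G /\ dvdb g (fst u) = true /\ dvdb g (fst w) = true) \/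
     (exists g, In g G1 /\ (dvdb g (fst u) = true \/ dvdb g (fst w) = true))) ->
  Rsum (list_prod l P1) (fun u => Rsum (list_prod l P2) (fun w => wt u*wt w *
     (if gd u w then 0 else Fej N ((y+pos u+pos w)/lam)))) <=
  128/INR N*Rsum (seq B B) (fun b => bil lam b (list_prod l P1) (list_prod l P2) one one y) +
  bil lam N (list_prod (filter top l) P1) (list_prod l P2) one one y +
  Rsum G (fun g => bil lam N (list_prod (filter (dvdb g) l) P1) (list_prod (filter (dvdb g) l) P2) one one y) +
  Rsum G1 (fun g => bil lam N (list_prod (filter (dvdb g) l) P1) (list_prod l P2) one one y +
                    bil lam N (list_prod l P1) (list_prod (filter (dvdb g) l) P2) one one y).
Proof.
intros HN HB Hgd. have HN1 : 0 < 128/INR N by pos. set (tt := fun _ : nat => true). set (F := fun u w => Fej N ((y+pos u+pos w)/lam)).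
have Ef : filter tt l = l by apply filter_all. set (T := fun b b' => Rsum (list_prod l P1) (fun u => Rsum (list_prod l P2) (fun w => wt u*wt w *
   (fsel b u*fsel b' w*F u w)))).
have ET : forall b b', T b b' = bil lam N (list_prod (filter b l) P1) (list_prod (filter b' l) P2) one one y.
{ intros. apply bil_filter. }
replace (bil lam N (list_prod (filter top l) P1) (list_prod l P2) one one y) with (T top tt) by congruence. rewrite (Rsum_ext G _ (fun g => T (dvdb g) (dvdb g))) by auto.
rewrite (Rsum_ext G1 _ (fun g => T (dvdb g) tt+T tt (dvdb g))) by congruence. set (E := Rsum (list_prod l P1) (fun u => Rsum (list_prod l P2) (fun w => wt u*wt w *
    (128/INR N*Rsum (seq B B) (fun b => Fej b ((y+pos u+pos w)/lam)))))).
replace (128/INR N*Rsum (seq B B) (fun b => bil lam b (list_prod l P1) (list_prod l P2) one one y)) with E.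
2:{ unfold E, bil. rewrite (Rsum_swap (seq B B)), <- Rsum_scal. apply Rsum_ext; intros u _.
    rewrite (Rsum_swap (seq B B)), <- Rsum_scal. apply Rsum_ext; intros w _.
    rewrite (Rsum_scal (seq B B) (fun x => Fej x ((y+pos u+pos w)/lam)) (wt u*one u*(wt w*one w))). unfold one. ring. }
have EH : forall H b b', Rsum H (fun g => T (b g) (b' g)) =
   Rsum (list_prod l P1) (fun u => Rsum (list_prod l P2) (fun w => wt u*wt w *
    (Rsum H (fun g : nat => fsel (b g) u*fsel (b' g) w)*F u w))).
{ intros H b b'. unfold T. rewrite Rsum_swap. apply Rsum_ext; intros u _. rewrite Rsum_swap. apply Rsum_ext; intros w _. rewrite Rsum_scal, Rsum_scal_r. lra. }
rewrite Rsum_plus, (EH G dvdb dvdb), (EH G1 dvdb (fun _ => tt)), (EH G1 (fun _ => tt) dvdb). unfold E, T.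
 rewrite <- !Rsum_plus. apply Rsum_le; intros u Hu.
rewrite <- !Rsum_plus. apply Rsum_le; intros w Hw. rewrite <- !Rmult_plus_distr_l. apply Rmult_le_compat_l; [apply Rmult_le_pos; apply wt_nonneg|].
specialize (Hgd u w Hu Hw). have HF : 0 <= F u w by apply Fej_nonneg. have Hs : forall b v, 0 <= fsel b v by (intros b v; unfold fsel; destruct (b (fst v)); lra).
have Hs1 : forall b v, b (fst v) = true -> fsel b v = 1 by (intros b v Hb; unfold fsel; rewrite Hb; easy).
have A1 : 0 <= 128/INR N*Rsum (seq B B) (fun b => Fej b ((y+pos u+pos w)/lam)).
{ apply Rmult_le_pos; [lra|]. apply Rsum_nonneg; intros; apply Fej_nonneg. }
have A2 : 0 <= fsel top u*fsel tt w*F u w by (apply Rmult_le_pos; [apply Rmult_le_pos; apply Hs|exact HF]).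
have A3 : 0 <= Rsum G (fun g => fsel (dvdb g) u*fsel (dvdb g) w)*F u w.
{ apply Rmult_le_pos; [|exact HF]. apply Rsum_nonneg; intros; apply Rmult_le_pos; apply Hs. }
have A4 : 0 <= Rsum G1 (fun g => fsel (dvdb g) u*fsel tt w)*F u w.
{ apply Rmult_le_pos; [|exact HF]. apply Rsum_nonneg; intros; apply Rmult_le_pos; apply Hs. }
have A5 : 0 <= Rsum G1 (fun g => fsel tt u*fsel (dvdb g) w)*F u w.
{ apply Rmult_le_pos; [|exact HF]. apply Rsum_nonneg; intros; apply Rmult_le_pos; apply Hs. }
destruct (gd u w); [lra|]. specialize (Hgd eq_refl). change (Fej N ((y+pos u+pos w)/lam)) with (F u w). destruct Hgd as [Hf|[Ht|[(g & Hg & Hg1 & Hg2)|(g & Hg & Hg1)]]].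
- have H := Fej_far N B _ HN HB Hf. fold (F u w) in H. lra.
- rewrite (Hs1 top u Ht) in *. replace (fsel tt w) with 1 in * by easy. lra.
- assert (1 <= Rsum G (fun g => fsel (dvdb g) u*fsel (dvdb g) w)).
  { etransitivity; [|apply (Rsum_In_le G _ g); [intros; apply Rmult_le_pos; apply Hs|exact Hg]]. cbv beta. rewrite !Hs1 by assumption. lra. }
  nra.
- have Htt : forall v, fsel tt v = 1 by easy. destruct Hg1 as [Hg1|Hg1].
  + assert (1 <= Rsum G1 (fun g => fsel (dvdb g) u*fsel tt w)).
    { etransitivity; [|apply (Rsum_In_le G1 _ g); [intros; apply Rmult_le_pos; apply Hs|exact Hg]]. cbv beta. rewrite (Hs1 _ _ Hg1), Htt. lra. }
    nra.
  + assert (1 <= Rsum G1 (fun g => fsel tt u*fsel (dvdb g) w)).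
    { etransitivity; [|apply (Rsum_In_le G1 _ g); [intros; apply Rmult_le_pos; apply Hs|exact Hg]]. cbv beta. rewrite (Hs1 _ _ Hg1), Htt. lra. }
    nra.
Qed.

Lemma In_pairs N k : In k (pairs N) <-> (fst k < N)%nat /\ (snd k < N)%nat.
Proof.
unfold pairs. destruct k as [m n]. rewrite in_prod_iff, !in_seq. simpl. lia.
Qed.

(** Zero frequencies give the main term exactly; at the others the sum over [j] is at most [dM] and
    the primes are left to the large sieve. *)
Lemma unsigned_energy lam N l P dM v e : lam <> 0 -> (1 <= N)%nat -> 0 <= dM ->
  (forall k, In k (pairs N) -> fst k <> snd k -> Cmod (Mh l (6*fr k/lam)) <= dM) ->
  zsum lam N P <= (v*num P)^2 -> dM^2*v^2 <= e*mass l^2 ->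
  / INR N*Rsum (pairs N) (fun k => Cmod (hat lam one (list_prod l P) (fr k))^2) <=
  (1+e)*(mass l*num P)^2.
Proof.
intros Hl HN HdM Hk Hz He. have HNi : 0 < / INR N by pos. rewrite pairs_diag, Rmult_plus_distr_l.
have Hd : / INR N*Rsum (seq 0 N) (fun n => Cmod (hat lam one (list_prod l P) (fr (n, n)))^2) = (mass l*num P)^2.
{ rewrite (Rsum_ext _ _ (fun _ => (mass l*num P)^2)).
  - rewrite Rsum_const, length_seq. fd.
  - intros n _. unfold fr. cbn [fst snd]. replace (INR n-INR n) with 0 by ring. rewrite hat_prod by exact Hl.
    replace (6*0/lam) with 0 by lra. replace (0/lam) with 0 by lra. rewrite Mh_0, Zh_0, <- RtoC_mult, Cmod_R, pow2_abs. lra. }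
rewrite Hd. have Ho : / INR N*Rsum (pairs N) (fun k => if (fst k =? snd k)%nat then 0 else
   Cmod (hat lam one (list_prod l P) (fr k))^2) <= dM^2*(v*num P)^2.
{ transitivity (dM^2*zsum lam N P).
  - unfold zsum. rewrite <- !Rsum_scal. apply Rsum_le. intros k Hin. destruct (Nat.eqb_spec (fst k) (snd k)) as [E|E].
    + rewrite Rmult_0_r. pos.
    + rewrite hat_prod, Cmod_mult, Rpow_mult_distr by exact Hl. replace (dM^2*(/ INR N*Cmod (Zh P (fr k/lam))^2)) with
        (/ INR N*(dM^2*Cmod (Zh P (fr k/lam))^2)) by ring.
      lmul. rmul. apply pow_incr. split; [pos|auto].
  - mono. }
nra.
Qed.

(** [dM] bounds the sums over [j] at nonzero frequencies, [mg g] the square of those over multiples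
    of [g], and [v] is the loss of the large sieve. The long average bounds the bad pairs. The
    disjunction on [(sh, sg)] expresses that the shift [al] reverses the sign of every good
    product. *)
Lemma core_contradiction (lam : R) (N B : nat) (l P1 P2 l1 G : list nat) (top : nat -> bool)
  (nu mg eps : nat -> R) (s1 s2 : nat*nat -> R) (al c dM v e b : R) :
  lam <> 0 -> (1 <= B)%nat -> (2*B <= N)%nat -> 0 < mass l -> 0 < num P1 -> 0 < num P2 ->
  (forall u, Rabs (s1 u) <= 1) -> (forall u, Rabs (s2 u) <= 1) -> 0 <= dM -> 0 <= v ->
  0 <= e -> 0 <= b -> e+b <= 1/50 ->
  (forall k, In k (pairs N) -> fst k <> snd k -> Cmod (Mh l (6*fr k/lam)) <= dM) ->
  (forall N', (1 <= N' <= N)%nat -> zsum lam N' P1 <= (v*num P1)^2) ->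
  (forall N', (1 <= N' <= N)%nat -> zsum lam N' P2 <= (v*num P2)^2) ->
  dM^2*v^2 <= e*mass l^2 ->
  (forall g, In g G -> (1 <= g)%nat /\ 0 <= mg g) ->
  (forall g k, In g G -> In k (pairs N) -> fst k <> snd k ->
     Cmod (Mh (filter (dvdb g) l) (6*fr k/lam))^2 <= mg g) ->
  (forall j, In j l1 -> 0 <= nu j) -> Rsum l1 nu = 1 -> (forall j, eps j = 1 \/ eps j = -1) ->
  Rsum l1 (fun j => nu j*(
     (128*INR B/INR N*(mass l^2+dM^2*v^2)+mass (filter top l)*(mass l+dM*v^2) +
      Rsum G (fun g => mass (filter (dvdb g) l)^2+mg g*v^2) +
      2*Rsum (filter (fun g => dvdb g j) G) (fun g => mass (filter (dvdb g) l)*(mass l+dM*v^2)))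
     / mass l^2)) <= b ->
  (forall j sh sg u w, In j l1 -> (sh = 0 /\ sg = eps j) \/ (sh = al /\ sg = - eps j) ->
     In u (list_prod l P1) -> In w (list_prod l P2) ->
     far B ((c+6*ln (INR j)+sh+pos u+pos w)/lam) \/ top (fst u) = true \/
     (exists g, In g G /\ dvdb g (fst u) = true /\ dvdb g (fst w) = true) \/
     (exists g, In g G /\ dvdb g j = true /\ (dvdb g (fst u) = true \/ dvdb g (fst w) = true)) \/
     sg*(s1 u*s2 w) = 1) ->
  (forall k, In k (pairs N) ->
     Cmod (Csum l1 (fun j => RtoC (nu j)*ce (2*(fr k/lam)*(6*ln (INR j))))%C) <= 1/2 \/
     Cmod (1-ce (fr k/lam*al)) <= b) ->
  False.
Proof.
intros Hl HB HBN HM Hn1 Hn2 Hs1 Hs2 HdM Hv He Hb Heb Hk HZ1 HZ2 Hde HG Hmg Hnu Hnu1 Heps Hbeta Hgood Hav. have HN : (1 <= N)%nat by lia.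
set (M := mass l) in *. set (n1 := num P1) in *. set (n2 := num P2) in *. set (U := list_prod l P1) in *. set (W := list_prod l P2) in *.
set (mu := M*n1*(M*n2)). have Hmu : 0 < mu by (unfold mu; repeat apply Rmult_lt_0_compat; assumption). set (q := dM^2*v^2) in *.
have Hpsub : forall N', (N' <= N)%nat -> forall k, In k (pairs N') -> In k (pairs N).
{ intros N' H k. rewrite !In_pairs. lia. }
have HU : forall N' l1' l2' y m, (1 <= N' <= N)%nat -> 0 <= m ->
   (forall k, In k (pairs N') -> fst k <> snd k ->
      Cmod (Mh l1' (6*fr k/lam))*Cmod (Mh l2' (6*fr k/lam)) <= m) ->
   Rabs (bil lam N' (list_prod l1' P1) (list_prod l2' P2) one one y-mass l1'*n1*(mass l2'*n2)) <=
   m*v^2*(n1*n2).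
{ intros N' l1' l2' y m HN' Hm Hmk. etransitivity; [apply (bil_unsigned lam N' l1' l2' P1 P2 y m (v*n1) (v*n2)); try assumption; try lia|].
  - pos.
  - pos.
  - auto.
  - auto.
  - lra. }
have Hfull : forall N' y, (1 <= N' <= N)%nat ->
   Rabs (bil lam N' U W one one y-mu) <= q*(n1*n2).
{ intros N' y HN'. apply HU; [exact HN'|pos|]. intros k Hin Hne. have Hc := Hk k (Hpsub N' ltac:(lia) k Hin) Hne. pose proof (Cmod_ge_0 (Mh l (6*fr k/lam))). nra. }
have Hhalf : forall b' y, bil lam N (list_prod (filter b' l) P1) W one one y <=
      mass (filter b' l)*(M+dM*v^2)*(n1*n2) /\
    bil lam N U (list_prod (filter b' l) P2) one one y <= mass (filter b' l)*(M+dM*v^2)*(n1*n2).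
{ intros b' y. have Hm : 0 <= mass (filter b' l)*dM by (apply Rmult_le_pos; [apply mass_nonneg|exact HdM]). split.
  - have H := HU N (filter b' l) l y (mass (filter b' l)*dM) ltac:(lia) Hm.
    assert (H' : Rabs (bil lam N (list_prod (filter b' l) P1) W one one y-mass (filter b' l)*n1*(M*n2)) <=
      mass (filter b' l)*dM*v^2*(n1*n2)).
    { apply H. intros k Hin Hne. apply Rmult_le_compat; try apply Cmod_ge_0; [apply Mh_le_mass|auto]. }
    apply Rabs_le_between in H'. lra.
  - have H := HU N l (filter b' l) y (mass (filter b' l)*dM) ltac:(lia) Hm.
    assert (H' : Rabs (bil lam N U (list_prod (filter b' l) P2) one one y-M*n1*(mass (filter b' l)*n2)) <=
      mass (filter b' l)*dM*v^2*(n1*n2)).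
    { apply H. intros k Hin Hne. rewrite Rmult_comm. apply Rmult_le_compat; try apply Cmod_ge_0; [apply Mh_le_mass|auto]. }
    apply Rabs_le_between in H'. lra. }
(* The relative unsigned mass of the bad pairs at the shift indexed by [j]: leakage of the kernel,
   top slice, factors common to [u] and [w], factors shared with [j]. *)
set (be := fun j => (128*INR B/INR N*(M^2+q)+mass (filter top l)*(M+dM*v^2) +
    Rsum G (fun g => mass (filter (dvdb g) l)^2+mg g*v^2) +
    2*Rsum (filter (fun g => dvdb g j) G) (fun g => mass (filter (dvdb g) l)*(M+dM*v^2)))/M^2).
have Hone : forall j sh sg, In j l1 -> (sh = 0 /\ sg = eps j) \/ (sh = al /\ sg = - eps j) ->
   (1-e-2*be j)*mu <= sg*bil lam N U W s1 s2 (c+6*ln (INR j)+sh).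
{ intros j sh sg Hj Hsh. set (y := c+6*ln (INR j)+sh).
  have Hsg : sg = 1 \/ sg = -1.
  { destruct (Heps j), Hsh as [[_ ->]|[_ ->]]; lra. }
  have HS := bil_sign lam N U W s1 s2 y (fun u w => ind (sg*(s1 u*s2 w) = 1)) sg Hsg Hs1 Hs2
    (fun u w _ _ H => proj1 (ind_true _) H).
  have HBad := bad_pairs lam N B l P1 P2 y (fun u w => ind (sg*(s1 u*s2 w) = 1)) top G
    (filter (fun g => dvdb g j) G) HN HB.
  assert (HBad' := HBad ltac:(
    intros u w Hu Hw Hgd; cbv beta in Hgd;
    destruct (Hgood j sh sg u w Hj Hsh Hu Hw) as [H|[H|[H|[H|H]]]];
    [left; exact H|right; left; exact H|right; right; left; exact H
    |right; right; right; destruct H as (g & H1 & H2 & H3); exists g; split; [apply filter_In; split; assumption|exact H3]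
    |exfalso; rewrite (proj2 (ind_true _) H) in Hgd; discriminate])).
  fold U W in HBad'. clear HBad. set (Bad := Rsum U (fun u => Rsum W (fun w => wt u*wt w *
       (if ind (sg*(s1 u*s2 w) = 1) then 0 else Fej N ((y+pos u+pos w)/lam))))) in *.
  have E1 : Rsum (seq B B) (fun b => bil lam b U W one one y) <= INR B*((M^2+q)*(n1*n2)).
  { rewrite <- (length_seq B B) at 3. rewrite <- Rsum_const. apply Rsum_le. intros b' Hb'%in_seq.
    pose proof (Hfull b' y ltac:(lia)) as H%Rabs_le_between. unfold mu in H. lra. }
  have E2 := proj1 (Hhalf top y). have E3 : Rsum G (fun g => bil lam N (list_prod (filter (dvdb g) l) P1) (list_prod (filter (dvdb g) l) P2) one one y)
     <= Rsum G (fun g => mass (filter (dvdb g) l)^2+mg g*v^2)*(n1*n2).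
  { rewrite <- Rsum_scal_r. apply Rsum_le. intros g Hg. have H := HU N (filter (dvdb g) l) (filter (dvdb g) l) y (mg g) ltac:(lia) (proj2 (HG g Hg)).
    assert (H' : Rabs (bil lam N (list_prod (filter (dvdb g) l) P1) (list_prod (filter (dvdb g) l) P2) one one y -
       mass (filter (dvdb g) l)*n1*(mass (filter (dvdb g) l)*n2)) <= mg g*v^2*(n1*n2)).
    { apply H. intros k Hin Hne. specialize (Hmg g k Hg Hin Hne). lra. }
    apply Rabs_le_between in H'. lra. }
  have E4 : Rsum (filter (fun g => dvdb g j) G) (fun g => bil lam N (list_prod (filter (dvdb g) l) P1) W one one y +
       bil lam N U (list_prod (filter (dvdb g) l) P2) one one y) <=
     2*Rsum (filter (fun g => dvdb g j) G) (fun g => mass (filter (dvdb g) l)*(M+dM*v^2))*(n1*n2).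
  { rewrite <- Rsum_scal, <- Rsum_scal_r. apply Rsum_le. intros g Hg. destruct (Hhalf (dvdb g) y). lra. }
  assert (E1' : 128/INR N*Rsum (seq B B) (fun b => bil lam b U W one one y) <=
     128*INR B/INR N*(M^2+q)*(n1*n2)).
  { replace (128*INR B/INR N*(M^2+q)*(n1*n2)) with (128/INR N*(INR B*((M^2+q)*(n1*n2)))) by lra. mono. }
  have HBb : Bad <= be j*mu.
  { unfold be, mu. replace (M*n1*(M*n2)) with (M^2*(n1*n2)) by ring. unfold Rdiv at 1. rewrite Rmult_assoc. rewrite <- (Rmult_assoc (/ M^2)), Rinv_l, Rmult_1_l by pos.
    lra. }
  pose proof (Hfull N y ltac:(lia)) as HF%Rabs_le_between.
  assert (q*(n1*n2) <= e*mu).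
  { unfold mu. replace (e*(M*n1*(M*n2))) with (e*M^2*(n1*n2)) by ring. mono. }
  lra. }
(* Spectral terms of the signed form, divided by the unsigned main term [mu]. *)
set (g := fun k => (RtoC (/ mu)*(RtoC (/ INR N)*ce (fr k*(c/lam))*hat lam s1 U (fr k)*hat lam s2 W (fr k)))%C).
have Hbil : forall y, bil lam N U W s1 s2 (c+y) = mu*Re (Csum (pairs N) (fun k => g k*ce (fr k/lam*y))%C).
{ intros y. have E := bil_fourier lam N U W s1 s2 (c+y) Hl HN. apply (f_equal Re) in E. simpl (Re (RtoC _)) in E.
  rewrite E. clear E. rewrite <- Re_RtoC_mult, <- Csum_scal. apply (f_equal Re). apply Csum_ext; intros k _.
  unfold g. replace (fr k*((c+y)/lam)) with (fr k*(c/lam)+fr k/lam*y) by lra. rewrite ce_plus. alg. }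
(* Cauchy-Schwarz, after replacing the energy of each signed factor by the unsigned one with
   [hat_energy_sign]. *)
have HgS : Rsum (pairs N) (fun k => Cmod (g k)) <= 1+e.
{ have EA : forall s P, (forall u, Rabs (s u) <= 1) -> zsum lam N P <= (v*num P)^2 -> 0 <= num P ->
     Rsum (pairs N) (fun k => (sqrt (/ INR N)*Cmod (hat lam s (list_prod l P) (fr k)))^2) <=
       (sqrt (1+e)*(M*num P))^2.
  { intros s P Hs Hz Hnp. rewrite Rpow_mult_distr, pow2_sqrt by lra. rewrite (Rsum_ext _ _ (fun k => / INR N*Cmod (hat lam s (list_prod l P) (fr k))^2)).
    - rewrite Rsum_scal. etransitivity; [apply hat_energy_sign; assumption|]. apply unsigned_energy with (dM := dM) (v := v); assumption.
    - intros k _. rewrite Rpow_mult_distr, pow2_sqrt; [lra|pos]. }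
  apply Rmult_le_reg_l with mu; [exact Hmu|]. rewrite <- Rsum_scal.
  rewrite (Rsum_ext _ _ (fun k => (sqrt (/ INR N)*Cmod (hat lam s1 U (fr k)))*(sqrt (/ INR N)*Cmod (hat lam s2 W (fr k))))).
  - replace (mu*(1+e)) with ((sqrt (1+e)*(M*n1))*(sqrt (1+e)*(M*n2))). 2:{ unfold mu. rewrite <- (sqrt_sqrt (1+e)) at 3 by lra. ring. }
    apply Rsum_CS_abs.
    + apply EA; [assumption|auto|unfold n1 in Hn1; lra].
    + apply EA; [assumption|auto|unfold n2 in Hn2; lra].
    + pos.
    + pos.
  - intros k _. unfold g. rewrite !Cmod_mult, !Cmod_R, Cmod_ce. rewrite (Rabs_right (/ mu)) by pos. rewrite (Rabs_right (/ INR N)) by pos.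
    rewrite <- (sqrt_sqrt (/ INR N)) at 1 by pos. fd. }
apply (spectral_contradiction (pairs N) g (fun k => fr k/lam) l1 nu eps be be (fun j => 6*ln (INR j)) al e b);
  try assumption.
- intros j Hj. have H := Hone j 0 (eps j) Hj ltac:(left; split; easy). rewrite Rplus_0_r, Hbil in H. nra.
- intros j Hj. have H := Hone j al (- eps j) Hj ltac:(right; split; easy). rewrite Rplus_assoc, Hbil in H. nra.
Qed.

(** * Progressions, their multiples, and sums over common factors *)

Lemma apl_hi_split J L g : INR g <> 0 -> J*exp L/INR g = J/INR g*exp L.
Proof. lra. Qed.

Lemma Mh_multiples q g lo hi t : (1 <= q)%nat -> (1 <= g)%nat ->
  (filter (dvdb g) (apl q 1 lo hi) = []) \/
  exists r, (1 <= r <= q)%nat /\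
   mass (filter (dvdb g) (apl q 1 lo hi)) = / INR g*mass (apl q r (lo/INR g) (hi/INR g)) /\
   Cmod (Mh (filter (dvdb g) (apl q 1 lo hi)) t) = / INR g*Cmod (Mh (apl q r (lo/INR g) (hi/INR g)) t).
Proof.
intros Hq Hg. destruct (apl_multiples q g lo hi Hq Hg) as [H|(r & Hr & HP)]; [auto|right]. exists r. split; [exact Hr|]. split.
- unfold mass. rewrite (Rsum_perm _ _ _ HP), Rsum_map, <- Rsum_scal. apply Rsum_ext; intros i _. rewrite mult_INR, Rinv_mult. lra.
- unfold Mh. rewrite (Csum_perm _ _ _ HP), Csum_map. rewrite (Csum_ext _ _ (fun i => RtoC (/ INR g)*ce (t*ln (INR g))*(RtoC (/ INR i)*ce (t*ln (INR i))))%C).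
  + rewrite Csum_scal, !Cmod_mult, Cmod_ce, Cmod_R, Rmult_1_r, Rabs_right; go.
  + intros i Hi%In_apl. rewrite mult_INR, Rinv_mult, RtoC_mult. rewrite ln_mult, Rmult_plus_distr_l, ce_plus by pos. ring.
Qed.

Lemma mass_apl q r J L : (1 <= r <= q)%nat -> 0 < J -> 0 < L ->
  Rabs (mass (apl q r J (J*exp L))-L/INR q) <= / J.
Proof.
intros Hr HJ HL. pose proof (exp_ineq1_le L). have H1 := apl_harmonic q r J (J*exp L) Hr HJ ltac:(nra).
replace (J*exp L/J) with (exp L) in H1 by fd. rewrite ln_exp in H1. exact H1.
Qed.

Lemma mass_multiples q J L g : (1 <= q)%nat -> 0 < L -> 0 < J -> (1 <= g)%nat ->
  mass (filter (dvdb g) (apl q 1 J (J*exp L))) <= (L+1)/INR g /\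
  mass (filter (dvdb g) (apl q 1 J (J*exp L))) <= (L/INR q+INR g/J)/INR g.
Proof.
intros Hq HL HJ Hg. have Hg0 : 0 < INR g by pos. have Hgi : 0 < / INR g by pos. have HLq : 0 < L/INR q by pos. have HgJ : 0 < INR g/J by pos.
destruct (Mh_multiples q g J (J*exp L) 0 Hq Hg) as [H|(r & Hr & H & _)].
- rewrite H. unfold mass. simpl. nra.
- rewrite H, apl_hi_split by lra. replace ((L+1)/INR g) with (/ INR g*(L+1)) by lra. replace ((L/INR q+INR g/J)/INR g) with (/ INR g*(L/INR q+INR g/J)) by lra.
  have HJg : 0 < J/INR g by pos. split; apply Rmult_le_compat_l; try lra.
  + apply apl_harmonic_crude; assumption.
  + pose proof (mass_apl q r (J/INR g) L Hr HJg HL) as H1%Rabs_le_between. replace (/ (J/INR g)) with (INR g/J) in H1 by fd. lra.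
Qed.

(** The condition [ce (t L) = 1] removes the integral term of [apl_exp_sum]. Multiples of
    [g <= J^(1/2)] form [g] times a progression starting at [J/g >= J^(1/2)], which is why the
    estimate is invoked with exponent [2 K] and half of the saving is kept. *)
Lemma sieve_exp_sum (q : nat) (L : R) (K : nat) : (1 <= q)%nat -> 0 < L ->
  exists A d, 0 <= A /\ 0 < d /\ ev (fun J => forall g t, (1 <= g)%nat -> INR g <= Rpower J (1/2) ->
     t <> 0 -> ce (t*L) = RtoC 1 -> Rabs t <= J^K ->
     Cmod (Mh (filter (dvdb g) (apl q 1 J (J*exp L))) t) <= A*Rpower J (- d)/INR g).
Proof.
intros Hq HL. destruct (apl_exp_sum q L (2*K) Hq HL) as (A & d & HA & Hd & [J0 H]). exists A, (d/2). split; [exact HA|]. split; [lra|].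
apply (ev_imp (fun J => 1 <= J /\ J0 <= Rpower J (1/2))).
{ apply ev_and; [apply ev_ge|apply ev_power; lra]. }
intros J [HJ1 HJ0] g t Hg HgJ Ht Hce HtK. have Hg1 : 1 <= INR g by inr. destruct (Mh_multiples q g J (J*exp L) t Hq Hg) as [E|(r & Hr & _ & E)].
- rewrite E. unfold Mh. simpl. rewrite Cmod_0. pos.
- rewrite E, apl_hi_split by lra. replace (A*Rpower J (- (d/2))/INR g) with (/ INR g*(A*Rpower J (- (d/2)))) by lra. lmul. set (y := Rpower J (1/2)) in *.
  have Hyy : y*y = J.
  { unfold y. rewrite <- Rpower_plus. replace (1/2+1/2) with 1 by lra. apply Rpower_1; lra. }
  have HyJ : y <= J/INR g.
  { cancel (INR g). nra. }
  have HJg : J0 <= J/INR g by lra. unfold Mh. via (H (J/INR g) HJg r t Hr Ht).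
  + via HtK. replace (J^K) with (y^(2*K)) by (rewrite <- Hyy, Rpow_mult_distr, <- pow_add; f_equal; lia). mono.
  + rewrite Hce. replace (1-1)%C with (RtoC 0) by ring. rewrite Cmod_0. unfold Rdiv at 2. rewrite Rmult_0_l, Rplus_0_r. lmul.
    replace (Rpower J (- (d/2))) with (Rpower y (- d)).
    * rewrite !Rpower_Ropp. apply Rinv_le_contravar; [pos|]. apply Rp_base; lra.
    * unfold y. rewrite Rpower_mult. alg.
Qed.

(** The sum telescopes against [1/max(g, y-1)], which treats alike the indices before and after
    [y]. *)
Lemma inv_sq_tail (p n : nat) (y : R) : 1 < y -> (1 <= p)%nat ->
  Rsum (seq (S p) n) (fun g => if Rlt_dec y (INR g) then / INR g^2 else 0) <= / (y-1).
Proof.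
intros Hy Hp. set (phi := fun g => / Rmax (INR g) (y-1)).
have Hphi : forall g, 0 < phi g.
{ intros g. apply Rinv_0_lt_compat. eapply Rlt_le_trans; [|apply Rmax_r]. lra. }
have H : Rsum (seq (S p) n) (fun g => if Rlt_dec y (INR g) then / INR g^2 else 0) <= phi p-phi (p+n)%nat.
{ induction n as [|n IH]; [simpl; rewrite Nat.add_0_r; lra|]. rewrite Rsum_seq_S. replace (S p+n)%nat with (S (p+n)) by lia. replace (p+S n)%nat with (S (p+n)) by lia.
  assert (Hs : (if Rlt_dec y (INR (S (p+n))) then / INR (S (p+n))^2 else 0) <= phi (p+n)%nat-phi (S (p+n))); [|lra].
rewrite S_INR in *. unfold phi. rewrite S_INR.
  destruct (Rlt_dec y (INR (p+n)+1)).
  - rewrite !Rmax_left by lra. set (x := INR (p+n)) in *. replace (/ x - / (x+1)) with (/ (x*(x+1))) by fd. mono.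
  - assert (/ Rmax (INR (p+n)+1) (y-1) <= / Rmax (INR (p+n)) (y-1)); [|lra]. apply Rinv_le_contravar; [eapply Rlt_le_trans; [|apply Rmax_r]; lra|].
    apply Rmax_le_compat; lra. }
assert (phi p <= / (y-1)) by (apply Rinv_le_contravar; [lra|apply Rmax_r]). pose proof (Hphi (p+n)%nat). lra.
Qed.

Lemma two_range_sum (p n : nat) (y a b : R) (f : nat -> R) : (2 <= p)%nat -> 1 < y -> 0 <= a -> 0 <= b ->
  (forall g, (p < g)%nat -> INR g <= y -> f g <= a/INR g^2) ->
  (forall g, (p < g)%nat -> y < INR g -> f g <= b/INR g^2) ->
  Rsum (seq (S p) n) f <= a/(INR p-1)+b/(y-1).
Proof.
intros Hp Hy Ha Hb H1 H2. have Hp2 : 2 <= INR p by inr. transitivity (Rsum (seq (S p) n) (fun g =>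
  a*(if Rlt_dec (INR p) (INR g) then / INR g^2 else 0)+b*(if Rlt_dec y (INR g) then / INR g^2 else 0))).
- apply Rsum_le. intros g Hg%in_seq. have Hg0 : 0 < / INR g^2 by pos. assert (INR p < INR g) by (apply lt_INR; lia). destruct (Rlt_dec (INR p) (INR g)); [|lra].
  destruct (Rlt_dec y (INR g)).
  + specialize (H2 g ltac:(lia) r0). nra.
  + specialize (H1 g ltac:(lia) ltac:(lra)). lra.
- rewrite Rsum_plus, !Rsum_scal. unfold Rdiv. apply Rplus_le_compat; apply Rmult_le_compat_l; try assumption.
  + apply inv_sq_tail; [lra|lia].
  + apply inv_sq_tail; [lra|lia].
Qed.

Definition sgn (x : R) : R := if Rlt_dec x 0 then -1 else 1.

Lemma sgn_cases x : sgn x = 1 \/ sgn x = -1.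
Proof. unfold sgn. destruct (Rlt_dec x 0); auto. Qed.

Lemma sgn_abs x : Rabs (sgn x) <= 1.
Proof. destruct (sgn_cases x) as [-> | ->]; apply Rabs_le; lra. Qed.

Lemma sgn_mult x y : x <> 0 -> y <> 0 -> sgn (x*y) = sgn x*sgn y.
Proof.
intros Hx Hy. unfold sgn. destruct (Rlt_dec x 0), (Rlt_dec y 0), (Rlt_dec (x*y) 0); try lra; exfalso; nra.
Qed.

Lemma fact_divide (n g : nat) : (1 <= g <= n)%nat -> Nat.divide g (fact n).
Proof.
induction n as [|n IH]; intros H; [lia|]. rewrite fact_simpl. destruct (Nat.eq_dec g (S n)) as [->|]; [apply Nat.divide_factor_l|]. apply Nat.divide_mul_r, IH. lia.
Qed.

(** An integer congruent to 1 modulo [P0!] is prime to every [g] with [2 <= g <= P0]. *)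
Lemma large_divisor (P0 j g : nat) : (1 <= P0)%nat -> (j mod fact P0 = 1 mod fact P0)%nat ->
  Nat.divide g j -> (2 <= g)%nat -> (P0 < g)%nat.
Proof.
intros HP Hj Hg H2. destruct (Nat.le_gt_cases g P0) as [H|H]; [exfalso|exact H]. have Hf := fact_divide P0 g ltac:(lia).
have H1 : Nat.divide g 1.
{ have E := Nat.div_mod_eq j (fact P0). rewrite Hj in E. have E1 := Nat.div_mod_eq 1 (fact P0).
  have Hm : Nat.divide g (1 mod fact P0).
  { apply (Nat.divide_add_cancel_r g (fact P0*(j/fact P0))).
    - apply Nat.divide_mul_l, Hf.
    - congruence. }
  rewrite E1. apply Nat.divide_add_r; [apply Nat.divide_mul_l, Hf|exact Hm]. }
apply Nat.divide_1_r in H1. lia.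
Qed.

Lemma Rsum_divisors (l G : list nat) (nu F : nat -> R) :
  Rsum l (fun j => nu j*Rsum (filter (fun g => dvdb g j) G) F) =
  Rsum G (fun g => F g*Rsum (filter (dvdb g) l) nu).
Proof.
rewrite (Rsum_ext l _ (fun j => Rsum G (fun g => if dvdb g j then nu j*F g else 0))).
- rewrite Rsum_swap. apply Rsum_ext; intros g _. rewrite Rsum_filter, <- Rsum_scal. apply Rsum_ext; intros j _. destruct (dvdb g j); ring.
- intros j _. rewrite Rsum_filter, <- Rsum_scal. apply Rsum_ext; intros g _. destruct (dvdb g j); ring.
Qed.

(** Up to [y] a divisor [g] has the expected density, up to a factor 2; beyond [y] only the crude
    bounds [c/g] and [c1/g] are available. As both factors of a product carry [1/g], the sums over
    [g > P0] are of order [1/P0] and [1/y]; the bounds 20000 and [y-1] make each share small. *)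
Lemma beta_bound (l l1 : list nat) (P0 n : nat) (mg : nat -> R) (r mt dM v y c c1 : R) :
  0 < mass l -> 0 < mass l1 -> 20000 <= INR P0 -> 1 < y -> 0 <= dM -> 0 <= v -> 0 <= c -> 0 <= c1 ->
  0 <= r <= 1/1000 -> 0 <= mt <= mass l/1000 ->
  dM^2*v^2 <= mass l^2/100 -> dM*v^2 <= mass l/100 ->
  (forall g, (P0 < g)%nat -> INR g <= y ->
     mass (filter (dvdb g) l) <= 2*mass l/INR g /\ mass (filter (dvdb g) l1) <= 2*mass l1/INR g /\
     mg g <= (dM/INR g)^2) ->
  (forall g, (P0 < g)%nat ->
     mass (filter (dvdb g) l) <= c/INR g /\ mass (filter (dvdb g) l1) <= c1/INR g /\
     mg g <= (c/INR g)^2) ->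
  c^2*(1+v^2) <= mass l^2/1000*(y-1) ->
  3*c*c1 <= mass l*mass l1/1000*(y-1) ->
  Rsum l1 (fun j => / INR j/mass l1*(
     (r*(mass l^2+dM^2*v^2)+mt*(mass l+dM*v^2) +
      Rsum (seq (S P0) n) (fun g => mass (filter (dvdb g) l)^2+mg g*v^2) +
      2*Rsum (filter (fun g => dvdb g j) (seq (S P0) n)) (fun g => mass (filter (dvdb g) l)*(mass l+dM*v^2)))
     / mass l^2)) <= 1/100.
Proof.
intros HM HM1 HP0 Hy HdM Hv Hc Hc1 Hr Hmt Hq Hq1 H1 H2 H3 H4. set (M := mass l) in *. set (m1 := mass l1) in *. set (D := M+dM*v^2) in *.
set (S1 := Rsum (seq (S P0) n) (fun g => mass (filter (dvdb g) l)^2+mg g*v^2)). have HdMv : 0 <= dM*v^2 by pos. rename HP0 into HP.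
have HP0 : (2 <= P0)%nat by (apply INR_le; simpl; lra). set (T := Rsum (seq (S P0) n) (fun g => mass (filter (dvdb g) l)*D*mass (filter (dvdb g) l1))).
rewrite (Rsum_ext l1 _ (fun j => / (m1*M^2)*((r*(M^2+dM^2*v^2)+mt*D+S1) * / INR j +
  2*(/ INR j*Rsum (filter (fun g => dvdb g j) (seq (S P0) n)) (fun g => mass (filter (dvdb g) l)*D))))).
2:{ intros j _. unfold Rdiv. rewrite Rinv_mult. ring. }
rewrite Rsum_scal, Rsum_plus, !Rsum_scal, Rsum_divisors. fold (mass l1). fold m1. fold T.
have HS1 : S1 <= 5*M^2/(INR P0-1)+c^2*(1+v^2)/(y-1).
{
  apply two_range_sum; [lia|exact Hy|nra|pos| |].
  - intros g Hg Hgy. destruct (H1 g Hg Hgy) as (Ha & _ & Hb).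
    assert (mass (filter (dvdb g) l)^2 <= (2*M/INR g)^2) by (apply pow_incr; split; [apply mass_nonneg|exact Ha]). assert (mg g*v^2 <= (dM/INR g)^2*v^2) by mono.
    replace (5*M^2/INR g^2) with ((2*M/INR g)^2+M^2/INR g^2) by fd. replace ((dM/INR g)^2*v^2) with (dM^2*v^2/INR g^2) in * by fd.
    assert (dM^2*v^2/INR g^2 <= M^2/INR g^2); [|lra]. rmul. nra.
  - intros g Hg Hgy. destruct (H2 g Hg) as (Ha & _ & Hb). assert (mass (filter (dvdb g) l)^2 <= (c/INR g)^2) by (apply pow_incr; split; [apply mass_nonneg|exact Ha]).
    assert (mg g*v^2 <= (c/INR g)^2*v^2) by mono. replace (c^2*(1+v^2)/INR g^2) with ((c/INR g)^2+(c/INR g)^2*v^2) by fd. lra. }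
have HT : T <= 5*M^2*m1/(INR P0-1)+(c*(2*M)*c1)/(y-1).
{ apply two_range_sum; [lia|exact Hy| | | |].
  - pos.
  - pos.
  - intros g Hg Hgy. destruct (H1 g Hg Hgy) as (Ha & Hb & _). transitivity (2*M/INR g*(5/4*M)*(2*m1/INR g)).
    + pose proof (mass_nonneg (filter (dvdb g) l)). pose proof (mass_nonneg (filter (dvdb g) l1)).
      apply Rmult_le_compat; try assumption; [apply Rmult_le_pos; unfold D; lra|]. apply Rmult_le_compat; try assumption; unfold D; lra.
    + right. fd.
  - intros g Hg Hgy. destruct (H2 g Hg) as (Ha & Hb & _). transitivity (c/INR g*(2*M)*(c1/INR g)).
    + pose proof (mass_nonneg (filter (dvdb g) l)). pose proof (mass_nonneg (filter (dvdb g) l1)).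
      apply Rmult_le_compat; try assumption; [apply Rmult_le_pos; unfold D; lra|]. apply Rmult_le_compat; try assumption; unfold D; lra.
    + right. fd. }
have HPi : / (INR P0-1) <= 1/19999.
{ replace (1/19999) with (/ 19999) by lra. mono. }
have HM2 : 0 < M^2 by pos.
have E1 : c^2*(1+v^2)/(y-1) <= M^2/1000.
{ apply Rmult_le_reg_r with (y-1); [lra|]. unfold Rdiv at 1. rewrite (Rmult_assoc _ (/ (y-1))), (Rinv_l (y-1)) by lra. lra. }
have E2 : c*(2*M)*c1/(y-1) <= M^2*m1/1000.
{ apply Rmult_le_reg_r with (y-1); [lra|]. unfold Rdiv at 1. rewrite (Rmult_assoc _ (/ (y-1))), (Rinv_l (y-1)) by lra. nra. }
have E3 : 5*M^2/(INR P0-1) <= M^2/3000 by nra. have HMm : 0 < M^2*m1 by pos. have E4 : 5*M^2*m1/(INR P0-1) <= M^2*m1/3000 by nra.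
have E5 : r*(M^2+dM^2*v^2) <= 1/1000*(101/100*M^2).
{ mono. }
have E6 : mt*D <= M/1000*(101/100*M) by (apply Rmult_le_compat; unfold D; lra). have Hmain : (r*(M^2+dM^2*v^2)+mt*D+S1) <= M^2*5/1000 by lra.
rewrite Rmult_comm. apply Rmult_le_reg_r with (m1*M^2); [nra|]. rewrite Rmult_assoc, Rinv_l by nra.
apply (Rmult_le_compat_r m1) in Hmain; [|lra]. change (((r*(M^2+dM^2*v^2)+mt*D+S1)*m1+2*T)*1 <= 1/100*(m1*M^2)). lra.
Qed.

(** * Coprimality, and products that are sums of two squares *)

Definition rp (m n : nat) : Prop := rel_prime (Z.of_nat m) (Z.of_nat n).

Lemma rp_sym m n : rp m n -> rp n m.
Proof. apply rel_prime_sym. Qed.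

Lemma rp_mul_r a b c : rp a b -> rp a c -> rp a (b*c).
Proof. unfold rp. rewrite Nat2Z.inj_mul. apply rel_prime_mult. Qed.

Lemma rp_mul_l a b c : rp a c -> rp b c -> rp (a*b) c.
Proof. intros. apply rp_sym, rp_mul_r; apply rp_sym; assumption. Qed.

Lemma rp_1_r a : rp a 1.
Proof. apply rel_prime_sym, rel_prime_1. Qed.

Lemma rp_1_l a : rp 1 a.
Proof. apply rp_sym, rp_1_r. Qed.

Lemma rp_pow_r a b n : rp a b -> rp a (b^n).
Proof. intros H. induction n; simpl; [apply rp_1_r|apply rp_mul_r; assumption]. Qed.

Lemma rp_pow_l a b n : rp a b -> rp (a^n) b.
Proof. intros. apply rp_sym, rp_pow_r, rp_sym. assumption. Qed.

Lemma rp_or_divisor m n : (1 <= m)%nat ->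
  rp m n \/ exists g, (2 <= g <= m)%nat /\ Nat.divide g m /\ Nat.divide g n.
Proof.
intros Hm. set (g := Z.gcd (Z.of_nat m) (Z.of_nat n)). have Hg0 : (0 <= g)%Z by apply Z.gcd_nonneg. have Hgm : (g | Z.of_nat m)%Z by apply Z.gcd_divide_l.
have Hgn : (g | Z.of_nat n)%Z by apply Z.gcd_divide_r. destruct (Z.eq_dec g 1) as [E|E].
- left. apply Zgcd_1_rel_prime. exact E.
- right. exists (Z.to_nat g). assert (g <> 0)%Z by (intros E0; rewrite E0 in Hgm; apply Z.divide_0_l in Hgm; lia).
  assert (g <= Z.of_nat m)%Z by (apply Z.divide_pos_le; [lia|exact Hgm]).
  have D : forall i, (g | Z.of_nat i)%Z -> Nat.divide (Z.to_nat g) i.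
  { intros i [q Hq]. exists (Z.to_nat q). lia. }
  split; [lia|]. auto.
Qed.

Lemma rp_prime_lt p m : prime (Z.of_nat p) -> (1 <= m < p)%nat -> rp p m.
Proof.
intros Hp Hm. apply rel_prime_sym, rel_prime_le_prime; go.
Qed.

(** Being 1 modulo 4 makes [p] a sum of two squares; being 1 modulo 3 makes the divisor sum [p+1]
    prime to 3, hence [A p] nonzero. *)
Definition good (p : nat) : Prop := prime (Z.of_nat p) /\ (p mod 12 = 1)%nat.

(** Brahmagupta's identity; one of the new squares is that of a difference, hence the passage
    through [Z] and absolute values. *)
Lemma sum_of_two_squares_mult m n :
  sum_of_two_squares m -> sum_of_two_squares n -> sum_of_two_squares (m*n).
Proof.
intros (Hm & a & b & Em) (Hn & c & d & En). split; [nia|]. exists (Z.to_nat (Z.abs (Z.of_nat a*Z.of_nat c-Z.of_nat b*Z.of_nat d))), (a*d+b*c)%nat.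
apply Nat2Z.inj. rewrite Em, En, Nat2Z.inj_add, !Nat2Z.inj_mul, !Nat2Z.inj_pow, !Nat2Z.inj_add.
rewrite Z2Nat.id by apply Z.abs_nonneg. rewrite !Nat2Z.inj_mul, !Nat2Z.inj_pow.
change (Z.of_nat 2) with 2%Z. rewrite Z.pow_2_r with (a := Z.abs _), <- Z.abs_mul, Z.abs_eq by apply Z.square_nonneg. ring.
Qed.

Lemma square_sum_of_two_squares n : (1 <= n)%nat -> sum_of_two_squares (n*n).
Proof. intros H. split; [nia|]. exists n, 0%nat. simpl. lia. Qed.

Definition multiplicative (A : nat -> R) : Prop :=
  A 1%nat = 1 /\ forall m n, (1 <= m)%nat -> (1 <= n)%nat -> rp m n -> A (m*n)%nat = A m*A n.

(* The number [a j1^6 j^6 p j'^6 p'] is a square times [p p']. *)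
Lemma good_product (A : nat -> R) (a d j1 j j' p p' : nat) : multiplicative A ->
  (forall q, good q -> sum_of_two_squares q) ->
  (a = d*d)%nat -> (1 <= d)%nat -> (1 <= j1)%nat -> (1 <= j)%nat -> (1 <= j')%nat ->
  good p -> good p' -> (p < p' \/ p' < p)%nat ->
  (a < p)%nat -> (a < p')%nat -> (j1 < p)%nat -> (j1 < p')%nat -> (j < p)%nat -> (j < p')%nat -> (j' < p)%nat -> (j' < p')%nat ->
  rp a j1 -> rp a j -> rp a j' -> rp j1 j -> rp j1 j' -> rp j j' ->
  let n := (a*j1^6*(j^6*p*(j'^6*p')))%nat in
  sum_of_two_squares n /\ A n = A a*A (j1^6)%nat*(A (j^6)%nat*A p*(A (j'^6)%nat*A p')).
Proof.
intros [HA1 HA] Hs Ea Hd H1 Hj Hj' Hp Hp' Hpp Hap Hap' H1p H1p' Hjp Hjp' Hj'p Hj'p' R1 R2 R3 R4 R5 R6 n. split.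
- unfold n. replace (a*j1^6*(j^6*p*(j'^6*p')))%nat with
    ((d*j1^3*j^3*j'^3)*(d*j1^3*j^3*j'^3)*(p*p'))%nat by (subst a; cbn [Nat.pow]; ring).
  apply sum_of_two_squares_mult; [|apply sum_of_two_squares_mult; apply Hs; assumption]. apply square_sum_of_two_squares.
  assert (forall i, (1 <= i)%nat -> (1 <= i^3)%nat) by (intros i Hi; apply Nat.neq_0_lt_0, Nat.pow_nonzero; lia).
  pose proof (H j1 H1). pose proof (H j Hj). pose proof (H j' Hj'). nia.
- have P6 : forall i, (1 <= i)%nat -> (1 <= i^6)%nat by (intros i Hi; apply Nat.neq_0_lt_0, Nat.pow_nonzero; lia).
  pose proof (P6 j1 H1). pose proof (P6 j Hj). pose proof (P6 j' Hj'). have Hpos : (1 <= p)%nat /\ (1 <= p')%nat /\ (1 <= a)%nat by lia.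
  destruct Hpos as (Hp1 & Hp1' & Ha1). have Q : forall i, (1 <= i < p)%nat -> rp i p by (intros; apply rp_sym, rp_prime_lt; [apply Hp|lia]).
  assert (Q' : forall i, (1 <= i < p')%nat -> rp i p') by (intros; apply rp_sym, rp_prime_lt; [apply Hp'|lia]).
  have Rpp : rp p p'.
  { destruct Hpp; [auto|apply rp_sym, Q; lia]. }
  have C1 : rp (j^6) (j'^6) by (apply rp_pow_l, rp_pow_r; assumption). have C2 : rp (j1^6) (j^6) by (apply rp_pow_l, rp_pow_r; assumption).
  have C3 : rp (j1^6) (j'^6) by (apply rp_pow_l, rp_pow_r; assumption). have C4 : rp a (j1^6) by (apply rp_pow_r; assumption).
  have C5 : rp a (j^6) by (apply rp_pow_r; assumption). have C6 : rp a (j'^6) by (apply rp_pow_r; assumption).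
  have D : forall i, (1 <= i < p)%nat -> rp (i^6) p by (intros; apply rp_pow_l, Q; assumption).
  assert (D' : forall i, (1 <= i < p')%nat -> rp (i^6) p') by (intros; apply rp_pow_l, Q'; assumption).
  have D1 := D j1 ltac:(lia). have D2 := D j ltac:(lia). have D3 := D j' ltac:(lia).
  pose proof (D' j1 ltac:(lia)) as D1'. pose proof (D' j ltac:(lia)) as D2'. pose proof (D' j' ltac:(lia)) as D3'.
  have Qa := Q a ltac:(lia). pose proof (Q' a ltac:(lia)) as Qa'. unfold n. set (x1 := (j1^6)%nat) in *. set (x := (j^6)%nat) in *. set (x' := (j'^6)%nat) in *.
  clearbody x1 x x'. rewrite (HA (a*x1)%nat), (HA a), (HA (x*p)%nat), (HA x), (HA x') by
    first [nia | repeat first [assumption | apply rp_sym; assumption | apply rp_mul_l | apply rp_mul_r]].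
  lra.
Qed.

(** The margin 1 keeps [s] away from [2 pi lam] and its opposite, so 0 is the only multiple of the
    period that it can approach. *)
Lemma far_or_close lam (B : nat) s : 1 <= lam -> (1 <= B)%nat -> 16*lam/INR B <= 1 ->
  - (2*PI*lam)+1 <= s <= 2*PI*lam-1 -> far B (s/lam) \/ Rabs s <= 16*lam/INR B.
Proof.
intros Hl HB HBl Hs. have Es : s/lam*lam = s by fd. set (z := s/lam) in *. destruct (Rle_dec (16/INR B) (Rabs z)) as [H1|H1].
2:{ right. rewrite <- Es, Rabs_mult, (Rabs_right lam) by lra. nra. }
left. destruct (Rle_dec z (- PI)) as [H2|H2]; [|destruct (Rle_dec z PI) as [H3|H3]].
- exists (z+2*PI), (-1)%Z. split; [ring|].
  assert (/ lam <= z+2*PI).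
  { apply Rmult_le_reg_r with lam; [lra|]. rewrite Rinv_l by lra. nra. }
  assert (0 < / lam) by pos. rewrite Rabs_right by lra. nra.
- exists z, 0%Z. go.
- exists (z-2*PI), 1%Z. split; [ring|].
  assert (/ lam <= 2*PI-z).
  { apply Rmult_le_reg_r with lam; [lra|]. rewrite Rinv_l by lra. nra. }
  assert (0 < / lam) by pos. rewrite Rabs_left by lra. nra.
Qed.

(** A deviation [d] of the logarithm changes [n] by a factor between [1-d] and [1+2 d], which moves
    it by at most [h/2] from the centre of the interval. *)
Lemma close_in_interval (X h d n : R) : 0 < X -> 0 < h <= X -> 0 < n -> Rabs (ln n-ln (X+h/2)) <= d ->
  d <= h/(8*X) -> X <= n <= X+h.
Proof.
intros HX Hh Hn H Hd. apply Rabs_le_between in H.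
have Hd8 : d*(8*X) <= h.
{ apply (Rmult_le_compat_r (8*X)) in Hd; [|lra]. unfold Rdiv in Hd. rewrite Rmult_assoc, Rinv_l in Hd by lra. lra. }
set (X' := X+h/2) in *. assert (HX' : 0 < X') by (unfold X'; lra).
have En : n = X'*exp (ln n-ln X').
{ unfold Rminus. rewrite exp_plus, exp_Ropp, !exp_ln by assumption. fd. }
set (s := ln n-ln X') in *. have E1 : 1-d <= exp s by (pose proof (exp_ineq1_le s); lra).
have E2 : exp s <= 1+2*d.
{ transitivity (exp d); [apply exp_mono; lra|]. have E := exp_ineq1_le (- d). rewrite exp_Ropp in E. assert (0 < exp d) by apply exp_pos.
  apply (Rmult_le_compat_r (exp d)) in E; [|lra]. rewrite Rinv_l in E by lra. nra. }
assert (X'*d <= h/4) by (unfold X'; nra). rewrite En. split; [transitivity (X'*(1-d))|transitivity (X'*(1+2*d))];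
  try (apply Rmult_le_compat_l; lra); unfold X' in *; lra.
Qed.

Lemma mass_incl (l l' : list nat) : NoDup l -> incl l l' -> mass l <= mass l'.
Proof.
intros H1 H2. unfold mass. apply Rsum_incl; [exact H1|exact H2|]. intros i _. destruct (Nat.eq_dec i 0) as [->|Hi]; [simpl; rewrite Rinv_0; lra|]. pos.
Qed.

(** Marks the top of the range of [j]. Discarding it for one of the two factors leaves room for the
    variation of the other variables within one period. *)
Definition topb (J w : R) (j : nat) : bool := ind (J*exp w <= INR j).

Lemma top_mass (q : nat) (J L W : R) : (1 <= q)%nat -> 0 < J -> 0 < W < L ->
  mass (filter (topb J (L-W)) (apl q 1 J (J*exp L))) <= W/INR q + / J.
Proof.
intros Hq HJ HW. set (J' := J*exp (L-W)). assert (1 <= exp (L-W)) by (pose proof (exp_ineq1_le (L-W)); lra). assert (HJ' : J <= J') by (unfold J'; nra).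
have E : J*exp L = J'*exp W by (unfold J'; rewrite Rmult_assoc, <- exp_plus; do 2 f_equal; ring). transitivity (mass (apl q 1 J' (J'*exp W))).
- apply mass_incl; [apply NoDup_filter, NoDup_apl|]. intros j [Hj Ht]%filter_In. apply (proj1 (ind_true _)) in Ht. apply In_apl in Hj. apply In_apl. go.
- pose proof (mass_apl q 1 J' W ltac:(lia) ltac:(lra) ltac:(lra)) as H1%Rabs_le_between. assert (/ J' <= / J) by mono. lra.
Qed.

Lemma apl_divisor (P0 : nat) (lo hi : R) (j g : nat) : (1 <= P0)%nat -> In j (apl (fact P0) 1 lo hi) ->
  Nat.divide g j -> (2 <= g)%nat -> (P0 < g <= j)%nat.
Proof.
intros HP Hj Hg H2. apply In_apl in Hj. destruct Hj as (H1 & _ & Hm). split; [apply (large_divisor P0 j g); assumption|]. apply Nat.divide_pos_le; go.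
Qed.

Lemma dvdb_divide g j : (1 <= g)%nat -> Nat.divide g j -> dvdb g j = true.
Proof. intros Hg [q ->]. apply dvdb_true; [exact Hg|]. exists q. lia. Qed.

Lemma filter_dvdb_1 l : filter (dvdb 1) l = l.
Proof. induction l as [|a l IH]; [auto|]. simpl. congruence. Qed.

Lemma fr_bound N k : In k (pairs N) -> Rabs (fr k) <= INR N.
Proof.
intros [H1 H2]%In_pairs. apply lt_INR in H1. apply lt_INR in H2. pose proof (pos_INR (fst k)). pose proof (pos_INR (snd k)). unfold fr. go.
Qed.

Lemma fr_neq0 k : fst k <> snd k -> fr k <> 0.
Proof. intros H E. apply H, INR_eq. unfold fr in E. lra. Qed.

Lemma ce_2PI_fr k : ce (2*PI*fr k) = RtoC 1.
Proof.
unfold fr. rewrite Rmult_minus_distr_l, ce_minus, !ce_2PI_nat. alg.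
Qed.

Lemma mass_apl_lower q J L : (1 <= q)%nat -> 1 <= J -> 0 < L -> 3*INR q <= L*Rpower J (1/2) ->
  2/3*(L/INR q) <= mass (apl q 1 J (J*exp L)) <= 4/3*(L/INR q) /\
  forall g, (1 <= g)%nat -> INR g <= Rpower J (1/2) ->
    mass (filter (dvdb g) (apl q 1 J (J*exp L))) <= 2*mass (apl q 1 J (J*exp L))/INR g.
Proof.
intros Hq HJ HL Hy. have Hq1 : 1 <= INR q by inr. set (y := Rpower J (1/2)) in *.
have Hyy : y*y = J.
{ unfold y. rewrite <- Rpower_plus. replace (1/2+1/2) with 1 by lra. apply Rpower_1; lra. }
have Hy1 : 1 <= y by nra.
have Hyi : / y <= L/INR q/3.
{ apply Rmult_le_reg_r with (y*INR q*3); [nra|]. replace (/ y*(y*INR q*3)) with (3*INR q) by fd. replace (L/INR q/3*(y*INR q*3)) with (L*y) by fd. exact Hy. }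
have HJy : / J <= / y by (apply Rinv_le_contravar; nra). pose proof (mass_apl q 1 J L ltac:(lia) ltac:(lra) HL) as H%Rabs_le_between.
set (M := mass (apl q 1 J (J*exp L))) in *. split; [lra|]. intros g Hg Hgy. destruct (mass_multiples q J L g Hq HL ltac:(lra) Hg) as [_ H2]. via H2. rmul.
assert (INR g/J <= / y); [|lra]. cancel J. rewrite <- Hyy at 1. replace (/ y*(y*y)) with y by fd. lra.
Qed.

(** The argument for one [X], with asymptotics turned into explicit inequalities. As
    [6 L = 2 pi lam] is the period of the kernel, each nonzero frequency satisfies [ce (t L) = 1]
    and comes under the bound [dM]. [W] adds up the other variations: [6 L1] for [j1], [al] for the
    shift, [2 ln 2] for [p] and [p'], and 2 for the two margins. [N = 128000 B] makes the leakage
    factor [128 B/N] equal to 1/1000. *)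
Lemma analytic_finite (A : nat -> R) (sg : R) (a d P0 B N n0 : nat) (P1 P2 : list nat)
  (X h lam J J1 Z Z' L1 dM dM1 v : R) :
  let Q := INR (fact P0) in let L := PI*lam/3 in let al := ln (INR a) in
  let W := 2+6*L1+al+2*ln 2 in
  let l := apl (fact P0) 1 J (J*exp L) in let l1 := apl (fact P0) 1 J1 (J1*exp L1) in
  multiplicative A -> (forall q, good q -> sum_of_two_squares q) -> (forall q, good q -> A q <> 0) ->
  (forall j, (1 <= j)%nat -> (j mod 3 <> 0)%nat -> A (j^6)%nat <> 0) ->
  (a = d*d)%nat -> (1 <= d)%nat -> A a < 0 -> (2 <= a <= P0)%nat -> (3 <= P0)%nat -> 20000 <= INR P0 ->
  0 < X -> 0 < h <= X -> 1 <= lam -> 2000*W <= 6*L -> L1 = 200*al ->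
  (1 <= B)%nat -> INR N = 128000*INR B -> 16*lam/INR B <= 1 -> 16*lam/INR B <= h/(8*X) ->
  1 <= J1 -> J1 <= J -> 12*ln J = 1-6*L+ln (X+h/2)-6*ln J1-ln Z-ln Z' ->
  1 <= Z' -> 2*Z' <= Z -> J*exp L <= Z' -> J1*exp L1 <= Z' -> INR a < Z' -> Z' <= INR n0 ->
  NoDup P1 -> NoDup P2 ->
  (forall p, In p P1 -> good p /\ Z <= INR p < 2*Z) -> (forall p, In p P2 -> good p /\ Z' <= INR p < 2*Z') ->
  0 < num P1 -> 0 < num P2 ->
  3*INR N+64*Z*lam <= v^2*num P1 -> 3*INR N+64*Z'*lam <= v^2*num P2 ->
  1 <= v -> 0 <= dM ->
  (forall g t, (1 <= g)%nat -> INR g <= Rpower J (1/2) -> t <> 0 -> ce (t*L) = RtoC 1 ->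
     Rabs t <= 12*INR N/lam -> Cmod (Mh (filter (dvdb g) l) t) <= dM/INR g) ->
  (forall t, t <> 0 -> Rabs t <= 12*INR N/lam -> Cmod (Mh l1 t) <= dM1+2/(Q*Rabs t)) ->
  dM1 <= L1/Q/10 -> / J <= W/Q/24 -> 3*Q <= L1*Rpower J1 (1/2) -> 3*Q <= L*Rpower J (1/2) ->
  dM*v^2 <= L/Q/200 ->
  4000*Q^2*(L+1)^2*(1+v^2) <= L^2*(Rpower J1 (1/2)-1) ->
  10000*Q^2*(L+1)*(L1+1) <= L*L1*(Rpower J1 (1/2)-1) ->
  (forall n, sum_of_two_squares n -> X <= INR n <= X+h -> A n <> 0 -> sgn (A n) = sg) ->
  sg = 1 \/ sg = -1 -> False.
Proof.
intros Q L al W l l1 HA Hsq Hgood H6 Ea Hd HAa Ha HP03 HP0 HX Hh Hlam HW HL1 HB HN HB1 HB2 HJ1 HJJ HJ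
  HZ' HZZ HJZ HJ1Z HaZ Hn0 Hnd1 Hnd2 HP1 HP2 Hn1 Hn2 HV1 HV2 Hv HdM Hsieve Hl1 HdM1 HJW HyQ1 HyQ Hdv Hb1 Hb2 Hsg Hsg1.
have HPI := PI2_1. have Hln2 := ln_lt_2. have Ha2 : 2 <= INR a by (apply (le_INR 2); lia).
have Hal : 1/2 < al by (eapply Rlt_le_trans; [|apply ln_le; [|exact Ha2]]; lra). have HL1p : 100 < L1 by lra. have HWp : 600 < W by (unfold W; lra).
have HLp : 100 < L by lra. have HQn : (1 <= fact P0)%nat by (pose proof (lt_O_fact P0); lia). have HQ : 1 <= Q by (apply (le_INR 1); exact HQn).
have HB0 : 1 <= INR B by inr. have HBN : (2*B <= N)%nat by (apply INR_le; rewrite mult_INR, HN; simpl; lra).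
destruct (mass_apl_lower (fact P0) J L HQn ltac:(lra) ltac:(lra) HyQ) as [HM HMg]. destruct (mass_apl_lower (fact P0) J1 L1 HQn HJ1 ltac:(lra) HyQ1) as [Hm1 Hm1g].
fold l in HM, HMg. fold l1 in Hm1, Hm1g. fold Q in HM, Hm1. set (y := Rpower J1 (1/2)) in *. have Hyy : y <= Rpower J (1/2) by (apply Rp_base; lra).
have HLQ : 0 < L/Q by pos. have HL1Q : 0 < L1/Q by pos. set (M := mass l) in *. set (m1 := mass l1) in *. have HMp : 0 < M by lra. have Hm1p : 0 < m1 by lra.
have Hlpos : forall j, In j l -> (1 <= j)%nat /\ INR j < J*exp L /\ J <= INR j.
{ intros j Hj%In_apl. tauto. }
have Hl1pos : forall j, In j l1 -> (1 <= j)%nat /\ INR j < J1*exp L1 /\ J1 <= INR j.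
{ intros j Hj%In_apl. tauto. }
have Htb : forall k, In k (pairs N) -> Rabs (6*fr k/lam) <= 12*INR N/lam.
{ intros k Hk. pose proof (fr_bound N k Hk). unfold Rdiv. rewrite Rabs_mult, (Rabs_right (/ lam)).
  - rmul. rewrite Rabs_mult, (Rabs_right 6) by lra. lra.
  - pos. }
have Hs : forall g k, (1 <= g)%nat -> INR g <= Rpower J (1/2) -> In k (pairs N) -> fst k <> snd k ->
   Cmod (Mh (filter (dvdb g) l) (6*fr k/lam)) <= dM/INR g.
{ intros g k Hg Hgy Hk Hne. apply Hsieve; try assumption.
  - intros E. apply (fr_neq0 k Hne). replace (fr k) with (6*fr k/lam*(lam/6)) by fd. rewrite E. ring.
  - replace (6*fr k/lam*L) with (2*PI*fr k) by (unfold L; field; lra). apply ce_2PI_fr.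
  - auto. }
(* Beyond [J^(1/2)] the exponential sum estimate is replaced by the trivial bound, the mass. *)
set (mg := fun g => if Rle_dec (INR g) (Rpower J (1/2)) then (dM/INR g)^2 else mass (filter (dvdb g) l)^2). have Hv2 : 1 <= v^2 by (apply pow_R1_Rle; exact Hv).
have Hvv : v <= v^2 by (clear-Hv; nra). have Hdv1 : dM*v <= dM*v^2 by mono. have Hdv0 : 0 <= dM*v by pos.
have Hdv2 : dM^2*v^2 <= M^2/100.
{ assert (dM*v <= M/10) by lra. replace (dM^2*v^2) with ((dM*v)*(dM*v)) by ring. clear-H Hdv0 HMp. nra. }
have HdML : dM <= L+1.
{ assert (dM <= dM*v^2) by (clear-HdM Hv2; nra). assert (L/Q <= L); [|lra]. unfold Rdiv. rewrite <- (Rmult_1_r L) at 2. lmul. rewrite <- Rinv_1. mono. }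
apply (core_contradiction lam N B l P1 P2 l1 (seq (S P0) n0) (topb J (L-W/6)) (fun j => / INR j/m1) mg
  (fun j => sg*sgn (A (j^6)%nat)) (fun u => sgn (A (fst u^6)%nat)*sgn (A (snd u)))
  (fun u => sgn (A (fst u^6)%nat)*sgn (A (snd u))) al (- ln (X+h/2)) dM v (1/100) (1/100)); try lra; try assumption.
- intros u. rewrite Rabs_mult. pose proof (sgn_abs (A (fst u^6)%nat)). pose proof (sgn_abs (A (snd u))).
pose proof (Rabs_pos (sgn (A (snd u)))). nra.
- intros u. rewrite Rabs_mult. pose proof (sgn_abs (A (fst u^6)%nat)). pose proof (sgn_abs (A (snd u))).
  pose proof (Rabs_pos (sgn (A (fst u^6)%nat))). pose proof (Rabs_pos (sgn (A (snd u)))). nra.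
- intros k Hk Hne. rewrite <- (filter_dvdb_1 l). replace dM with (dM/INR 1) by inr. apply Hs; try assumption; [lia|]. apply Rp_ge1; lra.
- intros N' HN'. etransitivity; [apply (zsum_bound lam N' Z); try assumption; [lia|lra|]|].
  + intros p Hp. apply HP1, Hp.
  + assert (INR N' <= INR N) by mono. replace ((v*num P1)^2) with (num P1*(v^2*num P1)) by ring. mono.
- intros N' HN'. etransitivity; [apply (zsum_bound lam N' Z'); try assumption; [lia|]|].
  + intros p Hp. apply HP2, Hp.
  + assert (INR N' <= INR N) by mono. replace ((v*num P2)^2) with (num P2*(v^2*num P2)) by ring. mono.
- fold M. lra.
- intros g Hg%in_seq. split; [lia|]. unfold mg. destruct (Rle_dec _ _); apply pow2_ge_0.
- intros g k Hg Hk Hne. apply in_seq in Hg. unfold mg. destruct (Rle_dec _ _) as [H|H]; apply pow_incr.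
  + split; [pos|apply Hs; try assumption; lia].
  + split; [pos|apply Mh_le_mass].
- intros j Hj. destruct (Hl1pos j Hj) as [H _]. pos.
- unfold Rdiv. rewrite Rsum_scal_r. change (m1 * / m1 = 1). fd.
- intros j. destruct Hsg1 as [-> | ->], (sgn_cases (A (j^6)%nat)) as [-> | ->]; lra.
- replace (128*INR B/INR N) with (1/1000) by (rewrite HN; field; lra).
  apply (beta_bound l l1 P0 n0 mg (1/1000) (mass (filter (topb J (L-W/6)) l)) dM v y (L+1) (L1+1)); try lra; try assumption; fold M; fold m1.
  + assert (H0y : 0 < L*(y-1)); [|nra]. apply Rmult_lt_reg_l with L1; [lra|]. rewrite Rmult_0_r.
    replace (L1*(L*(y-1))) with (L*L1*(y-1)) by ring. eapply Rlt_le_trans; [|exact Hb2]. pos.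
  + split; [apply mass_nonneg|]. etransitivity; [apply top_mass; [exact HQn|lra|lra]|].
    fold Q. assert (W/Q <= 6*L/2000/Q).
      { mono. }
    lra.
  + lra.
  + intros g Hg Hgy. repeat split.
    * apply HMg; [lia|lra].
    * apply Hm1g; [lia|lra].
    * unfold mg. destruct (Rle_dec _ _); lra.
  + intros g Hg. have Hg1 : (1 <= g)%nat by lia. destruct (mass_multiples (fact P0) J L g HQn ltac:(lra) ltac:(lra) Hg1) as [E1 _].
    destruct (mass_multiples (fact P0) J1 L1 g HQn ltac:(lra) ltac:(lra) Hg1) as [E2 _].
    split; [exact E1|]. split; [exact E2|]. unfold mg. destruct (Rle_dec _ _); apply pow_incr.
    * go.
    * split; [apply mass_nonneg|exact E1].
  + have E : (2/3*(L/Q))^2 <= M^2 by mono. have Hy1 : 0 <= y-1 by (pose proof (Rp_ge1 J1 (1/2) HJ1 ltac:(lra)); unfold y; lra).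
    transitivity ((2/3*(L/Q))^2/1000*(y-1)); [|mono]. replace ((2/3*(L/Q))^2/1000*(y-1)) with (L^2*(y-1)*(4/(9000*Q^2))) by fd.
    transitivity (4000*Q^2*(L+1)^2*(1+v^2)*(4/(9000*Q^2))).
    * replace (4000*Q^2*(L+1)^2*(1+v^2)*(4/(9000*Q^2))) with ((L+1)^2*(1+v^2)*(16/9)) by fd. assert (0 <= (L+1)^2*(1+v^2)) by pos. lra.
    * mono.
  + have Hy1 : 0 <= y-1 by (pose proof (Rp_ge1 J1 (1/2) HJ1 ltac:(lra)); unfold y; lra). transitivity ((2/3*(L/Q))*(2/3*(L1/Q))/1000*(y-1)).
    * replace ((2/3*(L/Q))*(2/3*(L1/Q))/1000*(y-1)) with (L*L1*(y-1)*(4/(9000*Q^2))) by fd. transitivity (10000*Q^2*(L+1)*(L1+1)*(4/(9000*Q^2))).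
      -- replace (10000*Q^2*(L+1)*(L1+1)*(4/(9000*Q^2))) with ((L+1)*(L1+1)*(40/9)) by fd. assert (0 <= (L+1)*(L1+1)) by pos. lra.
      -- mono.
    * mono.
- intros j1 sh sgj [j p] [j' p'] Hj1 Hsh Hu Hw. apply in_prod_iff in Hu. apply in_prod_iff in Hw. destruct Hu as [Hj Hp], Hw as [Hj' Hp']. cbn [fst snd].
  destruct (Hl1pos j1 Hj1) as (N1 & U1 & V1). destruct (Hlpos j Hj) as (N2 & U2 & V2). destruct (Hlpos j' Hj') as (N3 & U3 & V3).
  destruct (HP1 p Hp) as (Gp & Up & Vp). destruct (HP2 p' Hp') as (Gp' & Up' & Vp').
  assert (Hn0' : forall i, INR i <= Z' -> (i <= n0)%nat) by (intros i Hi; apply INR_le; lra). have M1 := Hn0' j1 ltac:(lra). have M2 := Hn0' j ltac:(lra).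
  destruct (topb J (L-W/6) j) eqn:Etop; [lra|]. destruct (rp_or_divisor j j' N2) as [R6|(g & Hg & G1 & G2)].
  2:{ right; right; left. exists g. pose proof (apl_divisor P0 _ _ j g ltac:(lia) Hj G1 ltac:(lia)).
      split; [sq|]. split; apply dvdb_divide; try assumption; lia. }
  destruct (rp_or_divisor j1 j N1) as [R4|(g & Hg & G1 & G2)]. 2:{ right; right; right; left. exists g. pose proof (apl_divisor P0 _ _ j1 g ltac:(lia) Hj1 G1 ltac:(lia)).
      split; [sq|]. split; [|left]; apply dvdb_divide; try assumption; lia. }
  destruct (rp_or_divisor j1 j' N1) as [R5|(g & Hg & G1 & G2)].
  2:{ right; right; right; left. exists g. pose proof (apl_divisor P0 _ _ j1 g ltac:(lia) Hj1 G1 ltac:(lia)).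
      split; [sq|]. split; [|right]; apply dvdb_divide; try assumption; lia. }
  have Ra : forall i lo hi, (1 <= i)%nat -> In i (apl (fact P0) 1 lo hi) -> rp a i.
  { intros i lo hi Hi Hin. destruct (rp_or_divisor a i ltac:(lia)) as [R|(g & Hg & G1 & G2)]; [exact R|].
    pose proof (apl_divisor P0 _ _ i g ltac:(lia) Hin G2 ltac:(lia)). lia. }
  have N6 : forall i lo hi, (1 <= i)%nat -> In i (apl (fact P0) 1 lo hi) -> A (i^6)%nat <> 0.
  { intros i lo hi Hi Hin. apply H6; [exact Hi|]. intros E. assert (Nat.divide 3 i) by (apply Nat.Lcm0.mod_divide; exact E).
    pose proof (apl_divisor P0 _ _ i 3 ltac:(lia) Hin H ltac:(lia)). lia. }
  have A1 := N6 j1 _ _ N1 Hj1. have A2 := N6 j _ _ N2 Hj. have A3 := N6 j' _ _ N3 Hj'. have A4 := Hgood p Gp. have A5 := Hgood p' Gp'.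
  have Pos : 0 < INR j1 /\ 0 < INR j /\ 0 < INR j' /\ 0 < INR p /\ 0 < INR p' by (repeat split; lra). destruct Pos as (O1 & O2 & O3 & O4 & O5).
  (* [a'] is [1] or [a]: the shift is [ln a']. *)
  assert (Ha' : exists a' d', (a' = d'*d')%nat /\ (1 <= d')%nat /\ sh = ln (INR a') /\ A a' <> 0 /\ INR a' < Z' /\ (1 <= a')%nat /\
     sgj = sgn (A a')*(sg*sgn (A (j1^6)%nat)) /\ rp a' j1 /\ rp a' j /\ rp a' j').
  { destruct Hsh as [[-> ->]|[-> ->]].
    - exists 1%nat, 1%nat. rewrite (proj1 HA). repeat match goal with |- _ /\ _ => split end; try lia; try apply rp_1_l; try (simpl; lra).
      + simpl. rewrite ln_1. lra.
      + replace (sgn 1) with 1 by (unfold sgn; destruct (Rlt_dec 1 0); lra). ring.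
    - exists a, d. repeat match goal with |- _ /\ _ => split end; try reflexivity; try assumption; try lia; try lra.
      + replace (sgn (A a)) with (-1) by (unfold sgn; destruct (Rlt_dec (A a) 0); lra). ring.
      + eauto.
      + eauto.
      + eauto. }
  destruct Ha' as (a' & d' & E1 & E2 & E3 & E4 & E5 & E6 & E7 & E8 & E9 & E10). have Hlt : forall i k, INR i < INR k -> (i < k)%nat by (intros; apply INR_lt; assumption).
  destruct (good_product A a' d' j1 j j' p p' HA Hsq E1 E2 N1 N2 N3 Gp Gp') as [S1 S2];
    try assumption; try (apply Hlt; lra).
  { right. apply Hlt. lra. }
  set (n := (a'*j1^6*(j^6*p*(j'^6*p')))%nat) in *. have Oa : 0 < INR a' by pos.
  have Ln : ln (INR n) = sh+6*ln (INR j1)+(pos (j, p)+pos (j', p')).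
  { unfold n, pos. cbn [fst snd]. rewrite !mult_INR, !pow_INR.
    have K6 : forall x, 0 < x -> exists x6, x^6 = x6 /\ 0 < x6 /\ ln x6 = 6*ln x.
    { intros x Hx. exists (x^6). split; [lra|]. split; [pos|]. rewrite Rpower.ln_pow by exact Hx. inr. }
    destruct (K6 _ O1) as (x1 & -> & X1 & X1'), (K6 _ O2) as (x2 & -> & X2 & X2'), (K6 _ O3) as (x3 & -> & X3 & X3').
    rewrite !ln_mult by (repeat match goal with |- 0 < _*_ => apply Rmult_lt_0_compat end; assumption). rewrite E3, X1', X2', X3'. ring. }
  replace (- ln (X+h/2)+6*ln (INR j1)+sh+pos (j, p)+pos (j', p')) with (ln (INR n)-ln (X+h/2)) by (rewrite Ln; ring).
  have Bd : forall lo hi x, 0 < lo -> lo <= x -> x <= hi -> ln lo <= ln x <= ln hi.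
  { intros lo hi x H1 H2 H3. split; apply ln_le; lra. }
  have LJ : forall J0 L0, 1 <= J0 -> ln (J0*exp L0) = ln J0+L0.
  { intros J0 L0 H. rewrite ln_mult, ln_exp; go. }
  have B1 := Bd J1 _ (INR j1) ltac:(lra) V1 ltac:(left; exact U1). rewrite LJ in B1 by lra.
  have B3 := Bd J _ (INR j') ltac:(lra) V3 ltac:(left; exact U3). rewrite LJ in B3 by lra.
  have B4 := Bd Z _ (INR p) ltac:(lra) Up ltac:(left; exact Vp). rewrite ln_mult in B4 by lra.
  have B5 := Bd Z' _ (INR p') ltac:(lra) Up' ltac:(left; exact Vp'). rewrite ln_mult in B5 by lra.
  have B2 : ln J <= ln (INR j) <= ln J+(L-W/6).
  { rewrite <- LJ by lra. apply Bd; try lra. apply Rnot_lt_le. intros Hlt'. assert (topb J (L-W/6) j = true) by (apply ind_true; lra). congruence. }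
  have B6 : 0 <= sh <= al by (destruct Hsh as [[-> _]|[-> _]]; lra). destruct (far_or_close lam B (ln (INR n)-ln (X+h/2)) Hlam HB HB1) as [F|F].
  (* The equation for [J] puts the lower end at exactly [1 - 6 L]; once the top slice is removed,
     the choice of [W] puts the upper end at [6 L - 1]. *)
  + replace (2*PI*lam) with (6*L) by (unfold L; field). rewrite Ln. unfold pos. cbn [fst snd]. unfold W in *. lra.
  + auto.
  + right; right; right; right. have On : 0 < INR n by (apply lt_0_INR; destruct S1; lia). have HI := close_in_interval X h _ (INR n) HX Hh On F HB2.
    have NZ : A n <> 0.
    { rewrite S2. repeat apply Rmult_integral_contrapositive_currified; assumption. }
    have Es := Hsg n S1 HI NZ. rewrite S2 in Es. rewrite !sgn_mult in Es by (repeat apply Rmult_integral_contrapositive_currified; assumption).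
    rewrite E7. replace 1 with (sg*sg) by (destruct Hsg1 as [-> | ->]; lra). rewrite <- Es at 2. ring.
(* A frequency with [|k/lam| al <= 1/100] hardly sees the shift. For the others the phase of [j1^12]
   has frequency [t = 12 k/lam], and [L1 = 200 al] makes the integral term [2/(Q |t|)] at most
   [L1/(12 Q)], well below half the mass of [l1]. *)
- intros k Hk. destruct (Rle_dec (Rabs (fr k/lam*al)) (1/100)) as [H|H].
  + right. rewrite <- ce_0. via ce_dist. rewrite Rminus_0_l, Rabs_Ropp. exact H.
  + left. set (t := 12*fr k/lam). have Ht0 : 1/100 < Rabs (fr k/lam)*al by (rewrite Rabs_mult, (Rabs_right al) in H by lra; lra).
    have Et : Rabs t = 12*Rabs (fr k/lam).
    { unfold t. replace (12*fr k/lam) with (12*(fr k/lam)) by lra. rewrite Rabs_mult, (Rabs_right 12) by lra. lra. }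
    have Htp : 0 < Rabs (fr k/lam) by nra. have Ht : t <> 0 by (intros E; rewrite E, Rabs_R0 in Et; lra).
    assert (Htb' : Rabs t <= 12*INR N/lam).
    { pose proof (fr_bound N k Hk). unfold t, Rdiv. rewrite Rabs_mult, (Rabs_right (/ lam)).
      - rmul. rewrite Rabs_mult, (Rabs_right 12) by lra. lra.
      - pos. }
    specialize (Hl1 t Ht Htb'). rewrite (Csum_ext l1 _ (fun j => RtoC (/ m1)*(RtoC (/ INR j)*ce (t*ln (INR j))))%C).
    * rewrite Csum_scal, Cmod_mult, Cmod_R, Rabs_right by pos.
      fold (Mh l1 t). apply Rmult_le_reg_l with m1; [exact Hm1p|]. rewrite <- Rmult_assoc, Rinv_r, Rmult_1_l by lra. via Hl1. assert (2/(Q*Rabs t) <= L1/Q/12); [|lra].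
      rewrite Et. apply Rmult_le_reg_r with (Q*(12*Rabs (fr k/lam))); [nra|]. unfold Rdiv at 1. rewrite Rmult_assoc, Rinv_l by nra.
      replace (L1/Q/12*(Q*(12*Rabs (fr k/lam)))) with (L1*Rabs (fr k/lam)) by fd. rewrite HL1. nra.
    * intros j _. unfold Rdiv at 1. rewrite RtoC_mult. replace (2*(fr k/lam)*(6*ln (INR j))) with (t*ln (INR j)) by (unfold t; field; lra). ring.
Qed.

(** One dyadic block with almost full exponent is enough, and it need only exist somewhere in the
    window. Such a supply follows from Mertens-type sums alone; the sizes of the other variables
    adapt to the block. *)
Definition prime_supply : Prop := forall t1 t2 dl, 0 < t1 < t2 -> 0 < dl ->
  ev (fun X => exists Z P, Rpower X t1 <= Z <= Rpower X t2 /\ NoDup P /\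
    (forall p, In p P -> good p /\ Z <= INR p < 2*Z) /\ Rpower Z (1-dl) <= num P).

Lemma constant_sign (A : nat -> R) x y : ~ has_sign_change sum_of_two_squares A x y ->
  exists s, (s = 1 \/ s = -1) /\ forall n, sum_of_two_squares n -> x <= INR n <= y -> A n <> 0 -> sgn (A n) = s.
Proof.
intros H. destruct (excluded_middle_informative (exists m, sum_of_two_squares m /\ x <= INR m <= y /\ A m < 0)) as [(m & H1 & H2 & H3)|H1].
- exists (-1). split; [lra|]. intros n Hn Hx H0. unfold sgn. destruct (Rlt_dec (A n) 0); [lra|]. exfalso. apply H. exists m, n. split; [tauto|]. split; [tauto|]. lra.
- exists 1. split; [lra|]. intros n Hn Hx H0. unfold sgn. destruct (Rlt_dec (A n) 0); [|lra]. exfalso. eauto.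
Qed.

Lemma nat_ceil x : 0 <= x -> exists n : nat, x <= INR n <= x+1.
Proof.
intros Hx. destruct (archimed x) as [H1 H2]. exists (Z.to_nat (up x)). assert (0 <= up x)%Z by (apply le_IZR; lra). rewrite INR_IZR_INZ, Z2Nat.id by assumption. lra.
Qed.

Lemma Rp_ln x y : ln (Rpower x y) = y*ln x.
Proof. unfold Rpower. apply ln_exp. Qed.

Lemma Rp_le_of_ln x y z : 0 < z -> y*ln x <= ln z -> Rpower x y <= z.
Proof. intros Hz H. rewrite <- (exp_ln z) by exact Hz. apply exp_mono. exact H. Qed.

Lemma Rp_ge_of_ln x y z : 0 < z -> ln z <= y*ln x -> z <= Rpower x y.
Proof. intros Hz H. rewrite <- (exp_ln z) at 1 by exact Hz. apply exp_mono. exact H. Qed.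

(** [a] alone determines [lam], [L], [L1] and [P0], and with [eps] the exponents; only the sizes
    grow with [X]. The two prime blocks lie below [X^(1/2-eps/2)] but above [X^(1/2-3 eps/4)], hence
    above the number of frequencies, and the [j] take up a remaining small power of [X]. *)
Theorem sign_changes_of_multiplicative (A : nat -> R) (a d : nat) (eps : R) :
  multiplicative A -> (forall q, good q -> sum_of_two_squares q) -> (forall q, good q -> A q <> 0) ->
  (forall j, (1 <= j)%nat -> (j mod 3 <> 0)%nat -> A (j^6)%nat <> 0) ->
  (a = d*d)%nat -> (1 <= d)%nat -> A a < 0 -> prime_supply -> 0 < eps <= 1/4 ->
  ev (fun X => has_sign_change sum_of_two_squares A X (X+Rpower X (1/2+eps))).
Proof.
intros HA Hsq Hgood H6 Ea Hd HAa Hps Heps.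
have Ha : (2 <= a)%nat.
{ destruct (Nat.eq_dec a 1) as [->|]; [rewrite (proj1 HA) in HAa; lra|]. nia. }
have Ha2 : 2 <= INR a by inr. have Hln2 := ln_lt_2. have HPI := PI2_1.
set (al := ln (INR a)). have Hal : 1/2 < al by (eapply Rlt_le_trans; [|apply ln_le; [|exact Ha2]]; lra).
(* [lam] is large enough for the top slice [W] to occupy at most 1/2000 of the period [6 L]. *)
set (L1 := 200*al). set (W := 2+6*L1+al+2*ln 2). set (lam := 1+2000*W). set (L := PI*lam/3). have HL1 : 100 < L1 by (unfold L1; lra).
have HW : 600 < W by (unfold W; lra). have HWL : 2000*W <= 6*L by (unfold L, lam; nra). have Hlam : 1 <= lam by (unfold lam; lra).
destruct (nat_ceil (Rmax 20000 (INR a))) as (P0 & HP0 & _); [etransitivity; [|apply Rmax_l]; lra|].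
have HP1 : 20000 <= INR P0 by (etransitivity; [apply Rmax_l|exact HP0]). have HP2 : INR a <= INR P0 by (etransitivity; [apply Rmax_r|exact HP0]). apply INR_le in HP2.
have HP3 : (3 <= P0)%nat by (apply INR_le; simpl; lra). set (Q := INR (fact P0)). have HQn : (1 <= fact P0)%nat by (pose proof (lt_O_fact P0); lia).
have HQ : 1 <= Q by (apply (le_INR 1); exact HQn). destruct (nat_ceil (24/eps)) as (K & HK & _); [pos|].
(* With [J1 = X^(eps/24)] this gives [J1^K >= X], which covers all frequencies. *)
have HKe : 24 <= INR K*eps.
{ apply (Rmult_le_compat_r eps) in HK; [|lra]. unfold Rdiv in HK. rewrite Rmult_assoc, Rinv_l in HK by lra. lra. }
destruct (sieve_exp_sum (fact P0) L K HQn ltac:(lra)) as (Am & dd & HAm & Hdd & [J0 HJ0]).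
(* The sums over [j] save [J^dd >= X^(dd eps/16)], and the loss [v^2 = X^(2 dl)] may use up half of
   that exponent. The bound [eps/192] keeps [v^2] below the powers of [J1] available for large
   divisors. *)
destruct (apl_exp_sum (fact P0) L1 K HQn ltac:(lra)) as (A1 & d1 & HA1 & Hd1 & [J01 HJ01]). set (dl := Rmin (dd*eps/64) (eps/192)).
have Hdl : 0 < dl by (apply Rmin_pos; [pos|]; lra). have Hdl1 : dl <= dd*eps/64 by apply Rmin_l. have Hdl2 : dl <= eps/192 by apply Rmin_r. set (C0 := 128000*(129*lam)).
have Hdde : 0 < dd*eps by lra. have Hd1e : 0 < d1*eps by pos. have Hev : forall c e, 0 < e -> ev (fun X => c <= Rpower X e) by (intros; apply ev_power; assumption).
apply (ev_imp (fun X => (1 <= X /\ exp (32*L/eps) <= X) /\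
  (2 <= Rpower X (eps/16) /\ exp L <= Rpower X (1/4) /\ exp L1 <= Rpower X (1/4) /\ INR a+1 <= Rpower X (1/4)) /\
  (3*C0+64*lam <= Rpower X dl /\ J0 <= Rpower X (eps/16) /\ J01 <= Rpower X (eps/24) /\ 12*C0 <= Rpower X (1/2)) /\
  (200*Am*Q/L <= Rpower X (dd*eps/32) /\ 10*Q*A1/L1 <= Rpower X (d1*eps/24) /\ 24*Q/W <= Rpower X (eps/16)) /\
  (3*Q/L1 <= Rpower X (eps/48) /\ 3*Q/L <= Rpower X (eps/48) /\ 2 <= Rpower X (eps/48) /\
   16000*Q^2*(L+1)^2/L^2 <= Rpower X (eps/96) /\
   20000*Q^2*(L+1)*(L1+1)/(L*L1) <= Rpower X (eps/48)) /\
  (exists Z P, Rpower X (1/2-5*eps/8) <= Z <= Rpower X (1/2-eps/2) /\ NoDup P /\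
    (forall p, In p P -> good p /\ Z <= INR p < 2*Z) /\ Rpower Z (1-dl) <= num P) /\
  (exists Z P, Rpower X (1/2-3*eps/4) <= Z <= Rpower X (1/2-11*eps/16) /\ NoDup P /\
    (forall p, In p P -> good p /\ Z <= INR p < 2*Z) /\ Rpower Z (1-dl) <= num P))).
{ repeat apply ev_and; try apply ev_ge; try (apply Hev; lra); apply Hps; lra. }
intros X ((X1 & X2) & (F1 & F2 & F3 & F4) & (F5 & F6 & F7 & F8) & (F9 & F10 & F11) & (F12 & F13 & F14 & F15 & F16) &
  (Z & Q1 & HZ & Hnd1 & HQ1 & Hnum1) & (Z' & Q2 & HZ' & Hnd2 & HQ2 & Hnum2)).
apply NNPP. intros Hno. destruct (constant_sign A _ _ Hno) as (sg & Hsg & Hconst).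
set (x := ln X). have Hx : 32*L/eps <= x.
{ unfold x. rewrite <- (ln_exp (32*L/eps)). apply ln_le; go. }
have Hx1 : 32*L <= x*eps.
{ apply (Rmult_le_compat_r eps) in Hx; [|lra]. unfold Rdiv in Hx. rewrite Rmult_assoc, Rinv_l in Hx by lra. lra. }
have Hxp : 0 < x by nra. set (R := fun s => Rpower X s). have RD : forall s t, R s*R t = R (s+t) by (intros; unfold R; rewrite Rpower_plus; easy).
have Rpos : forall s, 0 < R s by (intros; apply Rp_pos). have Rle : forall s t, s <= t -> R s <= R t by (intros; apply Rp_le; assumption).
have R1 : R 1 = X by (unfold R; apply Rpower_1; lra). have R0 : R 0 = 1 by (unfold R; apply Rpower_O; lra). set (h := R (1/2+eps)).
have Hh : 0 < h <= X by (split; [eauto|rewrite <- R1; apply Rle; lra]). have Hzz : R (1/4) <= Z' by (etransitivity; [apply Rle|apply HZ']; lra).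
have Hr4 : 1 <= R (1/4) by (rewrite <- R0; apply Rle; lra).
assert (Hlz' : (1/2-3*eps/4)*x <= ln Z' <= (1/2-11*eps/16)*x).
{ split; [rewrite <- (Rp_ln X)|unfold x; rewrite <- (Rp_ln X)]; apply ln_le; try apply HZ'; try apply Rp_pos; lra. }
have Hzz2 : 2*Z' <= Z.
{ etransitivity; [|apply HZ]. etransitivity; [lmul; [apply HZ']|]. fold (R (1/2-11*eps/16)). fold (R (1/2-5*eps/8)).
  replace (1/2-5*eps/8) with (eps/16+(1/2-11*eps/16)) by field. rewrite <- RD. apply Rmult_le_compat_r; [left; apply Rpos|exact F1]. }
have Hlz : (1/2-5*eps/8)*x <= ln Z <= (1/2-eps/2)*x.
{ split; [rewrite <- (Rp_ln X)|unfold x; rewrite <- (Rp_ln X)]; apply ln_le; try apply HZ; try apply Rp_pos; lra. }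
(* [J] is solved from the requirement that the products be of size [X], whatever the positions of
   [Z] and [Z'] in their windows; it then lies between [X^(eps/16)] and [X^(eps/8)]. *)
set (J1 := R (eps/24)). have HlJ1 : ln J1 = eps/24*x by apply Rp_ln. set (J := exp ((1-6*L+ln (X+h/2)-6*ln J1-ln Z-ln Z')/12)).
have HlJ : 12*ln J = 1-6*L+ln (X+h/2)-6*ln J1-ln Z-ln Z' by (unfold J; rewrite ln_exp; field). have HJp : 0 < J by apply exp_pos.
assert (HX' : x <= ln (X+h/2) <= x+1).
{ split; [apply ln_le; lra|]. replace 1 with (ln (exp 1)) at 1 by apply ln_exp. unfold x.
  rewrite <- ln_mult by pos. apply ln_le; [lra|]. pose proof (exp_ineq1_le 1). nra. }
have HJlo : R (eps/16) <= J by (apply Rp_le_of_ln; [exact HJp|fold x; lra]). have HJhi : J <= R (eps/8) by (apply Rp_ge_of_ln; [exact HJp|fold x; lra]).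
(* The resolution [16 lam/B <= h/(8 X)] with [h = X^(1/2+eps)] dictates [B]; the number [N] of
   frequencies then stays below both prime sizes, up to a constant. *)
destruct (nat_ceil (128*lam*R (1/2-eps))) as (B & HB1 & HB2); [apply Rmult_le_pos; [lra|left; apply Rpos]|].
have HR12 : 1 <= R (1/2-eps) by (rewrite <- R0; apply Rle; lra). have HlR2 : lam*1 <= lam*R (1/2-eps) by mono. have HBp : 1 <= INR B by lra.
set (N := (Z.to_nat 128000*B)%nat). have HN : INR N = 128000*INR B by (unfold N; rewrite mult_INR, (INR_IZR_INZ (Z.to_nat _)), Z2Nat.id by lia; easy).
have HNC : INR N <= C0*R (1/2-eps) by (rewrite HN; unfold C0; lra). destruct (nat_ceil Z') as (n0 & Hn0 & _); [lra|].
have HJ1 : 1 <= J1 by (rewrite <- R0; apply Rle; lra). have HJJ : J1 <= J by (etransitivity; [apply Rle|exact HJlo]; lra).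
have Htb : 12*INR N/lam <= X.
{ transitivity (12*INR N).
  - unfold Rdiv. rewrite <- (Rmult_1_r (12*INR N)) at 2. lmul. rewrite <- Rinv_1. mono.
  - transitivity (12*C0*R (1/2-eps)); [lra|]. rewrite <- R1. replace 1 with (1/2+1/2) at 2 by lra. rewrite <- RD. assert (R (1/2-eps) <= R (1/2)) by (apply Rle; lra).
    fold (R (1/2)) in F8. have HC0 : 0 <= C0 by (unfold C0; lra). mono. }
have HJK : X <= J1^K.
{ unfold J1, R. rewrite Rp_pow. rewrite <- R1 at 1. apply Rle. lra. }
assert (HJK' : X <= J^K) by (etransitivity; [exact HJK|mono]). set (v := R dl). set (dM := Am*Rpower J (- dd)).
have Hv2 : v^2 = R (2*dl) by (unfold v; simpl; rewrite Rmult_1_r, RD; f_equal; ring). have HdM : 0 <= dM by (apply Rmult_le_pos; [exact HAm|pos]).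
have Hpn : forall Z0 n, R (1/4) <= Z0 -> Z0 <= X -> R (1/2-eps) <= Z0 -> Rpower Z0 (1-dl) <= n ->
  3*INR N+64*Z0*lam <= v^2*n.
{ intros Z0 n G1 G2 G3 G4. have Hz0 : 0 < Z0 by lra. transitivity (v^2*Rpower Z0 (1-dl)); [|mono].
  have Hzd : Z0 <= Rpower Z0 (1-dl)*v.
  { rewrite <- (Rpower_1 Z0) at 1 by exact Hz0. replace 1 with (1-dl+dl) at 1 by ring. rewrite Rpower_plus. lmul. apply Rp_base; lra. }
  transitivity ((3*C0+64*lam)*Z0).
  - assert (0 <= C0) by (unfold C0; lra). assert (C0*R (1/2-eps) <= C0*Z0) by mono. lra.
  - fold (R dl) in F5. fold v in F5. transitivity (v*Z0); [mono|].
    replace (v^2*Rpower Z0 (1-dl)) with (v*(Rpower Z0 (1-dl)*v)) by ring. apply Rmult_le_compat_l; [left; apply Rpos|exact Hzd]. }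
have HdMv : dM*v^2 <= L/Q/200.
{ rewrite Hv2. transitivity (Am*R (- (dd*eps/32))).
  - unfold dM. rewrite Rmult_assoc. lmul. transitivity (R (- (dd*eps/16))*R (2*dl)).
    + apply Rmult_le_compat_r; [left; apply Rpos|]. unfold R. rewrite !Rpower_Ropp. apply Rinv_le_contravar; [auto|].
      replace (Rpower X (dd*eps/16)) with (Rpower (R (eps/16)) dd).
      * apply Rp_base; go.
      * unfold R. rewrite Rpower_mult. alg.
    + rewrite RD. apply Rle. lra.
  - apply Rmult_le_reg_r with (R (dd*eps/32)*(200*Q)); [apply Rmult_lt_0_compat; [auto|lra]|].
    replace (Am*R (- (dd*eps/32))*(R (dd*eps/32)*(200*Q))) with (200*Am*Q*(R (- (dd*eps/32))*R (dd*eps/32))) by ring.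
    rewrite RD. replace (- (dd*eps/32)+dd*eps/32) with 0 by ring. rewrite R0. replace (L/Q/200*(R (dd*eps/32)*(200*Q))) with (R (dd*eps/32)*L) by fd.
    apply (Rmult_le_compat_r L) in F9; [|lra]. unfold Rdiv in F9 at 1. rewrite Rmult_assoc, Rinv_l in F9 by lra. assumption. }
have Hy : Rpower J1 (1/2) = R (eps/48) by (unfold J1, R; rewrite Rpower_mult; f_equal; field).
have HyJ : R (eps/48) <= Rpower J (1/2) by (rewrite <- Hy; apply Rp_base; lra).
fold (R (eps/48)) in F12, F13, F14, F16. fold (R (eps/96)) in F15. fold (R (eps/16)) in F11, F6. fold J1 in F7.
have Hdiv : forall a0 b0 c0, 0 < b0 -> a0/b0 <= c0 -> a0 <= b0*c0.
{ intros a0 b0 c0 Hb H. apply (Rmult_le_compat_r b0) in H; [|lra]. unfold Rdiv in H. rewrite Rmult_assoc, Rinv_l in H by lra. lra. }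
have HL2 : 0 < L^2 by pos. have HLL : 0 < L*L1 by pos.
refine (analytic_finite A sg a d P0 B N n0 Q1 Q2 X h lam J J1 Z Z' L1 dM (A1*Rpower J1 (- d1)) v HA Hsq Hgood H6 Ea Hd HAa
  (conj Ha HP2) HP3 HP1 _ Hh Hlam HWL eq_refl _ HN _ _ HJ1 HJJ HlJ _ Hzz2 _ _ _ Hn0 Hnd1 Hnd2 HQ1 HQ2 _ _ _ _ _ HdM
  _ _ _ _ _ _ HdMv _ _ Hconst Hsg); try fold L; try fold Q; try fold W.
- lra.
- apply INR_le. exact HBp.
- cancel (INR B). lra.
- apply Rmult_le_reg_r with (INR B*(8*X)); [pos|]. replace (16*lam/INR B*(INR B*(8*X))) with (128*lam*X) by fd. replace (h/(8*X)*(INR B*(8*X))) with (INR B*h) by fd.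
  transitivity (128*lam*R (1/2-eps)*h); [|mono]. right. unfold h. rewrite (Rmult_assoc (128*lam) (R (1/2-eps))), RD, <- R1. f_equal. alg.
- lra.
- transitivity (R (eps/8)*R (1/4)); [mono|]. rewrite RD. etransitivity; [apply Rle|apply HZ']. lra.
- transitivity (R (eps/24)*R (1/4)); [mono|]. rewrite RD. etransitivity; [apply Rle|apply HZ']. lra.
- fold (R (1/4)) in F4. lra.
- eapply Rlt_le_trans; [apply Rp_pos|exact Hnum1].
- eapply Rlt_le_trans; [apply Rp_pos|exact Hnum2].
- apply Hpn; [lra| | |exact Hnum1].
  + via HZ. transitivity (R 1); [apply Rle; lra|lra].
  + etransitivity; [|apply HZ]. apply Rle. lra.
- apply Hpn; [lra| | |exact Hnum2].
  + via HZ'. transitivity (R 1); [apply Rle; lra|lra].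
  + etransitivity; [|apply HZ']. apply Rle. lra.
- unfold v. rewrite <- R0. apply Rle. lra.
- intros g t Hg Hgy Ht Hce Htt. apply HJ0; try assumption; lra.
- intros t Ht Htt. etransitivity; [apply (HJ01 J1 F7 1%nat t); try assumption; [lia|lra]|]. apply Rplus_le_compat_l. unfold Rdiv. apply Rmult_le_compat_r.
  + left. apply Rinv_0_lt_compat. apply Rmult_lt_0_compat; [lra|]. apply Rabs_pos_lt. exact Ht.
  + replace (1-ce (t*L1))%C with (1 + - ce (t*L1))%C by ring. via Cmod_triangle. rewrite Cmod_opp, Cmod_ce, Cmod_1. lra.
- replace (Rpower J1 (- d1)) with (R (- (d1*eps/24))) by (unfold J1, R; rewrite Rpower_mult; f_equal; field). apply Hdiv in F10; [|lra]. fold (R (d1*eps/24)) in F10.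
  apply Rmult_le_reg_r with (R (d1*eps/24)*(10*Q)); [apply Rmult_lt_0_compat; [auto|lra]|].
  replace (A1*R (- (d1*eps/24))*(R (d1*eps/24)*(10*Q))) with (10*Q*A1*(R (- (d1*eps/24))*R (d1*eps/24))) by ring.
  rewrite RD. replace (- (d1*eps/24)+d1*eps/24) with 0 by ring. rewrite R0. replace (L1/Q/10*(R (d1*eps/24)*(10*Q))) with (L1*R (d1*eps/24)) by fd. lra.
- change (/ J <= W/Q/24). apply Hdiv in F11; [|lra]. apply Rmult_le_reg_r with (J*(24*Q)); [pos|].
  replace (/ J*(J*(24*Q))) with (24*Q) by fd. replace (W/Q/24*(J*(24*Q))) with (W*J) by fd. via F11. mono.
- rewrite Hy. apply Hdiv; go.
- apply Hdiv; [lra|]. lra.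
- rewrite Hy. apply Hdiv in F15; [|exact HL2]. have E1 : R (eps/48) = R (eps/96)*R (eps/96) by (rewrite RD; f_equal; field).
  have E2 : v^2 <= R (eps/96) by (rewrite Hv2; apply Rle; lra). have E3 : 1 <= R (eps/96) by (rewrite <- R0; apply Rle; lra). set (r := R (eps/96)) in *.
  transitivity (4000*Q^2*(L+1)^2*(2*r)).
  + mono.
  + replace (4000*Q^2*(L+1)^2*(2*r)) with (16000*Q^2*(L+1)^2*(r/2)) by field. transitivity (L^2*r*(r/2)); [mono|].
    replace (L^2*r*(r/2)) with (L^2*(r*r/2)) by field. mono.
- rewrite Hy. apply Hdiv in F16; [|exact HLL]. transitivity (L*L1*(R (eps/48)/2)); go.
Qed.

(** * Primes congruent to 1 modulo 12 *)

Definition nprime (p : nat) : Prop := prime (Z.of_nat p).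

Lemma nprime_ge2 p : nprime p -> (2 <= p)%nat.
Proof. intros H%prime_ge_2. lia. Qed.

Lemma prime_divisor (n : nat) : (2 <= n)%nat -> exists p, nprime p /\ Nat.divide p n.
Proof.
induction n as [n IH] using lt_wf_ind. intros Hn. destruct (prime_dec (Z.of_nat n)) as [H|H]; [exists n; split; [exact H|easy]|].
apply not_prime_divide in H; [|lia]. destruct H as (m & Hm & [c Hc]). destruct (IH (Z.to_nat m) ltac:(lia) ltac:(lia)) as (p & Hp & Hpm).
exists p. split; [exact Hp|]. eapply Nat.divide_trans; [exact Hpm|]. exists (Z.to_nat c). lia.
Qed.

Lemma divide_Z m n : Nat.divide m n <-> (Z.of_nat m | Z.of_nat n)%Z.
Proof.
split.
- intros [c ->]. exists (Z.of_nat c). lia.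
- intros [c Hc]. destruct (Nat.eq_dec m 0) as [->|Hm].
  + exists 0%nat. lia.
  + exists (Z.to_nat c). lia.
Qed.

Lemma rp_gauss a b c : rp a b -> Nat.divide a (b*c) -> Nat.divide a c.
Proof.
intros H Hd. apply divide_Z. apply divide_Z in Hd. rewrite Nat2Z.inj_mul in Hd. apply (Gauss _ (Z.of_nat b)); go.
Qed.

Lemma primes_rp p q : nprime p -> nprime q -> p <> q -> rp p q.
Proof.
intros Hp Hq H. pose proof (nprime_ge2 p Hp). pose proof (nprime_ge2 q Hq). destruct (Nat.lt_total p q) as [L|[L|L]]; [|lia|].
- apply rp_sym, rp_prime_lt; go.
- apply rp_prime_lt; go.
Qed.

Lemma dvdb_iff g j : (1 <= g)%nat -> dvdb g j = true <-> Nat.divide g j.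
Proof.
intros Hg. rewrite dvdb_true by exact Hg. split; intros [c ->]; exists c; lia.
Qed.

Lemma Rsum_indicator (l : list nat) a c : NoDup l -> In a l -> Rsum l (fun x => if (x =? a)%nat then c else 0) = c.
Proof.
intros Hn Hi. destruct (in_split a l Hi) as (l1 & l2 & ->). apply NoDup_remove_2 in Hn. rewrite Rsum_app. simpl. rewrite Nat.eqb_refl.
rewrite !Rsum_zero; [ring| |]; intros x Hx; destruct (Nat.eqb_spec x a) as [->|]; try reflexivity;
  exfalso; apply Hn, in_app_iff; tauto.
Qed.

(* [LS N w] is the sum of [Lambda (q) w (q)] over the prime powers [q], provided [w] vanishes beyond [N]. *)
Definition LS (N : nat) (w : nat -> R) : R :=
  Rsum (seq 1 N) (fun p => if ind (nprime p) then ln (INR p)*Rsum (seq 1 N) (fun k => w (p^k)%nat) else 0).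

Lemma LS_ext N w w' : (forall p k, nprime p -> (1 <= k <= N)%nat -> w (p^k)%nat = w' (p^k)%nat) -> LS N w = LS N w'.
Proof.
intros H. apply Rsum_ext. intros p _. destruct (ind (nprime p)) eqn:E; [|lra]. apply (proj1 (ind_true _)) in E. f_equal. apply Rsum_ext. intros k Hk%in_seq. apply H; go.
Qed.

Lemma LS_plus N w w' : LS N (fun q => w q+w' q) = LS N w+LS N w'.
Proof.
unfold LS. rewrite <- Rsum_plus. apply Rsum_ext. intros p _. destruct (ind (nprime p)); [|ring]. rewrite Rsum_plus. ring.
Qed.

Lemma LS_scal N c w : LS N (fun q => c*w q) = c*LS N w.
Proof.
unfold LS. rewrite <- Rsum_scal. apply Rsum_ext. intros p _. destruct (ind (nprime p)); [|ring]. rewrite Rsum_scal. ring.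
Qed.

Lemma LS_le N w w' : (forall p k, nprime p -> (1 <= k <= N)%nat -> w (p^k)%nat <= w' (p^k)%nat) -> LS N w <= LS N w'.
Proof.
intros H. apply Rsum_le. intros p _. destruct (ind (nprime p)) eqn:E; [|lra].
apply (proj1 (ind_true _)) in E. have Hp := nprime_ge2 p E. apply (le_INR 2) in Hp. simpl in Hp. apply Rmult_le_compat_l; [rewrite <- ln_1; apply ln_le; lra|].
apply Rsum_le. intros k Hk%in_seq. apply H; go.
Qed.

Lemma LS_abs N w w' : (forall p k, nprime p -> (1 <= k <= N)%nat -> Rabs (w (p^k)%nat) <= w' (p^k)%nat) -> Rabs (LS N w) <= LS N w'.
Proof.
intros H. apply Rabs_le. split.
- replace (- LS N w') with (LS N (fun q => -1*w' q)) by (rewrite LS_scal; ring). apply LS_le. intros p k Hp Hk. specialize (H p k Hp Hk). apply Rabs_le_between in H. lra.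
- apply LS_le. intros p k Hp Hk. specialize (H p k Hp Hk). apply Rabs_le_between in H. lra.
Qed.

Lemma LS_Rsum {A} N (l : list A) (w : A -> nat -> R) :
  LS N (fun q => Rsum l (fun n => w n q)) = Rsum l (fun n => LS N (w n)).
Proof.
unfold LS. rewrite Rsum_swap. apply Rsum_ext. intros p _. destruct (ind (nprime p)).
- rewrite Rsum_scal. f_equal. apply Rsum_swap.
- symmetry. apply Rsum_zero. auto.
Qed.

Lemma pow_gt p k : (2 <= p)%nat -> (k < p^k)%nat.
Proof. intros H. apply Nat.pow_gt_lin_r. lia. Qed.

(** The logarithm is the convolution of von Mangoldt's function with 1. Removing one prime factor
    [q] from [n] affects only the powers of [q], of which exactly one fewer divides the result. *)
Lemma LS_ln N n : (1 <= n <= N)%nat -> LS N (fun q => if dvdb q n then 1 else 0) = ln (INR n).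
Proof.
induction n as [n IH] using lt_wf_ind. intros Hn.
destruct (Nat.eq_dec n 1) as [->|Hn1].
{ simpl (INR 1). rewrite ln_1. apply Rsum_zero. intros p _. destruct (ind (nprime p)) eqn:E; [|lra].
  apply (proj1 (ind_true _)) in E. apply nprime_ge2 in E. rewrite Rsum_zero; [ring|].
  intros k Hk%in_seq. pose proof (pow_gt p k E). unfold dvdb. rewrite Nat.mod_small by lia. auto. }
destruct (prime_divisor n ltac:(lia)) as (q & Hq & [m Em]). have Hq2 := nprime_ge2 q Hq. have Hm : (1 <= m < n)%nat by nia.
have E : ln (INR n) = LS N (fun i => if dvdb i m then 1 else 0)+ln (INR q).
{ rewrite (IH m) by lia. rewrite Em, mult_INR, ln_mult; [lra| |]; apply lt_0_INR; lia. }
rewrite E. unfold LS. rewrite <- (Rsum_indicator (seq 1 N) q (ln (INR q))) by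
  (try apply seq_NoDup; apply in_seq; nia).
rewrite <- Rsum_plus. apply Rsum_ext. intros p _. destruct (Nat.eqb_spec p q) as [->|Hpq].
- rewrite (proj2 (ind_true _) Hq). destruct N as [|N]; [lia|]. rewrite (Rsum_seq_S N 1 (fun k => if dvdb (q^k) m then 1 else 0)).
  have Z0 : dvdb (q^(1+N)) m = false.
  { unfold dvdb. pose proof (pow_gt q (1+N) Hq2). rewrite Nat.mod_small by lia. apply Nat.eqb_neq. lia. }
  rewrite Z0. change (seq 1 (S N)) with (1%nat :: seq 2 N). simpl (Rsum (_ :: _) _). rewrite (Rsum_seq_shift 1 1 N).
  have D1 : dvdb (q*1) n = true by (apply dvdb_iff; [lia|]; exists m; lia). simpl (q^1)%nat. rewrite D1.
  rewrite (Rsum_ext (seq 1 N) (fun k => if dvdb (q^(k+1)) n then 1 else 0) (fun k => if dvdb (q^k) m then 1 else 0)); [ring|].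
  intros k Hk%in_seq. replace (k+1)%nat with (S k) by lia. have P1 : (1 <= q^k)%nat by (pose proof (pow_gt q k Hq2); lia).
  assert (EB : dvdb (q^S k) n = dvdb (q^k) m); [|rewrite EB; easy]. apply Bool.eq_iff_eq_true. rewrite !dvdb_iff by (simpl; nia). rewrite Em, Nat.mul_comm. simpl.
  split; [apply Nat.mul_divide_cancel_l; lia|]. intros [c ->]. exists c. ring.
- rewrite Rplus_0_r. destruct (ind (nprime p)) eqn:Ep; [|lra]. apply (proj1 (ind_true _)) in Ep. have Hp2 := nprime_ge2 p Ep. f_equal. apply Rsum_ext. intros k Hk.
  have P1 : (1 <= p^k)%nat by (pose proof (pow_gt p k Hp2); lia). assert (EB : dvdb (p^k) n = dvdb (p^k) m); [|rewrite EB; easy].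
  apply Bool.eq_iff_eq_true. rewrite !dvdb_iff by exact P1. rewrite Em. split.
  + rewrite Nat.mul_comm. apply rp_gauss, rp_pow_l, primes_rp; assumption.
  + apply Nat.divide_mul_l.
Qed.

Lemma sum_ln N (G : nat -> R) : Rsum (seq 1 N) (fun n => G n*ln (INR n)) =
  LS N (fun q => Rsum (seq 1 N) (fun n => if dvdb q n then G n else 0)).
Proof.
rewrite LS_Rsum. apply Rsum_ext. intros n Hn%in_seq. rewrite <- (LS_ln N n) by lia. rewrite <- LS_scal. apply LS_ext. intros p k _ _. destruct (dvdb _ _); ring.
Qed.

Lemma Rsum_dvdb N q (G : nat -> R) : (1 <= q)%nat ->
  Rsum (seq 1 N) (fun n => if dvdb q n then G n else 0) = Rsum (seq 1 (N/q)) (fun m => G (q*m)%nat).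
Proof.
intros Hq. rewrite <- Rsum_filter, <- (Rsum_map (fun m => (q*m)%nat)). apply Rsum_perm, NoDup_Permutation.
- apply NoDup_filter, seq_NoDup.
- apply FinFun.Injective_map_NoDup; [intros x y H; nia|apply seq_NoDup].
- intros x. rewrite filter_In, in_seq, dvdb_iff, in_map_iff by exact Hq. split.
  + intros [H1 [c ->]]. exists c. split; [ring|]. apply in_seq. assert (c <= N/q)%nat by (apply Nat.div_le_lower_bound; nia). nia.
  + intros (m & <- & Hm). apply in_seq in Hm. split; [|exists m; ring]. pose proof (Nat.Div0.mul_div_le N q). nia.
Qed.

Lemma LS_extend (N M : nat) w : (N <= M)%nat -> (forall q, (N < q)%nat -> w q = 0) -> LS M w = LS N w.
Proof.
intros HNM Hw. unfold LS.
have Hk : forall p, nprime p -> Rsum (seq 1 M) (fun k => w (p^k)%nat) = Rsum (seq 1 N) (fun k => w (p^k)%nat).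
{ intros p Hp%nprime_ge2. replace M with (N+(M-N))%nat by lia. rewrite seq_app, Rsum_app.
  rewrite (Rsum_zero (seq (1+N) _)); [ring|]. intros k Hk%in_seq. apply Hw. pose proof (pow_gt p k Hp). lia. }
replace M with (N+(M-N))%nat at 1 by lia. rewrite seq_app, Rsum_app. rewrite (Rsum_zero (seq (1+N) _)), Rplus_0_r.
- apply Rsum_ext. intros p _. destruct (ind (nprime p)) eqn:E; [|lra]. rewrite Hk; [lra|apply ind_true, E].
- intros p Hp%in_seq. destruct (ind (nprime p)) eqn:E; [|lra].
  apply (proj1 (ind_true _)) in E. apply nprime_ge2 in E. rewrite Rsum_zero; [ring|]. intros k Hk'%in_seq. apply Hw.
  assert (p^1 <= p^k)%nat by (apply Nat.pow_le_mono_r; lia). simpl in H. lia.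
Qed.

Definition upto (N q : nat) : R := if (q <=? N)%nat then 1 else 0.

(** Chebyshev's function. *)
Definition psi (N : nat) : R := LS N (upto N).

Lemma ln_fact N : Rsum (seq 1 N) (fun n => ln (INR n)) = LS N (fun q => INR (N/q)).
Proof.
rewrite (Rsum_ext _ _ (fun n => 1*ln (INR n))) by alg. rewrite (sum_ln N (fun _ => 1)).
apply LS_ext. intros p k Hp _. apply nprime_ge2 in Hp. rewrite Rsum_dvdb by (pose proof (pow_gt p k Hp); lia). rewrite Rsum_const, length_seq. ring.
Qed.

(** Chebyshev's argument with the central binomial coefficient, which is at most [4^m]: in its
    logarithm a prime power [q] has the weight [floor (2 m/q) - 2 floor (m/q)], always nonnegative
    and equal to 1 for [m < q <= 2 m]. *)
Lemma psi_double m : psi (2*m) <= psi m+2*INR m*ln 2.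
Proof.
have HF : Rsum (seq 1 (2*m)) (fun n => ln (INR n)) <= 2*Rsum (seq 1 m) (fun n => ln (INR n))+2*INR m*ln 2.
{ induction m as [|m IH]; [simpl; lra|]. replace (2*S m)%nat with (S (S (2*m))) by lia. rewrite !Rsum_seq_S.
  replace (1+S (2*m))%nat with (2*S m)%nat by lia. replace (1+2*m)%nat with (2*m+1)%nat by lia. replace (1+m)%nat with (S m) by lia.
  assert (ln (INR (2*m+1)) <= ln (INR (2*S m))) by (apply ln_le; [pos|mono]; lia).
  assert (ln (INR (2*S m)) = ln 2+ln (INR (S m))) by (rewrite mult_INR, ln_mult; [auto|pos|pos]). inr. }
rewrite !ln_fact in HF. rewrite <- (LS_extend m (2*m) (fun q => INR (m/q))) in HF by (try lia; intros; rewrite Nat.div_small by lia; easy).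
have E : psi m = LS (2*m) (upto m).
{ symmetry. apply LS_extend; [lia|]. intros q Hq. unfold upto. destruct (Nat.leb_spec q m); [lia|lra]. }
rewrite E. unfold psi.
assert (LS (2*m) (upto (2*m)) <= LS (2*m) (fun q => upto m q+(INR (2*m/q) + -2*INR (m/q)))).
{ apply LS_le. intros p k Hp _. apply nprime_ge2 in Hp. pose proof (pow_gt p k Hp). set (q := (p^k)%nat) in *.
  have Hf : (2*(m/q) <= 2*m/q)%nat.
  { apply Nat.div_le_lower_bound; [lia|]. pose proof (Nat.Div0.mul_div_le m q). nia. }
  apply le_INR in Hf. rewrite mult_INR in Hf. simpl (INR 2) in Hf. unfold upto. destruct (Nat.leb_spec q (2*m)), (Nat.leb_spec q m); try lia; try lra.
  rewrite (Nat.div_small m q) by lia. assert (1 <= 2*m/q)%nat by (apply Nat.div_le_lower_bound; lia). inr. }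
rewrite !LS_plus, LS_scal in H. lra.
Qed.

Lemma psi_mono N M : (N <= M)%nat -> psi N <= psi M.
Proof.
intros H. unfold psi. rewrite <- (LS_extend N M (upto N) H).
- apply LS_le. intros p k _ _. unfold upto. destruct (Nat.leb_spec (p^k) N), (Nat.leb_spec (p^k) M); try lia; lra.
- intros q Hq. unfold upto. destruct (Nat.leb_spec q N); [lia|lra].
Qed.

Lemma psi_le N : psi N <= 4*INR N.
Proof.
have Hl2 : ln 2 <= 1 by (pose proof (ln_le_sub1 2); lra). induction N as [N IH] using lt_wf_ind. destruct (le_lt_dec N 1) as [H|H].
- assert (psi N = 0); [|pose proof (pos_INR N); lra]. apply Rsum_zero. intros p Hp%in_seq.
  destruct (ind (nprime p)) eqn:E; [|lra]. apply (proj1 (ind_true _)) in E. apply nprime_ge2 in E. lia.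
- set (m := (N/2)%nat). have E := Nat.div_mod_eq N 2. pose proof (Nat.mod_upper_bound N 2 ltac:(lia)). fold m in E. destruct (Nat.eq_dec (N mod 2) 0) as [E0|E0].
  + replace N with (2*m)%nat by lia. via psi_double. specialize (IH m ltac:(lia)). rewrite mult_INR. simpl (INR 2). pose proof (pos_INR m). nra.
  + (* [N] odd: pass to [N+1 = 2 (m+1)]. *)
    etransitivity; [apply (psi_mono N (2*S m)); lia|]. via psi_double. have I1 := IH (S m) ltac:(lia).
    have E3 : INR N = 2*INR (S m)-1.
    { have E4 : INR (S N) = 2*INR (S m) by (replace (S N) with (2*S m)%nat by lia; rewrite mult_INR; easy). inr. }
    assert (2 <= INR (S m)) by (apply (le_INR 2); lia). nra.
Qed.

Lemma Rsum_abel (c g : nat -> R) (a n : nat) (B : R) : (forall m, Rabs (Rsum (seq a m) c) <= B) ->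
  (forall i, (a <= i)%nat -> 0 <= g (S i) <= g i) ->
  Rabs (Rsum (seq a n) (fun i => c i*g i)) <= B*g a.
Proof.
intros Hc Hg. rewrite <- Cmod_R, <- Csum_RtoC, (Rmult_comm B), (Csum_ext _ _ (fun i => RtoC (g i)*RtoC (c i))%C)
  by alg.
apply Csum_abel; [exact Hg|]. intros m _. rewrite Csum_RtoC, Cmod_R. auto.
Qed.

Definition wupto (N : nat) (chi : nat -> R) (q : nat) : R := upto N q*(chi q/INR q).

Lemma upto_cases N q : (q <= N)%nat /\ upto N q = 1 \/ (N < q)%nat /\ upto N q = 0.
Proof. unfold upto. destruct (Nat.leb_spec q N); [left|right]; split; trivial. Qed.

Lemma INR_div_bounds N q : (1 <= q)%nat -> INR N/INR q-1 <= INR (N/q) <= INR N/INR q.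
Proof.
intros Hq. have Hq0 : 0 < INR q by pos. have E := Nat.div_mod_eq N q. have Hm := Nat.mod_upper_bound N q ltac:(lia).
apply (f_equal INR) in E. rewrite plus_INR, mult_INR in E. apply lt_INR in Hm. pose proof (pos_INR (N mod q)).
split; apply Rmult_le_reg_r with (INR q); try exact Hq0; unfold Rdiv; rewrite ?Rmult_minus_distr_r, (Rmult_assoc (INR N)), Rinv_l by lra; lra.
Qed.

Lemma ln_fact_bounds N : (1 <= N)%nat -> INR N*ln (INR N)-INR N <= Rsum (seq 1 N) (fun n => ln (INR n)) <= INR N*ln (INR N).
Proof.
intros HN. induction N as [|N IH]; [lia|]. destruct (Nat.eq_dec N 0) as [->|H0]; [simpl; rewrite ln_1; lra|].
specialize (IH ltac:(lia)). rewrite Rsum_seq_S. change (1+N)%nat with (S N). have Hp : 0 < INR N by pos. rewrite S_INR.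
have H1 : ln (INR N) <= ln (INR N+1) by (apply ln_le; lra).
have H2 : INR N*(ln (INR N+1)-ln (INR N)) <= 1.
{ rewrite <- ln_div by lra. replace ((INR N+1)/INR N) with (1 + / INR N) by fd. assert (0 < / INR N) by pos.
  pose proof (ln_le_sub1 (1 + / INR N) ltac:(lra)). transitivity (INR N * / INR N); [mono|]. rewrite Rinv_r; lra. }
nra.
Qed.

(** [ln (N!)] is the sum of the von Mangoldt weights times the floors of [N/q]. Dropping the floors
    costs at most [psi N <= 4 N], and the crude Stirling bound at most [N]. *)
Lemma mertens N : (1 <= N)%nat -> Rabs (LS N (wupto N (fun _ => 1))-ln (INR N)) <= 4.
Proof.
intros HN. have HF := ln_fact_bounds N HN. rewrite ln_fact in HF. have Hp : 1 <= INR N by inr. set (E := LS N (wupto N (fun _ => 1))).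
have H1 : LS N (fun q => INR (N/q)) <= INR N*E.
{ unfold E. rewrite <- LS_scal. apply LS_le. intros p k Hp' _. pose proof (pow_gt p k (nprime_ge2 p Hp')). set (q := (p^k)%nat) in *.
  unfold wupto. destruct (upto_cases N q) as [[Hq ->]|[Hq ->]].
  - pose proof (INR_div_bounds N q ltac:(lia)). lra.
  - rewrite Nat.div_small by lia. inr. }
have H2 : INR N*E + -1*psi N <= LS N (fun q => INR (N/q)).
{ unfold E, psi. rewrite <- !LS_scal, <- LS_plus. apply LS_le. intros p k Hp' _. pose proof (pow_gt p k (nprime_ge2 p Hp')). set (q := (p^k)%nat) in *.
  unfold wupto. destruct (upto_cases N q) as [[Hq ->]|[Hq ->]].
  - pose proof (INR_div_bounds N q ltac:(lia)). lra.
  - rewrite Nat.div_small by lia. inr. }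
pose proof (psi_le N). apply Rabs_le. nra.
Qed.

(** The function [ln x / x] decreases only from [x = exp 1] on, hence the bound 3. *)
Lemma ln_div_decr n : (3 <= n)%nat -> 0 <= ln (INR (S n))/INR (S n) <= ln (INR n)/INR n.
Proof.
intros Hn. apply (le_INR 3) in Hn. replace (INR 3) with 3 in Hn by inr. rewrite S_INR. set (x := INR n) in *.
have L1 : 1 <= ln x.
{ rewrite <- (ln_exp 1). apply ln_le; [pos|]. pose proof exp_le_3. lra. }
have L2 : ln x <= ln (x+1) by (apply ln_le; lra).
have L3 : x*(ln (x+1)-ln x) <= 1.
{ rewrite <- ln_div by lra. replace ((x+1)/x) with (1 + / x) by fd. assert (0 < / x) by pos.
  pose proof (ln_le_sub1 (1 + / x) ltac:(lra)). transitivity (x * / x); [mono|]. rewrite Rinv_r; lra. }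
split; [pos|]. apply Rmult_le_reg_r with (x*(x+1)); [nra|]. replace (ln (x+1)/(x+1)*(x*(x+1))) with (x*ln (x+1)) by fd.
replace (ln x/x*(x*(x+1))) with ((x+1)*ln x) by fd. lra.
Qed.

(** The sum of [chi n ln n / n] is bounded by partial summation. Expanding [ln] over prime powers
    makes it nearly [LS N (wupto N chi)] times the partial sum of [chi n / n], and [c] bounds the
    latter from below: it embodies the nonvanishing of the L-function at 1. *)
Lemma char_mertens (chi : nat -> R) (B c : R) (N : nat) :
  (forall m n, chi (m*n)%nat = chi m*chi n) -> (forall n, Rabs (chi n) <= 1) ->
  (forall a m, Rabs (Rsum (seq a m) chi) <= B) -> 0 < c -> (3 <= N)%nat ->
  c <= Rsum (seq 1 N) (fun n => chi n/INR n) ->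
  Rabs (LS N (wupto N chi)) <= (5*B+1)/c.
Proof.
intros Hmul Habs HB Hc HN HS. have HB0 : 0 <= B by (pose proof (HB 0%nat 0%nat) as H; simpl in H; rewrite Rabs_R0 in H; exact H).
set (S := fun n => Rsum (seq 1 n) (fun n => chi n/INR n)). change (c <= S N) in HS. have HN0 : 3 <= INR N by inr.
have H1 : Rabs (Rsum (seq 1 N) (fun n => chi n/INR n*ln (INR n))) <= B+1.
{ replace N with (2+(N-2))%nat by lia. rewrite seq_app, Rsum_app. simpl (Rsum (seq 1 2) _). rewrite ln_1. via Rabs_triang. rewrite Rplus_comm. apply Rplus_le_compat.
  - rewrite (Rsum_ext _ _ (fun n => chi n*(ln (INR n)/INR n))) by alg. etransitivity; [apply (Rsum_abel chi (fun n => ln (INR n)/INR n) (1+2) (N-2) B); [apply HB|]|].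
    + intros i Hi. apply ln_div_decr. lia.
    + rewrite <- (Rmult_1_r B) at 2. lmul. replace (INR (1+2)) with 3 by inr. pose proof (ln_le_sub1 3 ltac:(lra)). lra.
  - pose proof ln_lt_2. pose proof (ln_le_sub1 2 ltac:(lra)). specialize (Habs 2%nat). apply Rabs_le_between in Habs.
    simpl INR. replace (1+1) with 2 by ring. apply Rabs_le. nra. }
rewrite (sum_ln N (fun n => chi n/INR n)) in H1. cbn beta in H1.
(* Replacing the inner sum [S (N/q)] by [S N] costs at most [B/N] for each prime power. *)
have H2 : Rabs (LS N (fun q => Rsum (seq 1 N) (fun n => if dvdb q n then chi n/INR n else 0)) + - S N*LS N (wupto N chi))
   <= B/INR N*psi N.
{ unfold psi. rewrite <- !LS_scal, <- LS_plus. apply LS_abs. intros p k Hp _. pose proof (pow_gt p k (nprime_ge2 p Hp)). set (q := (p^k)%nat) in *.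
  rewrite Rsum_dvdb by lia. have Hq0 : 0 < INR q by pos. rewrite (Rsum_ext _ _ (fun m => chi q/INR q*(chi m/INR m))).
  2:{ intros m Hm%in_seq. rewrite Hmul, mult_INR. fd. }
  rewrite Rsum_scal. fold (S (N/q)%nat). unfold wupto. destruct (upto_cases N q) as [[Hq ->]|[Hq ->]].
  - replace (chi q/INR q*S (N/q)%nat + - S N*(1*(chi q/INR q))) with (chi q/INR q*(S (N/q)%nat-S N)) by ring.
    have Hd : Rabs (S (N/q)%nat-S N) <= B * / INR (1+N/q).
    { assert (N/q <= N)%nat by (apply Nat.Div0.div_le_upper_bound; nia). unfold S. replace N with (N/q+(N-N/q))%nat at 2 by lia. rewrite seq_app, Rsum_app.
      match goal with |- Rabs (?u-(?u + ?w)) <= _ => replace (u-(u+w)) with (- w) by ring end. rewrite Rabs_Ropp.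
      unfold Rdiv. apply (Rsum_abel chi (fun n => / INR n)); go. }
    rewrite Rabs_mult.
    have Hc1 : Rabs (chi q/INR q) <= / INR q.
    { unfold Rdiv. rewrite Rabs_mult, (Rabs_right (/ INR q)) by pos. rewrite <- (Rmult_1_l (/ INR q)) at 2. rmul; [auto]. }
    transitivity (/ INR q*(B * / INR (1+N/q))); [mono|]. replace (/ INR q*(B * / INR (1+N/q))) with (B * / (INR q*INR (1+N/q))) by fd.
    unfold Rdiv. rewrite Rmult_1_r. lmul. apply Rinv_le_contravar; [lra|]. pose proof (INR_div_bounds N q ltac:(lia)) as [D _]. rewrite plus_INR. simpl (INR 1).
    apply (Rmult_le_compat_l (INR q)) in D; [|lra]. replace (INR q*(INR N/INR q-1)) with (INR N-INR q) in D by fd. lra.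
  - rewrite Nat.div_small by lia. unfold S at 1. simpl (Rsum (seq 1 0) _). go. }
have H3 : B/INR N*psi N <= 4*B.
{ pose proof (psi_le N). replace (4*B) with (B/INR N*(4*INR N)) by fd. mono. }
have H4 : Rabs (S N*LS N (wupto N chi)) <= 5*B+1.
{ set (T := LS N (fun q => Rsum (seq 1 N) (fun n => if dvdb q n then chi n/INR n else 0))) in *.
  set (V := LS N (wupto N chi)) in *. apply Rabs_le_between in H1. apply Rabs_le_between in H2. go. }
rewrite Rabs_mult, (Rabs_right (S N)) in H4 by lra. apply Rmult_le_reg_r with c; [exact Hc|]. unfold Rdiv. rewrite Rmult_assoc, Rinv_l, Rmult_1_r by lra. nra.
Qed.

(** Values at the residues 0 to 11. The units modulo 12 have exponent 2, so all characters are real,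
    and each [sign_pattern] is one of the three nontrivial ones. *)
Definition chi12 (s5 s7 s11 : Z) (n : nat) : R :=
  IZR (nth (n mod 12) [0; 1; 0; 0; 0; s5; 0; s7; 0; 0; 0; s11]%Z 0%Z).

Definition sign_pattern (s5 s7 s11 : Z) : Prop :=
  (s5, s7, s11) = (1, -1, -1)%Z \/ (s5, s7, s11) = (-1, 1, -1)%Z \/ (s5, s7, s11) = (-1, -1, 1)%Z.

Lemma chi12_mult s5 s7 s11 m n : sign_pattern s5 s7 s11 ->
  chi12 s5 s7 s11 (m*n) = chi12 s5 s7 s11 m*chi12 s5 s7 s11 n.
Proof.
intros H. unfold chi12. rewrite <- mult_IZR. f_equal. rewrite Nat.Div0.mul_mod.
have Hm := Nat.mod_upper_bound m 12 ltac:(lia). have Hn := Nat.mod_upper_bound n 12 ltac:(lia).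
set (a := (m mod 12)%nat) in *. set (b := (n mod 12)%nat) in *. clearbody a b. destruct H as [E|[E|E]]; injection E as -> -> ->;
  do 12 (destruct a as [|a]; [do 12 (destruct b as [|b]; [auto|]); lia|]); lia.
Qed.

Lemma chi12_abs s5 s7 s11 n : sign_pattern s5 s7 s11 -> Rabs (chi12 s5 s7 s11 n) <= 1.
Proof.
intros H. unfold chi12. have Hn := Nat.mod_upper_bound n 12 ltac:(lia). set (a := (n mod 12)%nat) in *. clearbody a. destruct H as [E|[E|E]]; injection E as -> -> ->;
  do 12 (destruct a as [|a]; [simpl; apply Rabs_le; lra|]); lia.
Qed.

Lemma chi12_period s5 s7 s11 n : chi12 s5 s7 s11 (n+12) = chi12 s5 s7 s11 n.
Proof. unfold chi12. replace (n+12)%nat with (n+1*12)%nat by lia. rewrite Nat.Div0.mod_add. lra. Qed.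

Lemma chi12_sum s5 s7 s11 a m : sign_pattern s5 s7 s11 -> Rabs (Rsum (seq a m) (chi12 s5 s7 s11)) <= 12.
Proof.
intros H. have Z : forall a, Rsum (seq a 12) (chi12 s5 s7 s11) = 0.
{ intros b. induction b as [|b IH].
  - destruct H as [E|[E|E]]; injection E as -> -> ->; unfold chi12; simpl; ring.
  - rewrite Rsum_seq_S. replace (S b+11)%nat with (b+12)%nat by lia. rewrite chi12_period.
    change (chi12 s5 s7 s11 b+Rsum (seq (S b) 11) (chi12 s5 s7 s11) = 0) in IH. lra. }
revert a. induction m as [m IH] using lt_wf_ind. intros a. destruct (le_lt_dec 12 m) as [Hm|Hm].
- replace m with (12+(m-12))%nat by lia. rewrite seq_app, Rsum_app, Z, Rplus_0_l. apply IH. lia.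
- via Rsum_abs. etransitivity; [apply Rsum_le; intros; apply chi12_abs, H|]. rewrite Rsum_const, length_seq. inr.
Qed.

(** Every block of 12 consecutive terms is nonnegative, by monotonicity or, for the pattern
    [1 - - 1], convexity of the inverse; the first block alone exceeds 1/2. *)
Lemma chi12_L s5 s7 s11 M : sign_pattern s5 s7 s11 -> (1 <= M)%nat ->
  1/2 <= Rsum (seq 1 (12*M)) (fun n => chi12 s5 s7 s11 n/INR n).
Proof.
intros H HM. have Bl : forall k, Rsum (seq (1+12*k) 12) (fun n => chi12 s5 s7 s11 n/INR n) =
   1/(INR (12*k)+1)+IZR s5/(INR (12*k)+5)+IZR s7/(INR (12*k)+7)+IZR s11/(INR (12*k)+11).
{ intros k. rewrite (Rsum_seq_shift 1 (12*k)). rewrite (Rsum_ext _ _ (fun i => chi12 s5 s7 s11 i/(INR (12*k)+INR i))).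
  - pose proof (pos_INR (12*k)). set (x := INR (12*k)) in *. clearbody x. unfold chi12. simpl. fd.
  - intros i _. rewrite plus_INR, (Rplus_comm (INR i)). f_equal. unfold chi12. rewrite (Nat.mul_comm 12), Nat.Div0.mod_add. lra. }
have Inv : forall x, 0 <= x -> / (x+11) <= / (x+7) <= / (x+5) /\ / (x+5) <= / (x+1).
{ go. }
induction M as [|M IH]; [lia|]. replace (12*S M)%nat with (12*M+12)%nat by lia. rewrite seq_app, Rsum_app, Bl. have Hx : 0 <= INR (12*M) by apply pos_INR.
destruct (Nat.eq_dec M 0) as [->|H0].
- simpl (12*0)%nat. simpl (Rsum (seq 1 0) _). simpl (INR 0). destruct H as [E|[E|E]]; injection E as -> -> ->; lra.
- specialize (IH ltac:(lia)). set (x := INR (12*M)) in *. clearbody x.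
  have Hc : / (x+5) + / (x+7) <= / (x+1) + / (x+11).
  { replace (/ (x+5) + / (x+7)) with ((2*x+12) * / ((x+5)*(x+7))) by fd. replace (/ (x+1) + / (x+11)) with ((2*x+12) * / ((x+1)*(x+11))) by fd. mono. }
  specialize (Inv x Hx). unfold Rdiv. destruct H as [E|[E|E]]; injection E as -> -> ->; lra.
Qed.

Lemma geom_sum (x : R) N : 2 <= x -> Rsum (seq 1 N) (fun k => / x^k) <= / (x-1).
Proof.
intros Hx. have E : Rsum (seq 1 N) (fun k => / x^k) = / (x-1) - / (x-1) * / x^N.
{ induction N as [|N IH]; [simpl; field; lra|]. rewrite Rsum_seq_S, IH. change (1+N)%nat with (S N).
simpl. fd. }
rewrite E. assert (0 < / (x-1)) by pos. assert (0 < / x^N) by pos. nra.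
Qed.

Lemma ln_over_square N : Rsum (seq 2 N) (fun n => ln (INR n)/INR n^2) <= 6.
Proof.
(* A telescoping majorant, whose value at 1 is the constant 6. *)
set (h := fun n => 2*(ln (INR n)+3)/INR n).
have Hh : forall n, (1 <= n)%nat -> 0 <= h n.
{ intros n Hn. apply (le_INR 1) in Hn. simpl in Hn. assert (0 <= ln (INR n)) by (rewrite <- ln_1; apply ln_le; lra). apply Rdiv_le_0_compat; lra. }
have H : Rsum (seq 2 N) (fun n => ln (INR n)/INR n^2) <= h 1%nat-h (1+N)%nat.
{ induction N as [|N IH]; [simpl; lra|]. rewrite Rsum_seq_S. change (2+N)%nat with (S (1+N)). replace (1+S N)%nat with (S (1+N)) by lia.
  assert (Hs : ln (INR (S (1+N)))/INR (S (1+N))^2 <= h (1+N)%nat-h (S (1+N))); [|lra].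
  set (m := (1+N)%nat). have Hm : 1 <= INR m by (apply (le_INR 1); unfold m; lia). unfold h. rewrite S_INR. clearbody m. set (x := INR m) in *. clearbody x.
  have L : ln (x+1) <= ln x + / x.
  { assert (0 < / x) by pos. have L := ln_le_sub1 (1 + / x) ltac:(lra). replace (x+1) with (x*(1 + / x)) by fd. rewrite ln_mult by lra. lra. }
  have L0 : 0 <= ln (x+1) by (rewrite <- ln_1; apply ln_le; lra). set (l := ln (x+1)) in *. transitivity (2*(l - / x+3)/x-2*(l+3)/(x+1)).
  - replace (2*(l - / x+3)/x-2*(l+3)/(x+1)) with
      (l/(x+1)^2+(l*(x*(x+2))+(6*x*(x+1)-2*(x+1)*(x+1)))/(x^2*(x+1)^2)) by fd.
    assert (0 <= (l*(x*(x+2))+(6*x*(x+1)-2*(x+1)*(x+1)))/(x^2*(x+1)^2)); [|lra]. apply Rdiv_le_0_compat; [|pos]. nra.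
  - apply Rplus_le_compat_r. mono. }
assert (h 1%nat = 6) by (unfold h; simpl; rewrite ln_1; field). specialize (Hh (1+N)%nat ltac:(lia)). lra.
Qed.

Definition good_sum (N : nat) : R := Rsum (seq 1 N) (fun p => if ind (good p) then ln (INR p)/INR p else 0).

Lemma coprime_mod12 q : (1 <= q)%nat -> rp 2 q -> rp 3 q ->
  (q mod 12 = 1 \/ q mod 12 = 5 \/ q mod 12 = 7 \/ q mod 12 = 11)%nat.
Proof.
intros Hq H2 H3. have E := Nat.div_mod_eq q 12. have Hr := Nat.mod_upper_bound q 12 ltac:(lia).
set (r := (q mod 12)%nat) in *. clearbody r. set (d := (q/12)%nat) in *. clearbody d.
have N2 : forall c, (r <> 2*c)%nat.
{ intros c Ec. have H : Nat.divide 2 1 by (apply (rp_gauss 2 q); [exact H2|exists (6*d+c)%nat; lia]). apply Nat.divide_1_r in H. lia. }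
have N3 : forall c, (r <> 3*c)%nat.
{ intros c Ec. have H : Nat.divide 3 1 by (apply (rp_gauss 3 q); [exact H3|exists (4*d+c)%nat; lia]). apply Nat.divide_1_r in H. lia. }
pose proof (N2 0%nat). pose proof (N2 1%nat). pose proof (N2 2%nat). pose proof (N2 3%nat). pose proof (N2 4%nat). pose proof (N2 5%nat).
pose proof (N3 1%nat). pose proof (N3 3%nat). lia.
Qed.

Lemma LS_single N r : nprime r -> LS N (fun q => if dvdb r q then / INR q else 0) <= ln (INR r) * / (INR r-1).
Proof.
intros Hr. have Hr2 := nprime_ge2 r Hr. have H2 : 2 <= INR r by inr. have L0 : 0 <= ln (INR r) by (rewrite <- ln_1; apply ln_le; lra).
have C0 : 0 <= ln (INR r) * / (INR r-1) by pos. transitivity (Rsum (seq 1 N) (fun p => if (p =? r)%nat then ln (INR r) * / (INR r-1) else 0)).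
- apply Rsum_le. intros p _. destruct (ind (nprime p)) eqn:E; [apply (proj1 (ind_true _)) in E|]. 2:{ destruct (p =? r)%nat; lra. }
  destruct (Nat.eqb_spec p r) as [->|Hne].
  + lmul. etransitivity; [|apply (geom_sum (INR r) N H2)]. apply Rsum_le. intros k _. rewrite pow_INR. assert (0 < / INR r^k) by pos. destruct (dvdb r (r^k)); lra.
  + rewrite Rsum_zero; [lra|]. intros k _. destruct (dvdb r (p^k)) eqn:D; [exfalso|lra]. apply dvdb_iff in D; [|lia]. replace (p^k)%nat with (p^k*1)%nat in D by lia.
    apply rp_gauss in D; [apply Nat.divide_1_r in D; lia|]. apply rp_pow_r, primes_rp; auto.
- destruct (le_lt_dec r N).
  + rewrite Rsum_indicator; [lra|apply seq_NoDup|sq].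
  + rewrite Rsum_zero; [exact C0|]. intros p Hp%in_seq. destruct (Nat.eqb_spec p r); [lia|lra].
Qed.

Definition one_mod12 (q : nat) : R := if (q mod 12 =? 1)%nat then 1 else 0.

Lemma nprime_2 : nprime 2. Proof. exact prime_2. Qed.

Lemma nprime_3 : nprime 3. Proof. exact prime_3. Qed.

(** Orthogonality: for [q] prime to 12, [4 one_mod12 q] is the sum of the four characters. The
    powers of 2 and 3 left over contribute a bounded amount. *)
Lemma LS_one_mod12 M : (1 <= M)%nat ->
  Rabs (4*LS (12*M) (wupto (12*M) one_mod12)-ln (INR (12*M))) <= 400.
Proof.
intros HM. set (N := (12*M)%nat). set (ca := chi12 1 (-1) (-1)). set (cb := chi12 (-1) 1 (-1)). set (cc := chi12 (-1) (-1) 1).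
have HC : forall a b c, sign_pattern a b c -> Rabs (LS N (wupto N (chi12 a b c))) <= 122.
{ intros a b c H. replace 122 with ((5*12+1)/(1/2)) by field.
  apply char_mertens; [intros; apply chi12_mult, H|intros; apply chi12_abs, H|intros; apply chi12_sum, H|lra|lia|]. apply chi12_L; assumption. }
have Ha := HC 1%Z (-1)%Z (-1)%Z ltac:(left; easy). have Hb := HC (-1)%Z 1%Z (-1)%Z ltac:(right; left; easy).
have Hc := HC (-1)%Z (-1)%Z 1%Z ltac:(right; right; easy). fold ca in Ha. fold cb in Hb. fold cc in Hc. have H1 := mertens N ltac:(unfold N; lia).
have H2 : Rabs (LS N (fun q => 4*wupto N one_mod12 q+(-1*wupto N (fun _ => 1) q+(-1*wupto N ca q+(-1*wupto N cb q + -1*wupto N cc q)))))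
   <= LS N (fun q => (if dvdb 2 q then / INR q else 0)+(if dvdb 3 q then / INR q else 0)).
{ apply LS_abs. intros p k Hp Hk. have Hp2 := nprime_ge2 p Hp. pose proof (pow_gt p k Hp2). set (q := (p^k)%nat) in *. have Hq0 : 0 < / INR q by pos.
  have Hdv : 0 <= (if dvdb 2 q then / INR q else 0) /\ 0 <= (if dvdb 3 q then / INR q else 0) by (split; destruct (dvdb _ q); lra).
  have Hcases : (dvdb 2 q = true \/ dvdb 3 q = true) \/ rp 2 q /\ rp 3 q.
  { destruct (Nat.eq_dec p 2) as [E|E]; [left; left|destruct (Nat.eq_dec p 3) as [E3|E3]; [left; right|right]].
    - apply dvdb_iff; [lia|]. unfold q. rewrite E. destruct k; [lia|]. rewrite Nat.pow_succ_r'. apply Nat.divide_factor_l.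
    - apply dvdb_iff; [lia|]. unfold q. rewrite E3. destruct k; [lia|]. rewrite Nat.pow_succ_r'. apply Nat.divide_factor_l.
    - split; apply rp_pow_r, primes_rp; auto using nprime_2, nprime_3. }
  have Hval : 4*one_mod12 q-1-ca q-cb q-cc q = 0 \/ ((dvdb 2 q = true \/ dvdb 3 q = true) /\ 4*one_mod12 q-1-ca q-cb q-cc q = -1).
  { unfold one_mod12, ca, cb, cc, chi12. destruct Hcases as [D|[D2 D3]].
    - right. split; [exact D|]. assert (D' : (q mod 2 = 0 \/ q mod 3 = 0)%nat) by (unfold dvdb in D; rewrite !Nat.eqb_eq in D; exact D).
      have E := Nat.div_mod_eq q 12. have Hr := Nat.mod_upper_bound q 12 ltac:(lia). set (r := (q mod 12)%nat) in *.
      assert (D'' : (r mod 2 = 0 \/ r mod 3 = 0)%nat).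
      { rewrite E in D'. destruct D' as [D'|D']; [left|right].
        - replace (12*(q/12)+r)%nat with (r+(6*(q/12))*2)%nat in D' by lia. rewrite Nat.Div0.mod_add in D'. exact D'.
        - replace (12*(q/12)+r)%nat with (r+(4*(q/12))*3)%nat in D' by lia. rewrite Nat.Div0.mod_add in D'. exact D'. }
      clearbody r. clear-D'' Hr. do 12 (destruct r as [|r]; [simpl in *; first [lra | destruct D''; discriminate]|]); lia.
    - left. destruct (coprime_mod12 q ltac:(lia) D2 D3) as [->|[->|[->| ->]]]; simpl; lra. }
  unfold wupto. replace (4*(upto N q*(one_mod12 q/INR q))+(-1*(upto N q*(1/INR q))+(-1*(upto N q*(ca q/INR q)) +
    (-1*(upto N q*(cb q/INR q)) + -1*(upto N q*(cc q/INR q)))))) with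
    (upto N q*((4*one_mod12 q-1-ca q-cb q-cc q) * / INR q)) by lra.
  have Hu : 0 <= upto N q <= 1 by (destruct (upto_cases N q) as [[_ ->]|[_ ->]]; lra). destruct Hval as [->|[D ->]]; apply Rabs_le.
  - lra.
  - assert (/ INR q <= (if dvdb 2 q then / INR q else 0)+(if dvdb 3 q then / INR q else 0)).
    { destruct Hdv. destruct D as [D|D]; rewrite D in *; lra. }
    nra. }
rewrite !LS_plus, !LS_scal in H2. have S2 := LS_single N 2 nprime_2. have S3 := LS_single N 3 nprime_3.
have L2 := ln_le_sub1 2 ltac:(lra). have L3 := ln_le_sub1 3 ltac:(lra). replace (INR 2) with 2 in S2 by auto. replace (INR 3) with 3 in S3 by inr.
replace (/ (2-1)) with 1 in S2 by field. replace (/ (3-1)) with (1/2) in S3 by field.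
apply Rabs_le_between in H1. apply Rabs_le_between in H2. apply Rabs_le_between in Ha. apply Rabs_le_between in Hb. apply Rabs_le_between in Hc. go.
Qed.

(** The powers [p^k] with [k >= 2] contribute at most [2 ln p / p^2] for each [p], hence 12 in all
    by [ln_over_square]. *)
Lemma good_sum_LS N : good_sum N <= LS N (wupto N one_mod12) <= good_sum N+12.
Proof.
have T : forall p, In p (seq 1 N) -> let t := (if ind (good p) then ln (INR p)/INR p else 0) in
  let u := (if ind (nprime p) then ln (INR p)*Rsum (seq 1 N) (fun k => wupto N one_mod12 (p^k)) else 0) in
  t <= u <= t+(if (2 <=? p)%nat then 2*(ln (INR p)/INR p^2) else 0).
{ intros p Hp t u. apply in_seq in Hp. unfold t, u. destruct (ind (nprime p)) eqn:E.
  - apply (proj1 (ind_true _)) in E. have Hp2 := nprime_ge2 p E. destruct (Nat.leb_spec 2 p); [|lia]. have H2 : 2 <= INR p by inr.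
    have L0 : 0 <= ln (INR p) by (rewrite <- ln_1; apply ln_le; lra).
    have Hw : forall k, 0 <= wupto N one_mod12 (p^k) <= / INR p^k.
    { intros k. unfold wupto, one_mod12. rewrite pow_INR. assert (0 < / INR p^k) by pos.
      destruct (upto_cases N (p^k)) as [[_ ->]|[_ ->]]; destruct (_ =? 1)%nat; unfold Rdiv; lra. }
    have Hs : Rsum (seq 1 N) (fun k => wupto N one_mod12 (p^k)) = one_mod12 p/INR p+Rsum (seq 2 (N-1)) (fun k => wupto N one_mod12 (p^k)).
    { replace N with (S (N-1)) at 1 by lia. change (seq 1 (S (N-1))) with (1%nat :: seq 2 (N-1)). simpl (Rsum (_ :: _) _).
      f_equal. unfold wupto. replace (p*1)%nat with p by lia. destruct (upto_cases N p) as [[_ ->]|[H' _]]; [ring|lia]. }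
    rewrite Hs. set (V := Rsum (seq 2 (N-1)) _).
    have HV : 0 <= V <= 2/INR p^2.
    { split; [apply Rsum_nonneg; intros; apply Hw|]. unfold V. rewrite (Rsum_seq_shift 1 1). transitivity (Rsum (seq 1 (N-1)) (fun k => / INR p * / INR p^k)).
      - apply Rsum_le. intros k _. via Hw. rewrite pow_add, pow_1, Rinv_mult. lra.
      - rewrite Rsum_scal. transitivity (/ INR p * / (INR p-1)).
        + lmul. apply geom_sum, H2.
        + rewrite <- Rinv_mult. apply Rmult_le_reg_r with (INR p^2*(INR p*(INR p-1))); [nra|].
          replace (/ (INR p*(INR p-1))*(INR p^2*(INR p*(INR p-1)))) with (INR p^2) by fd.
          replace (2/INR p^2*(INR p^2*(INR p*(INR p-1)))) with (2*(INR p*(INR p-1))) by fd. nra. }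
    have Ht : (if ind (good p) then ln (INR p)/INR p else 0) = ln (INR p)*(one_mod12 p/INR p).
    { unfold one_mod12. destruct (ind (good p)) eqn:G; destruct (Nat.eqb_spec (p mod 12) 1) as [M|M].
      - lra.
      - apply (proj1 (ind_true _)) in G. destruct G. lia.
      - assert (ind (good p) = true) by (apply ind_true; split; assumption). congruence.
      - lra. }
    nra.
  - destruct (ind (good p)) eqn:G.
    + apply (proj1 (ind_true _)) in G. assert (ind (nprime p) = true) by (apply ind_true, G). congruence.
    + destruct (Nat.leb_spec 2 p); [|lra]. apply (le_INR 2) in H. simpl in H.
      assert (0 <= ln (INR p)/INR p^2); [|lra]. apply Rdiv_le_0_compat; [rewrite <- ln_1; apply ln_le; lra|pos]. }
split; [apply Rsum_le; intros p Hp; apply T, Hp|]. etransitivity; [apply Rsum_le; intros p Hp; apply T, Hp|]. rewrite Rsum_plus. apply Rplus_le_compat_l.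
destruct N as [|N]; [simpl; lra|]. change (seq 1 (S N)) with (1%nat :: seq 2 N). cbn [Rsum]. change (2 <=? 1)%nat with false. cbn iota.
rewrite (Rsum_ext (seq 2 N) _ (fun p => 2*(ln (INR p)/INR p^2))).
- rewrite Rsum_scal. pose proof (ln_over_square N). lra.
- intros p Hp%in_seq. destruct (Nat.leb_spec 2 p); [lra|lia].
Qed.

Lemma good_sum_asymp M : (1 <= M)%nat -> Rabs (4*good_sum (12*M)-ln (INR (12*M))) <= 448.
Proof.
intros HM. have H := LS_one_mod12 M HM. have G := good_sum_LS (12*M). apply Rabs_le_between in H. go.
Qed.

(** If every dyadic block between [X^t1] and [X^t2] held at most [Z^(1-dl)] good primes, each would
    contribute a negative power of [X] times a logarithm to the sum of [ln p / p], and all of them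
    at most 1; by [good_sum_asymp] this sum grows like [(t2-t1) ln X / 4]. *)
Theorem prime_supply_holds : prime_supply.
Proof.
(* In the last threshold [112*2] is the error of [good_sum_asymp], 448/4, at the two ends, and
   [ln 4/4] comes from rounding the ends to multiples of 12. *)
intros t1 t2 dl Ht Hdl. have Hl2 := ln_lt_2. set (K := 4*t2+3). apply (ev_imp (fun X => (1 <= X /\ 24 <= Rpower X t1) /\ K*(2+t2)*(1+ln X)^2 <= Rpower X (t1*dl) /\
   exp (4*(1+112*2+ln 4/4+1)/(t2-t1)) <= X /\ 24 <= Rpower X t2)).
{ apply ev_and; [apply ev_and; [apply ev_ge|apply ev_power; lra]|]. apply ev_and; [|apply ev_and; [apply ev_ge|apply ev_power; lra]]. apply ev_log_power. pos. }
intros X ((HX & HX1) & Hlog & Hbig & HX2). apply NNPP. intros Hno. set (a := Rpower X t1) in *. set (b := Rpower X t2) in *. have Hab : a <= b by (apply Rp_le; lra).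
have Hlx : 0 <= ln X by (rewrite <- ln_1; apply ln_le; lra). have Hla : ln a = t1*ln X by apply Rp_ln. have Hlb : ln b = t2*ln X by apply Rp_ln.
have Hfew : forall (Z : R) P, a <= Z <= b -> NoDup P -> (forall p, In p P -> good p /\ Z <= INR p < 2*Z) -> num P <= Rpower Z (1-dl).
{ intros Z P H1 H2 H3. apply Rnot_lt_le. intros H. apply Hno. exists Z, P. go. }
destruct (nat_ceil (a/12)) as (M1 & HM1 & HM1'); [lra|]. destruct (nat_ceil (b/12-1)) as (M2 & HM2 & HM2'); [lra|]. have HN1 : a <= INR (12*M1) <= 2*a by inr.
have HN2 : b/2 <= INR (12*M2) <= b by inr. set (N1 := (12*M1)%nat) in *. set (N2 := (12*M2)%nat) in *. set (g := fun p => ln (INR p)/INR p).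
have Hg : forall p, (1 <= p)%nat -> 0 <= g p.
{ intros p Hp. apply (le_INR 1) in Hp. simpl in Hp. apply Rdiv_le_0_compat; [rewrite <- ln_1; apply ln_le; lra|lra]. }
set (F := fun lo hi => Rsum (seq 1 N2) (fun p => if ind (good p /\ lo <= INR p < hi) then g p else 0)). set (eta := Rpower X (- (t1*dl))*(2+t2*ln X)).
have Heta : 0 <= eta by (apply Rmult_le_pos; [pos|nra]).
have Hstep : forall Z, a <= Z -> F Z (2*Z) <= eta.
{ intros Z HZ. destruct (Rle_dec Z b) as [Hb|Hb].
  -
    set (P := filter (fun p => ind (good p /\ Z <= INR p < 2*Z)) (seq 1 N2)).
    have HP : num P <= Rpower Z (1-dl).
    { apply Hfew; [lra|apply NoDup_filter, seq_NoDup|]. intros p Hp%filter_In. apply (proj1 (ind_true _)), Hp. }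
    unfold F. rewrite <- Rsum_filter. fold P. transitivity (Rsum P (fun _ => (2+t2*ln X)/Z)).
    + apply Rsum_le. intros p [_ Hp]%filter_In. apply (proj1 (ind_true _)) in Hp. destruct Hp as [_ Hp].
      assert (ln (INR p) <= 2+t2*ln X).
      { transitivity (ln (2*Z)); [apply ln_le; lra|]. rewrite ln_mult by lra. pose proof (ln_le_sub1 2 ltac:(lra)). assert (ln Z <= ln b) by (apply ln_le; lra). lra. }
      unfold g, Rdiv. apply Rmult_le_compat; try assumption.
      * rewrite <- ln_1. apply ln_le; lra.
      * pos.
      * mono.
    + rewrite Rsum_const. fold (num P). transitivity (Rpower Z (1-dl)*((2+t2*ln X)/Z)); [mono|]. replace (Rpower Z (1-dl)) with (Z*Rpower Z (- dl)).
      2:{ rewrite <- (Rpower_1 Z) at 1 by lra. rewrite <- Rpower_plus. auto. }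
      replace (Z*Rpower Z (- dl)*((2+t2*ln X)/Z)) with (Rpower Z (- dl)*(2+t2*ln X)) by fd.
      apply Rmult_le_compat_r; [nra|]. rewrite !Rpower_Ropp. apply Rinv_le_contravar; [pos|]. rewrite <- Rpower_mult. fold a. apply Rp_base; lra.
  - unfold F. rewrite Rsum_zero; [exact Heta|]. intros p Hp%in_seq. destruct (ind _) eqn:E; [exfalso|lra]. apply (proj1 (ind_true _)) in E. destruct E as [_ E].
    assert (INR p <= INR N2) by mono. lra. }
have Hi : forall i, F a (2^i*a) <= INR i*eta.
{ induction i as [|i IH].
  - unfold F. simpl. rewrite Rsum_zero; [lra|]. intros p _. destruct (ind _) eqn:E; [exfalso|lra]. apply (proj1 (ind_true _)) in E. lra.
  - set (Z := 2^i*a) in *. replace (2^S i*a) with (2*Z) by (unfold Z; simpl; ring). have HZ : a <= Z by (unfold Z; assert (1 <= 2^i) by (apply pow_R1_Rle; lra); nra).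
    have E : F a (2*Z) = F a Z+F Z (2*Z).
    { unfold F. rewrite <- Rsum_plus. apply Rsum_ext. intros p _.
      destruct (ind (good p /\ a <= INR p < 2*Z)) eqn:E1, (ind (good p /\ a <= INR p < Z)) eqn:E2, (ind (good p /\ Z <= INR p < 2*Z)) eqn:E3;
        try apply (proj1 (ind_true _)) in E1; try apply (proj1 (ind_true _)) in E2; try apply (proj1 (ind_true _)) in E3; try ring; exfalso.
      - lra.
      - destruct E1 as [G E1]. destruct (Rlt_dec (INR p) Z) as [C|C].
        + assert (ind (good p /\ a <= INR p < Z) = true) by (apply ind_true; split; [exact G|lra]). congruence.
        + assert (ind (good p /\ Z <= INR p < 2*Z) = true) by (apply ind_true; split; [exact G|lra]). congruence.
      - lra.
      - assert (ind (good p /\ a <= INR p < 2*Z) = true) by (apply ind_true; split; [apply E2|lra]). congruence.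
      - assert (ind (good p /\ a <= INR p < 2*Z) = true) by (apply ind_true; split; [apply E3|lra]). congruence. }
    rewrite E, S_INR. specialize (Hstep Z HZ). lra. }
destruct (nat_ceil (2*(t2*ln X))) as (i & Hi1 & Hi2); [nra|].
have H2i : b <= 2^i.
{ rewrite <- (exp_ln b) by lra. rewrite <- (exp_ln (2^i)) by pos. apply exp_mono. rewrite Rpower.ln_pow by lra. rewrite Hlb.
  assert (INR i*(1/2) <= INR i*ln 2) by mono. lra. }
have Hlow : good_sum N2-good_sum N1 <= F a (2^i*a+1).
{ destruct (le_lt_dec N1 N2) as [HN|HN].
  - unfold good_sum. replace N2 with (N1+(N2-N1))%nat at 1 by lia. rewrite seq_app, Rsum_app.
    unfold F. replace N2 with (N1+(N2-N1))%nat at 2 by lia. rewrite seq_app, Rsum_app.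
    assert (0 <= Rsum (seq 1 N1) (fun p => if ind (good p /\ a <= INR p < 2^i*a+1) then g p else 0)).
    { apply Rsum_nonneg. intros p Hp%in_seq. destruct (ind _); [apply Hg; lia|lra]. }
    assert (Rsum (seq (1+N1) (N2-N1)) (fun p => if ind (good p) then ln (INR p)/INR p else 0) <=
      Rsum (seq (1+N1) (N2-N1)) (fun p => if ind (good p /\ a <= INR p < 2^i*a+1) then g p else 0)); [|lra].
    apply Rsum_le. intros p Hp%in_seq. destruct (ind (good p)) eqn:G.
    + apply (proj1 (ind_true _)) in G. assert (INR N1 <= INR p <= INR N2) by go. assert (E : ind (good p /\ a <= INR p < 2^i*a+1) = true); [|rewrite E; unfold g; lra].
      apply ind_true. split; [exact G|]. split; [lra|]. nra.
    + destruct (ind (good p /\ a <= INR p < 2^i*a+1)); [apply Hg; lia|lra].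
  - apply Rle_trans with 0.
    + assert (good_sum N2 <= good_sum N1); [|lra]. unfold good_sum. replace N1 with (N2+(N1-N2))%nat by lia. rewrite seq_app, Rsum_app.
      assert (0 <= Rsum (seq (1+N2) (N1-N2)) (fun p => if ind (good p) then ln (INR p)/INR p else 0)); [|lra].
      apply Rsum_nonneg. intros p Hp%in_seq. destruct (ind _); [apply (Hg p); lia|lra].
    + apply Rsum_nonneg. intros p Hp%in_seq. destruct (ind _); [apply Hg; lia|lra]. }
have HF : F a (2^i*a+1) <= F a (2^S i*a).
{ apply Rsum_le. intros p Hp%in_seq. destruct (ind (good p /\ a <= INR p < 2^i*a+1)) eqn:E.
  - apply (proj1 (ind_true _)) in E. assert (E' : ind (good p /\ a <= INR p < 2^S i*a) = true); [|rewrite E'; lra]. apply ind_true. split; [apply E|]. simpl. lra.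
  - destruct (ind (good p /\ a <= INR p < 2^S i*a)); [apply Hg; lia|lra]. }
have HiS := Hi (S i). rewrite S_INR in HiS. have M1p : (1 <= M1)%nat by (apply INR_le; simpl; lra). have M2p : (1 <= M2)%nat by (apply INR_le; simpl; lra).
have A1 := good_sum_asymp M1 M1p. have A2 := good_sum_asymp M2 M2p. fold N1 in A1. fold N2 in A2. apply Rabs_le_between in A1. apply Rabs_le_between in A2.
have B1 : ln (INR N1) <= ln 2+ln a by (rewrite <- ln_mult by lra; apply ln_le; lra). have B2 : ln b-ln 2 <= ln (INR N2) by (rewrite <- ln_div by lra; apply ln_le; lra).
have Hsmall : (INR i+1)*eta <= 1.
{ transitivity (K*(1+ln X)*eta).
  - rmul. unfold K. nra.
  - unfold eta. transitivity (Rpower X (- (t1*dl))*Rpower X (t1*dl)); [|right; apply Rp_inv].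
    replace (K*(1+ln X)*(Rpower X (- (t1*dl))*(2+t2*ln X))) with (Rpower X (- (t1*dl))*(K*(1+ln X)*(2+t2*ln X))) by ring. lmul.
    etransitivity; [|exact Hlog]. replace (K*(2+t2)*(1+ln X)^2) with (K*(1+ln X)*((2+t2)*(1+ln X))) by ring.
    apply Rmult_le_compat_l; [apply Rmult_le_pos; unfold K; lra|]. nra. }
have B3 : 4*(1+112*2+ln 4/4+1) <= (t2-t1)*ln X.
{ have H : 4*(1+112*2+ln 4/4+1)/(t2-t1) <= ln X by (rewrite <- (ln_exp (4*(1+112*2+ln 4/4+1)/(t2-t1))); apply ln_le; [pos|exact Hbig]).
  apply (Rmult_le_compat_r (t2-t1)) in H; [|lra]. unfold Rdiv in H at 1. rewrite Rmult_assoc, Rinv_l in H by lra. lra. }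
assert (ln 4 = 2*ln 2) by (replace 4 with (2*2) by ring; rewrite ln_mult by lra; ring). lra.
Qed.

(** * Sums of two squares by counting fixed points of involutions *)

Lemma NoDup_product {A B} (l : list A) (l' : list B) : NoDup l -> NoDup l' -> NoDup (list_prod l l').
Proof.
intros H H'. induction H as [|x l Hx Hl IH]; simpl; [constructor|]. apply NoDup_app; [|exact IH|].
- apply FinFun.Injective_map_NoDup; go.
- intros [u v] H1 H2. apply in_map_iff in H1. destruct H1 as (w & E & _). injection E as <- <-. apply in_prod_iff in H2. tauto.
Qed.

Lemma involution_parity {A} (dec : forall x y : A, {x = y} + {x <> y}) (f : A -> A) (l : list A) : NoDup l ->
  (forall x, In x l -> In (f x) l /\ f (f x) = x) ->
  Nat.Even (length l+length (filter (fun x => if dec (f x) x then true else false) l)).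
Proof.
remember (length l) as n eqn:Hn. revert l Hn. induction n as [n IH] using lt_wf_ind. intros l Hn Hd Hf.
destruct l as [|x l]; [subst; exists 0%nat; easy|]. inversion Hd as [|? ? Hx Hd']; subst. cbn [filter length].
destruct (Hf x (or_introl eq_refl)) as [Hfx Hffx]. destruct (dec (f x) x) as [E|E].
- destruct (IH (length l) ltac:(simpl; lia) l eq_refl Hd') as [m Hm]; [|exists (S m); cbn [length]; lia].
  intros y Hy. destruct (Hf y (or_intror Hy)) as [H1 H2]. split; [|exact H2]. destruct H1 as [H1|H1]; go.
- destruct Hfx as [Hfx|Hfx]; [congruence|]. destruct (in_split (f x) l Hfx) as (l1 & l2 & El). subst l.
  have Hd2 : NoDup (l1 ++ l2) by (apply NoDup_remove_1 in Hd'; exact Hd'). have Hn2 : ~ In (f x) (l1 ++ l2) by (apply NoDup_remove_2 in Hd'; exact Hd').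
  have Hx2 : ~ In x (l1 ++ l2).
  { intros H. apply Hx. apply in_app_iff in H. apply in_app_iff. simpl. tauto. }
  destruct (IH (length (l1 ++ l2)) ltac:(simpl; rewrite !length_app; simpl; lia) (l1 ++ l2) eq_refl Hd2) as [m Hm].
  + intros y Hy. assert (Hy' : In y (x :: l1 ++ f x :: l2)).
    { right. apply in_app_iff in Hy. apply in_app_iff. simpl. tauto. }
    destruct (Hf y Hy') as [H1 H2]. split; [|exact H2]. destruct H1 as [H1|H1].
    * congruence.
    * apply in_app_iff in H1. apply in_app_iff. destruct H1 as [H1|[H1|H1]]; [tauto| |tauto]. congruence.
  + exists (S m). rewrite !filter_app, !length_app in *. simpl. destruct (dec (f (f x)) (f x)) as [E2|_]; go.
Qed.

Definition triple_dec : forall x y : Z*Z*Z, {x = y} + {x <> y}.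
Proof. repeat decide equality. Defined.

Definition zagier (t : Z*Z*Z) : Z*Z*Z :=
  let '(x, y, z) := t in
  if (x <? y-z)%Z then (x+2*z, z, y-x-z)%Z
  else if (x <? 2*y)%Z then (2*y-x, y, x-y+z)%Z else (x-2*y, x-y+z, y)%Z.

(* Zagier's proof: [zagier] has the single fixed point [(1, 1, (p-1)/4)], so the involution exchanging the last two coordinates has one as well. *)
Theorem prime_sum_of_two_squares p : good p -> sum_of_two_squares p.
Proof.
intros [Hp Hm]. set (n := Z.of_nat p) in *.
have Hm4 : (p mod 4 = 1)%nat.
{ rewrite (Nat.div_mod_eq p 12), Hm. replace (12*(p/12)+1)%nat with (1+(3*(p/12))*4)%nat by lia. rewrite Nat.Div0.mod_add. auto. }
set (k := Z.of_nat (p/4)). have Hk : (n = 4*k+1)%Z by (pose proof (Nat.div_mod_eq p 4); lia). have Hn2 : (2 <= n)%Z by (apply prime_ge_2, Hp).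
have Hpr : forall u v, (0 < u)%Z -> (n = u*v)%Z -> (u = 1 \/ u = n)%Z.
{ intros u v Hu E. destruct (prime_divisors n Hp u) as [H|[H|[H|H]]]; [exists v; lia|lia|lia|lia|lia]. }
set (r := map Z.of_nat (seq 1 p)).
have Hr : forall z, In z r <-> (1 <= z <= n)%Z.
{ intros z. unfold r. rewrite in_map_iff. split.
  - intros (i & <- & Hi). sq.
  - intros H. exists (Z.to_nat z); go. }
set (inS := fun t : Z*Z*Z => let '(x, y, z) := t in (x*x+4*y*z =? n)%Z). set (S := filter inS (list_prod (list_prod r r) r)).
have HS : forall x y z, In (x, y, z) S <-> (0 < x /\ 0 < y /\ 0 < z /\ x*x+4*y*z = n)%Z.
{ intros x y z. unfold S. rewrite filter_In, !in_prod_iff, !Hr. unfold inS. nia. }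
have Hnd : NoDup S.
{ apply NoDup_filter. assert (NoDup r) by (apply FinFun.Injective_map_NoDup; [intros u v; lia|apply seq_NoDup]).
  apply NoDup_product; [apply NoDup_product|]; assumption. }
have HZ : forall t, In t S -> In (zagier t) S /\ zagier (zagier t) = t.
{ intros [[x y] z] H. apply HS in H. destruct H as (H1 & H2 & H3 & H4).
  (* On the two boundary lines of the case distinction [p] would be the square of [y+z], or even. *)
  have B1 : (x <> y-z)%Z.
  { intros E. destruct (Hpr (y+z)%Z (y+z)%Z) as [H|H]; go. }
  have B2 : (x <> 2*y)%Z by lia. unfold zagier at 1 3. destruct (Z.ltb_spec x (y-z)) as [C1|C1]; [|destruct (Z.ltb_spec x (2*y)) as [C2|C2]].
  - split; [apply HS; repeat split; try lia|]. unfold zagier. destruct (Z.ltb_spec (x+2*z) (z-(y-x-z))); [lia|]. destruct (Z.ltb_spec (x+2*z) (2*z)); [lia|].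
    apply f_equal2; [alg|]; lia.
  - split; [apply HS; repeat split; try lia|]. unfold zagier. destruct (Z.ltb_spec (2*y-x) (y-(x-y+z))); [lia|]. destruct (Z.ltb_spec (2*y-x) (2*y)); [|lia].
    apply f_equal2; [alg|]; lia.
  - split; [apply HS; repeat split; try lia|]. unfold zagier. destruct (Z.ltb_spec (x-2*y) (x-y+z-y)); [|lia]. apply f_equal2; [alg|]; lia. }
have P1 := involution_parity triple_dec zagier S Hnd HZ.
have F1 : length (filter (fun t => if triple_dec (zagier t) t then true else false) S) = 1%nat.
{ have Perm : Permutation (filter (fun t => if triple_dec (zagier t) t then true else false) S) [(1, 1, k)%Z].
  { apply NoDup_Permutation; [apply NoDup_filter, Hnd|repeat constructor; simpl; tauto|]. intros [[x y] z]. rewrite filter_In. split.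
    - intros [H E]. apply HS in H. destruct H as (H1 & H2 & H3 & H4). destruct (triple_dec _ _) as [E'|]; [|lra].
      left. unfold zagier in E'. destruct (Z.ltb_spec x (y-z)) as [C1|C1]; [|destruct (Z.ltb_spec x (2*y)) as [C2|C2]]; injection E'; intros; try lia.
      assert (x = y) by lia. subst y. destruct (Hpr x (x+4*z)%Z H1) as [Ex|Ex]; [lia| |nia]. subst x. alg.
    - intros [E|[]]. injection E as <- <- <-. split; [apply HS; lia|]. destruct (triple_dec _ _) as [|C]; [lra|]. exfalso. apply C. unfold zagier.
      destruct (Z.ltb_spec 1 (1-k)); go. }
  rewrite (Permutation_length Perm). auto. }
set (sw := fun t : Z*Z*Z => let '(x, y, z) := t in (x, z, y)).
have Hsw : forall t, In t S -> In (sw t) S /\ sw (sw t) = t.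
{ intros [[x y] z] H. apply HS in H. split; [apply HS; lia|auto]. }
have P2 := involution_parity triple_dec sw S Hnd Hsw. rewrite F1 in P1.
destruct (filter (fun t => if triple_dec (sw t) t then true else false) S) as [|[[x y] z] l] eqn:F2.
{ exfalso. simpl in P2. destruct P1, P2. lia. }
have Hin : In (x, y, z) ((x, y, z) :: l) by (left; easy). rewrite <- F2 in Hin. apply filter_In in Hin.
destruct Hin as [Hin E]. apply HS in Hin. destruct Hin as (H1 & H2 & H3 & H4). destruct (triple_dec _ _) as [E'|]; [|lra]. injection E' as E1 _. subst z.
split; [lia|]. exists (Z.to_nat x), (Z.to_nat (2*y)). apply Nat2Z.inj. rewrite Nat2Z.inj_add, !Nat2Z.inj_pow, !Z2Nat.id by lia. lia.
Qed.

(** * Modular forms and their coefficients *)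

(** Convergence of [u 1 + u 2 + ...] to [l], stated with the finite sums over [seq] on which Hecke
    operators act by reindexing. *)
Definition hs (u : nat -> C) (l : C) : Prop :=
  forall eps, 0 < eps -> exists N, forall n, (N <= n)%nat -> Cmod (Csum (seq 1 n) u-l) <= eps.

Lemma Cmod_sub_triangle (a b c : C) : Cmod (a-c) <= Cmod (a-b)+Cmod (b-c).
Proof. replace (a-c)%C with ((a-b)+(b-c))%C by ring. apply Cmod_triangle. Qed.

Lemma Cmod_sub_sym (a b : C) : Cmod (a-b) = Cmod (b-a).
Proof. replace (a-b)%C with (- (b-a))%C by ring. apply Cmod_opp. Qed.

Lemma Cmod_small_eq (a b : C) : (forall eps, 0 < eps -> Cmod (a-b) <= eps) -> a = b.
Proof.
intros H. have E : Cmod (a-b) = 0.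
{ apply Rle_antisym; [|pos]. apply Rnot_lt_le. intros H0. specialize (H (Cmod (a-b)/2) ltac:(lra)). lra. }
apply Cmod_eq_0 in E. replace a with (a-b+b)%C by ring. rewrite E. ring.
Qed.

Lemma hs_unique u l l' : hs u l -> hs u l' -> l = l'.
Proof.
intros H H'. apply Cmod_small_eq. intros eps He. destruct (H (eps/2) ltac:(lra)) as [N HN]. destruct (H' (eps/2) ltac:(lra)) as [N' HN'].
specialize (HN (N+N')%nat ltac:(lia)). specialize (HN' (N+N')%nat ltac:(lia)).
etransitivity; [apply (Cmod_sub_triangle l (Csum (seq 1 (N+N')) u) l')|]. rewrite (Cmod_sub_sym l). lra.
Qed.

Lemma hs_ext u v l : (forall n, (1 <= n)%nat -> u n = v n) -> hs u l -> hs v l.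
Proof.
intros E H eps He. destruct (H eps He) as [N HN]. exists N. intros n Hn. rewrite (Csum_ext _ v u); [auto|]. intros i Hi%in_seq. symmetry. apply E. lia.
Qed.

Lemma hs_plus u v l m : hs u l -> hs v m -> hs (fun n => u n+v n)%C (l+m)%C.
Proof.
intros H H' eps He. destruct (H (eps/2) ltac:(lra)) as [N HN]. destruct (H' (eps/2) ltac:(lra)) as [N' HN']. exists (N+N')%nat. intros n Hn. rewrite Csum_plus.
replace (Csum (seq 1 n) u+Csum (seq 1 n) v-(l+m))%C with ((Csum (seq 1 n) u-l)+(Csum (seq 1 n) v-m))%C by ring.
via Cmod_triangle. specialize (HN n ltac:(lia)). specialize (HN' n ltac:(lia)). lra.
Qed.

Lemma hs_scal u l c : hs u l -> hs (fun n => c*u n)%C (c*l)%C.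
Proof.
intros H eps He. pose proof (Cmod_ge_0 c). destruct (H (eps/(Cmod c+1))) as [N HN]; [pos|].
exists N. intros n Hn. specialize (HN n Hn). rewrite Csum_scal. replace (c*Csum (seq 1 n) u-c*l)%C with (c*(Csum (seq 1 n) u-l))%C by ring.
rewrite Cmod_mult. transitivity ((Cmod c+1)*(eps/(Cmod c+1))); [|right; field; lra]. mono.
Qed.

Lemma hs_zero : hs (fun _ => RtoC 0) (RtoC 0).
Proof. intros eps He. exists 0%nat. intros n _. rewrite Csum_zero by easy. replace (0-0)%C with (RtoC 0) by ring. rewrite Cmod_0. lra. Qed.

Lemma hs_Csum {A} (s : list A) (u : A -> nat -> C) (l : A -> C) : (forall a, In a s -> hs (u a) (l a)) ->
  hs (fun n => Csum s (fun a => u a n)) (Csum s l).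
Proof.
induction s as [|a s IH]; intros H; simpl; [apply hs_zero|]. apply hs_plus; [apply H; left; easy|apply IH; intros b Hb; apply H; right; exact Hb].
Qed.

Lemma Rsum_geom (x : R) L n : 0 <= x < 1 -> Rsum (seq L n) (fun i => x^i) <= x^L/(1-x).
Proof.
intros Hx. have E : Rsum (seq L n) (fun i => x^i) = (x^L-x^(L+n))/(1-x).
{ induction n as [|n IH]; [simpl; rewrite Nat.add_0_r; unfold Rdiv; ring|]. rewrite Rsum_seq_S, IH, Nat.add_succ_r. simpl. fd. }
rewrite E. rmul. assert (0 <= x^(L+n)) by pos. lra.
Qed.

Lemma hs_le u l (b : R) : hs u l -> (forall n, Cmod (Csum (seq 1 n) u) <= b) -> Cmod l <= b.
Proof.
intros H Hb. apply Rnot_lt_le. intros Hl. destruct (H ((Cmod l-b)/2) ltac:(lra)) as [N HN]. specialize (HN N (le_n N)). specialize (Hb N). rewrite Cmod_sub_sym in HN.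
have T := Cmod_triangle (l-Csum (seq 1 N) u) (Csum (seq 1 N) u). replace (l-Csum (seq 1 N) u+Csum (seq 1 N) u)%C with l in T by ring. lra.
Qed.

(** [Series] is total, so this is the sum of the series only when convergence is known, as in
    [hs_CS]. *)
Definition CS (u : nat -> C) : C := (Series (fun n => Re (u (S n))), Series (fun n => Im (u (S n)))).

Lemma im_le_Cmod (c : C) : Rabs (Im c) <= Cmod c.
Proof. etransitivity; [|apply Rmax_Cmod]. apply Rmax_r. Qed.

Lemma Cmod_le_Re_Im (c : C) : Cmod c <= Rabs (Re c)+Rabs (Im c).
Proof. destruct c. apply Cmod_le_abs. Qed.

Lemma hs_CS u (K x : R) : 0 <= x < 1 -> (forall n, (1 <= n)%nat -> Cmod (u n) <= K*x^n) -> hs u (CS u).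
Proof.
intros Hx Hu.
have Hex : forall v : nat -> R, (forall n, Rabs (v n) <= Cmod (u (S n))) -> ex_series v.
{ intros v Hv. apply (ex_series_le v (fun n => K*x^S n)).
  - intros n. via Hv. apply Hu. lia.
  - apply (ex_series_ext (fun n => (K*x)*x^n)); [intros n; simpl; ring|]. apply (ex_series_scal (K*x) (fun n => x^n)). exists (/ (1-x)). apply is_series_geom. go. }
have Hre := Hex (fun n => Re (u (S n))) ltac:(intros n; apply re_le_Cmod). have Him := Hex (fun n => Im (u (S n))) ltac:(intros n; apply im_le_Cmod).
apply Series_correct in Hre. apply Series_correct in Him.
have Hc : forall v l, is_series v l -> forall eps, 0 < eps -> exists N, forall n, (N <= n)%nat -> Rabs (Rsum (seq 1 n) (fun i => v (pred i))-l) <= eps.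
{ intros v l Hv eps He. assert (Hv' : is_lim_seq (sum_n v) l) by exact Hv. clear Hv. rename Hv' into Hv.
  apply is_lim_seq_spec in Hv. specialize (Hv (mkposreal eps He)). destruct Hv as [N HN]. simpl in HN.
  exists (S N). intros n Hn. destruct n as [|n]; [lia|]. specialize (HN n ltac:(lia)).
  have E : Rsum (seq 1 (S n)) (fun i => v (pred i)) = sum_n v n.
  { clear. induction n as [|n IH]; [auto|]. rewrite Rsum_seq_S, IH, sum_Sn. auto. }
  rewrite E. lra. }
intros eps He. destruct (Hc _ _ Hre (eps/2) ltac:(lra)) as [N1 H1]. destruct (Hc _ _ Him (eps/2) ltac:(lra)) as [N2 H2].
exists (N1+N2)%nat. intros n Hn. specialize (H1 n ltac:(lia)). specialize (H2 n ltac:(lia)). via Cmod_le_Re_Im.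
have ER : Re (Csum (seq 1 n) u-CS u)%C = Rsum (seq 1 n) (fun i => Re (u (S (pred i))))-Series (fun n => Re (u (S n))).
{ change (Re (Csum (seq 1 n) u-CS u)%C) with (Re (Csum (seq 1 n) u)-Series (fun n => Re (u (S n)))). rewrite Re_Csum. f_equal.
  apply Rsum_ext. intros i Hi%in_seq. replace (S (pred i)) with i by lia. lra. }
have EI : Im (Csum (seq 1 n) u-CS u)%C = Rsum (seq 1 n) (fun i => Im (u (S (pred i))))-Series (fun n => Im (u (S n))).
{ change (Im (Csum (seq 1 n) u-CS u)%C) with (Im (Csum (seq 1 n) u)-Series (fun n => Im (u (S n)))). rewrite Im_Csum. f_equal.
  apply Rsum_ext. intros i Hi%in_seq. replace (S (pred i)) with i by lia. lra. }
rewrite ER, EI. lra.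
Qed.

Lemma qpar_eq z : qpar z = (RtoC (exp (- (2*PI*Im z)))*ce (2*PI*Re z))%C.
Proof.
unfold qpar, Cexp, ce. destruct z as [x y]. simpl. apply injective_projections; simpl.
- replace ((2*PI*0-0*1)*x-(2*PI*1+0*0)*y) with (- (2*PI*y)) by ring. replace ((2*PI*0-0*1)*y+(2*PI*1+0*0)*x) with (2*PI*x) by ring. ring.
- replace ((2*PI*0-0*1)*x-(2*PI*1+0*0)*y) with (- (2*PI*y)) by ring. replace ((2*PI*0-0*1)*y+(2*PI*1+0*0)*x) with (2*PI*x) by ring. ring.
Qed.

Definition qabs (z : C) : R := exp (- (2*PI*Im z)).

Lemma Cmod_qpar z : Cmod (qpar z) = qabs z.
Proof.
rewrite qpar_eq, Cmod_mult, Cmod_ce, Cmod_R, Rmult_1_r. apply Rabs_right. left. apply exp_pos.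
Qed.

Lemma Cmod_pow_nat (z : C) n : Cmod (z^n)%C = Cmod z^n.
Proof. induction n as [|n IH]; simpl; [apply Cmod_1|]. rewrite Cmod_mult, IH. lra. Qed.

(** Subexponential growth: the power series with coefficients [g] converges in the whole unit
    disc. *)
Definition sub (g : nat -> C) : Prop :=
  forall rho, 1 < rho -> exists K, 0 <= K /\ forall n, (1 <= n)%nat -> Cmod (g n) <= K*rho^n.

Definition qs (g : nat -> C) (z : C) : C := CS (fun n => g n*qpar z^n)%C.

Lemma sub_terms g y : sub g -> 0 < y -> exists K x, 0 <= K /\ 0 < x < 1 /\ forall z n, y <= Im z -> (1 <= n)%nat ->
  Cmod (g n*qpar z^n)%C <= K*x^n*exp (- (2*PI*(Im z-y))).
Proof.
intros Hg Hy. pose proof PI_RGT_0. set (r := exp (- (2*PI*y))). have Hr : 0 < r < 1 by (unfold r; split; [pos|rewrite <- exp_0; apply exp_increasing; nra]).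
(* Strictly between 1 and [1/r], so that [rho r < 1]. *)
set (rho := (1 + / r)/2). have Hri : 1 < / r by (rewrite <- Rinv_1; apply Rinv_lt_contravar; lra). have Hrr : / r*r = 1 by fd.
destruct (Hg rho) as (K & HK & Hb); [unfold rho; lra|]. exists K, (rho*r). split; [exact HK|]. split; [unfold rho; split; nra|].
intros z n Hz Hn. rewrite Cmod_mult, Cmod_pow_nat, Cmod_qpar. have E : qabs z = r*exp (- (2*PI*(Im z-y))) by (unfold qabs, r; rewrite <- exp_plus; f_equal; ring).
set (t := exp (- (2*PI*(Im z-y)))) in *. have Ht : 0 < t <= 1.
{ split; [apply exp_pos|]. rewrite <- exp_0. apply exp_mono. nra. }
rewrite E, !Rpow_mult_distr. have Htn : t^n <= t.
{ destruct n as [|n]; [lia|]. simpl. assert (t^n <= 1) by (rewrite <- (pow1 n); apply pow_incr; lra). nra. }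
transitivity ((K*rho^n)*(r^n*t)); [|lra]. apply Rmult_le_compat; [pos|pos|auto|mono].
Qed.

Lemma hs_qs g z : sub g -> 0 < Im z -> hs (fun n => g n*qpar z^n)%C (qs g z).
Proof.
intros Hg Hz. destruct (sub_terms g (Im z) Hg Hz) as (K & x & HK & Hx & H). apply (hs_CS _ K x); [lra|].
intros n Hn. specialize (H z n (Rle_refl _) Hn). replace (- (2*PI*(Im z-Im z))) with 0 in H by ring. rewrite exp_0 in H. lra.
Qed.

Lemma qs_decay g y : sub g -> 0 < y -> exists K, 0 <= K /\ forall z, y <= Im z -> Cmod (qs g z) <= K*exp (- (2*PI*(Im z-y))).
Proof.
intros Hg Hy. destruct (sub_terms g y Hg Hy) as (K & x & HK & Hx & H). exists (K*(x/(1-x))). split; [pos|].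
intros z Hz. apply (hs_le _ _ _ (hs_qs g z Hg ltac:(lra))). intros n. via Cmod_Csum. set (t := exp (- (2*PI*(Im z-y)))) in *. assert (0 < t) by apply exp_pos.
transitivity (Rsum (seq 1 n) (fun i => (K*t)*x^i)).
- apply Rsum_le. intros i Hi%in_seq. etransitivity; [apply H; [exact Hz|lia]|]. fold t. lra.
- rewrite Rsum_scal. replace (K*(x/(1-x))*t) with ((K*t)*(x/(1-x))) by ring. lmul. have G := Rsum_geom x 1 n ltac:(lra). rewrite pow_1 in G. exact G.
Qed.

Lemma qs_tail g y : sub g -> 0 < y -> exists K x, 0 <= K /\ 0 < x < 1 /\ forall z L, Im z = y ->
  Cmod (qs g z-Csum (seq 1 L) (fun n => g n*qpar z^n)%C) <= K*x^L.
Proof.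
intros Hg Hy. destruct (sub_terms g y Hg Hy) as (K & x & HK & Hx & H). exists (K*(x/(1-x))), x. split; [pos|]. split; [exact Hx|].
intros z L Hz. set (u := fun n => (g n*qpar z^n)%C). have Hh := hs_qs g z Hg ltac:(lra). fold u in Hh.
apply Rnot_lt_le. intros Hc. set (gap := Cmod (qs g z-Csum (seq 1 L) u)-K*(x/(1-x))*x^L) in *.
destruct (Hh (gap/2)) as [N HN]; [unfold gap; lra|]. specialize (HN (L+N)%nat ltac:(lia)). rewrite seq_app, Csum_app in HN.
have Ht : Cmod (Csum (seq (1+L) N) u) <= K*(x/(1-x))*x^L.
{ via Cmod_Csum. transitivity (Rsum (seq (1+L) N) (fun i => K*x^i)).
  - apply Rsum_le. intros i Hi%in_seq. specialize (H z i ltac:(lra) ltac:(lia)).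
    rewrite Hz in H. replace (- (2*PI*(y-y))) with 0 in H by ring. rewrite exp_0, Rmult_1_r in H. exact H.
  - rewrite Rsum_scal. have G := Rsum_geom x (1+L) N ltac:(lra). replace (K*(x/(1-x))*x^L) with (K*(x^(1+L)/(1-x))) by (simpl; field; lra). mono. }
have T := Cmod_sub_triangle (qs g z) (Csum (seq 1 L) u+Csum (seq (1+L) N) u)%C (Csum (seq 1 L) u).
rewrite (Cmod_sub_sym (qs g z) (Csum (seq 1 L) u+Csum (seq (1+L) N) u)%C) in T.
replace (Csum (seq 1 L) u+Csum (seq (1+L) N) u-Csum (seq 1 L) u)%C with (Csum (seq (1+L) N) u) in T by ring. unfold gap in *. lra.
Qed.

Lemma Cmult_integral (a b : C) : (a*b)%C = RtoC 0 -> a = RtoC 0 \/ b = RtoC 0.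
Proof.
intros E. apply (f_equal Cmod) in E. rewrite Cmod_mult, Cmod_0 in E. apply Rmult_integral in E. destruct E as [E|E]; [left|right]; apply Cmod_eq_0, E.
Qed.

Lemma root_sum (N a b : nat) : a <> b -> (a < b+N)%nat -> (b < a+N)%nat ->
  Csum (seq 0 N) (fun j => ce ((INR a-INR b)*(2*PI*INR j/INR N))) = RtoC 0.
Proof.
intros Hab H1 H2. have HN : 0 < INR N by pos. have HPI := PI_RGT_0. set (th := (INR a-INR b)*(2*PI/INR N)).
have E : forall n, ((1-ce th)*Csum (seq 0 n) (fun j => ce ((INR a-INR b)*(2*PI*INR j/INR N))) = 1-ce (INR n*th))%C.
{ induction n as [|n IH]; [simpl; rewrite Rmult_0_l, ce_0; ring|].
  rewrite Csum_seq_S, Cmult_plus_distr_l, IH, S_INR, Rmult_plus_distr_r, Rmult_1_l, ce_plus. simpl (0+n)%nat.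
  replace ((INR a-INR b)*(2*PI*INR n/INR N)) with (INR n*th) by (unfold th; field; lra). ring. }
specialize (E N). replace (INR N*th) with (2*PI*INR a-2*PI*INR b) in E by (unfold th; field; lra). rewrite ce_minus, !ce_2PI_nat in E.
have Hne : (1-ce th)%C <> RtoC 0.
{ intros Hz. have Hc := Cmod_1_ce th. rewrite Hz, Cmod_0 in Hc. replace th with (2*(th/2)) in Hc by field. rewrite cos_2a_sin in Hc.
  assert (Hs : sin (th/2) <> 0); [|nra]. apply lt_INR in H1. apply lt_INR in H2. rewrite plus_INR in H1, H2.
  have Eth : th/2*INR N = PI*(INR a-INR b) by (unfold th; field; lra). destruct (Rtotal_order (INR a) (INR b)) as [C|[C|C]].
  - assert (0 < - (th/2) < PI) by nra. rewrite <- (Ropp_involutive (th/2)), sin_neg. pose proof (sin_gt_0 (- (th/2))). lra.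
  - exfalso. apply Hab, INR_eq, C.
  - assert (0 < th/2 < PI) by nra. pose proof (sin_gt_0 (th/2)). lra. }
have E0 : ((1-ce th)*Csum (seq 0 N) (fun j => ce ((INR a-INR b)*(2*PI*INR j/INR N))) = 0)%C.
{ rewrite E. alg. }
apply Cmult_integral in E0. tauto.
Qed.

Lemma qpar_pow x y n : (qpar (x, y)^n)%C = (RtoC (exp (- (2*PI*INR n*y)))*ce (INR n*(2*PI*x)))%C.
Proof.
rewrite qpar_eq. change (Im (x, y)) with y. change (Re (x, y)) with x. rewrite Cpow_mult_l, ce_pow, <- RtoC_pow. f_equal. f_equal. rewrite <- Rpower_pow by apply exp_pos.
unfold Rpower. rewrite ln_exp. alg.
Qed.

(** Parseval's identity for trigonometric polynomials of degree below [N], on which the mean over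
    [N] equidistant points agrees with the integral over a period. *)
Lemma discrete_parseval (L N : nat) (c : nat -> C) : (L < N)%nat ->
  Rsum (seq 0 N) (fun j => Cmod (Csum (seq 1 L) (fun n => c n*ce (INR n*(2*PI*INR j/INR N)))%C)^2) =
  INR N*Rsum (seq 1 L) (fun n => Cmod (c n)^2).
Proof.
intros HLN. apply RtoC_inj. rewrite <- Csum_RtoC. rewrite (Csum_ext _ _ (fun j => Csum (seq 1 L) (fun n => Csum (seq 1 L) (fun m =>
  (c n*Cconj (c m))*ce ((INR n-INR m)*(2*PI*INR j/INR N)))%C))).
2:{ intros j _. rewrite Cmod_sq_double. apply Csum_ext; intros n _. apply Csum_ext; intros m _.
    rewrite Cmult_conj, Rmult_minus_distr_r, ce_minus. ring. }
rewrite Csum_swap. rewrite RtoC_mult, <- Csum_RtoC, <- Csum_scal. apply Csum_ext. intros n Hn%in_seq.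
rewrite Csum_swap. rewrite (Csum_ext _ _ (fun m => if (m =? n)%nat then RtoC (INR N)*RtoC (Cmod (c n)^2) else RtoC 0)%C).
- set (w := (RtoC (INR N)*RtoC (Cmod (c n)^2))%C). clearbody w. clear-Hn. destruct Hn as [H1 H2]. assert (In n (seq 1 L)) as Hi by sq. have Hd := seq_NoDup L 1.
  induction (seq 1 L) as [|x l IH]; [easy|]. inversion Hd as [|? ? Hx Hd']; subst. simpl. destruct (Nat.eqb_spec x n) as [->|Hne].
  + rewrite Csum_zero; [ring|]. intros y Hy. destruct (Nat.eqb_spec y n) as [->|]; [easy|auto].
  + destruct Hi as [Hi|Hi]; [lia|]. rewrite (IH Hi Hd'). ring.
- intros m Hm%in_seq. rewrite Csum_scal. destruct (Nat.eqb_spec m n) as [->|Hne].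
  + rewrite (Csum_ext _ _ (fun _ => RtoC 1)).
    * rewrite Csum_const, length_seq, <- Cmod2_conj, RtoC_pow. ring.
    * intros j _. replace (INR n-INR n) with 0 by ring. rewrite Rmult_0_l. apply ce_0.
  + rewrite root_sum by lia. ring.
Qed.

(** Bessel's inequality on a horizontal line: the series is cut where its tail is below [eps], and
    the discrete identity is applied to the polynomial that remains. *)
Lemma bessel g y M K : sub g -> 0 < y -> (forall x, Cmod (qs g (x, y)) <= M) ->
  Rsum (seq 1 K) (fun n => Cmod (g n)^2*exp (- (4*PI*INR n*y))) <= M^2.
Proof.
intros Hg Hy HM. have HM0 : 0 <= M by (etransitivity; [apply Cmod_ge_0|apply (HM 0)]). destruct (qs_tail g y Hg Hy) as (K0 & x & HK0 & Hx & Ht).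
set (S := Rsum (seq 1 K) _).
have H : forall eps, 0 < eps -> S <= (M+eps)^2.
{ intros eps He. destruct (pow_lt_1_zero x ltac:(rewrite Rabs_right; lra) (eps/(K0+1))) as [L0 HL0]; [pos|]. set (L := (L0+K)%nat). set (N := Datatypes.S L).
  have HxL : K0*x^L <= eps.
  { specialize (HL0 L ltac:(unfold L; lia)). rewrite Rabs_right in HL0 by pos. transitivity ((K0+1)*(eps/(K0+1))); [|right; field; lra]. mono. }
  set (c := fun n => (g n*RtoC (exp (- (2*PI*INR n*y))))%C). have HN : 0 < INR N by pos.
  have HP : forall j, Cmod (Csum (seq 1 L) (fun n => c n*ce (INR n*(2*PI*INR j/INR N)))%C)^2 <= (M+eps)^2.
  { intros j. apply pow_incr. split; [pos|]. set (z := (INR j/INR N, y) : C). specialize (Ht z L eq_refl). rewrite (Csum_ext _ _ (fun n => g n*qpar z^n)%C).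
    - rewrite Cmod_sub_sym in Ht. have T := Cmod_triangle (Csum (seq 1 L) (fun n => g n*qpar z^n)%C-qs g z) (qs g z).
      replace (Csum (seq 1 L) (fun n => g n*qpar z^n)%C-qs g z+qs g z)%C with (Csum (seq 1 L) (fun n => g n*qpar z^n)%C) in T by ring.
      specialize (HM (INR j/INR N)). fold z in HM. lra.
    - intros n _. unfold c, z. rewrite qpar_pow. replace (2*PI*(INR j/INR N)) with (2*PI*INR j/INR N) by lra. ring. }
  have P := discrete_parseval L N c ltac:(unfold N; lia).
  have Hsum : INR N*Rsum (seq 1 L) (fun n => Cmod (c n)^2) <= INR N*(M+eps)^2.
  { rewrite <- P. etransitivity; [apply Rsum_le; intros j _; apply HP|]. rewrite Rsum_const, length_seq. lra. }
  apply Rmult_le_reg_l in Hsum; [|exact HN]. etransitivity; [|exact Hsum]. unfold S, L. rewrite Nat.add_comm, seq_app, Rsum_app.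
  assert (0 <= Rsum (seq (1+K) L0) (fun n => Cmod (c n)^2)) by pos.
  assert (Rsum (seq 1 K) (fun n => Cmod (g n)^2*exp (- (4*PI*INR n*y))) = Rsum (seq 1 K) (fun n => Cmod (c n)^2)); [|lra].
  apply Rsum_ext. intros n _. unfold c. rewrite Cmod_mult, Cmod_R, Rabs_right by pos. rewrite Rpow_mult_distr. f_equal. simpl. rewrite Rmult_1_r, <- exp_plus. alg. }
apply Rnot_lt_le. intros Hc. set (gap := S-M^2) in *. set (eps := Rmin 1 (gap/(2*(2*M+1)))). assert (0 < gap) by (unfold gap; lra).
have He : 0 < eps by (apply Rmin_pos; [lra|pos]). have He1 : eps <= 1 by apply Rmin_l.
have He2 : eps*(2*(2*M+1)) <= gap.
{ have E : eps <= gap/(2*(2*M+1)) by apply Rmin_r. apply (Rmult_le_compat_r (2*(2*M+1))) in E; [|lra]. unfold Rdiv in E. rewrite Rmult_assoc, Rinv_l in E by lra. lra. }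
specialize (H eps He). unfold gap in *. nra.
Qed.

(** * Invariance under the modular group, and the vanishing of forms of weight at most 0 *)

Definition uhp (z : C) : Prop := 0 < Im z.

Lemma Im_inv_neg (z : C) : Im (- / z)%C = Im z/(Re z^2+Im z^2).
Proof. destruct z as [x y]. simpl. lra. Qed.

Lemma H_neq0 z : uhp z -> z <> RtoC 0.
Proof. intros Hz E. rewrite E in Hz. unfold uhp in Hz. simpl in Hz. lra. Qed.

Lemma H_norm_pos z : uhp z -> 0 < Re z^2+Im z^2.
Proof. go. Qed.

Lemma H_inv_neg z : uhp z -> uhp (- / z)%C.
Proof. intros Hz. unfold uhp. rewrite Im_inv_neg. pos. Qed.

(** The half plane [Im z >= 1/2] contains a fundamental domain, so it suffices to climb into it by
    translations and inversions. *)
Lemma reduction (Phi : C -> R) (b : R) :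
  (forall z, uhp z -> Phi (z+1)%C = Phi z) -> (forall z, uhp z -> Phi (- / z)%C = Phi z) ->
  (forall z, 1/2 <= Im z -> Phi z <= b) -> forall z, uhp z -> Phi z <= b.
Proof.
intros HT HS Hb.
have HTn : forall n z, uhp z -> Phi (z+RtoC (INR n))%C = Phi z.
{ induction n as [|n IH]; intros z Hz; [simpl; f_equal; ring|]. rewrite S_INR, RtoC_plus, Cplus_assoc, HT, IH; [lra|exact Hz|].
  unfold uhp in *. destruct z as [zx zy]. simpl in *. lra. }
have HTz : forall (t : Z) z, uhp z -> Phi (z+RtoC (IZR t))%C = Phi z.
{ intros t z Hz. destruct (Z_le_gt_dec 0 t) as [Ht|Ht].
  - replace (IZR t) with (INR (Z.to_nat t)) by (rewrite INR_IZR_INZ, Z2Nat.id by lia; easy). auto.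
  - rewrite <- (HTn (Z.to_nat (- t)) (z+RtoC (IZR t))%C).
    + f_equal. rewrite INR_IZR_INZ, Z2Nat.id, opp_IZR, RtoC_opp by lia. ring.
    + unfold uhp in *. destruct z as [zx zy]. simpl in *. lra. }
have Hn : forall n z, uhp z -> 1/2 <= Im z*2^n -> Phi z <= b.
{ induction n as [|n IH]; intros z Hz Hi; [apply Hb; simpl in Hi; lra|]. destruct (Rle_dec (1/2) (Im z)) as [C|C]; [auto|].
  destruct (archimed (Re z-1/2)) as [A1 A2]. set (t := up (Re z-1/2)) in *. rewrite <- (HTz (- t)%Z z Hz). set (z' := (z+RtoC (IZR (- t)))%C).
  have R1 : Re z' = Re z-IZR t by (change (Re z') with (Re z+IZR (- t)); rewrite opp_IZR; ring). have I1 : Im z' = Im z by apply Rplus_0_r.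
  assert (Hz' : uhp z') by (unfold uhp; rewrite I1; exact Hz). rewrite <- HS by exact Hz'. apply IH; [apply H_inv_neg, Hz'|]. rewrite Im_inv_neg.
  (* The translate has real part at most 1/2 in modulus, and [Im z < 1/2]; inversion thus at least
     doubles the imaginary part. *)
  have D : Re z'^2+Im z'^2 <= 1/2.
  { unfold uhp in Hz. nra. }
  have D0 := H_norm_pos z' Hz'. rewrite I1 in *. set (D1 := Re z'^2+Im z^2) in *. assert (2 <= / D1) by (rewrite <- (Rinv_inv 2); apply Rinv_le_contravar; lra).
  via Hi. simpl. unfold uhp in Hz. unfold Rdiv. replace (Im z*(2*2^n)) with (Im z*2^n*2) by ring. replace (Im z * / D1*2^n) with (Im z*2^n * / D1) by ring. mono. }
intros z Hz. destruct (Pow_x_infinity 2 ltac:(rewrite Rabs_right; lra) (1/Im z)) as [n Hn0].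
apply (Hn n z Hz). specialize (Hn0 n (le_n n)). rewrite Rabs_right in Hn0 by pos. unfold uhp in Hz. apply Rge_le in Hn0. apply (Rmult_le_compat_l (Im z)) in Hn0; [|lra].
replace (Im z*(1/Im z)) with 1 in Hn0 by fd. lra.
Qed.

Lemma qpar_plus_1 z : qpar (z+1)%C = qpar z.
Proof.
rewrite !qpar_eq. replace (Im (z+1)%C) with (Im z) by (symmetry; apply Rplus_0_r). f_equal.
change (Re (z+1)%C) with (Re z+INR 1). rewrite Rmult_plus_distr_l. rewrite ce_plus, ce_2PI_nat. ring.
Qed.

Lemma qs_plus_1 g z : qs g (z+1)%C = qs g z.
Proof. unfold qs. rewrite qpar_plus_1. auto. Qed.

Lemma nonneg_small (a b : R) (w : nat) (c : R) : (1 <= w)%nat -> 0 <= b -> 0 <= c -> (forall y, 0 < y <= 1 -> a*exp (- (c*y)) <= b*y^w) -> a <= 0.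
Proof.
intros Hw Hb Hc Hy. apply Rnot_lt_le. intros Ha. set (y := Rmin 1 (a*exp (- c)/(2*(b+1)))). have Y : 0 < y <= 1 by (split; [apply Rmin_pos; [lra|pos]|apply Rmin_l]).
have Y2 : y*(2*(b+1)) <= a*exp (- c).
{ have E : y <= a*exp (- c)/(2*(b+1)) by apply Rmin_r. apply (Rmult_le_compat_r (2*(b+1))) in E; [|lra]. unfold Rdiv in E. rewrite Rmult_assoc, Rinv_l in E by lra. lra. }
specialize (Hy y Y). have Yw : y^w <= y by (destruct w as [|w]; [lia|]; simpl; assert (y^w <= 1) by (rewrite <- (pow1 w); apply pow_incr; lra); nra).
assert (exp (- c) <= exp (- (c*y))) by (apply exp_mono; nra). nra.
Qed.

(** The hypothesis is modularity of weight [-w]. The quotient [|qs g z|^2 / (Im z)^w] is invariant,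
    hence bounded, and for [w > 0] the function tends to 0 as [Im z] does, taking every coefficient
    with it by Bessel's inequality. *)
Lemma cusp_vanish g (w : nat) : sub g -> (forall z, uhp z -> (qs g (- / z)*z^w)%C = qs g z) ->
  forall n, (1 <= n)%nat -> g n = RtoC 0.
Proof.
intros Hg HS n Hn. have HPI := PI_RGT_0. destruct (qs_decay g (1/2) Hg ltac:(lra)) as (K & HK & Hdec).
have Hin : forall z, uhp z -> Cmod (qs g (- / z)%C)^2/Im (- / z)%C^w = Cmod (qs g z)^2/Im z^w.
{ intros z Hz. rewrite <- (HS z Hz), Im_inv_neg, Cmod_mult, Cmod_pow_nat, Rpow_mult_distr.
  have Hp := H_norm_pos z Hz. unfold uhp in Hz. rewrite <- pow_mult, Nat.mul_comm, pow_mult, (Cmod2_alt z). unfold Rdiv. rewrite Rpow_mult_distr, pow_inv. fd. }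
have Hb : forall z, uhp z -> Cmod (qs g z)^2/Im z^w <= K^2*2^w.
{ apply (reduction (fun z => Cmod (qs g z)^2/Im z^w)).
  - intros z Hz. rewrite qs_plus_1. replace (Im (z+1)%C) with (Im z) by (symmetry; apply Rplus_0_r). lra.
  - exact Hin.
  - intros z Hz. apply Rmult_le_compat; [pos|pos| |].
    + apply pow_incr. split; [pos|]. etransitivity; [apply Hdec, Hz|]. rewrite <- (Rmult_1_r K) at 2.
      lmul. transitivity (exp 0); [apply exp_mono; nra|rewrite exp_0; lra].
    + replace (2^w) with (/ (1/2)^w) by (rewrite <- pow_inv; f_equal; field). mono. }
have Hc : forall (M : R) y m, 0 <= M -> 0 < y -> (1 <= m)%nat -> (forall z, Im z = y -> Cmod (qs g z) <= M) -> Cmod (g m)^2*exp (- (4*PI*INR m*y)) <= M^2.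
{ intros M y m HM Hy Hm Hz. etransitivity; [|apply (bessel g y M m Hg Hy); intros x; apply Hz; easy].
  apply (Rsum_In_le (seq 1 m) (fun n => Cmod (g n)^2*exp (- (4*PI*INR n*y)))); go. }
have Hpos : forall m, 0 <= 4*PI*INR m by go. destruct (Nat.eq_dec w 0) as [->|Hw].
(* In weight 0 the bound does not improve near the real axis. Instead a bound [M] for the function
   bounds the coefficients by [M], hence the series for [Im z >= 1/2] by [M/3], as
   [exp (- PI) <= 1/4]; iteration gives 0. *)
- have Hhalf : forall M, 0 <= M -> (forall z, uhp z -> Cmod (qs g z) <= M) -> forall z, uhp z -> Cmod (qs g z) <= M/2.
  { intros M HM HMz.
    have Hgm : forall m, (1 <= m)%nat -> Cmod (g m) <= M.
    { intros m Hm. apply Rnot_lt_le. intros Hlt. assert (A0 : Cmod (g m)^2-M^2 <= 0); [|nra].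
      set (cc := 4*PI*INR m). apply (nonneg_small _ (Cmod (g m)^2*cc) 1 0); [lia|apply Rmult_le_pos; [pos|eauto]|lra|].
      intros y Hy. rewrite Rmult_0_l, Ropp_0, exp_0, pow_1, Rmult_1_r. specialize (Hc M y m HM ltac:(lra) Hm ltac:(intros z Hz; apply HMz; unfold uhp; lra)).
      have E := exp_ineq1_le (- (cc*y)). replace (4*PI*INR m*y) with (cc*y) in Hc by easy. nra. }
    apply (reduction (fun z => Cmod (qs g z))); [intros; rewrite qs_plus_1; easy| |].
    - intros z Hz. rewrite <- (HS z Hz). alg.
    - intros z Hz. apply (hs_le _ _ _ (hs_qs g z Hg ltac:(lra))). intros m. via Cmod_Csum. transitivity (Rsum (seq 1 m) (fun i => M*(1/4)^i)).
      + apply Rsum_le. intros i Hi%in_seq. rewrite Cmod_mult, Cmod_pow_nat, Cmod_qpar. apply Rmult_le_compat; [pos|apply pow_le; left; apply exp_pos|apply Hgm; lia|].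
        apply pow_incr. split; [left; apply exp_pos|]. unfold qabs. rewrite exp_Ropp.
        replace (1/4) with (/ 4) by field. apply Rinv_le_contravar; [lra|]. pose proof (exp_ineq1_le (2*PI*Im z)). pose proof PI2_3_2. nra.
      + rewrite Rsum_scal. have G := Rsum_geom (1/4) 1 m ltac:(lra). rewrite pow_1 in G. transitivity (M*(1/4/(1-1/4))); go. }
  have Hb0 : forall z, uhp z -> Cmod (qs g z) <= K.
  { intros z Hz. specialize (Hb z Hz). simpl in Hb. nra. }
  have Hit : forall i z, uhp z -> Cmod (qs g z) <= K/2^i.
  { induction i as [|i IH]; [simpl; unfold Rdiv; rewrite Rinv_1, Rmult_1_r; exact Hb0|].
    replace (K/2^S i) with (K/2^i/2) by (simpl; field; apply pow_nonzero; lra). apply Hhalf; [|exact IH]. pos. }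
  have Hz0 : forall z, uhp z -> Cmod (qs g z) <= 0.
  { intros z Hz. apply Rnot_lt_le. intros Hl. destruct (Pow_x_infinity 2 ltac:(rewrite Rabs_right; lra) ((K+1)/Cmod (qs g z))) as [i Hi].
    specialize (Hi i (le_n i)). rewrite Rabs_right in Hi by pos. specialize (Hit i z Hz). have H2 : 0 < 2^i by pos. apply Rge_le in Hi.
    apply (Rmult_le_compat_r (2^i)) in Hit; [|lra]. unfold Rdiv in Hit. rewrite Rmult_assoc, Rinv_l in Hit by lra.
    apply (Rmult_le_compat_r (Cmod (qs g z))) in Hi; [|lra]. unfold Rdiv in Hi. rewrite Rmult_assoc, Rinv_l in Hi by lra. lra. }
  specialize (Hc 0 1 n (Rle_refl _) ltac:(lra) Hn ltac:(intros z Hz; apply Hz0; unfold uhp; lra)).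
apply Cmod_eq_0.
  destruct (Rle_lt_or_eq_dec 0 (Cmod (g n)) (Cmod_ge_0 _)) as [Hp|Hp]; [exfalso|lra]. assert (0 < Cmod (g n)^2*exp (- (4*PI*INR n*1))) by pos. lra.
- have A0 : Cmod (g n)^2 <= 0.
  { apply (nonneg_small _ (K^2*2^w) w (4*PI*INR n)); [lia| |auto|].
    - pos.
    - intros y Hy. have Hyw : 0 < y^w by pos. set (B := K^2*2^w*y^w). have HB : 0 <= B by (apply Rmult_le_pos; [pos|lra]).
      rewrite <- (pow2_sqrt B HB). apply Hc; [pos|lra|exact Hn|]. intros z Hz. specialize (Hb z ltac:(unfold uhp; lra)). rewrite Hz in Hb.
      apply (Rmult_le_compat_r (y^w)) in Hb; [|lra]. unfold Rdiv in Hb. rewrite Rmult_assoc, Rinv_l in Hb by lra.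
      rewrite <- (sqrt_pow2 (Cmod (qs g z))) by apply Cmod_ge_0. apply sqrt_le_1_alt. unfold B. lra. }
  apply Cmod_eq_0. nra.
Qed.

Lemma hs_bounded u l : hs u l -> exists K, 0 <= K /\ forall n, (1 <= n)%nat -> Cmod (u n) <= K.
Proof.
intros Hu. destruct (Hu 1 ltac:(lra)) as [N HN]. have H0 : 0 <= Rsum (seq 1 (S N)) (fun i => Cmod (u i)) by pos.
exists (2+Rsum (seq 1 (S N)) (fun i => Cmod (u i))). split; [lra|]. intros n Hn. destruct (le_lt_dec n (S N)) as [C|C].
- assert (Cmod (u n) <= Rsum (seq 1 (S N)) (fun i => Cmod (u i))); [|lra]. apply (Rsum_In_le (seq 1 (S N)) (fun i => Cmod (u i))); [go|sq].
- destruct n as [|n]; [lia|]. have B1 := HN (S n) ltac:(lia). have B2 := HN n ltac:(lia). rewrite Csum_seq_S in B1. change (1+n)%nat with (S n) in B1.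
  have T := Cmod_sub_triangle (Csum (seq 1 n) u+u (S n)) l (Csum (seq 1 n) u). replace (Csum (seq 1 n) u+u (S n)-Csum (seq 1 n) u)%C with (u (S n)) in T by ring.
  rewrite (Cmod_sub_sym l) in T. lra.
Qed.

Lemma sub_of_hs g : (forall z, uhp z -> exists l, hs (fun n => g n*qpar z^n)%C l) -> sub g.
Proof.
intros Hg rho Hr. pose proof PI_RGT_0. have Hl : 0 < ln rho by (rewrite <- ln_1; apply ln_increasing; lra). set (z := (0, ln rho/(2*PI)) : C).
have Hz : uhp z by (unfold uhp, z; simpl; apply Rdiv_lt_0_compat; lra).
destruct (Hg z Hz) as [l Hh]. destruct (hs_bounded _ _ Hh) as (K & HK & Hb). exists K. split; [exact HK|].
intros n Hn. specialize (Hb n Hn). rewrite Cmod_mult, Cmod_pow_nat, Cmod_qpar in Hb.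
have Eq : qabs z = / rho.
{ unfold qabs, z. simpl. replace (2*PI*(ln rho/(2*PI))) with (ln rho) by fd. rewrite exp_Ropp, exp_ln by lra. lra. }
rewrite Eq in Hb. apply (Rmult_le_compat_r (rho^n)) in Hb; [|pos]. rewrite Rmult_assoc, <- Rpow_mult_distr, Rinv_l, pow1, Rmult_1_r in Hb by lra. exact Hb.
Qed.

Lemma qcoeff_unique g g' : (forall z, uhp z -> exists l, hs (fun n => g n*qpar z^n)%C l /\ hs (fun n => g' n*qpar z^n)%C l) ->
  forall n, (1 <= n)%nat -> g n = g' n.
Proof.
intros Hg n Hn. set (d := fun n => (g n + - (1)*g' n)%C).
have Hd : forall z, uhp z -> hs (fun n => d n*qpar z^n)%C (RtoC 0).
{ intros z Hz. destruct (Hg z Hz) as (l & H1 & H2). replace (RtoC 0) with (l + - (1)*l)%C by ring. apply (hs_ext (fun n => g n*qpar z^n + - (1)*(g' n*qpar z^n))%C).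
  - alg.
  - apply hs_plus; [exact H1|apply hs_scal; exact H2]. }
have Hs : sub d by (apply sub_of_hs; intros z Hz; exists (RtoC 0); apply Hd, Hz).
have Hq : forall z, uhp z -> qs d z = RtoC 0 by (intros z Hz; eapply hs_unique; [apply hs_qs; assumption|auto]). have B := bessel d 1 0 n Hs ltac:(lra).
have B0 : Rsum (seq 1 n) (fun n => Cmod (d n)^2*exp (- (4*PI*INR n*1))) <= 0^2.
{ apply B. intros x. rewrite Hq by (unfold uhp; simpl; lra). rewrite Cmod_0. lra. }
have B1 : Cmod (d n)^2*exp (- (4*PI*INR n*1)) <= 0^2.
{ etransitivity; [|exact B0]. apply (Rsum_In_le (seq 1 n) (fun n => Cmod (d n)^2*exp (- (4*PI*INR n*1)))); go. }
have E : d n = RtoC 0.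
{ apply Cmod_eq_0. destruct (Rle_lt_or_eq_dec 0 (Cmod (d n)) (Cmod_ge_0 _)) as [Hp|Hp]; [exfalso|lra]. assert (0 < Cmod (d n)^2*exp (- (4*PI*INR n*1))) by pos. lra. }
unfold d in E. replace (g n) with (g n + - (1)*g' n+g' n)%C by ring. rewrite E. ring.
Qed.

Lemma expansion_hs f a z : cuspidal_expansion f a -> uhp z -> hs (fun n => a n*qpar z^n)%C (f z).
Proof.
intros Hf Hz eps He. specialize (Hf z Hz). have Hl := proj1 (filterlim_locally _ _) Hf (mkposreal (eps/2) ltac:(lra)). destruct Hl as [N HN].
exists (S N). intros n Hn. destruct n as [|n]; [lia|]. specialize (HN n ltac:(lia)).
have E : Csum (seq 1 (S n)) (fun n => a n*qpar z^n)%C = @sum_n C_AbelianMonoid (fun n => a (S n)*qpar z^S n)%C n.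
{ clear. induction n as [|n IH]; [auto|]. rewrite Csum_seq_S, IH, sum_Sn. auto. }
rewrite E. destruct HN as [H1 H2]. via Cmod_le_Re_Im. change (Rabs (Re (@sum_n C_AbelianMonoid (fun n => a (S n)*qpar z^S n)%C n)-Re (f z)) < eps/2) in H1.
change (Rabs (Im (@sum_n C_AbelianMonoid (fun n => a (S n)*qpar z^S n)%C n)-Im (f z)) < eps/2) in H2.
change (Rabs (Re (@sum_n C_AbelianMonoid (fun n => a (S n)*qpar z^S n)%C n)-Re (f z)) +
  Rabs (Im (@sum_n C_AbelianMonoid (fun n => a (S n)*qpar z^S n)%C n)-Im (f z)) <= eps). lra.
Qed.

Lemma hs_spread (d e : nat) (c : nat -> C) (X : nat -> C) l : (1 <= e)%nat ->
  hs (fun m => c m*X (e*m)%nat)%C l -> hs (fun r => if dvdb e r then c (r/e)%nat*X r else RtoC 0)%C l.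
Proof.
intros He Hh eps Heps. destruct (Hh eps Heps) as [N HN]. exists (e*N)%nat. intros n Hn.
have E : Csum (seq 1 n) (fun r => if dvdb e r then (c (r/e)%nat*X r)%C else RtoC 0) = Csum (seq 1 (n/e)) (fun m => c m*X (e*m)%nat)%C.
{ apply injective_projections; change (@fst R R) with Re; change (@snd R R) with Im; rewrite ?Re_Csum, ?Im_Csum.
  - rewrite (Rsum_ext _ _ (fun r => if dvdb e r then Re (c (r/e)%nat*X r)%C else 0)) by (intros i _; destruct (dvdb e i); easy).
    rewrite (Rsum_dvdb n e (fun r => Re (c (r/e)%nat*X r)%C)) by exact He. apply Rsum_ext. intros m _. rewrite (Nat.mul_comm e), Nat.div_mul by lia. lra.
  - rewrite (Rsum_ext _ _ (fun r => if dvdb e r then Im (c (r/e)%nat*X r)%C else 0)) by (intros i _; destruct (dvdb e i); easy).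
    rewrite (Rsum_dvdb n e (fun r => Im (c (r/e)%nat*X r)%C)) by exact He. apply Rsum_ext. intros m _. rewrite (Nat.mul_comm e), Nat.div_mul by lia. lra. }
rewrite E. apply HN. apply Nat.div_le_lower_bound; lia.
Qed.

Lemma hs_gather (d : nat) (u : nat -> C) l : (1 <= d)%nat ->
  hs (fun m => if dvdb d m then u m else RtoC 0) l -> hs (fun m => u (d*m)%nat) l.
Proof.
intros Hd Hh eps Heps. destruct (Hh eps Heps) as [N HN]. exists N. intros n Hn. specialize (HN (d*n)%nat ltac:(nia)).
assert (E : Csum (seq 1 (d*n)) (fun m => if dvdb d m then u m else RtoC 0) = Csum (seq 1 n) (fun m => u (d*m)%nat)); [|congruence].
have Ed : (d*n/d = n)%nat by (rewrite Nat.mul_comm; apply Nat.div_mul; lia).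
apply injective_projections; change (@fst R R) with Re; change (@snd R R) with Im; rewrite ?Re_Csum, ?Im_Csum.
- rewrite (Rsum_ext _ _ (fun r => if dvdb d r then Re (u r) else 0)) by (intros i _; destruct (dvdb d i); easy).
  rewrite (Rsum_dvdb (d*n) d (fun r => Re (u r))) by exact Hd. congruence.
- rewrite (Rsum_ext _ _ (fun r => if dvdb d r then Im (u r) else 0)) by (intros i _; destruct (dvdb d i); easy).
  rewrite (Rsum_dvdb (d*n) d (fun r => Im (u r))) by exact Hd. congruence.
Qed.

Lemma root_sum_dvd (d m : nat) : (1 <= d)%nat ->
  Csum (seq 0 d) (fun b => ce (INR m*(2*PI*INR b/INR d))) = if dvdb d m then RtoC (INR d) else RtoC 0.
Proof.
intros Hd. have Hd0 : 0 < INR d by pos. rewrite (Csum_ext _ _ (fun b => ce ((INR (m mod d)-INR 0)*(2*PI*INR b/INR d)))).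
- unfold dvdb. destruct (Nat.eqb_spec (m mod d) 0) as [->|E].
  + rewrite (Csum_ext _ _ (fun _ => RtoC 1)); [rewrite Csum_const, length_seq; ring|]. intros b _. simpl (INR 0). rewrite Rminus_0_r, Rmult_0_l. apply ce_0.
  + pose proof (Nat.mod_upper_bound m d ltac:(lia)). apply root_sum; lia.
- intros b _. rewrite (Nat.div_mod_eq m d) at 1. rewrite plus_INR, mult_INR. simpl (INR 0). replace ((INR d*INR (m/d)+INR (m mod d))*(2*PI*INR b/INR d)) with
    (2*PI*INR (m/d*b)+(INR (m mod d)-0)*(2*PI*INR b/INR d)) by (rewrite mult_INR; field; lra).
  rewrite ce_plus, ce_2PI_nat. ring.
Qed.

Lemma qpar_affine (z : C) (e d b m : nat) : (1 <= d)%nat ->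
  (qpar ((RtoC (INR e)*z+RtoC (INR b))/RtoC (INR d))^m)%C =
  (qpar (RtoC (INR e/INR d)*z)^m*ce (INR m*(2*PI*INR b/INR d)))%C.
Proof.
intros Hd. have Hd0 : 0 < INR d by pos. destruct z as [x y].
replace ((RtoC (INR e)*(x, y)+RtoC (INR b))/RtoC (INR d))%C with ((INR e/INR d*x+INR b/INR d, INR e/INR d*y) : C).
- replace (RtoC (INR e/INR d)*(x, y))%C with ((INR e/INR d*x, INR e/INR d*y) : C) by alg. rewrite !qpar_pow. rewrite <- Cmult_assoc, <- ce_plus. apply f_equal2; go.
- alg.
Qed.

Lemma qpar_scale (z : C) (e d m : nat) : (1 <= d)%nat ->
  (qpar (RtoC (INR e/INR d)*z)^(d*m))%C = (qpar z^(e*m))%C.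
Proof.
intros Hd. have Hd0 : 0 < INR d by pos. destruct z as [x y]. replace (RtoC (INR e/INR d)*(x, y))%C with ((INR e/INR d*x, INR e/INR d*y) : C) by alg.
rewrite !qpar_pow, !mult_INR. apply f_equal2; [apply f_equal, f_equal, f_equal|alg]; field; lra.
Qed.

Lemma H_affine (z : C) (e d b : nat) : uhp z -> (1 <= e)%nat -> (1 <= d)%nat -> uhp ((RtoC (INR e)*z+RtoC (INR b))/RtoC (INR d))%C.
Proof.
intros Hz He Hd. have Hd0 : 0 < INR d by pos. unfold uhp in *. unfold Cdiv. rewrite <- RtoC_inv by lra. destruct z as [x y]. simpl in *. pos.
Qed.

(** The sum over [b] retains the exponents divisible by [d], with a factor [d]; the scaling by [e/d]
    then turns [q^(d m)] into [q^(e m)]. *)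
Lemma hecke_term a z (e d : nat) : sub a -> uhp z -> (1 <= e)%nat -> (1 <= d)%nat ->
  hs (fun r => if dvdb e r then RtoC (INR d)*a (d*(r/e))%nat*qpar z^r else RtoC 0)%C
    (Csum (seq 0 d) (fun b => qs a ((RtoC (INR e)*z+RtoC (INR b))/RtoC (INR d))%C)).
Proof.
intros Ha Hz He Hd. apply (hs_spread d e (fun m => RtoC (INR d)*a (d*m)%nat)%C (fun r => qpar z^r)%C); [exact He|]. set (w := (RtoC (INR e/INR d)*z)%C).
apply (hs_ext (fun m => RtoC (INR d)*a (d*m)%nat*qpar w^(d*m))%C).
{ intros m _. unfold w. rewrite qpar_scale by exact Hd. auto. }
apply (hs_gather d (fun m => RtoC (INR d)*a m*qpar w^m)%C); [exact Hd|].
apply (hs_ext (fun m => Csum (seq 0 d) (fun b => a m*qpar ((RtoC (INR e)*z+RtoC (INR b))/RtoC (INR d))^m)%C)).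
- intros m _. rewrite (Csum_ext _ _ (fun b => a m*qpar w^m*ce (INR m*(2*PI*INR b/INR d)))%C).
  + rewrite Csum_scal, root_sum_dvd by exact Hd. destruct (dvdb d m); ring.
  + intros b _. rewrite qpar_affine by exact Hd. unfold w. ring.
- apply hs_Csum. intros b _. apply hs_qs; [exact Ha|apply H_affine; assumption].
Qed.

Lemma sum_n_m_Csum (u : nat -> C) n : @sum_n_m C_AbelianMonoid u 1 n = Csum (seq 1 n) u.
Proof.
induction n as [|n IH]; [auto|]. rewrite sum_n_Sm by lia. rewrite IH, Csum_seq_S. auto.
Qed.

Lemma sum_n_Csum (u : nat -> C) d : (1 <= d)%nat -> @sum_n C_AbelianMonoid u (pred d) = Csum (seq 0 d) u.
Proof.
intros Hd. destruct d as [|d]; [lia|]. simpl pred. clear. induction d as [|d IH]; [auto|]. rewrite sum_Sn, IH, (Csum_seq_S (S d)). auto.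
Qed.

Definition acoef (k : nat) (A : nat -> R) (n : nat) : C := RtoC (A n*Rpower (INR n) ((INR k-1)/2)).

Lemma acoef_sub k f A (Hf : normalized_eigenform k f A) : sub (acoef k A).
Proof.
apply sub_of_hs. intros z Hz. exists (f z). destruct (Datatypes.id Hf) as (_ & He & _). apply (expansion_hs f (acoef k A) z He Hz).
Qed.

Lemma f_qs k f A (Hf : normalized_eigenform k f A) z : uhp z -> f z = qs (acoef k A) z.
Proof.
intros Hz. destruct (Datatypes.id Hf) as (_ & He & _). eapply hs_unique; [apply (expansion_hs f (acoef k A) z He Hz)|apply hs_qs; [apply (acoef_sub _ _ _ Hf)|exact Hz]].
Qed.

Lemma acoef_1 k f A (Hf : normalized_eigenform k f A) : (acoef k A) 1 = RtoC 1.
Proof. unfold acoef. destruct (Datatypes.id Hf) as (_ & _ & ->). simpl (INR 1). unfold Rpower. rewrite ln_1, Rmult_0_r, exp_0, Rmult_1_r. auto. Qed.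

Lemma qs_S k f A (Hf : normalized_eigenform k f A) z : uhp z -> qs (acoef k A) (- / z)%C = (z^k*qs (acoef k A) z)%C.
Proof.
intros Hz. rewrite <- !(f_qs _ _ _ Hf) by (try apply H_inv_neg; exact Hz). destruct (Datatypes.id Hf) as (((_ & Hm & _) & _) & _).
specialize (Hm 0%Z (-1)%Z 1%Z 0%Z eq_refl z Hz). have Hz0 := H_neq0 z Hz. replace ((RtoC 0*z+RtoC (-1))/(RtoC 1*z+RtoC 0))%C with (- / z)%C in Hm.
- rewrite Hm. f_equal. alg.
- fd.
Qed.

(** In odd weight minus the identity forces [f = - f]; weight 0 is excluded by [cusp_vanish]. In
    both cases the first coefficient 1 gives the contradiction. *)
Lemma weight_even_pos k f A (Hf : normalized_eigenform k f A) : Nat.Even k /\ (1 <= k)%nat.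
Proof.
split.
- destruct (Nat.Even_or_Odd k) as [E|[m E]]; [exact E|exfalso].
  have Hz : forall z, uhp z -> f z = RtoC 0.
  { intros z Hz. destruct (Datatypes.id Hf) as (((_ & Hm & _) & _) & _). specialize (Hm (-1)%Z 0%Z 0%Z (-1)%Z eq_refl z Hz).
    replace (RtoC (-1)) with (- RtoC 1)%C in Hm by fd. replace ((- RtoC 1*z+RtoC 0)/(RtoC 0*z + - RtoC 1))%C with z in Hm.
    - replace (RtoC 0*z + - RtoC 1)%C with (- RtoC 1)%C in Hm by ring. rewrite E in Hm. replace ((- RtoC 1)^(2*m+1))%C with (- RtoC 1)%C in Hm.
      + have E2 : (RtoC 2*f z = 0)%C by (replace (RtoC 2) with (RtoC 1+RtoC 1)%C by fd;
          transitivity (f z+f z)%C; [ring|rewrite Hm at 1; ring]).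
        apply Cmult_integral in E2. destruct E2 as [E2|E2]; [apply RtoC_inj in E2; lra|exact E2].
      + clear. induction m as [|m IH]; [alg|]. replace (2*S m+1)%nat with (S (S (2*m+1))) by lia. simpl. simpl in IH. rewrite <- IH. ring.
    - field. }
  have E1 : (acoef k A) 1 = RtoC 0.
  { apply (qcoeff_unique (acoef k A) (fun _ => RtoC 0)); [|lia]. intros z Hz'. exists (RtoC 0). split.
    - rewrite <- (Hz z Hz'), (f_qs _ _ _ Hf z Hz'). apply hs_qs; [apply (acoef_sub _ _ _ Hf)|exact Hz'].
    - apply (hs_ext (fun _ => RtoC 0)); [alg|apply hs_zero]. }
  rewrite (acoef_1 _ _ _ Hf) in E1. apply RtoC_inj in E1. lra.
- destruct (Nat.eq_dec k 0) as [E|E]; [exfalso; subst k|lia].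
  have E1 : acoef 0 A 1 = RtoC 0.
  { apply (cusp_vanish (acoef 0 A) 0 (acoef_sub _ _ _ Hf)); [|lia]. intros z Hz. rewrite (qs_S _ _ _ Hf z Hz). fd. }
  rewrite (acoef_1 _ _ _ Hf) in E1. apply RtoC_inj in E1. lra.
Qed.

Lemma eigenform_bound k f A (Hf : normalized_eigenform k f A) : exists B, 0 <= B /\ forall z, uhp z -> Cmod (qs (acoef k A) z)^2*Im z^k <= B.
Proof.
have HPI := PI2_1. destruct (qs_decay (acoef k A) (1/2) (acoef_sub _ _ _ Hf) ltac:(lra)) as (K & HK & Hdec). set (B := K^2*exp (4*PI*(1/2))*INR (S k)^k).
exists B. split; [apply Rmult_le_pos; [pos|pos]|]. apply (reduction (fun z => Cmod (qs (acoef k A) z)^2*Im z^k)).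
- intros z Hz. rewrite qs_plus_1. replace (Im (z+1)%C) with (Im z) by (symmetry; apply Rplus_0_r). lra.
- intros z Hz. rewrite (qs_S _ _ _ Hf z Hz), Im_inv_neg, Cmod_mult, Cmod_pow_nat, Rpow_mult_distr.
unfold uhp in Hz. rewrite <- pow_mult, Nat.mul_comm, pow_mult, (Cmod2_alt z).
  unfold Rdiv. rewrite Rpow_mult_distr, pow_inv. fd.
- intros z Hz. set (y := Im z) in *. specialize (Hdec z Hz). fold y in Hdec. have Hk1 : 1 <= INR (S k) by (apply (le_INR 1); lia).
  have Hyk : y^k <= INR (S k)^k*exp y.
  { have E : y <= INR (S k)*exp (y/INR (S k)).
    { have E := exp_ineq1_le (y/INR (S k)). apply (Rmult_le_compat_l (INR (S k))) in E; [|lra]. replace (INR (S k)*(1+y/INR (S k))) with (INR (S k)+y) in E by fd. lra. }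
    etransitivity; [apply pow_incr; split; [lra|exact E]|]. rewrite Rpow_mult_distr. lmul.
    rewrite <- Rpower_pow by apply exp_pos. unfold Rpower. rewrite ln_exp. apply exp_mono.
    replace (INR k*(y/INR (S k))) with (y*(INR k/INR (S k))) by lra. rewrite <- (Rmult_1_r y) at 2. lmul. cancel (INR (S k)). inr. }
  have Hq : Cmod (qs (acoef k A) z)^2 <= K^2*exp (- (4*PI*(y-1/2))).
  { etransitivity; [apply pow_incr; split; [pos|exact Hdec]|]. rewrite Rpow_mult_distr. right. f_equal. simpl. rewrite Rmult_1_r, <- exp_plus. alg. }
  transitivity (K^2*exp (- (4*PI*(y-1/2)))*(INR (S k)^k*exp y)).
  + mono.
  + unfold B. replace (K^2*exp (- (4*PI*(y-1/2)))*(INR (S k)^k*exp y)) with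
      (K^2*(exp (- (4*PI*(y-1/2)))*exp y)*INR (S k)^k) by ring.
    rmul. lmul. rewrite <- exp_plus. apply exp_mono. nra.
Qed.

(** The eigenvalue equation is read on [q]-coefficients: the first identifies the eigenvalue, the
    [r]-th gives the relation. *)
Lemma hecke_eigenvalue k f A (Hf : normalized_eigenform k f A) n z0 : (1 <= n)%nat -> uhp z0 -> hecke_operator k n f z0 = ((acoef k A) n*f z0)%C /\
  forall r, (1 <= r)%nat -> ((acoef k A) n*(acoef k A) r)%C = Csum (seq 1 n) (fun d => if (dvdb d n && dvdb (n/d) r)%bool then
    RtoC (INR (n/d)^k*INR d/INR n)*(acoef k A) (d*(r/(n/d))) else RtoC 0)%C.
Proof.
intros Hn Hz0. have Hn0 : 0 < INR n by pos. destruct (Datatypes.id Hf) as ((_ & _ & HT) & _). destruct (HT n ltac:(lia)) as [lam Hlam].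
set (b := fun r => Csum (seq 1 n) (fun d => if (dvdb d n && dvdb (n/d) r)%bool then
  RtoC (INR (n/d)^k*INR d/INR n)*(acoef k A) (d*(r/(n/d))) else RtoC 0)%C).
have Hb : forall z, uhp z -> hs (fun r => b r*qpar z^r)%C (lam*f z)%C.
{ intros z Hz. rewrite <- (Hlam z Hz). unfold hecke_operator. rewrite sum_n_m_Csum, <- Csum_scal.
  apply (hs_ext (fun r => Csum (seq 1 n) (fun d => if dvdb d n then (RtoC (/ INR n)*RtoC (INR (n/d))^k) *
     (if dvdb (n/d) r then RtoC (INR d)*(acoef k A) (d*(r/(n/d)))*qpar z^r else RtoC 0) else RtoC 0)%C)).
  - intros r _. unfold b. rewrite <- Csum_scal_r. apply Csum_ext. intros d _.
    destruct (dvdb d n), (dvdb (n/d) r); simpl; try ring. unfold Rdiv. rewrite !RtoC_mult, RtoC_pow. ring.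
  - apply (hs_Csum (seq 1 n) (fun d r => if dvdb d n then (RtoC (/ INR n)*RtoC (INR (n/d))^k) *
       (if dvdb (n/d) r then RtoC (INR d)*(acoef k A) (d*(r/(n/d)))*qpar z^r else RtoC 0) else RtoC 0)%C).
    intros d Hd%in_seq. change (n mod d =? 0)%nat with (dvdb d n). destruct (dvdb d n) eqn:E.
    + rewrite Cmult_assoc, sum_n_Csum by lia. rewrite <- RtoC_inv by lra. apply hs_scal. have He : (1 <= n/d)%nat by (apply Nat.div_le_lower_bound; lia).
      rewrite (Csum_ext _ _ (fun b => qs (acoef k A) ((RtoC (INR (n/d))*z+RtoC (INR b))/RtoC (INR d))%C)).
      * apply hecke_term; [apply (acoef_sub _ _ _ Hf)|exact Hz|exact He|lia].
      * intros b0 _. apply (f_qs _ _ _ Hf). apply H_affine; go.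
    + rewrite Cmult_0_r. apply hs_zero. }
have Hlr : forall r, (1 <= r)%nat -> (lam*(acoef k A) r)%C = b r.
{ intros r Hr. apply (qcoeff_unique (fun r => lam*(acoef k A) r)%C b); [|exact Hr]. intros z Hz. exists (lam*f z)%C. split; [|auto].
  apply (hs_ext (fun r => lam*((acoef k A) r*qpar z^r))%C); [alg|]. apply hs_scal. rewrite (f_qs _ _ _ Hf z Hz). apply hs_qs; [apply (acoef_sub _ _ _ Hf)|exact Hz]. }
(* At [r = 1] only [d = n] survives, since [n/d] has to divide 1. *)
have El : lam = (acoef k A) n.
{ specialize (Hlr 1%nat (le_n 1)). rewrite (acoef_1 _ _ _ Hf), Cmult_1_r in Hlr. rewrite Hlr. unfold b. destruct n as [|n']; [lia|]. rewrite Csum_seq_S, Csum_zero.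
  - change (1+n')%nat with (S n'). have E1 : dvdb (S n') (S n') = true by (apply dvdb_iff; [lia|easy]).
    rewrite E1, Nat.div_same by lia. change (dvdb 1 1) with true. cbn [andb]. rewrite Nat.div_same by lia. rewrite Nat.mul_1_r. simpl (INR 1). rewrite pow1. alg.
  - intros d Hd%in_seq. destruct (dvdb d (S n')) eqn:E; [|auto]. apply dvdb_iff in E; [|lia]. destruct E as [c Ec]. rewrite Ec, Nat.div_mul by lia.
    assert (Hc : dvdb c 1 = false); [|rewrite Hc; easy]. unfold dvdb. rewrite Nat.mod_small by nia. auto. }
rewrite <- El. auto.
Qed.

Lemma Rpower_INR_mult m n s : (1 <= m)%nat -> (1 <= n)%nat -> Rpower (INR (m*n)) s = Rpower (INR m) s*Rpower (INR n) s.
Proof. intros Hm Hn. rewrite mult_INR. apply eq_sym, Rpower_mult_distr; apply lt_0_INR; lia. Qed.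

(** With [e = n/d] the factor [e^k d / n = e^(k-1)] is exactly what the normalisation by
    [n^((k-1)/2)] cancels. *)
Lemma hecke_relation k f A (Hf : normalized_eigenform k f A) n r : (1 <= n)%nat -> (1 <= r)%nat ->
  A n*A r = Rsum (seq 1 n) (fun d => if (dvdb d n && dvdb (n/d) r)%bool then A (d*(r/(n/d)))%nat else 0).
Proof.
intros Hn Hr. destruct (hecke_eigenvalue _ _ _ Hf n (0, 1) Hn ltac:(unfold uhp; simpl; lra)) as [_ HE]. specialize (HE r Hr). set (s := (INR k-1)/2) in *.
apply Rmult_eq_reg_r with (Rpower (INR n) s*Rpower (INR r) s); [|pos].
apply RtoC_inj. replace (RtoC (A n*A r*(Rpower (INR n) s*Rpower (INR r) s))) with ((acoef k A) n*(acoef k A) r)%C. 2:{ unfold acoef. fold s. alg. }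
rewrite HE, <- Rsum_scal_r, <- Csum_RtoC. apply Csum_ext. intros d Hd%in_seq. destruct ((dvdb d n && dvdb (n/d) r)%bool) eqn:E; [|alg].
apply andb_prop in E. destruct E as [E1 E2]. apply dvdb_iff in E1; [|lia]. destruct E1 as [e Ee].
rewrite Ee in *. rewrite Nat.div_mul in * by lia. have He : (1 <= e)%nat by nia.
apply dvdb_iff in E2; [|exact He]. destruct E2 as [r' Er]. rewrite Er in *. rewrite Nat.div_mul in * by lia.
unfold acoef. fold s. rewrite <- RtoC_mult. f_equal. rewrite !Rpower_INR_mult by lia. have He0 : 0 < INR e by pos.
have Ek : INR e^k*INR d/INR (e*d) = Rpower (INR e) s*Rpower (INR e) s.
{ rewrite mult_INR. replace (INR e^k*INR d/(INR e*INR d)) with (INR e^k * / INR e) by fd.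
  rewrite <- (Rpower_pow k) by exact He0. rewrite <- (Rpower_1 (INR e)) at 2 by exact He0. rewrite <- Rpower_Ropp, <- !Rpower_plus. f_equal. unfold s. field. }
rewrite Ek. ring.
Qed.

Lemma eigenform_multiplicative k f A (Hf : normalized_eigenform k f A) : multiplicative A.
Proof.
split; [apply Hf|]. intros m n Hm Hn Hr. rewrite (hecke_relation _ _ _ Hf m n Hm Hn). destruct m as [|m']; [lia|]. rewrite Rsum_seq_S, Rsum_zero.
- change (1+m')%nat with (S m'). have E1 : dvdb (S m') (S m') = true by (apply dvdb_iff; [lia|easy]).
  rewrite E1, Nat.div_same by lia. have E2 : dvdb 1 n = true by auto. rewrite E2. cbn [andb]. rewrite Nat.div_1_r. ring.
- intros d Hd%in_seq. destruct (dvdb d (S m')) eqn:E1; [|auto]. destruct (dvdb (S m'/d) n) eqn:E2; [|auto]. exfalso.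
  apply dvdb_iff in E1; [|lia]. destruct E1 as [e Ee]. rewrite Ee, Nat.div_mul in E2 by lia.
  apply dvdb_iff in E2; [|lia]. have Hd1 : Nat.divide e 1.
  { apply (rp_gauss e n); [|rewrite Nat.mul_1_r; exact E2]. unfold rp in *. apply rel_prime_div with (Z.of_nat (S m')); [exact Hr|]. exists (Z.of_nat d). lia. }
  apply Nat.divide_1_r in Hd1. lia.
Qed.

Lemma square_relation k f A (Hf : normalized_eigenform k f A) n : (1 <= n)%nat -> A n^2 = Rsum (seq 1 n) (fun d => if dvdb d n then A (d*d)%nat else 0).
Proof.
intros Hn. simpl. rewrite Rmult_1_r, (hecke_relation _ _ _ Hf n n Hn Hn). apply Rsum_ext. intros d Hd%in_seq.
destruct (dvdb d n) eqn:E1; [|auto]. apply dvdb_iff in E1; [|lia]. destruct E1 as [e Ee].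
rewrite Ee, Nat.div_mul by lia. have E2 : dvdb e (e*d) = true by (apply dvdb_iff; [lia|apply Nat.divide_factor_l]).
rewrite E2. cbn [andb]. rewrite (Nat.mul_comm e), Nat.div_mul by lia. lra.
Qed.

Lemma harmonic_unbounded (c : R) : exists D, (1 <= D)%nat /\ c < Rsum (seq 1 D) (fun d => / INR d).
Proof.
have Hl : forall n, ln (INR (S n)) <= Rsum (seq 1 n) (fun d => / INR d).
{ induction n as [|n IH]; [simpl; rewrite ln_1; lra|]. rewrite Rsum_seq_S. change (1+n)%nat with (S n). have Hp : 0 < INR (S n) by pos. rewrite (S_INR (S n)).
  assert (0 < / INR (S n)) by pos. have L := ln_le_sub1 (1 + / INR (S n)) ltac:(lra).
  replace (INR (S n)+1) with (INR (S n)*(1 + / INR (S n))) by fd. rewrite ln_mult by lra. lra. }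
destruct (nat_ceil (exp c)) as (D & HD & _); [pos|]. exists (S D). split; [lia|]. eapply Rlt_le_trans; [|apply Hl].
rewrite <- (ln_exp c). apply ln_increasing; [pos|]. inr.
Qed.

(* If all [A (d^2)] were nonnegative, [A n^2] would dominate the number of divisors of [n]. *)
Lemma negative_square k f A (Hf : normalized_eigenform k f A) : exists d, (1 <= d)%nat /\ A (d*d)%nat < 0.
Proof.
apply NNPP. intros Hno. have Hpos : forall d, (1 <= d)%nat -> 0 <= A (d*d)%nat by (intros d Hd; apply Rnot_lt_le; intros Hl; apply Hno; exists d; tauto).
have Hge1 : forall d, (1 <= d)%nat -> 1 <= A (d*d)%nat.
{ intros d Hd. have E := square_relation _ _ _ Hf (d*d) ltac:(nia).
  assert (1 <= A (d*d)%nat^2).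
  { rewrite E. transitivity ((fun e => if dvdb e (d*d) then A (e*e)%nat else 0) 1%nat).
    - have E1 : dvdb 1 (d*d) = true by auto. cbv beta. rewrite E1. change (1*1)%nat with 1%nat. destruct Hf as (_ & _ & ->). lra.
    - apply (Rsum_In_le (seq 1 (d*d)) (fun e => if dvdb e (d*d) then A (e*e)%nat else 0)); [|sq]. intros e He%in_seq. destruct (dvdb e (d*d)); [apply Hpos; lia|lra]. }
  specialize (Hpos d Hd). nra. }
have Htau : forall n, (1 <= n)%nat -> forall D, (D <= n)%nat -> Rsum (seq 1 D) (fun d => if dvdb d n then 1 else 0) <= A n^2.
{ intros n Hn D HD. rewrite (square_relation _ _ _ Hf n Hn). replace (seq 1 n) with (seq 1 (D+(n-D))) by alg. rewrite seq_app, Rsum_app.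
  assert (0 <= Rsum (seq (1+D) (n-D)) (fun d => if dvdb d n then A (d*d)%nat else 0)).
  { apply Rsum_nonneg. intros e He%in_seq. destruct (dvdb e n); [apply Hpos; lia|lra]. }
  assert (Rsum (seq 1 D) (fun d => if dvdb d n then 1 else 0) <= Rsum (seq 1 D) (fun d => if dvdb d n then A (d*d)%nat else 0)); [|lra].
  apply Rsum_le. intros e He%in_seq. destruct (dvdb e n); [apply Hge1; lia|lra]. }
destruct (eigenform_bound _ _ _ Hf) as (B & HB & Hbd). destruct (weight_even_pos _ _ _ Hf) as [_ Hk]. destruct (harmonic_unbounded (B*2^k*exp (4*PI))) as (D & HD & HH).
(* Every [d <= D] divides [m], so its multiples in [(m, 2 m]] are counted without rounding. At the
   height [1/(2 m)] the exponential weights on that range are at least [exp (- 4 PI)]. *)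
set (m := fact D). have HDm : (D <= m)%nat by (apply Nat.divide_pos_le; [pose proof (lt_O_fact D); unfold m; lia|apply fact_divide; lia]). have Hm0 : 1 <= INR m by inr.
set (y := / (2*INR m)). have Hy : 0 < y by (apply Rinv_0_lt_compat; lra).
have Hup : Rsum (seq 1 (2*m)) (fun n => Cmod (acoef k A n)^2*exp (- (4*PI*INR n*y))) <= B/y^k.
{ have HBy : 0 <= B/y^k by pos. rewrite <- (pow2_sqrt (B/y^k) HBy). apply bessel; [apply (acoef_sub _ _ _ Hf)|exact Hy|]. intros x.
  rewrite <- (sqrt_pow2 (Cmod _)) by apply Cmod_ge_0. apply sqrt_le_1_alt. specialize (Hbd (x, y) Hy). change (Im (x, y)) with y in Hbd. cancel (y^k). lra. }
set (lo := INR m^(k-1)*exp (- (4*PI))). have Hlo : 0 < lo by (apply Rmult_lt_0_compat; [pos|pos]).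
have Hdown : lo*Rsum (seq (1+m) m) (fun n => A n^2) <= Rsum (seq 1 (2*m)) (fun n => Cmod (acoef k A n)^2*exp (- (4*PI*INR n*y))).
{ replace (2*m)%nat with (m+m)%nat by lia. rewrite (seq_app m m 1), Rsum_app.
  assert (0 <= Rsum (seq 1 m) (fun n => Cmod (acoef k A n)^2*exp (- (4*PI*INR n*y)))).
  { pos. }
  rewrite <- Rsum_scal. assert (Rsum (seq (1+m) m) (fun n => lo*A n^2) <= Rsum (seq (1+m) m) (fun n => Cmod (acoef k A n)^2*exp (- (4*PI*INR n*y)))); [|lra].
  apply Rsum_le. intros n Hn%in_seq. have Hn1 : INR m <= INR n <= 2*INR m.
  { replace (2*INR m) with (INR (2*m)) by inr. go. }
  unfold acoef. rewrite Cmod_R, pow2_abs, Rpow_mult_distr, Rp_pow. replace ((INR k-1)/2*INR 2) with (INR (k-1)) by (rewrite minus_INR by lia; simpl; field).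
  rewrite Rpower_pow by lra. replace (lo*A n^2) with (A n^2*lo) by ring. rewrite Rmult_assoc. lmul. unfold lo. apply Rmult_le_compat; [pos|pos|mono|]. apply exp_mono.
  assert (INR n*y <= 1).
  { apply Rmult_le_reg_r with (2*INR m); [lra|]. unfold y. rewrite Rmult_assoc, Rinv_l by lra. lra. }
  pose proof PI_RGT_0. nra. }
have Hcount : INR m*Rsum (seq 1 D) (fun d => / INR d) <= Rsum (seq (1+m) m) (fun n => A n^2).
{ transitivity (Rsum (seq (1+m) m) (fun n => Rsum (seq 1 D) (fun d => if dvdb d n then 1 else 0))).
  - rewrite Rsum_swap, <- Rsum_scal. right. apply Rsum_ext. intros d Hd%in_seq. destruct (fact_divide D d ltac:(lia)) as [c Hc]. fold m in Hc.
    have E2 : Rsum (seq 1 (m+m)) (fun n => if dvdb d n then 1 else 0) = INR (m+m) * / INR d.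
    { rewrite (Rsum_dvdb (m+m) d (fun _ => 1)) by lia. rewrite Rsum_const, length_seq, Rmult_1_r. replace (m+m)%nat with ((c+c)*d)%nat by lia.
      rewrite Nat.div_mul by lia. rewrite (mult_INR (c+c) d). fd. }
    have E1 : Rsum (seq 1 m) (fun n => if dvdb d n then 1 else 0) = INR m * / INR d.
    { rewrite (Rsum_dvdb m d (fun _ => 1)) by lia. rewrite Rsum_const, length_seq, Rmult_1_r. rewrite Hc at 1. rewrite Nat.div_mul by lia. rewrite Hc, mult_INR. fd. }
    rewrite seq_app, Rsum_app, E1, plus_INR in E2. lra.
  - apply Rsum_le. intros n Hn%in_seq. apply Htau; lia. }
have Hfin : B/y^k = B*2^k*INR m^(k-1)*INR m.
{ unfold y. rewrite pow_inv. unfold Rdiv. rewrite Rinv_inv, Rpow_mult_distr. replace k with (S (k-1)) at 2 by lia. simpl. ring. }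
rewrite Hfin in Hup.
have HX : lo*(INR m*Rsum (seq 1 D) (fun d => / INR d)) <= B*2^k*INR m^(k-1)*INR m.
{ nra. }
have HY : lo*(INR m*(B*2^k*exp (4*PI))) < lo*(INR m*Rsum (seq 1 D) (fun d => / INR d)).
{ apply Rmult_lt_compat_l; [exact Hlo|]. nra. }
have HZ : lo*(INR m*(B*2^k*exp (4*PI))) = B*2^k*INR m^(k-1)*INR m.
{ unfold lo. replace (INR m^(k-1)*exp (- (4*PI))*(INR m*(B*2^k*exp (4*PI)))) with
    (B*2^k*INR m^(k-1)*INR m*(exp (- (4*PI))*exp (4*PI))) by ring. rewrite <- exp_plus.
  replace (- (4*PI)+4*PI) with 0 by ring. rewrite exp_0. ring. }
lra.
Qed.

(** * Complex derivatives *)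

Definition cder (f : C -> C) (z l : C) : Prop :=
  forall eps, 0 < eps -> exists d, 0 < d /\ forall h, Cmod h < d -> Cmod (f (z+h)%C-f z-l*h) <= eps*Cmod h.

Lemma cder_const c z : cder (fun _ => c) z (RtoC 0).
Proof.
intros eps He. exists 1. split; [lra|]. intros h _. replace (c-c-0*h)%C with (RtoC 0) by ring. rewrite Cmod_0. pos.
Qed.

Lemma cder_id z : cder (fun z => z) z (RtoC 1).
Proof.
intros eps He. exists 1. split; [lra|]. intros h _. replace (z+h-z-1*h)%C with (RtoC 0) by ring. rewrite Cmod_0. pos.
Qed.

Lemma cder_plus f g z l m : cder f z l -> cder g z m -> cder (fun z => f z+g z)%C z (l+m)%C.
Proof.
intros Hf Hg eps He. destruct (Hf (eps/2) ltac:(lra)) as (d1 & Hd1 & H1). destruct (Hg (eps/2) ltac:(lra)) as (d2 & Hd2 & H2).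
exists (Rmin d1 d2). split; [apply Rmin_pos; assumption|]. intros h Hh.
specialize (H1 h (Rlt_le_trans _ _ _ Hh (Rmin_l _ _))). specialize (H2 h (Rlt_le_trans _ _ _ Hh (Rmin_r _ _))).
replace (f (z+h)+g (z+h)-(f z+g z)-(l+m)*h)%C with ((f (z+h)-f z-l*h)+(g (z+h)-g z-m*h))%C by ring. via Cmod_triangle. lra.
Qed.

Lemma cder_lip f z l : cder f z l -> exists d, 0 < d /\ forall h, Cmod h < d -> Cmod (f (z+h)%C-f z) <= (Cmod l+1)*Cmod h.
Proof.
intros Hf. destruct (Hf 1 ltac:(lra)) as (d & Hd & H1). exists d. split; [exact Hd|]. intros h Hh. specialize (H1 h Hh).
replace (f (z+h)-f z)%C with ((f (z+h)-f z-l*h)+l*h)%C by ring. via Cmod_triangle. rewrite Cmod_mult. lra.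
Qed.

Lemma cder_mult f g z l m : cder f z l -> cder g z m -> cder (fun z => f z*g z)%C z (l*g z+f z*m)%C.
Proof.
intros Hf Hg eps He. destruct (cder_lip f z l Hf) as (d0 & Hd0 & H0). destruct (cder_lip g z m Hg) as (d3 & Hd3 & H3).
have Pf := Cmod_ge_0 (f z). have Pg := Cmod_ge_0 (g z). have Pl := Cmod_ge_0 l. have Pm := Cmod_ge_0 m. set (S := Cmod (f z)+Cmod (g z)+1).
destruct (Hf (eps/(3*S))) as (d1 & Hd1 & H1); [apply Rdiv_lt_0_compat; unfold S; lra|].
destruct (Hg (eps/(3*S))) as (d2 & Hd2 & H2); [apply Rdiv_lt_0_compat; unfold S; lra|].
set (T := (Cmod l+1)*(Cmod m+1)). have HT : 0 < T by (apply Rmult_lt_0_compat; lra). set (d4 := eps/(3*T)). have Hd4 : 0 < d4 by (apply Rdiv_lt_0_compat; lra).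
exists (Rmin (Rmin d0 d3) (Rmin d4 (Rmin d1 d2))). split; [repeat apply Rmin_pos; assumption|]. intros h Hh.
have B : Cmod h < d0 /\ Cmod h < d3 /\ Cmod h < d4 /\ Cmod h < d1 /\ Cmod h < d2.
{ repeat split; eapply Rlt_le_trans; try exact Hh.
  - etransitivity; apply Rmin_l.
  - etransitivity; [apply Rmin_l|apply Rmin_r].
  - etransitivity; [apply Rmin_r|apply Rmin_l].
  - via Rmin_r. etransitivity; [apply Rmin_r|apply Rmin_l].
  - via Rmin_r. etransitivity; [apply Rmin_r|apply Rmin_r]. }
destruct B as (B0 & B3 & B4 & B1 & B2). specialize (H0 h B0). specialize (H3 h B3). specialize (H1 h B1). specialize (H2 h B2).
set (x := Cmod h) in *. have Hx : 0 <= x by apply Cmod_ge_0. replace (f (z+h)*g (z+h)-f z*g z-(l*g z+f z*m)*h)%C with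
  ((f (z+h)-f z-l*h)*g z+(f z*(g (z+h)-g z-m*h)+(f (z+h)-f z)*(g (z+h)-g z)))%C by ring.
via Cmod_triangle. etransitivity; [apply Rplus_le_compat_l, Cmod_triangle|]. rewrite !Cmod_mult. have E1 : eps/(3*S)*S = eps/3 by (field; unfold S; lra).
have Q1 : Cmod (f (z+h)%C-f z-l*h)*Cmod (g z) <= eps/(3*S)*x*S.
{ apply Rmult_le_compat; [pos|exact Pg|exact H1|unfold S; lra]. }
have Q2 : Cmod (f z)*Cmod (g (z+h)%C-g z-m*h) <= S*(eps/(3*S)*x).
{ apply Rmult_le_compat; [exact Pf|pos|unfold S; lra|exact H2]. }
have Q3 : Cmod (f (z+h)%C-f z)*Cmod (g (z+h)%C-g z) <= (Cmod l+1)*x*((Cmod m+1)*x).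
{ mono. }
have Q4 : (Cmod l+1)*x*((Cmod m+1)*x) <= eps/3*x.
{ replace ((Cmod l+1)*x*((Cmod m+1)*x)) with (T*x*x) by (unfold T; ring). rmul. transitivity (T*d4); [mono|]. unfold d4. right. fd. }
nra.
Qed.

Lemma cder_scal c f z l : cder f z l -> cder (fun z => c*f z)%C z (c*l)%C.
Proof.
intros Hf. have Hm := cder_mult (fun _ => c) f z (RtoC 0) l (cder_const c z) Hf. cbv beta in Hm. replace (0*f z+c*l)%C with (c*l)%C in Hm by ring. exact Hm.
Qed.

Lemma cder_Csum {A} (s : list A) (f : A -> C -> C) (l : A -> C) z : (forall a, In a s -> cder (f a) z (l a)) ->
  cder (fun z => Csum s (fun a => f a z)) z (Csum s l).
Proof.
induction s as [|a s IH]; intros Hs; simpl; [apply cder_const|]. apply cder_plus; [apply Hs; left; easy|apply IH; intros b Hb; apply Hs; right; exact Hb].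
Qed.

Lemma cder_pow z n : cder (fun z => z^S n)%C z (RtoC (INR (S n))*z^n)%C.
Proof.
induction n as [|n IH].
- replace (RtoC (INR 1)*z^0)%C with (1*1+z*0)%C by alg. apply (cder_mult (fun z => z) (fun _ => RtoC 1)); [apply cder_id|apply cder_const].
- replace (RtoC (INR (S (S n)))*z^S n)%C with (1*z^S n+z*(RtoC (INR (S n))*z^n))%C by alg. apply (cder_mult (fun z => z) (fun z => z^S n)%C); [apply cder_id|exact IH].
Qed.

Lemma cder_comp f g z l m : cder g z l -> cder f (g z) m -> cder (fun z => f (g z)) z (m*l)%C.
Proof.
intros Hg Hf eps He. destruct (cder_lip g z l Hg) as (d0 & Hd0 & H0). have Pl := Cmod_ge_0 l. destruct (Hf (eps/(2*(Cmod l+1)))) as (d1 & Hd1 & H1); [pos|].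
destruct (Hg (eps/(2*(Cmod m+1)))) as (d2 & Hd2 & H2); [pos|]. set (d3 := d1/(Cmod l+1)). have Hd3 : 0 < d3 by (apply Rdiv_lt_0_compat; lra).
exists (Rmin d0 (Rmin d2 d3)). split; [repeat apply Rmin_pos; assumption|]. intros h Hh.
have B : Cmod h < d0 /\ Cmod h < d2 /\ Cmod h < d3.
{ repeat split; eapply Rlt_le_trans; try exact Hh; [apply Rmin_l| |]; (via Rmin_r); [apply Rmin_l|apply Rmin_r]. }
destruct B as (B0 & B2 & B3). specialize (H0 h B0). specialize (H2 h B2). set (k := (g (z+h)-g z)%C) in *.
have Hk : Cmod k < d1.
{ eapply Rle_lt_trans; [exact H0|]. apply Rlt_le_trans with ((Cmod l+1)*d3); [nra|]. unfold d3. right. fd. }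
specialize (H1 k Hk). replace (g z+k)%C with (g (z+h)%C) in H1 by alg. replace (f (g (z+h))-f (g z)-m*l*h)%C with ((f (g (z+h))-f (g z)-m*k)+m*(k-l*h))%C by ring.
via Cmod_triangle. rewrite Cmod_mult.
have Q1 : eps/(2*(Cmod l+1))*Cmod k <= eps/2*Cmod h.
{ transitivity (eps/(2*(Cmod l+1))*((Cmod l+1)*Cmod h)); [mono|]. right. fd. }
have Q2 : Cmod m*Cmod (k-l*h) <= eps/2*Cmod h.
{ transitivity ((Cmod m+1)*(eps/(2*(Cmod m+1))*Cmod h)); [mono|]. right. fd. }
lra.
Qed.

Lemma cder_inv_neg z : z <> RtoC 0 -> cder (fun z => - / z)%C z (/ (z*z))%C.
Proof.
intros Hz eps He. have Hm : 0 < Cmod z by (apply Cmod_gt_0; exact Hz). set (r := Cmod z) in *. exists (Rmin (r/2) (eps*(r*r*r)/2)).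
split; [apply Rmin_pos; [lra|pos]|]. intros h Hh. have B1 : Cmod h < r/2 by (eapply Rlt_le_trans; [exact Hh|apply Rmin_l]).
have B2 : Cmod h < eps*(r*r*r)/2 by (eapply Rlt_le_trans; [exact Hh|apply Rmin_r]).
have Hw : r/2 <= Cmod (z+h).
{ have T := Cmod_triangle (z+h) (- h). replace (z+h + - h)%C with z in T by ring. rewrite Cmod_opp in T. fold r in T. lra. }
have Hwz : (z+h)%C <> RtoC 0 by (apply Cmod_gt_0; lra). replace (- / (z+h) - - / z - / (z*z)*h)%C with (- (h*h/(z*z*(z+h))))%C by fd.
rewrite Cmod_opp, Cmod_div, !Cmod_mult by (intros E; apply Cmult_integral in E; destruct E as [E|E]; [apply Cmult_integral in E; tauto|auto]). fold r.
have Ph := Cmod_ge_0 h. have Hd : 0 < r*r*Cmod (z+h) by pos.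
apply Rmult_le_reg_r with (r*r*Cmod (z+h)); [exact Hd|]. unfold Rdiv. rewrite Rmult_assoc, Rinv_l, Rmult_1_r by lra.
replace (eps*Cmod h*(r*r*Cmod (z+h))) with (Cmod h*(eps*(r*r*Cmod (z+h)))) by ring. lmul. nra.
Qed.

(** The real mean value theorem along the segment from [z] to [z'], which stays in the half plane,
    applied to the real and the imaginary part. *)
Lemma cder_unique_zero f : (forall z, uhp z -> cder f z (RtoC 0)) -> forall z z', uhp z -> uhp z' -> f z = f z'.
Proof.
intros Hf z z' Hz Hz'. set (dz := (z'-z)%C). set (pt := fun t : R => (z+RtoC t*dz)%C).
have Hpt : forall t, 0 <= t <= 1 -> uhp (pt t).
{ intros t Ht. unfold uhp in *. unfold pt, dz. replace (Im (z+RtoC t*(z'-z))%C) with ((1-t)*Im z+t*Im z') by (destruct z, z'; simpl; ring). nra. }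
have Hpart : forall (u : C -> R), (forall a b, u (a-b)%C = u a-u b) -> (forall a, Rabs (u a) <= Cmod a) -> u (f z')-u (f z) = 0.
{ intros u Hu1 Hu2.
  have Hd : forall t, 0 <= t <= 1 -> derivable_pt_lim (fun t => u (f (pt t))) t 0.
  { intros t Ht eps He. have Pd := Cmod_ge_0 dz. destruct (Hf (pt t) (Hpt t Ht) (eps/2/(Cmod dz+1))) as (d & Hd & H1); [pos|].
    assert (Hd' : 0 < d/(Cmod dz+1)) by pos. exists (mkposreal _ Hd'). simpl. intros h Hh0 Hh. have Hab : 0 < Rabs h by (apply Rabs_pos_lt; exact Hh0).
    have Hmh : Cmod (RtoC h*dz) <= Rabs h*(Cmod dz+1) by (rewrite Cmod_mult, Cmod_R; apply Rmult_le_compat_l; lra). specialize (H1 (RtoC h*dz)%C).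
    have Hsm : Cmod (RtoC h*dz) < d.
    { eapply Rle_lt_trans; [exact Hmh|]. apply Rlt_le_trans with (d/(Cmod dz+1)*(Cmod dz+1)); [nra|]. right. fd. }
    specialize (H1 Hsm). replace (pt t+RtoC h*dz)%C with (pt (t+h)) in H1 by alg.
    replace (f (pt (t+h)%R)-f (pt t)-0*(RtoC h*dz))%C with (f (pt (t+h)%R)-f (pt t))%C in H1 by ring.
    rewrite <- Hu1, Rminus_0_r. unfold Rdiv. rewrite Rabs_mult, Rabs_inv. apply Rmult_lt_reg_r with (Rabs h); [exact Hab|]. rewrite Rmult_assoc, Rinv_l, Rmult_1_r by lra.
    eapply Rle_lt_trans; [apply Hu2|]. eapply Rle_lt_trans; [exact H1|]. apply Rle_lt_trans with (eps/2/(Cmod dz+1)*(Rabs h*(Cmod dz+1))); [mono|].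
    replace (eps/2/(Cmod dz+1)*(Rabs h*(Cmod dz+1))) with (eps/2*Rabs h) by fd. nra. }
  destruct (MVT_gen (fun t => u (f (pt t))) 0 1 (fun _ => 0)) as (c & _ & Hc).
  - intros t Ht. rewrite Rmin_left, Rmax_right in Ht by lra. apply is_derive_Reals. apply Hd. lra.
  - intros t Ht. rewrite Rmin_left, Rmax_right in Ht by lra. apply derivable_continuous_pt. exists 0. apply Hd. lra.
  - replace (pt 1) with z' in Hc by alg. replace (pt 0) with z in Hc by alg. lra. }
apply injective_projections.
- pose proof (Hpart Re ltac:(intros; easy) re_le_Cmod). unfold Re in *. lra.
- pose proof (Hpart Im ltac:(intros; easy) im_le_Cmod). unfold Im in *. lra.
Qed.

(** * Periods *)

Lemma sin_sub_bound b : Rabs (sin b-b) <= b^2.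
Proof.
destruct (MVT_gen (fun x => sin x-x) 0 b (fun x => cos x-1)) as (c & Hc & E).
- intros x _. auto_derive; [trivial|ring].
- intros x _. apply derivable_continuous_pt. apply derivable_pt_minus; [apply derivable_pt_sin|apply derivable_pt_id].
- rewrite sin_0 in E. replace (sin b-b) with ((cos c-1)*(b-0)) by lra. rewrite Rminus_0_r, Rabs_mult.
  have Hcb : Rabs c <= Rabs b.
  { unfold Rmin, Rmax in Hc. destruct (Rle_dec 0 b); apply Rabs_le; [go|rewrite Rabs_left]; lra. }
  have Hcos : Rabs (cos c-1) <= Rabs c.
  { have D := ce_dist c 0. rewrite ce_0, Rminus_0_r in D. etransitivity; [|exact D]. apply (re_le_Cmod (ce c-1)%C). }
  rewrite <- (pow2_abs b). pose proof (Rabs_pos b). nra.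
Qed.

Lemma exp_sub_bounds a : Rabs (exp a-1) <= Rabs a*exp (Rabs a) /\ Rabs (exp a-1-a) <= a^2*exp (Rabs a).
Proof.
have H1 : forall a, Rabs (exp a-1) <= Rabs a*exp (Rabs a).
{ clear a. intros a. destruct (MVT_gen exp 0 a exp) as (c & Hc & E).
  - intros x _. apply is_derive_exp.
  - intros x _. apply derivable_continuous_pt, derivable_pt_exp.
  - rewrite exp_0 in E. rewrite E, Rminus_0_r, Rabs_mult, (Rabs_right (exp c)), Rmult_comm by pos.
    lmul. apply exp_mono. unfold Rmin, Rmax in Hc. destruct (Rle_dec 0 a); [go|rewrite Rabs_left]; lra. }
split; [apply H1|]. destruct (MVT_gen (fun x => exp x-x) 0 a (fun x => exp x-1)) as (c & Hc & E).
- intros x _. auto_derive; [trivial|ring].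
- intros x _. apply derivable_continuous_pt. apply derivable_pt_minus; [apply derivable_pt_exp|apply derivable_pt_id].
- rewrite exp_0 in E. replace (exp a-1-a) with ((exp c-1)*(a-0)) by lra. rewrite Rminus_0_r, Rabs_mult.
  have Hca : Rabs c <= Rabs a.
  { unfold Rmin, Rmax in Hc. destruct (Rle_dec 0 a); apply Rabs_le; [go|rewrite Rabs_left]; lra. }
  rewrite <- (pow2_abs a). pose proof (Rabs_pos c). pose proof (exp_mono _ _ Hca). transitivity (Rabs a*exp (Rabs a)*Rabs a); [|lra]. rmul. via H1. mono.
Qed.

Lemma Cexp_bound u : Cmod (Cexp u-1-u) <= 2*Cmod u^2*exp (Cmod u).
Proof.
via Cmod_le_Re_Im. rewrite Cmod2_alt. have Ha := re_le_Cmod u. set (E := exp (Cmod u)).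
destruct u as [a b]. change (Re (a, b)) with a in *. change (Im (a, b)) with b in *.
change (Re (Cexp (a, b)-1-(a, b))%C) with (exp a*cos b-1-a). replace (Im (Cexp (a, b)-1-(a, b))%C) with (exp a*sin b-b) by (simpl; ring).
destruct (exp_sub_bounds a) as [B1 B2]. have B3 := sin_sub_bound b.
have HE : exp (Rabs a) <= E by (apply exp_mono, Ha). have HE1 : exp a <= E by (apply exp_mono; pose proof (Rle_abs a); lra). have Pa := exp_pos a.
have B4 : Rabs (cos b-1) <= b^2/2.
{ replace b with (2*(b/2)) at 1 by field. rewrite cos_2a_sin. replace (1-2*sin (b/2)*sin (b/2)-1) with (- (2*(sin (b/2))^2)) by ring.
  rewrite Rabs_Ropp, Rabs_right by pos.
  have Hs : Rabs (sin (b/2)) <= Rabs (b/2).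
  { have D := ce_dist (b/2) 0. rewrite ce_0, Rminus_0_r in D. etransitivity; [|exact D].
    replace (sin (b/2)) with (Im (ce (b/2)-1)%C) by (simpl; ring). apply im_le_Cmod. }
  apply pow_maj_Rabs with (n := 2%nat) in Hs. rewrite pow2_abs in Hs. lra. }
have Q1 : Rabs (exp a*cos b-1-a) <= a^2*E+E*(b^2/2).
{ replace (exp a*cos b-1-a) with ((exp a-1-a)+exp a*(cos b-1)) by ring. via Rabs_triang. rewrite Rabs_mult, (Rabs_right (exp a)) by lra. nra. }
have Q2 : Rabs (exp a*sin b-b) <= E*b^2+Rabs a*E*Rabs b.
{ replace (exp a*sin b-b) with (exp a*(sin b-b)+(exp a-1)*b) by ring. via Rabs_triang. rewrite !Rabs_mult, (Rabs_right (exp a)) by lra. apply Rplus_le_compat.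
  - mono.
  - rmul. via B1. mono. }
have Q3 : Rabs a*Rabs b <= (a^2+b^2)/2.
{ rewrite <- (pow2_abs a), <- (pow2_abs b). pose proof (pow2_ge_0 (Rabs a-Rabs b)). nra. }
nra.
Qed.

Lemma Cexp_plus u v : Cexp (u+v)%C = (Cexp u*Cexp v)%C.
Proof.
destruct u as [a b], v as [c d]. unfold Cexp. simpl. rewrite exp_plus, cos_plus, sin_plus. alg.
Qed.

Lemma Cexp_0 : Cexp 0 = RtoC 1.
Proof. unfold Cexp. simpl. rewrite exp_0, cos_0, sin_0. alg. Qed.

Lemma Cexp_nat n u : Cexp (RtoC (INR n)*u)%C = (Cexp u^n)%C.
Proof.
induction n as [|n IH]; [simpl; rewrite Cmult_0_l; apply Cexp_0|]. rewrite S_INR, RtoC_plus.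
replace ((RtoC (INR n)+1)*u)%C with (u+RtoC (INR n)*u)%C by ring. rewrite Cexp_plus, IH. auto.
Qed.

Definition tw : C := (RtoC (2*PI)*Ci)%C.

Lemma Cmod_tw : Cmod tw = 2*PI.
Proof. unfold tw. rewrite Cmod_mult, Cmod_R, Cmod_Ci, Rmult_1_r. apply Rabs_right. pose proof PI_RGT_0. lra. Qed.

Lemma qpar_shift z h n : (qpar (z+h)^n)%C = (qpar z^n*Cexp (RtoC (INR n)*(tw*h)))%C.
Proof. rewrite Cexp_nat, <- Cpow_mult_l. f_equal. unfold qpar. rewrite <- Cexp_plus. f_equal. alg. Qed.

Lemma sub_mul_n g : sub g -> sub (fun n => RtoC (INR n)*g n)%C.
Proof.
intros Hg rho Hr. set (s := sqrt rho). have Hss : s*s = rho by (apply sqrt_sqrt; lra). have Hs : 1 < s by (rewrite <- sqrt_1; apply sqrt_lt_1; lra).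
destruct (Hg s Hs) as (K & HK & Hb). exists (K/(s-1)). split; [pos|]. intros n Hn. specialize (Hb n Hn).
rewrite Cmod_mult, Cmod_R, Rabs_right by pos. rewrite <- Hss, Rpow_mult_distr.
have Hn1 : INR n*(s-1) <= s^n.
{ have P := poly n (s-1) ltac:(lra). replace (1+(s-1)) with s in P by ring. lra. }
replace (K/(s-1)*(s^n*s^n)) with ((s^n/(s-1))*(K*s^n)) by lra. apply Rmult_le_compat; [pos|pos| |exact Hb]. cancel (s-1). lra.
Qed.

Lemma sub_bounded_mul (c : nat -> C) (B : R) g : 0 <= B -> (forall n, (1 <= n)%nat -> Cmod (c n) <= B) -> sub g -> sub (fun n => c n*g n)%C.
Proof.
intros HB Hc Hg rho Hr. destruct (Hg rho Hr) as (K & HK & Hb). exists (B*K). split; [pos|].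
intros n Hn. rewrite Cmod_mult, Rmult_assoc. apply Rmult_le_compat; try apply Cmod_ge_0; [auto|auto].
Qed.

Lemma sub_scal c g : sub g -> sub (fun n => c*g n)%C.
Proof. apply (sub_bounded_mul (fun _ => c) (Cmod c)); [pos|easy]. Qed.

Lemma qs_ext g g' z : (forall n, (1 <= n)%nat -> g n = g' n) -> qs g z = qs g' z.
Proof.
intros E. unfold qs, CS. f_equal; apply Series_ext; intros n; rewrite E by lia; easy.
Qed.

(** Termwise differentiation: the second-order remainders sum to [O(|h|^2)], since the coefficients
    [n^2 g n] give a convergent series at height [y/2] and [|h| <= y/2]. *)
Lemma cder_qs g z : sub g -> uhp z -> cder (qs g) z (qs (fun n => tw*(RtoC (INR n)*g n))%C z).
Proof.
intros Hg Hz. have HPI := PI_RGT_0. set (y := Im z). unfold uhp in Hz. fold y in Hz. set (g2 := fun n => (RtoC (INR n)*(RtoC (INR n)*g n))%C).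
have Hg2 : sub g2 by (apply sub_mul_n, sub_mul_n, Hg). destruct (sub_terms g2 (y/2) Hg2 ltac:(lra)) as (K & x & HK & Hx & Ht). set (S := 8*PI^2*(K*(x/(1-x)))).
have HS : 0 <= S. { unfold S. pos. }
have Hmain : forall h, Cmod h <= y/2 -> Cmod (qs g (z+h)%C-qs g z-qs (fun n => tw*(RtoC (INR n)*g n))%C z*h) <= S*Cmod h^2.
{ intros h Hh. have Hzh : uhp (z+h)%C.
  { pose proof (im_le_Cmod h) as I%Rabs_le_between. unfold uhp. change (Im (z+h)%C) with (Im z+Im h). fold y. lra. }
  set (u := fun n => (g n*qpar (z+h)^n+(- (1)*(g n*qpar z^n) + - h*(tw*(RtoC (INR n)*g n)*qpar z^n)))%C).
  have Hu : hs u (qs g (z+h)%C-qs g z-qs (fun n => tw*(RtoC (INR n)*g n))%C z*h)%C.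
  { replace (qs g (z+h)%C-qs g z-qs (fun n => tw*(RtoC (INR n)*g n))%C z*h)%C with
      (qs g (z+h)%C+(- (1)*qs g z + - h*qs (fun n => tw*(RtoC (INR n)*g n))%C z))%C by ring.
    apply hs_plus; [apply hs_qs; assumption|]. apply hs_plus; apply hs_scal; apply hs_qs; try assumption. apply sub_scal, sub_mul_n, Hg. }
  apply (hs_le _ _ _ Hu). intros n. via Cmod_Csum. transitivity (Rsum (seq 1 n) (fun i => 8*PI^2*Cmod h^2*K*x^i)).
  - apply Rsum_le. intros i Hi%in_seq. unfold u. rewrite qpar_shift. set (v := (RtoC (INR i)*(tw*h))%C).
    replace (g i*(qpar z^i*Cexp v)+(- (1)*(g i*qpar z^i) + - h*(tw*(RtoC (INR i)*g i)*qpar z^i)))%C with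
      (g i*qpar z^i*(Cexp v-1-v))%C by alg.
    have Hv : Cmod v = 2*PI*INR i*Cmod h.
    { unfold v. rewrite !Cmod_mult, Cmod_tw, Cmod_R, Rabs_right by pos. ring. }
    have B := Cexp_bound v. rewrite Hv in B. rewrite !Cmod_mult, Cmod_pow_nat, Cmod_qpar.
    specialize (Ht (0, y/2) i (Rle_refl _) ltac:(lia)). change (Im (0, y/2)) with (y/2) in Ht.
    replace (- (2*PI*(y/2-y/2))) with 0 in Ht by ring. rewrite exp_0, Rmult_1_r in Ht.
    unfold g2 in Ht. rewrite !Cmod_mult, Cmod_pow_nat, Cmod_qpar, Cmod_R, (Rabs_right (INR i)) in Ht by pos.
    have Hq : qabs z^i*exp (2*PI*INR i*Cmod h) <= qabs (0, y/2)^i.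
    { unfold qabs. rewrite <- !Rpower_pow by apply exp_pos. unfold Rpower. rewrite !ln_exp, <- exp_plus. apply exp_mono. fold y. change (Im (0, y/2)) with (y/2).
assert (0 <= INR i*(2*PI)*(y/2-Cmod h)) by pos. nra. }
    transitivity (Cmod (g i)*qabs z^i*(2*(2*PI*INR i*Cmod h)^2*exp (2*PI*INR i*Cmod h))).
    { apply Rmult_le_compat_l; [|exact B]. apply Rmult_le_pos; [pos|apply pow_le; left; apply exp_pos]. }
    replace (Cmod (g i)*qabs z^i*(2*(2*PI*INR i*Cmod h)^2*exp (2*PI*INR i*Cmod h))) with
      (8*PI^2*Cmod h^2*(INR i*(INR i*Cmod (g i))*(qabs z^i*exp (2*PI*INR i*Cmod h)))) by ring.
    replace (8*PI^2*Cmod h^2*K*x^i) with (8*PI^2*Cmod h^2*(K*x^i)) by ring. lmul. etransitivity; [|exact Ht]. mono.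
  - rewrite Rsum_scal. have G := Rsum_geom x 1 n ltac:(lra). rewrite pow_1 in G. unfold S.
    replace (8*PI^2*(K*(x/(1-x)))*Cmod h^2) with (8*PI^2*Cmod h^2*K*(x/(1-x))) by ring. mono. }
intros eps He. exists (Rmin (y/2) (eps/(S+1))). split; [apply Rmin_pos; [lra|pos]|]. intros h Hh.
have H1 : Cmod h < y/2 by (eapply Rlt_le_trans; [exact Hh|apply Rmin_l]). have H2 : Cmod h < eps/(S+1) by (eapply Rlt_le_trans; [exact Hh|apply Rmin_r]).
etransitivity; [apply Hmain; lra|]. pose proof (Cmod_ge_0 h). replace (S*Cmod h^2) with (S*Cmod h*Cmod h) by ring. rmul.
transitivity ((S+1)*(eps/(S+1))); [mono|right; field; lra].
Qed.

(** Decay at [i oo], uniform on vertical strips. It fixes the constants of integration, as a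
    constant with this property is 0. *)
Definition dec (G : C -> C) : Prop := forall X0 eps, 0 < eps -> exists Y, forall z, uhp z -> Rabs (Re z) <= X0 -> Y <= Im z -> Cmod (G z) <= eps.

Lemma dec_plus F G : dec F -> dec G -> dec (fun z => F z+G z)%C.
Proof.
intros HF HG X0 eps He. destruct (HF X0 (eps/2) ltac:(lra)) as [Y1 H1]. destruct (HG X0 (eps/2) ltac:(lra)) as [Y2 H2].
exists (Rmax Y1 Y2). intros z Hz Hx Hy. via Cmod_triangle.
specialize (H1 z Hz Hx (Rle_trans _ _ _ (Rmax_l _ _) Hy)). specialize (H2 z Hz Hx (Rle_trans _ _ _ (Rmax_r _ _) Hy)). lra.
Qed.

Lemma dec_scal c G : dec G -> dec (fun z => c*G z)%C.
Proof.
intros HG X0 eps He. pose proof (Cmod_ge_0 c). destruct (HG X0 (eps/(Cmod c+1))) as [Y H1]; [pos|].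
exists Y. intros z Hz Hx Hy. rewrite Cmod_mult. specialize (H1 z Hz Hx Hy). transitivity ((Cmod c+1)*(eps/(Cmod c+1))); [mono|right; field; lra].
Qed.

Lemma dec_zero : dec (fun _ => RtoC 0).
Proof. intros X0 eps He. exists 0. intros. rewrite Cmod_0. lra. Qed.

Lemma dec_Csum {A} (s : list A) (F : A -> C -> C) : (forall a, In a s -> dec (F a)) -> dec (fun z => Csum s (fun a => F a z)).
Proof.
induction s as [|a s IH]; intros Hs; simpl; [apply dec_zero|]. apply dec_plus; [apply Hs; left; easy|apply IH; intros b Hb; apply Hs; right; exact Hb].
Qed.

Lemma dec_ext F G : (forall z, uhp z -> F z = G z) -> dec F -> dec G.
Proof. intros E HF X0 eps He. destruct (HF X0 eps He) as [Y HY]. exists Y. intros z Hz. rewrite <- E by exact Hz. auto. Qed.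

Lemma dec_affine G (al be de : R) : 0 < al -> 0 < de -> dec G -> dec (fun z => G ((RtoC al*z+RtoC be)/RtoC de)%C).
Proof.
intros Ha Hd HG X0 eps He. destruct (HG ((al*X0+Rabs be)/de) eps He) as [Y HY]. exists (Y*de/al). intros z Hz Hx Hy.
have E : ((RtoC al*z+RtoC be)/RtoC de)%C = ((al*Re z+be)/de, al*Im z/de) :> C.
{ unfold Cdiv. rewrite <- RtoC_inv by lra. destruct z as [x y]. alg. }
rewrite E. unfold uhp in *. apply HY; unfold uhp; simpl.
- pos.
- change (Re (?u, _)) with u. unfold Rdiv. rewrite Rabs_mult, (Rabs_right (/ de)) by pos. rmul. via Rabs_triang. apply Rplus_le_compat_r.
  rewrite Rabs_mult, (Rabs_right al) by lra. mono.
- apply Rmult_le_reg_r with (de/al); [pos|]. replace (al*Im z/de*(de/al)) with (Im z) by fd. lra.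
Qed.

Lemma dec_const (c : C) : dec (fun _ => c) -> c = RtoC 0.
Proof.
intros Hc. apply Cmod_small_eq. intros eps He. destruct (Hc 0 eps He) as [Y HY]. specialize (HY (0, Rmax 1 Y)). replace (c-0)%C with c by ring. apply HY.
- unfold uhp. simpl. eapply Rlt_le_trans; [|apply Rmax_l]. lra.
- simpl. go.
- simpl. apply Rmax_r.
Qed.

Lemma dec_zpow_qs g j : sub g -> dec (fun z => z^j*qs g z)%C.
Proof.
intros Hg X0 eps He. have HPI := PI2_1. destruct (qs_decay g 1 Hg ltac:(lra)) as (K & HK & Hd). set (C0 := INR (S j)^j*K*exp (Rabs X0+2*PI)).
exists (Rmax 1 (C0/eps)). intros z Hz Hx Hy. set (y := Im z) in *.
have Hy1 : 1 <= y by (etransitivity; [apply Rmax_l|exact Hy]). have Hy2 : C0/eps <= y by (etransitivity; [apply Rmax_r|exact Hy]).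
specialize (Hd z Hy1). fold y in Hd. rewrite Cmod_mult, Cmod_pow_nat. set (t := Rabs X0+y). have Ht : 0 <= t by (unfold t; pose proof (Rabs_pos X0); lra).
have Hz1 : Cmod z <= t.
{ via Cmod_le_Re_Im. fold y. unfold t. rewrite (Rabs_right y) by lra. pose proof (Rle_abs X0). lra. }
have Hk1 : 1 <= INR (S j) by (apply (le_INR 1); lia).
have Hpow : t^j <= INR (S j)^j*exp t.
{ have E : t <= INR (S j)*exp (t/INR (S j)).
  { have E := exp_ineq1_le (t/INR (S j)). apply (Rmult_le_compat_l (INR (S j))) in E; [|lra]. replace (INR (S j)*(1+t/INR (S j))) with (INR (S j)+t) in E by fd. lra. }
  etransitivity; [apply pow_incr; split; [lra|exact E]|]. rewrite Rpow_mult_distr. lmul.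
  rewrite <- Rpower_pow by apply exp_pos. unfold Rpower. rewrite ln_exp. apply exp_mono.
  replace (INR j*(t/INR (S j))) with (t*(INR j/INR (S j))) by lra. rewrite <- (Rmult_1_r t) at 2. lmul. cancel (INR (S j)). inr. }
transitivity (INR (S j)^j*exp t*(K*exp (- (2*PI*(y-1))))).
- apply Rmult_le_compat; [pos|pos| |exact Hd]. etransitivity; [|exact Hpow]. mono.
- replace (INR (S j)^j*exp t*(K*exp (- (2*PI*(y-1))))) with (INR (S j)^j*K*(exp t*exp (- (2*PI*(y-1))))) by ring. rewrite <- exp_plus. transitivity (C0*exp (- y)).
  + unfold C0. rewrite (Rmult_assoc _ (exp (Rabs X0+2*PI))), <- exp_plus. lmul. apply exp_mono. unfold t. nra.
  + rewrite exp_Ropp. pose proof (exp_ineq1_le y). cancel (exp y).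
    apply (Rmult_le_compat_r eps) in Hy2; [|lra]. unfold Rdiv in Hy2. rewrite Rmult_assoc, Rinv_l in Hy2 by lra. nra.
Qed.

(** Coefficients of the [m]-fold primitive: each integration divides by [2 pi i n]. *)
Definition gm (a : nat -> C) (m n : nat) : C := ((/ (tw*RtoC (INR n)))^m*a n)%C.

Lemma gm_sub a m : sub a -> sub (gm a m).
Proof.
intros Ha. apply (sub_bounded_mul (fun n => (/ (tw*RtoC (INR n)))^m)%C 1); [lra| |exact Ha].
intros n Hn. apply (le_INR 1) in Hn. simpl in Hn. have HPI := PI2_1. rewrite Cmod_pow_nat, <- (pow1 m). apply pow_incr. split; [pos|].
have E : Cmod (tw*RtoC (INR n)) = 2*PI*INR n by (rewrite Cmod_mult, Cmod_tw, Cmod_R, Rabs_right; lra).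
rewrite Cmod_inv, E by (apply Cmod_gt_0; rewrite E; nra). rewrite <- Rinv_1. apply Rinv_le_contravar; nra.
Qed.

Lemma qs_gm_deriv a m z : qs (fun n => tw*(RtoC (INR n)*gm a (S m) n))%C z = qs (gm a m) z.
Proof.
apply qs_ext. intros n Hn. unfold gm. simpl. apply (le_INR 1) in Hn. simpl in Hn. have HPI := PI2_1. alg.
Qed.

(* The primitive of [z^j f_m] vanishing at [i oo], where [f_m] is the [m]-fold primitive of [f]. *)
Fixpoint DD (a : nat -> C) (j m : nat) (z : C) : C :=
  match j with
  | O => qs (gm a (S m)) z
  | S j' => (z^S j'*qs (gm a (S m)) z-RtoC (INR (S j'))*DD a j' (S m) z)%C
  end.

Lemma cder_DD a j m z : sub a -> uhp z -> cder (DD a j m) z (z^j*qs (gm a m) z)%C.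
Proof.
intros Ha. revert m. induction j as [|j IH]; intros m Hz.
- simpl. rewrite Cmult_1_l, <- qs_gm_deriv. apply cder_qs; [apply gm_sub, Ha|exact Hz].
- have D1 := cder_mult _ _ _ _ _ (cder_pow z j) (cder_qs (gm a (S m)) z (gm_sub a (S m) Ha) Hz). rewrite qs_gm_deriv in D1.
  assert (D2 := cder_plus _ _ _ _ _ D1 (cder_scal (- RtoC (INR (S j)))%C _ _ _ (IH (S m) Hz))). cbv beta in D2.
  intros eps He. destruct (D2 eps He) as (d & Hd & Hh). exists d. split; [exact Hd|]. intros h Hlt. specialize (Hh h Hlt).
  cbn [DD]. etransitivity; [|exact Hh]. right. alg.
Qed.

Lemma dec_DD a j m : sub a -> dec (DD a j m).
Proof.
intros Ha. revert m. induction j as [|j IH]; intros m.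
- apply (dec_ext (fun z => z^0*qs (gm a (S m)) z)%C); [alg|]. apply dec_zpow_qs, gm_sub, Ha.
- apply (dec_ext (fun z => z^S j*qs (gm a (S m)) z+(- RtoC (INR (S j)))*DD a j (S m) z)%C); [alg|]. apply dec_plus; [apply dec_zpow_qs, gm_sub, Ha|apply dec_scal, IH].
Qed.

(** * Integral binary forms and the period cocycle *)

Definition zr (n : Z) : C := RtoC (IZR n).

Lemma zr_plus a b : zr (a+b) = (zr a+zr b)%C.
Proof. unfold zr. rewrite plus_IZR, RtoC_plus. auto. Qed.

Lemma zr_mult a b : zr (a*b) = (zr a*zr b)%C.
Proof. unfold zr. rewrite mult_IZR, RtoC_mult. auto. Qed.

Lemma zr_opp a : zr (- a) = (- zr a)%C.
Proof. unfold zr. rewrite opp_IZR, RtoC_opp. auto. Qed.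

Lemma zr_pow a n : zr (a^Z.of_nat n) = (zr a^n)%C.
Proof. unfold zr. rewrite <- pow_IZR, RtoC_pow. auto. Qed.

Lemma zr_inj a b : zr a = zr b -> a = b.
Proof. intros E%RtoC_inj. apply eq_IZR, E. Qed.

Lemma zr_nat n : zr (Z.of_nat n) = RtoC (INR n).
Proof. unfold zr. rewrite <- INR_IZR_INZ. auto. Qed.

Fixpoint Zsum {A} (l : list A) (f : A -> Z) : Z := match l with [] => 0%Z | a :: l => (f a+Zsum l f)%Z end.

Lemma zr_Zsum {A} (l : list A) f : zr (Zsum l f) = Csum l (fun a => zr (f a)).
Proof. induction l as [|a l IH]; simpl; [auto|]. rewrite zr_plus, IH. auto. Qed.

(* A binary form of degree [w] is the sequence [c] of its coefficients: [sum c i X^i Y^(w-i)]. *)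
Definition mulX (c : nat -> Z) (j : nat) : Z := match j with O => 0%Z | S j' => c j' end.

(** Coefficients of [(al X + be Y)^i]. *)
Fixpoint lp (al be : Z) (i : nat) : nat -> Z :=
  match i with
  | O => fun j => if (j =? 0)%nat then 1%Z else 0%Z
  | S i' => fun j => (be*lp al be i' j+al*mulX (lp al be i') j)%Z
  end.

(** The sign [(-1)^n]. *)
Definition zs (n : nat) : Z := if Nat.even n then 1%Z else (-1)%Z.

(** Substitution of [(-Y, X)] for [(X, Y)], the action of [z -> -1/z] on forms. *)
Definition Sact (w : nat) (c : nat -> Z) (j : nat) : Z := if (j <=? w)%nat then (zs (w-j)*c (w-j)%nat)%Z else 0%Z.

(* Substitution of [(al X+be Y, de Y)] for [(X, Y)]. *)
Definition Uact (w : nat) (al be de : Z) (c : nat -> Z) (j : nat) : Z :=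
  Zsum (seq 0 (S w)) (fun i => (c i*de^Z.of_nat (w-i)*lp al be i j)%Z).

Lemma lp_support al be i j : (i < j)%nat -> lp al be i j = 0%Z.
Proof.
revert j. induction i as [|i IH]; intros j Hj; simpl.
- destruct (Nat.eqb_spec j 0); [lia|lia].
- destruct j as [|j]; [lia|]. simpl. rewrite !IH by lia. ring.
Qed.

Lemma lp_eval al be i w z : (i <= w)%nat -> Csum (seq 0 (S w)) (fun j => zr (lp al be i j)*z^j)%C = ((zr al*z+zr be)^i)%C.
Proof.
intros Hi. induction i as [|i IH].
- change (seq 0 (S w)) with (0%nat :: seq 1 w). cbn [Csum]. rewrite Csum_zero; [alg|]. intros j Hj%in_seq. simpl. destruct (Nat.eqb_spec j 0); [lia|alg].
- have Hx : Csum (seq 0 (S w)) (fun j => zr (mulX (lp al be i) j)*z^j)%C = (z*Csum (seq 0 (S w)) (fun j => zr (lp al be i j)*z^j))%C.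
  { change (seq 0 (S w)) with (0%nat :: seq (0+1) w) at 1. cbn [Csum]. rewrite (Csum_seq_shift 0 1). rewrite (Csum_seq_S w 0), Nat.add_0_l, (lp_support al be i w) by lia.
    change (zr (mulX (lp al be i) 0)) with (RtoC 0). rewrite Cmult_plus_distr_l, <- Csum_scal.
    rewrite (Csum_ext (seq 0 w) _ (fun x => z*(zr (lp al be i x)*z^x))%C); [alg|]. intros j _. rewrite Nat.add_1_r. alg. }
  change ((zr al*z+zr be)^S i)%C with ((zr al*z+zr be)*(zr al*z+zr be)^i)%C.
  rewrite <- (IH ltac:(lia)), Cmult_plus_distr_r, <- Cmult_assoc, <- Hx, <- !Csum_scal, <- Csum_plus.
  apply Csum_ext. intros j _. cbn [lp]. rewrite zr_plus, !zr_mult. ring.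
Qed.

Definition evp (w : nat) (c : nat -> Z) (z : C) : C := Csum (seq 0 (S w)) (fun i => zr (c i)*z^i)%C.

Lemma ev_Uact w al be de c z : evp w (Uact w al be de c) z =
  Csum (seq 0 (S w)) (fun i => zr (c i)*zr de^(w-i)*(zr al*z+zr be)^i)%C.
Proof.
unfold evp, Uact. rewrite (Csum_ext _ _ (fun j => Csum (seq 0 (S w)) (fun i => zr (c i)*zr de^(w-i)*(zr (lp al be i j)*z^j))%C)).
- rewrite Csum_swap. apply Csum_ext. intros i Hi%in_seq. rewrite Csum_scal, lp_eval by lia. auto.
- intros j _. rewrite zr_Zsum, <- Csum_scal_r. apply Csum_ext. intros i _. rewrite !zr_mult, zr_pow. ring.
Qed.

Lemma Csum_rev w (f : nat -> C) : Csum (seq 0 (S w)) f = Csum (seq 0 (S w)) (fun i => f (w-i)%nat).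
Proof.
rewrite <- (Csum_map (fun i => (w-i)%nat)). apply Csum_perm, NoDup_Permutation.
- apply seq_NoDup.
- apply NoDup_map_NoDup_ForallPairs; [|apply seq_NoDup]. intros x y Hx Hy E. sq.
- intros x. rewrite in_map_iff, in_seq. split.
  + intros Hx. exists (w-x)%nat; go.
  + intros (y & <- & Hy). lia.
Qed.

(** The primitive of [c(z, 1) f(z)] that vanishes at [i oo], an Eichler integral. *)
Definition FP (a : nat -> C) (w : nat) (c : nat -> Z) (z : C) : C := Csum (seq 0 (S w)) (fun i => zr (c i)*DD a i 0 z)%C.

Lemma qs_gm0 a z : qs (gm a 0) z = qs a z.
Proof. apply qs_ext. alg. Qed.

Lemma cder_FP a w c z : sub a -> uhp z -> cder (FP a w c) z (evp w c z*qs a z)%C.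
Proof.
intros Ha Hz. unfold evp. rewrite <- Csum_scal_r. apply cder_Csum. intros i _. rewrite <- qs_gm0, <- Cmult_assoc. apply cder_scal, cder_DD; assumption.
Qed.

Lemma dec_FP a w c : sub a -> dec (FP a w c).
Proof. intros Ha. apply dec_Csum. intros i _. apply dec_scal, dec_DD, Ha. Qed.

Lemma cder_ext f g z l : (forall z, f z = g z) -> cder f z l -> cder g z l.
Proof. intros E Hf eps He. destruct (Hf eps He) as (d & Hd & Hh). exists d. split; [exact Hd|]. intros h. rewrite <- !E. auto. Qed.

Lemma dec_primitive_zero G : (forall z, uhp z -> cder G z (RtoC 0)) -> dec G -> forall z, uhp z -> G z = RtoC 0.
Proof.
intros Hd Hdec z Hz. apply dec_const. apply (dec_ext G); [|exact Hdec]. intros z' Hz'. apply cder_unique_zero; assumption.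
Qed.

Lemma uhp_Ci : uhp Ci.
Proof. unfold uhp. simpl. lra. Qed.

Lemma zs_S i : zs (S i) = (- zs i)%Z.
Proof. unfold zs. rewrite Nat.even_succ, <- Nat.negb_even. destruct (Nat.even i); easy. Qed.

Lemma zs_pow (x : C) i : ((- x)^i)%C = (zr (zs i)*x^i)%C.
Proof.
induction i as [|i IH]; [change (zr (zs 0)) with (RtoC 1); simpl; ring|]. rewrite zs_S, zr_opp. simpl. rewrite IH. ring.
Qed.

(** The integral of [z^i f] from [i oo] to 0. It is the constant by which the primitives fail to be
    exchanged by [z -> -1/z], read off at the fixed point [Ci]. *)
Definition phi (a : nat -> C) (w i : nat) : C := (DD a i 0 Ci-zr (zs i)*DD a (w-i) 0 Ci)%C.

Lemma DD_S a w i z : sub a -> (forall z, uhp z -> qs a (- / z)%C = (z^S (S w)*qs a z)%C) -> (i <= w)%nat -> uhp z ->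
  DD a i 0 (- / z)%C = (zr (zs i)*DD a (w-i) 0 z+phi a w i)%C.
Proof.
intros Ha HS Hi Hz. set (G := fun z => (DD a i 0 (- / z) + - zr (zs i)*DD a (w-i) 0 z)%C).
have HG : forall z, uhp z -> cder G z (RtoC 0).
{ intros t Ht. have Ht0 := H_neq0 t Ht. have D1 := cder_comp (DD a i 0) (fun z => - / z)%C t _ _ (cder_inv_neg t Ht0) (cder_DD a i 0 _ Ha (H_inv_neg t Ht)).
  have D2 := cder_plus _ _ _ _ _ D1 (cder_scal (- zr (zs i))%C _ _ _ (cder_DD a (w-i) 0 t Ha Ht)). cbv beta in D2.
  match type of D2 with cder _ _ ?l => replace (RtoC 0) with l; [exact D2|] end.
  rewrite !qs_gm0, HS by exact Ht. rewrite zs_pow. replace (S (S w)) with (i+((w-i)+2))%nat by lia. rewrite !Cpow_add_r.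
  rewrite Cpow_inv by exact Ht0. simpl. field. split; [exact Ht0|]. apply Cpow_nz, Ht0. }
have E := cder_unique_zero G HG z Ci Hz uhp_Ci. unfold G in E. replace (- / Ci)%C with Ci in E.
- unfold phi. replace (DD a i 0 (- / z)) with (DD a i 0 (- / z) + - zr (zs i)*DD a (w-i) 0 z+zr (zs i)*DD a (w-i) 0 z)%C by ring. rewrite E. ring.
- alg.
Qed.

Definition phiL (a : nat -> C) (w : nat) (c : nat -> Z) : C := Csum (seq 0 (S w)) (fun i => zr (c i)*phi a w i)%C.

Lemma FP_S a w c z : sub a -> (forall z, uhp z -> qs a (- / z)%C = (z^S (S w)*qs a z)%C) -> uhp z ->
  FP a w c (- / z)%C = (FP a w (Sact w c) z+phiL a w c)%C.
Proof.
intros Ha HS Hz. unfold FP at 2. rewrite Csum_rev. unfold FP, phiL. rewrite <- Csum_plus. apply Csum_ext. intros i Hi%in_seq.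
rewrite (DD_S a w i z Ha HS ltac:(lia) Hz). unfold Sact. destruct (Nat.leb_spec (w-i) w); [|lia]. replace (w-(w-i))%nat with i by lia. rewrite zr_mult. ring.
Qed.

Lemma cder_affine (al be : C) z : cder (fun z => al*z+be)%C z al.
Proof.
have D := cder_plus _ _ _ _ _ (cder_scal al _ _ _ (cder_id z)) (cder_const be z). cbv beta in D. replace (al*1+0)%C with al in D by ring. exact D.
Qed.

Lemma qs_shift_unit a z e : (e = 1 \/ e = -1)%Z -> qs a (z+zr e)%C = qs a z.
Proof.
intros [-> | ->]; [apply qs_plus_1|]. rewrite <- (qs_plus_1 a (z+zr (-1))%C). f_equal. alg.
Qed.

Lemma uhp_shift z e : uhp z -> uhp (z+zr e)%C.
Proof. unfold uhp. destruct z. simpl. lra. Qed.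

(** A translation contributes no period: the two sides have the same derivative, and both vanish at
    [i oo]. *)
Lemma FP_T a w c z e : sub a -> (e = 1 \/ e = -1)%Z -> uhp z -> FP a w c (z+zr e)%C = FP a w (Uact w 1 e 1 c) z.
Proof.
intros Ha He Hz. set (G := fun z => (FP a w c (1*z+zr e) + - (1)*FP a w (Uact w 1 e 1 c) z)%C).
have HG : forall z, uhp z -> cder G z (RtoC 0).
{ intros t Ht. assert (Ht' : uhp (1*t+zr e)%C) by (rewrite Cmult_1_l; apply uhp_shift, Ht).
  have D1 := cder_comp (FP a w c) (fun z => 1*z+zr e)%C t _ _ (cder_affine 1 (zr e) t) (cder_FP a w c _ Ha Ht').
  have D2 := cder_plus _ _ _ _ _ D1 (cder_scal (- (1))%C _ _ _ (cder_FP a w (Uact w 1 e 1 c) t Ha Ht)). cbv beta in D2.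
  match type of D2 with cder _ _ ?l => replace (RtoC 0) with l; [exact D2|] end. rewrite ev_Uact, Cmult_1_l, (qs_shift_unit a t e He). unfold evp.
  rewrite (Csum_ext _ (fun i => zr (c i)*zr 1^(w-i)*(zr 1*t+zr e)^i)%C (fun i => zr (c i)*(t+zr e)^i)%C); [ring|].
  intros i _. change (zr 1) with (RtoC 1). rewrite Cmult_1_l. replace (RtoC 1^(w-i))%C with (RtoC 1); [ring|].
  induction (w-i)%nat as [|m IH]; [auto|]. simpl. rewrite <- IH. ring. }
have Hdec : dec G.
{ apply dec_plus; [|apply dec_scal, dec_FP, Ha]. apply (dec_ext (fun z => FP a w c ((RtoC 1*z+RtoC (IZR e))/RtoC 1)%C)).
  - intros t _. f_equal. alg.
  - apply dec_affine; [lra|lra|apply dec_FP, Ha]. }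
have E := dec_primitive_zero G HG Hdec z Hz. unfold G in E. rewrite Cmult_1_l in E.
replace (FP a w c (z+zr e)) with (FP a w c (z+zr e) + - (1)*FP a w (Uact w 1 e 1 c) z+FP a w (Uact w 1 e 1 c) z)%C by ring. rewrite E. ring.
Qed.

(** [GS] is [z -> -1/z], [GT] the translation by 1 and [GU] its inverse. They act on points by [gz],
    on forms by [ga] and on integer vectors by [gv]. *)
Inductive gen : Type := GS | GT | GU.

Definition gz (x : gen) (z : C) : C := match x with GS => (- / z)%C | GT => (z+zr 1)%C | GU => (z+zr (-1))%C end.

Definition ga (w : nat) (x : gen) (c : nat -> Z) : nat -> Z :=
  match x with GS => Sact w c | GT => Uact w 1 1 1 c | GU => Uact w 1 (-1) 1 c end.

Definition gv (x : gen) (v : Z*Z) : Z*Z :=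
  match x with GS => (- snd v, fst v)%Z | GT => (fst v+snd v, snd v)%Z | GU => (fst v-snd v, snd v)%Z end.

Definition wz (s : list gen) (z : C) : C := fold_right gz z s.

Definition wv (s : list gen) (v : Z*Z) : Z*Z := fold_right gv v s.

Fixpoint wa (w : nat) (s : list gen) (c : nat -> Z) : nat -> Z := match s with [] => c | x :: s => wa w s (ga w x c) end.

(* The value at [c] of the period cocycle on the word [s], as a form to be paired with the periods [phi]. *)
Fixpoint cw (w : nat) (s : list gen) (c : nat -> Z) : nat -> Z :=
  match s with
  | [] => fun _ => 0%Z
  | x :: s => fun i => ((match x with GS => c i | _ => 0%Z end)+cw w s (ga w x c) i)%Z
  end.

Lemma uhp_wz s z : uhp z -> uhp (wz s z).
Proof.
intros Hz. induction s as [|x s IH]; [exact Hz|]. simpl. destruct x; simpl; [apply H_inv_neg, IH|apply uhp_shift, IH|apply uhp_shift, IH].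
Qed.

Lemma phiL_plus a w c c' : phiL a w (fun i => (c i+c' i)%Z) = (phiL a w c+phiL a w c')%C.
Proof. unfold phiL. rewrite <- Csum_plus. apply Csum_ext. intros i _. rewrite zr_plus. ring. Qed.

Lemma phiL_zero a w : phiL a w (fun _ => 0%Z) = RtoC 0.
Proof. apply Csum_zero. alg. Qed.

Lemma FP_word a w s c z : sub a -> (forall z, uhp z -> qs a (- / z)%C = (z^S (S w)*qs a z)%C) -> uhp z ->
  FP a w c (wz s z) = (FP a w (wa w s c) z+phiL a w (cw w s c))%C.
Proof.
intros Ha HS Hz. revert c. induction s as [|x s IH]; intros c.
- simpl. rewrite phiL_zero. ring.
- cbn [cw wa]. rewrite phiL_plus. have Hs := uhp_wz s z Hz. change (wz (x :: s) z) with (gz x (wz s z)). destruct x; cbn [gz ga].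
  + rewrite (FP_S a w c _ Ha HS Hs), IH. alg.
  + rewrite (FP_T a w c _ 1 Ha ltac:(left; easy) Hs), IH, phiL_zero. fd.
  + rewrite (FP_T a w c _ (-1) Ha ltac:(right; easy) Hs), IH, phiL_zero. fd.
Qed.

(** By [FP_word] the difference of the two values equals a difference of primitives; a constant that
    decays at [i oo] is 0. All the relations between periods have this source. *)
Lemma word_relation a w s s' c : sub a -> (forall z, uhp z -> qs a (- / z)%C = (z^S (S w)*qs a z)%C) ->
  (forall z, uhp z -> wz s z = wz s' z) -> phiL a w (cw w s c) = phiL a w (cw w s' c).
Proof.
intros Ha HS E. have D : (phiL a w (cw w s c)-phiL a w (cw w s' c))%C = RtoC 0.
{ apply dec_const. apply (dec_ext (fun z => FP a w (wa w s' c) z + - (1)*FP a w (wa w s c) z)%C).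
  - intros z Hz. have E1 := FP_word a w s c z Ha HS Hz. have E2 := FP_word a w s' c z Ha HS Hz. rewrite (E z Hz) in E1. rewrite E1 in E2.
    replace (phiL a w (cw w s c)) with (FP a w (wa w s c) z+phiL a w (cw w s c)-FP a w (wa w s c) z)%C by ring. rewrite E2. ring.
  - apply dec_plus; [|apply dec_scal]; apply dec_FP, Ha. }
replace (phiL a w (cw w s c)) with (phiL a w (cw w s c)-phiL a w (cw w s' c)+phiL a w (cw w s' c))%C by ring. rewrite D. ring.
Qed.

Lemma lin_neq0 p q z : uhp z -> (p <> 0 \/ q <> 0)%Z -> (zr p*z+zr q)%C <> RtoC 0.
Proof.
intros Hz Hpq E. unfold uhp in Hz. destruct z as [x y]. simpl in Hz. have EI := f_equal Im E. have ER := f_equal Re E. simpl in EI, ER.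
assert (IZR p*y = 0) by lra. apply Rmult_integral in H. destruct H as [H|H]; [|lra].
rewrite H in ER. apply eq_IZR in H. assert (IZR q = 0) by lra. apply eq_IZR in H0. lia.
Qed.

Definition Tq (q : Z) : list gen := if (0 <=? q)%Z then repeat GT (Z.to_nat q) else repeat GU (Z.to_nat (- q)).

Lemma wz_Tq q s z : wz (Tq q ++ s) z = (wz s z+zr q)%C.
Proof.
have P : forall n, wz (repeat GT n ++ s) z = (wz s z+zr (Z.of_nat n))%C.
{ induction n as [|n IH]; [alg|]. change (wz (repeat GT (S n) ++ s) z) with (wz (repeat GT n ++ s) z+zr 1)%C. rewrite IH, Nat2Z.inj_succ, <- Z.add_1_r, zr_plus. ring. }
have M : forall n, wz (repeat GU n ++ s) z = (wz s z+zr (- Z.of_nat n))%C.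
{ induction n as [|n IH]; [alg|]. change (wz (repeat GU (S n) ++ s) z) with (wz (repeat GU n ++ s) z+zr (-1))%C.
  rewrite IH. replace (- Z.of_nat (S n))%Z with (- Z.of_nat n + -1)%Z by lia. rewrite zr_plus. ring. }
unfold Tq. destruct (Z.leb_spec 0 q); [rewrite P|rewrite M]; do 2 f_equal; lia.
Qed.

Lemma wv_Tq q s v : wv (Tq q ++ s) v = (fst (wv s v)+q*snd (wv s v), snd (wv s v))%Z.
Proof.
have P : forall n, wv (repeat GT n ++ s) v = (fst (wv s v)+Z.of_nat n*snd (wv s v), snd (wv s v))%Z.
{ induction n as [|n IH]; [alg|]. change (wv (repeat GT (S n) ++ s) v) with (gv GT (wv (repeat GT n ++ s) v)). rewrite IH. cbn [gv fst snd]. alg. }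
have M : forall n, wv (repeat GU n ++ s) v = (fst (wv s v)-Z.of_nat n*snd (wv s v), snd (wv s v))%Z.
{ induction n as [|n IH]; [alg|]. change (wv (repeat GU (S n) ++ s) v) with (gv GU (wv (repeat GU n ++ s) v)). rewrite IH. cbn [gv fst snd]. alg. }
unfold Tq. destruct (Z.leb_spec 0 q); [rewrite P, Z2Nat.id by lia; easy|rewrite M, Z2Nat.id by lia; f_equal; ring].
Qed.

(* Euclid's algorithm: an integral matrix of positive determinant is a word times an upper triangular matrix. *)
Lemma euclid_word (N : nat) : forall x u y v n : Z, (Z.abs y <= Z.of_nat N)%Z -> (x*v-u*y = n)%Z -> (0 < n)%Z ->
  exists s al be de, (0 < al)%Z /\ (0 < de)%Z /\ (wv s (al, 0%Z) = (x, y) \/ wv s (al, 0%Z) = (- x, - y)%Z) /\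
    forall z, uhp z -> ((zr x*z+zr u)/(zr y*z+zr v))%C = wz s ((zr al*z+zr be)/zr de)%C.
Proof.
induction N as [|N IH]; intros x u y v n Hy Hdet Hn.
- assert (y = 0)%Z as -> by lia. destruct (Z_lt_le_dec 0 x) as [Hx|Hx].
  + exists [], x, u, v. split; [exact Hx|]. split; [nia|]. split; [auto|]. intros z Hz. simpl. f_equal. alg.
  + have Hx0 : (x < 0)%Z by (assert (x <> 0)%Z by lia; lia). exists [], (- x)%Z, (- u)%Z, (- v)%Z. split; [lia|]. split; [lia|]. split; [auto|]. intros z Hz. simpl.
    have Hv : zr v <> RtoC 0 by (intros E; apply (zr_inj v 0) in E; lia). rewrite !zr_opp. replace (zr 0) with (RtoC 0) by easy. fd.
- destruct (Z.eq_dec y 0) as [Hy0|Hy0]; [apply (IH x u y v n); [lia|exact Hdet|exact Hn]|].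
  set (q := (x/y)%Z). set (r := (x mod y)%Z). have Er : (x = y*q+r)%Z by (apply Z.div_mod, Hy0). have Hr : (Z.abs r < Z.abs y)%Z by (apply Z.mod_bound_abs, Hy0).
  set (u' := (u-q*v)%Z). destruct (IH y v (- r)%Z (- u')%Z n) as (s & al & be & de & Hal & Hde & Hcol & Hact); [lia|lia|exact Hn|].
  exists (Tq q ++ GS :: s), al, be, de. split; [exact Hal|]. split; [exact Hde|]. split.
  + rewrite wv_Tq. change (wv (GS :: s) (al, 0%Z)) with (gv GS (wv s (al, 0%Z))). destruct Hcol as [-> | ->]; cbn [gv fst snd]; [left|right]; f_equal; lia.
  + intros z Hz. rewrite wz_Tq. change (wz (GS :: s) ?t) with (- / wz s t)%C. rewrite <- Hact by exact Hz.
    have N1 : (zr y*z+zr v)%C <> RtoC 0 by (apply lin_neq0; [exact Hz|lia]).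
    have N2 : (zr (- r)*z+zr (- u'))%C <> RtoC 0.
    { apply lin_neq0; go. }
    have Ex : zr x = (zr y*zr q-zr (- r))%C by (rewrite Er, zr_plus, zr_mult, zr_opp; ring).
    have Eu : zr u = (- zr (- u')+zr q*zr v)%C by (unfold u'; rewrite zr_opp; unfold Z.sub; rewrite zr_plus, zr_opp, zr_mult; ring). rewrite Ex, Eu. fd.
Qed.

(** * Hecke operators on periods *)

Definition hz (n d b : nat) (z : C) : C := ((RtoC (INR (n/d))*z+RtoC (INR b))/RtoC (INR d))%C.

Lemma hecke_qs k f A (Hf : normalized_eigenform k f A) n z : (1 <= n)%nat -> uhp z ->
  Csum (seq 1 n) (fun d => if dvdb d n then RtoC (INR (n/d)^k/INR n)*Csum (seq 0 d) (fun b => qs (acoef k A) (hz n d b z)) else RtoC 0)%C =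
  (acoef k A n*qs (acoef k A) z)%C.
Proof.
intros Hn Hz. destruct (hecke_eigenvalue _ _ _ Hf n z Hn Hz) as [E _]. rewrite <- (f_qs _ _ _ Hf z Hz), <- E.
unfold hecke_operator. rewrite sum_n_m_Csum, <- Csum_scal. apply Csum_ext. intros d Hd%in_seq.
change (n mod d =? 0)%nat with (dvdb d n). destruct (dvdb d n) eqn:Ed; [|ring]. rewrite sum_n_Csum by lia.
have Hn0 : INR n <> 0 by pos. unfold Rdiv. rewrite RtoC_mult, RtoC_inv, RtoC_pow by exact Hn0.
rewrite (Csum_ext (seq 0 d) (fun b => qs (acoef k A) (hz n d b z)) (fun b => f ((RtoC (INR (n/d))*z+RtoC (INR b))/RtoC (INR d))%C)); [ring|].
intros b _. symmetry. apply (f_qs _ _ _ Hf). apply H_affine; [exact Hz|apply Nat.div_le_lower_bound; lia|lia].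
Qed.

(** The form is moved by the adjugate of the Hecke matrix, [X -> d X - b Y] and [Y -> (n/d) Y], so
    that at the image point it takes its old value up to a constant factor, as [ev_hact] states. *)
Definition hact (w n d b : nat) (c : nat -> Z) : nat -> Z := Uact w (Z.of_nat d) (- Z.of_nat b) (Z.of_nat (n/d)) c.

Lemma ev_hact w n d b c z : (1 <= d)%nat -> evp w (hact w n d b c) (hz n d b z) = (RtoC (INR (n/d))^w*evp w c z)%C.
Proof.
intros Hd. have Hd0 : RtoC (INR d) <> RtoC 0 by (intros E; apply RtoC_inj in E; apply (not_0_INR d); [lia|exact E]).
unfold hact. rewrite ev_Uact. unfold evp. rewrite <- Csum_scal. apply Csum_ext. intros i Hi%in_seq.
rewrite zr_opp, !zr_nat. replace (RtoC (INR d)*hz n d b z + - RtoC (INR b))%C with (RtoC (INR (n/d))*z)%C by alg.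
rewrite Cpow_mult_l. replace w with ((w-i)+i)%nat at 2 by lia. rewrite Cpow_add_r. ring.
Qed.

Lemma cder_hz n d b z : (1 <= d)%nat -> cder (hz n d b) z (RtoC (INR (n/d)/INR d))%C.
Proof.
intros Hd. have Hd1 : INR d <> 0 by pos. have Hd0 : RtoC (INR d) <> RtoC 0 by (intros E; apply RtoC_inj in E; contradiction).
apply (cder_ext (fun z => RtoC (INR (n/d)/INR d)*z+RtoC (INR b/INR d))%C); [|apply cder_affine]. alg.
Qed.

(** Both sides are primitives of [a n c(z, 1) f(z)] that vanish at [i oo]. *)
Lemma hecke_FP k w f A (Hf : normalized_eigenform k f A) n c z : k = S (S w) -> (1 <= n)%nat -> uhp z ->
  Csum (seq 1 n) (fun d => if dvdb d n then Csum (seq 0 d) (fun b => FP (acoef k A) w (hact w n d b c) (hz n d b z)) else RtoC 0) =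
  (acoef k A n*FP (acoef k A) w c z)%C.
Proof.
intros Hk Hn Hz. set (a := acoef k A) in *. have Ha : sub a by apply (acoef_sub _ _ _ Hf).
set (G := fun z => (Csum (seq 1 n) (fun d => if dvdb d n then Csum (seq 0 d) (fun b => FP a w (hact w n d b c) (hz n d b z)) else RtoC 0) + - a n*FP a w c z)%C).
have Hhz : forall d b t, (1 <= d <= n)%nat -> uhp t -> uhp (hz n d b t).
{ intros d b t Hd Ht. apply H_affine; [exact Ht|apply Nat.div_le_lower_bound; lia|lia]. }
have HG : forall z, uhp z -> cder G z (RtoC 0).
{ intros t Ht. have D1 : cder (fun z => Csum (seq 1 n) (fun d => if dvdb d n then Csum (seq 0 d) (fun b => FP a w (hact w n d b c) (hz n d b z)) else RtoC 0)) t
    (Csum (seq 1 n) (fun d => if dvdb d n then Csum (seq 0 d) (fun b => evp w (hact w n d b c) (hz n d b t)*qs a (hz n d b t)*RtoC (INR (n/d)/INR d)) else RtoC 0)%C).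
  { apply (cder_Csum (seq 1 n) (fun d z => if dvdb d n then Csum (seq 0 d) (fun b => FP a w (hact w n d b c) (hz n d b z)) else RtoC 0)
      (fun d => if dvdb d n then Csum (seq 0 d) (fun b => evp w (hact w n d b c) (hz n d b t)*qs a (hz n d b t)*RtoC (INR (n/d)/INR d)) else RtoC 0)%C).
    intros d Hd%in_seq. destruct (dvdb d n); [|apply cder_const].
    apply cder_Csum. intros b _. apply (cder_comp (FP a w (hact w n d b c)) (hz n d b)); [apply cder_hz; lia|]. apply cder_FP; [exact Ha|apply Hhz; [lia|exact Ht]]. }
  have D2 := cder_plus _ _ _ _ _ D1 (cder_scal (- a n)%C _ _ _ (cder_FP a w c t Ha Ht)). cbv beta in D2.
  match type of D2 with cder _ _ ?l => replace (RtoC 0) with l; [exact D2|] end. have E := hecke_qs k f A Hf n t Hn Ht. fold a in E.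
  match goal with |- (?S1+_)%C = _ => replace S1 with (evp w c t*(a n*qs a t))%C; [ring|] end.
  rewrite <- E, <- Csum_scal. apply Csum_ext. intros d Hd%in_seq. destruct (dvdb d n) eqn:Ed; [|ring].
  rewrite <- !Csum_scal. apply Csum_ext. intros b _. rewrite ev_hact by lia. apply dvdb_iff in Ed; [|lia]. destruct Ed as [e Ee]. rewrite Ee, Nat.div_mul by lia.
  have Hd0 : INR d <> 0 by pos. have He0 : INR e <> 0 by pos.
  replace (INR e^k/INR (e*d)) with (INR e^w*(INR e/INR d)) by (rewrite mult_INR, Hk; simpl; field; split; assumption). rewrite RtoC_mult, RtoC_pow. ring. }
have Hdec : dec G.
{ apply dec_plus; [|apply dec_scal, dec_FP, Ha]. apply (dec_Csum (seq 1 n) (fun d z => if dvdb d n then Csum (seq 0 d) (fun b => FP a w (hact w n d b c) (hz n d b z)) else RtoC 0)).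
  intros d Hd%in_seq. destruct (dvdb d n); [|apply dec_zero]. apply dec_Csum. intros b _. apply dec_affine; [apply lt_0_INR, Nat.div_str_pos; lia|pos|apply dec_FP, Ha]. }
have E := dec_primitive_zero G HG Hdec z Hz. unfold G in E.
match goal with |- ?S1 = _ => replace S1 with (S1 + - a n*FP a w c z+a n*FP a w c z)%C by ring end. rewrite E. ring.
Qed.

(** When [a n = 0] the sum in [hecke_FP] vanishes, in particular at [-1/z]. There each matrix
    factors as a word times an upper triangular one; the triangular parts decay at [i oo], and what
    remains is a relation between periods. The first conclusion records that the lower entry of the
    word's first column divides [d], which makes it prime to 3 when [n] is. *)
Lemma period_relation k w f A (Hf : normalized_eigenform k f A) n : k = S (S w) -> (1 <= n)%nat -> acoef k A n = RtoC 0 ->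
  exists ws : nat -> nat -> list gen,
    (forall d b, (1 <= d)%nat -> dvdb d n = true -> exists al, (al*snd (wv (ws d b) (1, 0)) = Z.of_nat d \/ al*snd (wv (ws d b) (1, 0)) = - Z.of_nat d)%Z) /\
    forall c, phiL (acoef k A) w (fun i => Zsum (seq 1 n) (fun d => if dvdb d n then Zsum (seq 0 d) (fun b => cw w (ws d b) (hact w n d b c) i) else 0%Z)) = RtoC 0.
Proof.
intros Hk Hn H0. set (a := acoef k A) in *. have Ha : sub a by apply (acoef_sub _ _ _ Hf).
have HS : forall z, uhp z -> qs a (- / z)%C = (z^S (S w)*qs a z)%C by (intros z Hz; rewrite <- Hk; apply (qs_S _ _ _ Hf z Hz)).
have Hex : forall db : nat*nat, exists s, (1 <= fst db)%nat -> dvdb (fst db) n = true -> exists al be de, (0 < al)%Z /\ (0 < de)%Z /\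
   (wv s (al, 0%Z) = (Z.of_nat (snd db), Z.of_nat (fst db)) \/ wv s (al, 0%Z) = (- Z.of_nat (snd db), - Z.of_nat (fst db))%Z) /\
   forall z, uhp z -> hz n (fst db) (snd db) (- / z)%C = wz s ((zr al*z+zr be)/zr de)%C.
{ intros [d b]. cbn [fst snd]. destruct (le_lt_dec 1 d) as [Hd|Hd]; [|exists []; intros; lia].
  destruct (dvdb d n) eqn:Ed; [|exists []; intros; discriminate]. apply dvdb_iff in Ed; [|exact Hd]. destruct Ed as [e Ee].
  destruct (euclid_word d (Z.of_nat b) (- Z.of_nat e) (Z.of_nat d) 0 (Z.of_nat n)) as (s & al & be & de & Hal & Hde & Hcol & Hact); [lia|lia|lia|].
  exists s. intros _ _. exists al, be, de. split; [exact Hal|]. split; [exact Hde|]. split; [exact Hcol|]. intros z Hz. rewrite <- Hact by exact Hz.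
  unfold hz. rewrite Ee, Nat.div_mul by lia. rewrite zr_opp, !zr_nat. alg. }
set (ws := fun d b => proj1_sig (constructive_indefinite_description _ (Hex (d, b)))).
have Hws : forall d b, (1 <= d)%nat -> dvdb d n = true -> exists al be de, (0 < al)%Z /\ (0 < de)%Z /\
   (wv (ws d b) (al, 0%Z) = (Z.of_nat b, Z.of_nat d) \/ wv (ws d b) (al, 0%Z) = (- Z.of_nat b, - Z.of_nat d)%Z) /\
   forall z, uhp z -> hz n d b (- / z)%C = wz (ws d b) ((zr al*z+zr be)/zr de)%C.
{ intros d b. exact (proj2_sig (constructive_indefinite_description _ (Hex (d, b)))). }
exists ws. split.
- intros d b Hd Ed. destruct (Hws d b Hd Ed) as (al & be & de & Hal & _ & Hcol & _). exists al.
  have Hlin : forall s, wv s (al, 0%Z) = (al*fst (wv s (1, 0)%Z), al*snd (wv s (1, 0)%Z))%Z.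
  { induction s as [|x s IH]; [alg|]. change (wv (x :: s) (al, 0%Z)) with (gv x (wv s (al, 0%Z))). change (wv (x :: s) (1, 0)%Z) with (gv x (wv s (1, 0)%Z)).
    rewrite IH. destruct x; cbn [gv fst snd]; f_equal; ring. }
  rewrite Hlin in Hcol. destruct Hcol as [E|E]; injection E as _ E2; [left|right]; exact E2.
- intros c. have HT : phiL a w (fun i => Zsum (seq 1 n) (fun d => if dvdb d n then Zsum (seq 0 d) (fun b => cw w (ws d b) (hact w n d b c) i) else 0%Z)) =
    Csum (seq 1 n) (fun d => if dvdb d n then Csum (seq 0 d) (fun b => phiL a w (cw w (ws d b) (hact w n d b c))) else RtoC 0).
  { have HZ : forall {X} (l : list X) (u : X -> nat -> Z), phiL a w (fun i => Zsum l (fun x => u x i)) = Csum l (fun x => phiL a w (u x)).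
    { intros X l u. induction l as [|x l IH]; cbn [Zsum Csum]; [apply phiL_zero|]. rewrite phiL_plus, IH. auto. }
    rewrite (HZ _ (seq 1 n) (fun d i => if dvdb d n then Zsum (seq 0 d) (fun b => cw w (ws d b) (hact w n d b c) i) else 0%Z)).
    apply Csum_ext. intros d _. destruct (dvdb d n); [|apply phiL_zero]. auto. }
  rewrite HT. apply dec_const. have Hd : forall d b, exists T, (1 <= d)%nat -> dvdb d n = true -> dec T /\ forall z, uhp z ->
    FP a w (hact w n d b c) (hz n d b (- / z)%C) = (T z+phiL a w (cw w (ws d b) (hact w n d b c)))%C.
  { intros d b. destruct (le_lt_dec 1 d) as [Hd|Hd]; [|exists (fun _ => RtoC 0); intros; lia].
    destruct (dvdb d n) eqn:Ed; [|exists (fun _ => RtoC 0); intros; discriminate].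
    destruct (Hws d b Hd Ed) as (al & be & de & Hal & Hde & _ & Hact). apply IZR_lt in Hal. apply IZR_lt in Hde.
    exists (fun z => FP a w (wa w (ws d b) (hact w n d b c)) ((zr al*z+zr be)/zr de)%C). intros _ _. split.
    - apply dec_affine; [exact Hal|exact Hde|apply dec_FP, Ha].
    - intros z Hz. rewrite (Hact z Hz). apply FP_word; [exact Ha|exact HS|]. unfold uhp in *. unfold zr, Cdiv. rewrite <- RtoC_inv by lra. destruct z as [x y]. simpl in *.
      pos. }
  set (T := fun d b => proj1_sig (constructive_indefinite_description _ (Hd d b))).
  have HTd : forall d b, (1 <= d)%nat -> dvdb d n = true -> dec (T d b) /\ forall z, uhp z ->
    FP a w (hact w n d b c) (hz n d b (- / z)%C) = (T d b z+phiL a w (cw w (ws d b) (hact w n d b c)))%C.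
  { intros d b. exact (proj2_sig (constructive_indefinite_description _ (Hd d b))). }
  apply (dec_ext (fun z => - (1)*Csum (seq 1 n) (fun d => if dvdb d n then Csum (seq 0 d) (fun b => T d b z) else RtoC 0))%C).
  + intros z Hz. have E := hecke_FP k w f A Hf n c (- / z)%C Hk Hn (H_inv_neg z Hz). fold a in E. rewrite H0, Cmult_0_l in E.
    rewrite (Csum_ext (seq 1 n) _ (fun d => (if dvdb d n then Csum (seq 0 d) (fun b => T d b z) else RtoC 0) +
      (if dvdb d n then Csum (seq 0 d) (fun b => phiL a w (cw w (ws d b) (hact w n d b c))) else RtoC 0))%C) in E.
    * rewrite Csum_plus in E. match goal with |- (_ * ?u)%C = ?v => replace v with (u+v + - (1)*u)%C by ring end. rewrite E. ring.
    * intros d Hd'%in_seq. destruct (dvdb d n) eqn:Ed; [|ring]. rewrite <- Csum_plus. apply Csum_ext. intros b _. apply (HTd d b); go.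
  + apply dec_scal. apply (dec_Csum (seq 1 n) (fun d z => if dvdb d n then Csum (seq 0 d) (fun b => T d b z) else RtoC 0)).
    intros d Hd'%in_seq. destruct (dvdb d n) eqn:Ed; [|apply dec_zero]. apply dec_Csum. intros b _. apply (HTd d b); go.
Qed.

(** The primitive [DD] with [z^j] replaced by [(z-x)^j]. At [z = x] the repeated integration by
    parts leaves a single term, a multiple of an iterated primitive of [f]. *)
Fixpoint KK (a : nat -> C) (x : C) (j m : nat) (z : C) : C :=
  match j with
  | O => qs (gm a (S m)) z
  | S j' => ((z-x)^S j'*qs (gm a (S m)) z-RtoC (INR (S j'))*KK a x j' (S m) z)%C
  end.

Lemma KK_diag a j m z : KK a z j m z = (zr (zs j)*RtoC (INR (fact j))*qs (gm a (S m+j)) z)%C.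
Proof.
revert m. induction j as [|j IH]; intros m.
- cbn [KK]. rewrite Nat.add_0_r. change (zr (zs 0)) with (RtoC 1). alg.
- cbn [KK]. rewrite IH, zs_S, zr_opp, fact_simpl, mult_INR, RtoC_mult. replace (S (S m)+j)%nat with (S m+S j)%nat by lia; go.
Qed.

Lemma cder_KK a x j m z : sub a -> uhp z -> cder (KK a x j m) z ((z-x)^j*qs (gm a m) z)%C.
Proof.
intros Ha. revert m. induction j as [|j IH]; intros m Hz.
- simpl. rewrite Cmult_1_l, <- qs_gm_deriv. apply cder_qs; [apply gm_sub, Ha|exact Hz].
- have Dx : cder (fun z => (z-x)^S j)%C z (RtoC (INR (S j))*(z-x)^j*1)%C.
  { apply (cder_comp (fun z => z^S j)%C (fun z => z-x)%C); [|apply cder_pow]. apply (cder_ext (fun z => 1*z + - x)%C); [alg|apply cder_affine]. }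
  have D1 := cder_mult _ _ _ _ _ Dx (cder_qs (gm a (S m)) z (gm_sub a (S m) Ha) Hz). rewrite qs_gm_deriv in D1.
  assert (D2 := cder_plus _ _ _ _ _ D1 (cder_scal (- RtoC (INR (S j)))%C _ _ _ (IH (S m) Hz))). cbv beta in D2.
  intros eps He. destruct (D2 eps He) as (d & Hd & Hh). exists d. split; [exact Hd|]. intros h Hlt. specialize (Hh h Hlt).
  cbn [KK]. etransitivity; [|exact Hh]. right. alg.
Qed.

Lemma shifted_power x w : exists c : nat -> C, forall z, Csum (seq 0 (S w)) (fun i => c i*z^i)%C = ((z-x)^w)%C.
Proof.
induction w as [|w [c Hc]].
- exists (fun _ => RtoC 1). alg.
- exists (fun i => ((match i with O => RtoC 0 | S j => c j end)-x*(if (i <=? w)%nat then c i else RtoC 0))%C). intros z.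
  change ((z-x)^S w)%C with ((z-x)*(z-x)^w)%C. rewrite <- Hc.
  rewrite (Csum_ext (seq 0 (S (S w))) _ (fun i => (match i with O => RtoC 0 | S j => c j end)*z^i-x*((if (i <=? w)%nat then c i else RtoC 0)*z^i))%C) by alg.
  rewrite Csum_minus, Csum_scal, (Csum_seq_S (S w) 0 (fun i => (if (i <=? w)%nat then c i else RtoC 0)*z^i)%C). destruct (Nat.leb_spec (0+S w) w); [lia|].
  rewrite (Csum_ext (seq 0 (S w)) (fun i => (if (i <=? w)%nat then c i else RtoC 0)*z^i)%C (fun i => c i*z^i)%C).
  + change (seq 0 (S (S w))) with (0%nat :: seq (0+1) (S w)). cbn [Csum]. rewrite (Csum_seq_shift 0 1).
    rewrite (Csum_ext (seq 0 (S w)) (fun i => (match (i+1)%nat with O => RtoC 0 | S j => c j end)*z^(i+1))%C (fun i => z*(c i*z^i))%C).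
    * rewrite Csum_scal. ring.
    * intros i _. rewrite Nat.add_1_r. alg.
  + intros i Hi%in_seq. destruct (Nat.leb_spec i w); [auto|lia].
Qed.

Lemma KK_expand a x w c z : sub a -> (forall z, Csum (seq 0 (S w)) (fun i => c i*z^i)%C = ((z-x)^w)%C) -> uhp z ->
  dec (KK a x w 0) -> KK a x w 0 z = Csum (seq 0 (S w)) (fun i => c i*DD a i 0 z)%C.
Proof.
intros Ha Hc Hz Hdec. set (G := fun z => (KK a x w 0 z + - (1)*Csum (seq 0 (S w)) (fun i => c i*DD a i 0 z))%C).
have E : G z = RtoC 0.
{ apply dec_primitive_zero; [| |exact Hz].
  - intros t Ht. have D1 : cder (fun z => Csum (seq 0 (S w)) (fun i => c i*DD a i 0 z)%C) t (Csum (seq 0 (S w)) (fun i => c i*(t^i*qs (gm a 0) t)))%C.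
    { apply (cder_Csum (seq 0 (S w)) (fun i z => c i*DD a i 0 z)%C). intros i _. apply cder_scal, cder_DD; assumption. }
    have D2 := cder_plus _ _ _ _ _ (cder_KK a x w 0 t Ha Ht) (cder_scal (- (1))%C _ _ _ D1). cbv beta in D2.
    match type of D2 with cder _ _ ?l => replace (RtoC 0) with l; [exact D2|] end.
    rewrite (Csum_ext _ _ (fun i => c i*t^i*qs (gm a 0) t)%C) by alg. rewrite Csum_scal_r, Hc. ring.
  - apply dec_plus; [exact Hdec|]. apply dec_scal. apply (dec_Csum (seq 0 (S w)) (fun i z => c i*DD a i 0 z)%C). intros i _. apply dec_scal, dec_DD, Ha. }
unfold G in E. match goal with |- ?u = ?v => replace u with (u + - (1)*v+v)%C by ring end. rewrite E. ring.
Qed.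

Lemma dec_KK a x j m : sub a -> dec (KK a x j m).
Proof.
intros Ha. revert m. induction j as [|j IH]; intros m.
- apply (dec_DD a 0 m Ha).
- destruct (shifted_power x (S j)) as [c Hc].
  apply (dec_ext (fun z => Csum (seq 0 (S (S j))) (fun i => c i*(z^i*qs (gm a (S m)) z))+(- RtoC (INR (S j)))*KK a x j (S m) z)%C).
  + intros z _. cbn [KK]. rewrite <- Hc, <- Csum_scal_r. rewrite (Csum_ext _ _ (fun i => c i*z^i*qs (gm a (S m)) z)%C) by alg. ring.
  + apply dec_plus; [|apply dec_scal, IH]. apply (dec_Csum _ (fun i z => c i*(z^i*qs (gm a (S m)) z))%C). intros i _. apply dec_scal, dec_zpow_qs, gm_sub, Ha.
Qed.

(* If all periods vanished, the [(w+1)]-fold primitive of [f] would be a cusp form of weight [- w]. *)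
Lemma phi_nonzero a w : sub a -> (forall z, uhp z -> qs a (- / z)%C = (z^S (S w)*qs a z)%C) -> a 1%nat <> RtoC 0 ->
  exists i, (i <= w)%nat /\ phi a w i <> RtoC 0.
Proof.
intros Ha HS Ha1. apply NNPP. intros Hno.
have Hphi : forall i, (i <= w)%nat -> phi a w i = RtoC 0.
{ intros i Hi. apply NNPP. eauto. }
(* When all periods vanish, the primitive of [(z-x)^w f] is equivariant under the inversion of [x]
   and [z] together. Setting [x = z] gives weight [-w] for the [(w+1)]-fold primitive. *)
have HK : forall x z, uhp x -> uhp z -> (KK a (- / x) w 0 (- / z)*x^w)%C = KK a x w 0 z.
{ intros x z Hx Hz. have Hx0 := H_neq0 x Hx. destruct (shifted_power (- / x)%C w) as [c Hc]. set (G := fun z => (x^w*KK a (- / x) w 0 (- / z) + - (1)*KK a x w 0 z)%C).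
  have E : G z = RtoC 0.
  { apply dec_primitive_zero; [| |exact Hz].
    - intros t Ht. have Ht0 := H_neq0 t Ht.
      have D1 := cder_comp (KK a (- / x) w 0) (fun z => - / z)%C t _ _ (cder_inv_neg t Ht0) (cder_KK a (- / x)%C w 0 _ Ha (H_inv_neg t Ht)).
      have D2 := cder_plus _ _ _ _ _ (cder_scal (x^w)%C _ _ _ D1) (cder_scal (- (1))%C _ _ _ (cder_KK a x w 0 t Ha Ht)). cbv beta in D2.
      match type of D2 with cder _ _ ?l => replace (RtoC 0) with l; [exact D2|] end. rewrite !qs_gm0, HS by exact Ht.
      have Ew : ((t-x)^w = x^w*(- / t - - / x)^w*t^w)%C.
      { rewrite <- !Cpow_mult_l. alg. }
      rewrite Ew. simpl. fd.
    - apply dec_plus; [|apply dec_scal, dec_KK, Ha]. apply dec_scal. apply (dec_ext (fun z => Csum (seq 0 (S w)) (fun i => c i*(zr (zs i)*DD a (w-i) 0 z)))%C).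
      + intros t Ht. rewrite (KK_expand a (- / x)%C w c (- / t)%C Ha Hc (H_inv_neg t Ht) (dec_KK a _ w 0 Ha)).
        apply Csum_ext. intros i Hi%in_seq. rewrite (DD_S a w i t Ha HS ltac:(lia) Ht), Hphi by lia. ring.
      + apply (dec_Csum _ (fun i z => c i*(zr (zs i)*DD a (w-i) 0 z))%C). intros i _. apply dec_scal, dec_scal, dec_DD, Ha. }
  unfold G in E. rewrite Cmult_comm. match goal with |- ?u = ?v => replace u with (u + - (1)*v+v)%C by ring end. rewrite E. ring. }
have Hg : gm a (S w) 1 = RtoC 0.
{ apply (cusp_vanish (gm a (S w)) w); [apply gm_sub, Ha| |lia]. intros z Hz. specialize (HK z z Hz Hz). rewrite !KK_diag in HK.
  have Hc : (zr (zs w)*RtoC (INR (fact w)))%C <> RtoC 0.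
  { intros E%Cmult_integral. destruct E as [E|E].
    - apply (zr_inj _ 0) in E. unfold zs in E. destruct (Nat.even w); go.
    - apply RtoC_inj in E. apply (INR_fact_neq_0 w), E. }
  have E : (zr (zs w)*RtoC (INR (fact w))*(qs (gm a (S w)) (- / z)*z^w-qs (gm a (S w)) z) = 0)%C.
  { change (1+w)%nat with (S w) in HK. replace (zr (zs w)*RtoC (INR (fact w))*(qs (gm a (S w)) (- / z)*z^w-qs (gm a (S w)) z))%C with
      (zr (zs w)*RtoC (INR (fact w))*qs (gm a (S w)) (- / z)*z^w-zr (zs w)*RtoC (INR (fact w))*qs (gm a (S w)) z)%C by ring. rewrite HK. ring. }
  apply Cmult_integral in E. destruct E as [E|E]; [easy|].
  replace (qs (gm a (S w)) (- / z)*z^w)%C with (qs (gm a (S w)) (- / z)*z^w-qs (gm a (S w)) z+qs (gm a (S w)) z)%C by ring. rewrite E. ring. }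
unfold gm in Hg. apply Cmult_integral in Hg. destruct Hg as [Hg|Hg]; [|auto].
have Htw : (tw*RtoC (INR 1))%C <> RtoC 0.
{ intros E. apply (f_equal Cmod) in E. rewrite Cmod_mult, Cmod_tw, Cmod_R, Cmod_0, Rabs_right in E by pos. simpl in E. pose proof PI_RGT_0. lra. }
apply (Cpow_nz (/ (tw*RtoC (INR 1)))%C (S w)); [|exact Hg]. intros E.
have E1 : (tw*RtoC (INR 1) * / (tw*RtoC (INR 1)) = 1)%C by (field; split; intros E2; apply Htw; rewrite E2; ring). rewrite E, Cmult_0_r in E1. apply RtoC_inj in E1. lra.
Qed.

(** * Forms modulo 3 *)

Definition c3 (a b : Z) : Prop := (3 | a-b)%Z.

Lemma c3_refl a : c3 a a.
Proof. exists 0%Z. ring. Qed.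

Lemma c3_eq a b : a = b -> c3 a b.
Proof. intros ->. apply c3_refl. Qed.

Lemma c3_sym a b : c3 a b -> c3 b a.
Proof. intros [x E]. exists (- x)%Z. lia. Qed.

Lemma c3_trans a b c : c3 a b -> c3 b c -> c3 a c.
Proof. intros [x E] [y E']. exists (x+y)%Z. lia. Qed.

Lemma c3_add a b c d : c3 a b -> c3 c d -> c3 (a+c) (b+d).
Proof. intros [x E] [y E']. exists (x+y)%Z. lia. Qed.

Lemma c3_sub a b c d : c3 a b -> c3 c d -> c3 (a-c) (b-d).
Proof. intros [x E] [y E']. exists (x-y)%Z. lia. Qed.

Lemma c3_mul a b c d : c3 a b -> c3 c d -> c3 (a*c) (b*d).
Proof. intros [x E] [y E']. exists (x*c+b*y)%Z. lia. Qed.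

Lemma c3_Zsum {A} (l : list A) f g : (forall x, In x l -> c3 (f x) (g x)) -> c3 (Zsum l f) (Zsum l g).
Proof.
induction l as [|x l IH]; intros H; [apply c3_refl|]. simpl. apply c3_add; [apply H; left; easy|apply IH; intros y Hy; apply H; right; exact Hy].
Qed.

Lemma c3_0 a : c3 a 0 <-> (3 | a)%Z.
Proof. unfold c3. rewrite Z.sub_0_r. easy. Qed.

Lemma c3_cases a : c3 a 0 \/ c3 a 1 \/ c3 a (-1).
Proof.
have E := Z.div_mod a 3 ltac:(lia). have B := Z.mod_pos_bound a 3 ltac:(lia). assert (a mod 3 = 0 \/ a mod 3 = 1 \/ a mod 3 = 2)%Z as [H|[H|H]] by lia; rewrite H in E;
  [left|right; left|right; right]; [exists (a/3)%Z|exists (a/3)%Z|exists (a/3+1)%Z]; lia.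
Qed.

Lemma c3_cube a : c3 (a*a*a) a.
Proof.
destruct (c3_cases a) as [H|[H|H]]; (eapply c3_trans; [apply c3_mul; [apply c3_mul; exact H|exact H]|apply c3_sym; exact H]).
Qed.

Lemma c3_square a : ~ (3 | a)%Z -> c3 (a*a) 1.
Proof.
intros Ha. destruct (c3_cases a) as [H|[H|H]].
- exfalso. apply Ha, c3_0, H.
- exact (c3_mul _ _ _ _ H H).
- exact (c3_mul _ _ _ _ H H).
Qed.

Lemma Zsum_ext {A} (l : list A) f g : (forall x, In x l -> f x = g x) -> Zsum l f = Zsum l g.
Proof.
induction l as [|x l IH]; intros H; [auto|]. simpl. rewrite H by (left; easy). rewrite IH; [lia|]. intros y Hy. apply H. right. exact Hy.
Qed.

Lemma Zsum_zero {A} (l : list A) f : (forall x, In x l -> f x = 0%Z) -> Zsum l f = 0%Z.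
Proof. intros H. rewrite (Zsum_ext l f (fun _ => 0%Z) H). clear H. induction l; simpl; lia. Qed.

Lemma Zsum_plus {A} (l : list A) f g : Zsum l (fun x => (f x+g x)%Z) = (Zsum l f+Zsum l g)%Z.
Proof. induction l as [|x l IH]; simpl; [lia|]. lia. Qed.

Lemma Zsum_scal {A} (l : list A) c f : Zsum l (fun x => (c*f x)%Z) = (c*Zsum l f)%Z.
Proof. induction l as [|x l IH]; simpl; go. Qed.

Lemma Zsum_scal_r {A} (l : list A) c f : Zsum l (fun x => (f x*c)%Z) = (Zsum l f*c)%Z.
Proof. induction l as [|x l IH]; simpl; go. Qed.

Lemma Zsum_swap {A B} (l : list A) (l' : list B) f : Zsum l (fun x => Zsum l' (fun y => f x y)) = Zsum l' (fun y => Zsum l (fun x => f x y)).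
Proof.
induction l as [|x l IH]; simpl; [symmetry; apply Zsum_zero; easy|]. rewrite IH, Zsum_plus. auto.
Qed.

Lemma Zsum_app {A} (l l' : list A) f : Zsum (l ++ l') f = (Zsum l f+Zsum l' f)%Z.
Proof. induction l as [|x l IH]; simpl; go. Qed.

Lemma Zsum_seq_S n a f : Zsum (seq a (S n)) f = (Zsum (seq a n) f+f (a+n)%nat)%Z.
Proof. rewrite seq_S, Zsum_app. simpl. ring. Qed.

Lemma Zsum_rev w (f : nat -> Z) : Zsum (seq 0 (S w)) f = Zsum (seq 0 (S w)) (fun i => f (w-i)%nat).
Proof. apply zr_inj. rewrite !zr_Zsum. apply (Csum_rev w (fun i => zr (f i))). Qed.

(** Induction on [m]. If no relation has a last coefficient prime to 3, the last coordinate is the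
    functional. Otherwise such a relation expresses the last number through the others, which are
    therefore not all zero, and the functional obtained for them extends. *)
Lemma relations_mod3 (m : nat) (phi : nat -> C) : (exists i, (i < m)%nat /\ phi i <> RtoC 0) ->
  exists h : nat -> Z, (exists i, (i < m)%nat /\ ~ (3 | h i)%Z) /\
    forall c : nat -> Z, Csum (seq 0 m) (fun i => zr (c i)*phi i)%C = RtoC 0 -> (3 | Zsum (seq 0 m) (fun i => h i*c i))%Z.
Proof.
induction m as [|m IH]; intros [i0 [Hi0 Hp0]]; [lia|].
destruct (excluded_middle_informative (exists c : nat -> Z, Csum (seq 0 (S m)) (fun i => zr (c i)*phi i)%C = RtoC 0 /\ ~ (3 | c m)%Z)) as [(c & Hc & Hcm)|Hno].
- destruct IH as (h' & (i1 & Hi1 & Hh1) & Hrel).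
  { apply NNPP. intros Hn. rewrite Csum_seq_S, Csum_zero in Hc.
    - simpl (0+m)%nat in Hc. rewrite Cplus_0_l in Hc. apply Cmult_integral in Hc. destruct Hc as [Hc|Hc].
      + apply (zr_inj _ 0) in Hc. apply Hcm. rewrite Hc. exists 0%Z. lia.
      + destruct (Nat.eq_dec i0 m) as [->|Hne]; [auto|]. apply Hn. exists i0. go.
    - intros i Hi%in_seq. have E : phi i = RtoC 0 by (apply NNPP; intros Hp; apply Hn; exists i; split; [lia|exact Hp]). rewrite E. ring. }
  (* The value that makes the functional kill [c] itself, [c m] being its own inverse modulo 3. *)
  set (t := (- c m*Zsum (seq 0 m) (fun i => h' i*c i))%Z). exists (fun i => if (i =? m)%nat then t else h' i). split.
  + exists i1. split; [lia|]. destruct (Nat.eqb_spec i1 m); go.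
  + intros d Hd. rewrite Zsum_seq_S. simpl (0+m)%nat. rewrite Nat.eqb_refl.
    rewrite (Zsum_ext (seq 0 m) _ (fun i => h' i*d i)%Z) by (intros i Hi; apply in_seq in Hi; destruct (Nat.eqb_spec i m); [lia|lia]).
    have He : (3 | Zsum (seq 0 m) (fun i => h' i*(c m*d i-d m*c i)))%Z.
    { apply Hrel. rewrite Csum_seq_S in Hc, Hd. simpl (0+m)%nat in Hc, Hd. rewrite (Csum_ext _ _ (fun i => zr (c m)*(zr (d i)*phi i)-zr (d m)*(zr (c i)*phi i))%C).
      - rewrite Csum_minus, !Csum_scal. replace (Csum (seq 0 m) (fun i => zr (d i)*phi i)%C) with (- (zr (d m)*phi m))%C by (rewrite <- (Cplus_0_r (- _)), <- Hd; ring).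
        replace (Csum (seq 0 m) (fun i => zr (c i)*phi i)%C) with (- (zr (c m)*phi m))%C by (rewrite <- (Cplus_0_r (- _)), <- Hc; ring). ring.
      - intros i _. unfold Z.sub. rewrite zr_plus, zr_opp, !zr_mult. ring. }
    rewrite (Zsum_ext (seq 0 m) _ (fun i => c m*(h' i*d i) + - d m*(h' i*c i))%Z) in He by lia. rewrite Zsum_plus, !Zsum_scal in He. apply c3_0. apply c3_0 in He.
    set (D := Zsum (seq 0 m) (fun i => (h' i*d i)%Z)) in *. set (E := Zsum (seq 0 m) (fun i => (h' i*c i)%Z)) in *.
    apply c3_trans with (c m*(c m*D + - d m*E))%Z; [|eapply c3_trans; [apply c3_mul; [apply c3_refl|exact He]|apply c3_eq; ring]].
    replace (c m*(c m*D + - d m*E))%Z with ((c m*c m)*D+t*d m)%Z by lia.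
    apply c3_add; [|apply c3_refl]. replace D with (1*D)%Z at 1 by ring. apply c3_mul; [apply c3_sym, c3_square, Hcm|apply c3_refl].
- exists (fun i => if (i =? m)%nat then 1%Z else 0%Z). split.
  + exists m. split; [lia|]. rewrite Nat.eqb_refl. intros [x E]. lia.
  + intros c Hc. rewrite Zsum_seq_S, Zsum_zero.
    * simpl (0+m)%nat. rewrite Nat.eqb_refl. apply NNPP. intros Hn. apply Hno. exists c. split; [exact Hc|]. intros Hd. apply Hn.
      replace (0+1*c m)%Z with (c m) by ring. exact Hd.
    * intros i Hi%in_seq. destruct (Nat.eqb_spec i m); [lia|ring].
Qed.

Definition pair (w : nat) (h c : nat -> Z) : Z := Zsum (seq 0 (S w)) (fun i => (h i*c i)%Z).

Definition supp (w : nat) (c : nat -> Z) : Prop := forall i, (w < i)%nat -> c i = 0%Z.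

Definition ceq (c c' : nat -> Z) : Prop := forall i, c3 (c i) (c' i).

Lemma pair_ceq w h c c' : ceq c c' -> c3 (pair w h c) (pair w h c').
Proof. intros H. apply c3_Zsum. intros i _. apply c3_mul; [apply c3_refl|apply H]. Qed.

Lemma pair_plus w h c c' : pair w h (fun i => (c i+c' i)%Z) = (pair w h c+pair w h c')%Z.
Proof. unfold pair. rewrite <- Zsum_plus. apply Zsum_ext. lia. Qed.

Lemma Uact_ceq w al be de c c' : ceq c c' -> ceq (Uact w al be de c) (Uact w al be de c').
Proof. intros H j. apply c3_Zsum. intros i _. apply c3_mul; [apply c3_mul; [apply H|apply c3_refl]|apply c3_refl]. Qed.

Lemma Sact_ceq w c c' : ceq c c' -> ceq (Sact w c) (Sact w c').
Proof. intros H j. unfold Sact. destruct (j <=? w)%nat; [apply c3_mul; [apply c3_refl|apply H]|apply c3_refl]. Qed.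

Lemma ga_ceq w x c c' : ceq c c' -> ceq (ga w x c) (ga w x c').
Proof. intros H. destruct x; [apply Sact_ceq|apply Uact_ceq|apply Uact_ceq]; exact H. Qed.

Lemma cw_ceq w s c c' : ceq c c' -> ceq (cw w s c) (cw w s c').
Proof.
revert c c'. induction s as [|x s IH]; intros c c' H i; [apply c3_refl|]. cbn [cw]. apply c3_add; [destruct x; [apply H|apply c3_refl|apply c3_refl]|].
apply IH, ga_ceq, H.
Qed.

Lemma Uact_supp w al be de c : supp w (Uact w al be de c).
Proof. intros j Hj. apply Zsum_zero. intros i Hi%in_seq. rewrite lp_support by lia. ring. Qed.

Lemma Sact_supp w c : supp w (Sact w c).
Proof. intros j Hj. unfold Sact. destruct (Nat.leb_spec j w); [lia|lia]. Qed.

Lemma ga_supp w x c : supp w (ga w x c).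
Proof. destruct x; [apply Sact_supp|apply Uact_supp|apply Uact_supp]. Qed.

Lemma cw_supp w s c : supp w c -> supp w (cw w s c).
Proof.
revert c. induction s as [|x s IH]; intros c H i Hi; [auto|]. cbn [cw]. rewrite (IH _ (ga_supp w x c) i Hi). destruct x; [rewrite (H i Hi)|lia|lia]; easy.
Qed.

(* Multiplication by the invariant [X^3 Y-X Y^3] of [SL_2 (F_3)]. *)
Definition TH (c : nat -> Z) (j : nat) : Z := (mulX (mulX (mulX c)) j-mulX c j)%Z.

Lemma TH_val c j : TH c j = ((if (3 <=? j)%nat then c (j-3)%nat else 0)-(if (1 <=? j)%nat then c (j-1)%nat else 0))%Z.
Proof. unfold TH. destruct j as [|[|[|j]]]; simpl; rewrite ?Nat.sub_0_r; easy. Qed.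

Lemma Zsum_mulX n c F : Zsum (seq 0 (S n)) (fun i => mulX c i*F i)%Z = Zsum (seq 0 n) (fun i => c i*F (S i))%Z.
Proof.
induction n as [|n IH]; [auto|]. rewrite (Zsum_seq_S (S n)), IH, (Zsum_seq_S n). auto.
Qed.

Lemma Zsum_supp w n c F : (w <= n)%nat -> supp w c -> Zsum (seq 0 (S n)) (fun i => c i*F i)%Z = Zsum (seq 0 (S w)) (fun i => c i*F i)%Z.
Proof.
intros H Hs. replace (S n) with (S w+(n-w))%nat by lia. rewrite seq_app, Zsum_app, (Zsum_zero (seq (0+S w) _)); [ring|]. intros i Hi%in_seq. rewrite Hs by lia. ring.
Qed.

Lemma Zsum_TH w c F : supp w c -> Zsum (seq 0 (S (w+4))) (fun i => TH c i*F i)%Z = Zsum (seq 0 (S w)) (fun i => c i*(F (i+3)%nat-F (i+1)%nat))%Z.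
Proof.
intros Hs. unfold TH. rewrite (Zsum_ext _ _ (fun i => mulX (mulX (mulX c)) i*F i + -1*(mulX c i*F i))%Z) by lia.
have E1 : Zsum (seq 0 (S (w+4))) (fun i => mulX c i*F i)%Z = Zsum (seq 0 (S w)) (fun i => c i*F (S i))%Z.
{ rewrite Zsum_mulX. replace (w+4)%nat with (S (w+3)) by lia. apply (Zsum_supp w (w+3) c (fun i => F (S i))); go. }
have E3 : Zsum (seq 0 (S (w+4))) (fun i => mulX (mulX (mulX c)) i*F i)%Z = Zsum (seq 0 (S w)) (fun i => c i*F (S (S (S i))))%Z.
{ rewrite Zsum_mulX. replace (w+4)%nat with (S (w+3)) by lia. rewrite (Zsum_mulX _ _ (fun i => F (S i))). replace (w+3)%nat with (S (w+2)) by lia.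
  rewrite (Zsum_mulX _ _ (fun i => F (S (S i)))). replace (w+2)%nat with (S (w+1)) by lia. apply (Zsum_supp w (w+1) c (fun i => F (S (S (S i))))); go. }
rewrite Zsum_plus, Zsum_scal, E1, E3, <- Zsum_scal, <- Zsum_plus. apply Zsum_ext.
intros i _. replace (i+3)%nat with (S (S (S i))) by lia. replace (i+1)%nat with (S i) by lia. ring.
Qed.

Lemma pair_TH w h c : supp w c -> pair (w+4) h (TH c) = pair w (fun i => (h (i+3)%nat-h (i+1)%nat)%Z) c.
Proof.
intros Hs. unfold pair. rewrite (Zsum_ext _ _ (fun i => TH c i*h i)%Z) by lia. rewrite (Zsum_TH w c h Hs). apply Zsum_ext. lia.
Qed.

Lemma TH_supp w c : supp w c -> supp (w+4) (TH c).
Proof.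
intros Hs j Hj. rewrite TH_val. destruct (Nat.leb_spec 3 j), (Nat.leb_spec 1 j); try lia. rewrite !Hs by lia. lia.
Qed.

Lemma Sact_TH w c : supp w c -> ceq (Sact (w+4) (TH c)) (TH (Sact w c)).
Proof.
intros Hs j. apply c3_eq. rewrite TH_val. unfold Sact. rewrite TH_val.
have Z3 : forall n, zs (n+3) = (- zs n)%Z by (intros n; replace (n+3)%nat with (S (S (S n))) by lia; rewrite !zs_S; ring).
have Z1 : forall n, zs (n+1) = (- zs n)%Z by (intros n; replace (n+1)%nat with (S n) by lia; apply zs_S). destruct (Nat.leb_spec j (w+4)) as [Hj|Hj].
- have EA : (zs (w+4-j)*(if (1 <=? w+4-j)%nat then c (w+4-j-1)%nat else 0))%Z =
    (- (if (3 <=? j)%nat then if (j-3 <=? w)%nat then zs (w-(j-3))*c (w-(j-3))%nat else 0 else 0))%Z.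
  { destruct (Nat.leb_spec 1 (w+4-j)), (Nat.leb_spec 3 j); try destruct (Nat.leb_spec (j-3) w); try lia.
    - replace (w+4-j)%nat with (w-(j-3)+1)%nat by lia. rewrite Z1. replace (w-(j-3)+1-1)%nat with (w-(j-3))%nat by lia. ring.
    - rewrite Hs by lia. ring. }
  have EB : (zs (w+4-j)*(if (3 <=? w+4-j)%nat then c (w+4-j-3)%nat else 0))%Z =
    (- (if (1 <=? j)%nat then if (j-1 <=? w)%nat then zs (w-(j-1))*c (w-(j-1))%nat else 0 else 0))%Z.
  { destruct (Nat.leb_spec 3 (w+4-j)), (Nat.leb_spec 1 j); try destruct (Nat.leb_spec (j-1) w); try lia.
    - replace (w+4-j)%nat with (w-(j-1)+3)%nat by lia. rewrite Z3. replace (w-(j-1)+3-3)%nat with (w-(j-1))%nat by lia. ring.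
    - rewrite Hs by lia. ring. }
  lia.
- destruct (Nat.leb_spec 3 j), (Nat.leb_spec 1 j), (Nat.leb_spec (j-3) w), (Nat.leb_spec (j-1) w); try lia.
Qed.

Lemma Zpow_S x n : (x^Z.of_nat (S n) = x*x^Z.of_nat n)%Z.
Proof. rewrite Nat2Z.inj_succ, Z.pow_succ_r by lia. lia. Qed.

(** Modulo 3 the cube of [al X + be Y] is [al X^3 + be Y^3], so the form [X^3 Y - X Y^3] is
    multiplied by the determinant [al de]. *)
Lemma TH_lp al be de i j : c3 (de*lp al be (i+3) j-de*de*de*lp al be (i+1) j) (al*de*TH (lp al be i) j).
Proof.
replace (i+3)%nat with (S (S (S i))) by lia. replace (i+1)%nat with (S i) by lia. cbn [lp]. unfold TH. set (c := lp al be i).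
have M : forall (u v : nat -> Z) (x y : Z) n, mulX (fun n => (x*u n+y*v n)%Z) n = (x*mulX u n+y*mulX v n)%Z by (intros u v x y [|n]; simpl; ring). rewrite !M.
assert (M' : forall n, mulX (mulX (fun n => (be*c n+al*mulX c n)%Z)) n = (be*mulX (mulX c) n+al*mulX (mulX (mulX c)) n)%Z).
{ intros [|[|n]]; simpl; ring. }
have M2 : mulX (mulX (fun j0 => (be*c j0+al*mulX c j0)%Z)) j = (be*mulX (mulX c) j+al*mulX (mulX (mulX c)) j)%Z by apply M'.
rewrite ?M2. set (c0 := c j). set (c1 := mulX c j). set (c2 := mulX (mulX c) j). set (d3 := mulX (mulX (mulX c)) j).
apply c3_trans with (de*((be*be*be)*c0+(al*al*al)*d3)-de*de*de*(be*c0+al*c1))%Z.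
- exists (de*(be*be*al*c1+be*al*al*c2))%Z. ring.
- apply c3_trans with (de*(be*c0+al*d3)-de*(be*c0+al*c1))%Z; [|apply c3_eq; ring].
  apply c3_sub; apply c3_mul; try apply c3_refl; [|apply c3_cube]. apply c3_add; apply c3_mul; try apply c3_refl; apply c3_cube.
Qed.

Lemma Uact_TH w al be de c : supp w c -> ceq (Uact (w+4) al be de (TH c)) (fun j => (al*de*TH (Uact w al be de c) j)%Z).
Proof.
intros Hs j. unfold Uact at 1. rewrite (Zsum_ext _ _ (fun i => TH c i*(de^Z.of_nat (w+4-i)*lp al be i j))%Z) by lia.
rewrite (Zsum_TH w c (fun i => de^Z.of_nat (w+4-i)*lp al be i j)%Z Hs).
have E : (al*de*TH (Uact w al be de c) j)%Z = Zsum (seq 0 (S w)) (fun i => c i*de^Z.of_nat (w-i)*(al*de*TH (lp al be i) j))%Z.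
{ rewrite (Zsum_ext _ _ (fun i => (al*de)*(c i*de^Z.of_nat (w-i)*TH (lp al be i) j))%Z) by lia. rewrite Zsum_scal. f_equal. rewrite TH_val. unfold Uact.
  rewrite (Zsum_ext (seq 0 (S w)) (fun i => c i*de^Z.of_nat (w-i)*TH (lp al be i) j)%Z
    (fun i => (if (3 <=? j)%nat then c i*de^Z.of_nat (w-i)*lp al be i (j-3) else 0) + -1*(if (1 <=? j)%nat then c i*de^Z.of_nat (w-i)*lp al be i (j-1) else 0))%Z).
  - rewrite Zsum_plus, Zsum_scal. destruct (3 <=? j)%nat, (1 <=? j)%nat; rewrite ?(Zsum_zero _ (fun _ => 0%Z)) by easy; ring.
  - intros i _. rewrite TH_val. destruct (3 <=? j)%nat, (1 <=? j)%nat; ring. }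
rewrite E. apply c3_Zsum. intros i Hi%in_seq. replace (w+4-(i+3))%nat with (S (w-i)) by lia. replace (w+4-(i+1))%nat with (S (S (S (w-i)))) by lia. rewrite !Zpow_S.
apply c3_trans with (c i*de^Z.of_nat (w-i)*(de*lp al be (i+3) j-de*de*de*lp al be (i+1) j))%Z; [apply c3_eq; ring|]. apply c3_mul; [apply c3_refl|apply TH_lp].
Qed.

Lemma ceq_trans c c' c'' : ceq c c' -> ceq c' c'' -> ceq c c''.
Proof. intros H H' i. eapply c3_trans; go. Qed.

Lemma ga_TH w x c : supp w c -> ceq (ga (w+4) x (TH c)) (TH (ga w x c)).
Proof.
intros Hs. destruct x; cbn [ga]; [apply Sact_TH, Hs| |]; (eapply ceq_trans; [apply Uact_TH, Hs|]); intros j; apply c3_eq; ring.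
Qed.

Lemma cw_TH w s c : supp w c -> ceq (cw (w+4) s (TH c)) (TH (cw w s c)).
Proof.
revert c. induction s as [|x s IH]; intros c Hs.
- intros j. apply c3_eq. rewrite TH_val. cbn [cw]. destruct (3 <=? j)%nat, (1 <=? j)%nat; easy.
- intros j. cbn [cw]. apply c3_trans with ((match x with GS => TH c j | _ => 0 end)+TH (cw w s (ga w x c)) j)%Z.
  + apply c3_add; [apply c3_refl|]. eapply c3_trans; [apply (cw_ceq _ _ _ _ (ga_TH w x c Hs))|]. apply IH, ga_supp.
  + apply c3_eq. rewrite !TH_val. destruct x, (3 <=? j)%nat, (1 <=? j)%nat; ring.
Qed.

(** The value of the form [c] at the integer vector [v]. *)
Definition Ez (w : nat) (c : nat -> Z) (v : Z*Z) : Z := Zsum (seq 0 (S w)) (fun i => c i*(fst v^Z.of_nat i*snd v^Z.of_nat (w-i)))%Z.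

Lemma lp_Ez al be x y i : forall w, (i <= w)%nat ->
  Zsum (seq 0 (S w)) (fun j => lp al be i j*(x^Z.of_nat j*y^Z.of_nat (w-j)))%Z = ((al*x+be*y)^Z.of_nat i*y^Z.of_nat (w-i))%Z.
Proof.
induction i as [|i IH]; intros w Hi.
- change (seq 0 (S w)) with (0%nat :: seq 1 w). cbn [Zsum]. rewrite Zsum_zero.
  + simpl lp. lia.
  + intros j Hj%in_seq. simpl. destruct (Nat.eqb_spec j 0); [lia|ring].
- destruct w as [|w]; [lia|]. cbn [lp].
  rewrite (Zsum_ext _ _ (fun j => be*(lp al be i j*(x^Z.of_nat j*y^Z.of_nat (S w-j)))+al*(mulX (lp al be i) j*(x^Z.of_nat j*y^Z.of_nat (S w-j))))%Z) by lia.
  rewrite Zsum_plus, !Zsum_scal, IH by lia. rewrite (Zsum_mulX (S w) (lp al be i) (fun j => x^Z.of_nat j*y^Z.of_nat (S w-j))%Z).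
  rewrite (Zsum_ext (seq 0 (S w)) _ (fun j => x*(lp al be i j*(x^Z.of_nat j*y^Z.of_nat (w-j))))%Z).
  + rewrite Zsum_scal, IH by lia. replace (S w-i)%nat with (S (w-i)) by lia. change (S w-S i)%nat with (w-i)%nat. rewrite !Zpow_S. ring.
  + intros j _. change (S w-S j)%nat with (w-j)%nat. rewrite Zpow_S. ring.
Qed.

Lemma Ez_Uact w al be de c v : Ez w (Uact w al be de c) v = Ez w c (al*fst v+be*snd v, de*snd v)%Z.
Proof.
unfold Ez, Uact. cbn [fst snd]. destruct v as [x y]. cbn [fst snd].
rewrite (Zsum_ext _ _ (fun j => Zsum (seq 0 (S w)) (fun i => c i*de^Z.of_nat (w-i)*(lp al be i j*(x^Z.of_nat j*y^Z.of_nat (w-j))))%Z)).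
- rewrite Zsum_swap. apply Zsum_ext. intros i Hi%in_seq. rewrite Zsum_scal, lp_Ez by lia. rewrite Z.pow_mul_l. ring.
- intros j _. rewrite <- Zsum_scal_r. apply Zsum_ext. lia.
Qed.

Lemma zs_Zpow y i : ((- y)^Z.of_nat i = zs i*y^Z.of_nat i)%Z.
Proof. induction i as [|i IH]; [auto|]. rewrite !Zpow_S, zs_S, IH. ring. Qed.

Lemma Ez_Sact w c v : Ez w (Sact w c) v = Ez w c (- snd v, fst v)%Z.
Proof.
unfold Ez. cbn [fst snd]. rewrite Zsum_rev. apply Zsum_ext. intros i Hi%in_seq. unfold Sact. destruct (Nat.leb_spec (w-i) w); [|lia].
replace (w-(w-i))%nat with i by lia. rewrite zs_Zpow. ring.
Qed.

Lemma Ez_ga w x c v : Ez w (ga w x c) v = Ez w c (gv x v).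
Proof.
destruct x; cbn [ga gv]; [apply Ez_Sact| |]; rewrite Ez_Uact; f_equal; apply injective_projections; cbn [fst snd]; ring.
Qed.

Definition delta (k i : nat) : Z := if (i =? k)%nat then 1%Z else 0%Z.

Lemma delta_supp w k : (k <= w)%nat -> supp w (delta k).
Proof. intros H i Hi. unfold delta. destruct (Nat.eqb_spec i k); [lia|lia]. Qed.

Lemma Zsum_delta w k F : (k <= w)%nat -> Zsum (seq 0 (S w)) (fun i => delta k i*F i)%Z = F k.
Proof.
intros Hk. replace (S w) with (k+S (w-k))%nat by lia. rewrite seq_app, Zsum_app. cbn [seq Zsum]. simpl (0+k)%nat.
rewrite !Zsum_zero; unfold delta; [rewrite Nat.eqb_refl; ring| |]; intros i Hi; apply in_seq in Hi; destruct (Nat.eqb_spec i k); try lia; ring.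
Qed.

Lemma pair_delta w h k : (k <= w)%nat -> pair w h (delta k) = h k.
Proof. intros Hk. unfold pair. rewrite (Zsum_ext _ _ (fun i => delta k i*h i)%Z) by lia. apply Zsum_delta, Hk. Qed.

Lemma Ez_delta w k v : (k <= w)%nat -> Ez w (delta k) v = (fst v^Z.of_nat k*snd v^Z.of_nat (w-k))%Z.
Proof. intros Hk. apply (Zsum_delta w k (fun i => fst v^Z.of_nat i*snd v^Z.of_nat (w-i))%Z Hk). Qed.

Definition hecke_pairing (w n : nat) (ws : nat -> nat -> list gen) (h c : nat -> Z) : Z :=
  Zsum (seq 1 n) (fun d => if dvdb d n then Zsum (seq 0 d) (fun b => pair w h (cw w (ws d b) (hact w n d b c))) else 0%Z).

Lemma c3_even_pow x m : ~ (3 | x)%Z -> c3 (x^Z.of_nat (2*m)) 1.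
Proof.
intros Hx. induction m as [|m IH]; [apply c3_refl|]. replace (2*S m)%nat with (S (S (2*m))) by lia. rewrite !Zpow_S, Z.mul_assoc.
exact (c3_mul _ _ _ _ (c3_square x Hx) IH).
Qed.

(* A period functional modulo 3 killed by the Hecke operator at [n] is zero: modulo the multiples of the invariant form
   it is a combination of point evaluations, hence Eisenstein, with Hecke eigenvalue the sum of the divisors of [n]. *)
Lemma devissage (n : nat) (ws : nat -> nat -> list gen) : (1 <= n)%nat -> ~ (3 | Z.of_nat n)%Z ->
  ~ (3 | Zsum (seq 1 n) (fun d => if dvdb d n then Z.of_nat d else 0%Z))%Z ->
  (forall d b, (1 <= d)%nat -> dvdb d n = true -> exists al, (al*snd (wv (ws d b) (1, 0)) = Z.of_nat d \/ al*snd (wv (ws d b) (1, 0)) = - Z.of_nat d)%Z) ->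
  forall m w h, w = (2*m)%nat ->
  (forall c, supp w c -> c3 (pair w h c+pair w h (Sact w c)) 0) ->
  (forall c, supp w c -> c3 (pair w h (Uact w 1 1 1 c)) (pair w h c+pair w h (Uact w 1 (-1) 1 (Sact w c)))) ->
  (forall c, supp w c -> c3 (hecke_pairing w n ws h c) 0) ->
  forall i, (i <= w)%nat -> c3 (h i) 0.
Proof.
intros Hn Hn3 Hsig Hws m. induction m as [m IH] using lt_wf_ind. intros w h Hw R1 R2 R3.
have HS : forall i, (i <= w)%nat -> c3 (h i+zs i*h (w-i)%nat) 0.
{ intros i Hi. have E := R1 (delta i) (delta_supp w i Hi). rewrite (pair_delta w h i Hi) in E.
  replace (pair w h (Sact w (delta i))) with (zs i*h (w-i)%nat)%Z in E; [exact E|]. symmetry. unfold pair. rewrite Zsum_rev. unfold Sact.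
  rewrite (Zsum_ext _ _ (fun j => delta i j*(zs j*h (w-j)%nat))%Z); [apply Zsum_delta, Hi|].
  intros j Hj%in_seq. destruct (Nat.leb_spec (w-j) w); [|lia]. replace (w-(w-j))%nat with j by lia. ring. }
have H2a : forall a, c3 (a+a) 0 -> c3 a 0.
{ intros a [x E]. exists (x*2-a)%Z. lia. }
destruct m as [|m].
{ intros i Hi. assert (i = 0)%nat as -> by lia. apply H2a. specialize (HS 0%nat ltac:(lia)). subst w. change (zs 0) with 1%Z in HS. simpl (2*0-0)%nat in HS. rewrite Z.mul_1_l in HS. exact HS. }
(* Restricted to the multiples of [X^3 Y - X Y^3], the functional becomes one of degree [w-4] with
   the same relations; the Hecke relation acquires the determinant [n], invertible modulo 3. It
   vanishes by induction, so away from the ends [h] depends only on parity. *)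
have Hstep : forall j, (1 <= j)%nat -> (j+3 <= w)%nat -> c3 (h (j+2)%nat) (h j).
{ intros j Hj1 Hj2. destruct m as [|m]; [lia|]. set (w' := (2*m)%nat). have Ew : w = (w'+4)%nat by lia.
  have Hh : c3 (h (j-1+3)%nat-h (j-1+1)%nat) 0.
  { apply (IH m ltac:(lia) w' (fun i => (h (i+3)%nat-h (i+1)%nat)%Z) eq_refl); [| | |lia].
    - intros c Hc. rewrite <- !pair_TH by (try apply Sact_supp; exact Hc). rewrite <- Ew.
      eapply c3_trans; [|apply (R1 (TH c)); rewrite Ew; apply TH_supp, Hc]. apply c3_add; [apply c3_refl|]. apply pair_ceq. rewrite Ew. intros i. apply c3_sym, Sact_TH, Hc.
    - intros c Hc. rewrite <- !pair_TH by (try apply Uact_supp; exact Hc). rewrite <- Ew.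
      have E1 : ceq (Uact w 1 1 1 (TH c)) (TH (Uact w' 1 1 1 c)) by (rewrite Ew; exact (ga_TH w' GT c Hc)).
      have E2 : ceq (Uact w 1 (-1) 1 (Sact w (TH c))) (TH (Uact w' 1 (-1) 1 (Sact w' c))).
      { rewrite Ew. eapply ceq_trans; [apply Uact_ceq, Sact_TH, Hc|]. exact (ga_TH w' GU (Sact w' c) (Sact_supp w' c)). }
      eapply c3_trans; [apply c3_sym, pair_ceq, E1|]. eapply c3_trans; [apply (R2 (TH c)); rewrite Ew; apply TH_supp, Hc|].
      apply c3_add; [apply c3_refl|apply pair_ceq, E2].
    - intros c Hc. have E := R3 (TH c) ltac:(rewrite Ew; apply TH_supp, Hc).
      have E1 : c3 (hecke_pairing w n ws h (TH c)) (Z.of_nat n*hecke_pairing w' n ws (fun i => (h (i+3)%nat-h (i+1)%nat)%Z) c).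
      { unfold hecke_pairing. rewrite <- Zsum_scal. apply c3_Zsum. intros d Hd%in_seq. destruct (dvdb d n) eqn:Ed; [|apply c3_eq; ring].
        rewrite <- Zsum_scal. apply c3_Zsum. intros b _. unfold hact. apply dvdb_iff in Ed; [|lia]. destruct Ed as [e Ee]. rewrite Ee, Nat.div_mul by lia.
        rewrite <- pair_TH by (apply cw_supp, Uact_supp). rewrite <- Ew, Nat2Z.inj_mul.
        have Hcw : forall s k c1, ceq (cw w s (fun j => (k*c1 j)%Z)) (fun j => (k*cw w s c1 j)%Z).
        { intros s k. induction s as [|x s IHs]; intros c1 j0; [apply c3_eq; simpl; ring|]. cbn [cw].
          have Eg : ceq (ga w x (fun j => (k*c1 j)%Z)) (fun j => (k*ga w x c1 j)%Z).
          { intros j1. apply c3_eq. destruct x; cbn [ga]; unfold Sact, Uact.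
            - destruct (j1 <=? w)%nat; ring.
            - rewrite <- Zsum_scal. apply Zsum_ext. lia.
            - rewrite <- Zsum_scal. apply Zsum_ext. lia. }
          eapply c3_trans; [apply c3_add; [apply c3_refl|eapply c3_trans; [apply (cw_ceq w s _ _ Eg)|apply IHs]]|]. apply c3_eq. destruct x; ring. }
        have E2 : ceq (cw w (ws d b) (Uact w (Z.of_nat d) (- Z.of_nat b) (Z.of_nat e) (TH c)))
           (fun j => (Z.of_nat e*Z.of_nat d*TH (cw w' (ws d b) (Uact w' (Z.of_nat d) (- Z.of_nat b) (Z.of_nat e) c)) j)%Z).
        { eapply ceq_trans; [apply cw_ceq; rewrite Ew; apply (Uact_TH w' _ _ _ c Hc)|]. eapply ceq_trans; [apply Hcw|]. intros j0.
          apply c3_trans with (Z.of_nat d*Z.of_nat e*TH (cw w' (ws d b) (Uact w' (Z.of_nat d) (- Z.of_nat b) (Z.of_nat e) c)) j0)%Z; [|apply c3_eq; ring].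
          apply c3_mul; [apply c3_refl|]. rewrite Ew. apply cw_TH, Uact_supp. }
        eapply c3_trans; [apply pair_ceq, E2|]. apply c3_eq. unfold pair. rewrite <- Zsum_scal. apply Zsum_ext. lia. }
      have E3 := c3_trans _ _ _ (c3_sym _ _ E1) E. apply (proj1 (c3_0 _)) in E3. apply (proj2 (c3_0 _)). destruct (prime_mult 3 prime_3 _ _ E3); go. }
  replace (j-1+3)%nat with (j+2)%nat in Hh by lia. replace (j-1+1)%nat with j in Hh by lia. destruct Hh as [x E]. exists x. lia. }
have Hodd : forall i, (2*i+1 < w)%nat -> c3 (h (2*i+1)%nat) (h 1%nat).
{ induction i as [|i IHi]; intros Hi; [apply c3_refl|]. replace (2*S i+1)%nat with (2*i+1+2)%nat by lia. eapply c3_trans; [apply Hstep; lia|apply IHi; lia]. }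
have Heven : forall i, (1 <= i)%nat -> (2*i < w)%nat -> c3 (h (2*i)%nat) (h 2%nat).
{ induction i as [|i IHi]; intros Hi1 Hi; [lia|]. destruct (Nat.eq_dec i 0) as [->|Hi0]; [apply c3_refl|]. replace (2*S i)%nat with (2*i+2)%nat by lia.
  eapply c3_trans; [apply Hstep; lia|apply IHi; lia]. }
(* The inversion exchanges [2 i] and [w - 2 i] with sign plus, so twice the common value is 0. *)
have Heven0 : forall i, (1 <= i)%nat -> (2*i < w)%nat -> c3 (h (2*i)%nat) 0.
{ intros i Hi1 Hi2. eapply c3_trans; [apply Heven; assumption|]. apply H2a. specialize (HS (2*i)%nat ltac:(lia)).
  replace (zs (2*i)) with 1%Z in HS by (unfold zs; rewrite Nat.even_mul; easy). rewrite Z.mul_1_l in HS. replace (w-2*i)%nat with (2*(S m-i))%nat in HS by lia.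
  eapply c3_trans; [|exact HS]. apply c3_add; apply c3_sym, Heven; lia. }
set (u := h 1%nat). set (h0 := h 0%nat).
have Hhw : c3 (h w) (- h0).
{ specialize (HS 0%nat ltac:(lia)). rewrite Nat.sub_0_r in HS. change (zs 0) with 1%Z in HS. destruct HS as [x E]. exists x. lia. }
(* Only [h0] at the two ends, with opposite signs, and [u] at the odd indices are left. These are
   evaluations at the four points of the projective line over the field with three elements; at odd
   indices the last two give [-2 u], which is [u] modulo 3. *)
have HE : forall c, c3 (pair w h c) (h0*(Ez w c (0, 1)%Z-Ez w c (1, 0)%Z)-u*(Ez w c (1, 1)%Z-Ez w c (-1, 1)%Z)).
{ intros c. unfold Ez. cbn [fst snd].
  set (g := fun i => (h0*(0^Z.of_nat i*1^Z.of_nat (w-i)) + - h0*(1^Z.of_nat i*0^Z.of_nat (w-i)) + - u*(1^Z.of_nat i*1^Z.of_nat (w-i))+u*((-1)^Z.of_nat i*1^Z.of_nat (w-i)))%Z).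
  apply c3_trans with (Zsum (seq 0 (S w)) (fun i => g i*c i)%Z).
  - apply c3_Zsum. intros i Hi%in_seq. apply c3_mul; [|apply c3_refl]. unfold g. rewrite !Z.pow_1_l by lia.
    replace ((-1)^Z.of_nat i)%Z with (zs i) by (change (-1)%Z with (- (1))%Z; rewrite zs_Zpow, Z.pow_1_l by lia; ring).
    have P0 : forall x, (1 <= x)%nat -> (0^Z.of_nat x = 0)%Z by (intros x Hx; apply Z.pow_0_l; lia).
    destruct (Nat.eq_dec i 0) as [->|Hi0]; [|destruct (Nat.eq_dec i w) as [->|Hiw]].
    + rewrite Nat.sub_0_r, (P0 w) by lia. change (zs 0) with 1%Z. change (0^Z.of_nat 0)%Z with 1%Z. apply c3_eq. lia.
    + rewrite Nat.sub_diag, (P0 w) by lia. change (0^Z.of_nat 0)%Z with 1%Z. replace (zs w) with 1%Z by (unfold zs; rewrite Hw, Nat.even_mul; easy).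
      eapply c3_trans; [exact Hhw|]. apply c3_eq. ring.
    + rewrite (P0 i), (P0 (w-i)%nat) by lia. destruct (Nat.Even_or_Odd i) as [[t Et]|[t Et]].
      * replace (zs i) with 1%Z by (unfold zs; rewrite Et, Nat.even_mul; easy). eapply c3_trans; [rewrite Et; apply Heven0; lia|]. apply c3_eq. ring.
      * replace (zs i) with (-1)%Z by (unfold zs; rewrite Et, Nat.add_1_r, Nat.even_succ, <- Nat.negb_even, Nat.even_mul; easy).
        eapply c3_trans; [rewrite Et; apply Hodd; lia|]. fold u. exists u. ring.
  - apply c3_eq. unfold g. rewrite (Zsum_ext _ _ (fun i => h0*(c i*(0^Z.of_nat i*1^Z.of_nat (w-i)))+(- h0*(c i*(1^Z.of_nat i*0^Z.of_nat (w-i))) +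
      (- u*(c i*(1^Z.of_nat i*1^Z.of_nat (w-i)))+u*(c i*((-1)^Z.of_nat i*1^Z.of_nat (w-i))))))%Z) by lia.
    rewrite !Zsum_plus, !Zsum_scal. ring. }
have Hw2 : forall x, c3 x 0 \/ c3 (x^Z.of_nat w) 1.
{ intros x. destruct (excluded_middle_informative (3 | x)%Z) as [D|D]; [left; apply c3_0, D|right]. rewrite Hw. apply c3_even_pow, D. }
(* The three-term relation tested on [X^w]: the left side is [-u], while the two terms on the right
   are [-h0] and [h0]. *)
have Hu : c3 u 0.
{ have E := R2 (delta w) (delta_supp w w (le_n w)). have P0 : (0^Z.of_nat w = 0)%Z by (apply Z.pow_0_l; lia).
  have Pm : ((-1)^Z.of_nat w = 1)%Z by (change (-1)%Z with (- (1))%Z; rewrite zs_Zpow, Z.pow_1_l by lia; unfold zs; rewrite Hw, Nat.even_mul; easy).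
  have A1 := HE (Uact w 1 1 1 (delta w)). have A2 := HE (delta w). have A3 := HE (Uact w 1 (-1) 1 (Sact w (delta w))).
  rewrite !Ez_Uact, !Ez_delta in A1 by lia. rewrite !Ez_delta in A2 by lia. rewrite !Ez_Uact, !Ez_Sact, !Ez_delta in A3 by lia. cbn [fst snd] in A1, A2, A3.
  rewrite !Nat.sub_diag in A1, A2, A3. change (Z.of_nat 0) with 0%Z in A1, A2, A3. rewrite !Z.pow_0_r in A1, A2, A3.
  change (1*0+1*1)%Z with 1%Z in A1. change (1*1+1*0)%Z with 1%Z in A1. change (1*1+1*1)%Z with 2%Z in A1. change (1 * -1+1*1)%Z with 0%Z in A1.
  change (- (1*1))%Z with (-1)%Z in A3. change (- (1*0))%Z with 0%Z in A3.
  rewrite P0, Pm, ?Z.pow_1_l in A2 by lia. rewrite P0, ?Z.pow_1_l in A1 by lia. rewrite P0, Pm in A3.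
  have P2 : c3 (2^Z.of_nat w) 1 by (destruct (Hw2 2%Z) as [[x Ex]|P]; [lia|exact P]).
  assert (A1' : c3 (pair w h (Uact w 1 1 1 (delta w))) (- u)).
  { eapply c3_trans; [exact A1|]. apply c3_trans with (h0*(1*1-1*1)-u*(1*1-0*1))%Z; [|apply c3_eq; ring].
    apply c3_sub; [apply c3_refl|]. apply c3_mul; [apply c3_refl|]. apply c3_sub; [apply c3_mul; [exact P2|apply c3_refl]|apply c3_refl]. }
  have A4 := c3_trans _ _ _ (c3_trans _ _ _ (c3_sym _ _ A1') E) (c3_add _ _ _ _ A2 A3). destruct A4 as [x Ex]. exists (- x)%Z. lia. }
assert (HE' : forall c, c3 (pair w h c) (h0*(Ez w c (0, 1)%Z-Ez w c (1, 0)%Z))).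
{ intros c. eapply c3_trans; [apply HE|]. apply c3_trans with (h0*(Ez w c (0, 1)%Z-Ez w c (1, 0)%Z)-0*(Ez w c (1, 1)%Z-Ez w c (-1, 1)%Z))%Z; [|apply c3_eq; ring].
  apply c3_sub; [apply c3_refl|apply c3_mul; [exact Hu|apply c3_refl]]. }
(* The functional is now a coboundary: along a word it telescopes to a difference of evaluations at
   the image of [(1, 0)] and at [(1, 0)]. *)
have Hcw : forall s c, c3 (pair w h (cw w s c)) (h0*(Ez w c (wv s (1, 0)%Z)-Ez w c (1, 0)%Z)).
{ induction s as [|x s IHs]; intros c.
  - apply c3_eq. simpl wv. rewrite Z.sub_diag, Z.mul_0_r. apply Zsum_zero. intros i _. simpl. ring.
  - cbn [cw]. rewrite pair_plus. change (wv (x :: s) (1, 0)%Z) with (gv x (wv s (1, 0)%Z)). specialize (IHs (ga w x c)). rewrite !Ez_ga in IHs.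
    have E1 : c3 (pair w h (fun i => match x with GS => c i | _ => 0%Z end)) (h0*(Ez w c (gv x (1, 0)%Z)-Ez w c (1, 0)%Z)).
    { destruct x; cbn [gv fst snd].
      - auto.
      - apply c3_eq. change (1+0)%Z with 1%Z. rewrite Z.sub_diag, Z.mul_0_r. apply Zsum_zero. lia.
      - apply c3_eq. change (1-0)%Z with 1%Z. rewrite Z.sub_diag, Z.mul_0_r. apply Zsum_zero. lia. }
    eapply c3_trans; [exact (c3_add _ _ _ _ E1 IHs)|]. apply c3_eq. ring. }
(* Test on [Y^w]. Each pair [(d, b)] contributes [h0], because the entry evaluated is prime to 3 and
   [w] is even; there are [d] values of [b] for each [d], so the total is [h0] times the divisor
   sum. *)
have Hh0 : c3 h0 0.
{ have E := R3 (delta 0) (delta_supp w 0 ltac:(lia)).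
  have E1 : c3 (hecke_pairing w n ws h (delta 0)) (h0*Zsum (seq 1 n) (fun d => if dvdb d n then Z.of_nat d else 0%Z)).
  { unfold hecke_pairing. rewrite <- Zsum_scal. apply c3_Zsum. intros d Hd%in_seq. destruct (dvdb d n) eqn:Ed; [|apply c3_eq; ring].
    apply c3_trans with (Zsum (seq 0 d) (fun _ => h0)).
    - apply c3_Zsum. intros b _. eapply c3_trans; [apply Hcw|]. unfold hact. rewrite !Ez_Uact, !Ez_delta by lia. cbn [fst snd].
      rewrite Nat.sub_0_r. change (Z.of_nat 0) with 0%Z. rewrite !Z.pow_0_r, Z.mul_0_r, (Z.pow_0_l (Z.of_nat w)) by lia.
      destruct (Hws d b ltac:(lia) Ed) as [al Hal]. set (y := snd (wv (ws d b) (1, 0)%Z)) in *.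
      apply dvdb_iff in Ed; [|lia]. destruct Ed as [e Ee]. rewrite Ee, Nat.div_mul by lia.
      have Hey : ~ (3 | Z.of_nat e*y)%Z.
      { intros [x Ex]. apply Hn3. rewrite Ee, Nat2Z.inj_mul. destruct Hal as [Hal|Hal]; [exists (al*x)%Z|exists (- (al*x))%Z]; nia. }
      destruct (Hw2 (Z.of_nat e*y)%Z) as [P|P]; [exfalso; apply Hey, c3_0, P|].
      apply c3_trans with (h0*(1*1-1*0))%Z; [|apply c3_eq; ring]. apply c3_mul; [apply c3_refl|]. apply c3_sub; [|apply c3_refl]. apply c3_mul; [apply c3_refl|exact P].
    - apply c3_eq. clear. assert (forall a, Zsum (seq a d) (fun _ => h0) = (h0*Z.of_nat d)%Z); [|apply H].
      induction d as [|d IHd]; intros a; [simpl; ring|]. cbn [seq Zsum]. rewrite IHd, Nat2Z.inj_succ. ring. }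
  have E2 := c3_trans _ _ _ (c3_sym _ _ E1) E. apply (proj1 (c3_0 _)) in E2. apply (proj2 (c3_0 _)). destruct (prime_mult 3 prime_3 _ _ E2); go. }
intros i Hi. destruct (Nat.eq_dec i 0) as [->|Hi0]; [exact Hh0|]. destruct (Nat.eq_dec i w) as [->|Hiw].
- eapply c3_trans; [exact Hhw|]. destruct Hh0 as [x Ex]. exists (- x)%Z. lia.
- destruct (Nat.Even_or_Odd i) as [[t Et]|[t Et]].
  + rewrite Et. apply Heven0; lia.
  + rewrite Et. eapply c3_trans; [apply Hodd; lia|exact Hu].
Qed.

Lemma eigen_nonzero k f A (Hf : normalized_eigenform k f A) n : (1 <= n)%nat -> ~ (3 | Z.of_nat n)%Z ->
  ~ (3 | Zsum (seq 1 n) (fun d => if dvdb d n then Z.of_nat d else 0%Z))%Z -> A n <> 0.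
Proof.
intros Hn Hn3 Hsig HA. destruct (weight_even_pos _ _ _ Hf) as [[m' Hk] Hk1]. set (m := (m'-1)%nat). set (w := (2*m)%nat). have Ek : k = S (S w) by lia.
set (a := acoef k A). have Ha : sub a by apply (acoef_sub _ _ _ Hf). have H0 : acoef k A n = RtoC 0 by (unfold acoef; rewrite HA, Rmult_0_l; easy).
have HS : forall z, uhp z -> qs a (- / z)%C = (z^S (S w)*qs a z)%C by (intros z Hz; rewrite <- Ek; apply (qs_S _ _ _ Hf z Hz)).
have Ha1 : a 1%nat <> RtoC 0 by (unfold a; rewrite (acoef_1 _ _ _ Hf); apply C1_nz). destruct (period_relation k w f A Hf n Ek Hn H0) as (ws & Hws & R3).
destruct (phi_nonzero a w Ha HS Ha1) as (i1 & Hi1 & Hp1).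
destruct (relations_mod3 (S w) (phi a w)) as (h & (i0 & Hi0 & Hh0) & Hrel); [exists i1; split; [lia|exact Hp1]|].
have Hr : forall c, phiL a w c = RtoC 0 -> c3 (pair w h c) 0 by (intros c Hc; apply (proj2 (c3_0 _)), Hrel, Hc).
have Hphm : forall c c', phiL a w c = phiL a w c' -> c3 (pair w h c) (pair w h c').
{ intros c c' E. have D : c3 (pair w h (fun i => (c i + -1*c' i)%Z)) 0.
  { apply Hr. rewrite phiL_plus, E. unfold phiL. rewrite <- Csum_plus. apply Csum_zero. intros i _. rewrite zr_mult; go. }
  rewrite pair_plus in D. have E1 : pair w h (fun i => (-1*c' i)%Z) = (- pair w h c')%Z.
  { unfold pair. replace (- Zsum (seq 0 (S w)) (fun i => h i*c' i))%Z with (-1*Zsum (seq 0 (S w)) (fun i => h i*c' i))%Z by ring. rewrite <- Zsum_scal. apply Zsum_ext. lia. }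
  rewrite E1 in D. destruct D as [x D]. exists x. lia. }
apply Hh0, (proj1 (c3_0 _)). revert i0 Hi0 Hh0. assert (Hfin : forall i, (i <= w)%nat -> c3 (h i) 0); [|intros i0 Hi0 _; apply Hfin; lia].
apply (devissage n ws Hn Hn3 Hsig Hws m w h eq_refl).
(* The relation given by the square of the inversion. *)
- intros c _. rewrite <- pair_plus. apply Hr. rewrite <- (phiL_zero a w). change (fun _ : nat => 0%Z) with (cw w [] c).
  rewrite <- (word_relation a w [GS; GS] [] c Ha HS).
  + unfold phiL. apply Csum_ext. intros i _. cbn [cw ga]. rewrite Z.add_0_r. auto.
  + intros z Hz; go.
(* The relation [T S T = S U S]: both send [z] to [z/(z+1)]. *)
- intros c _. rewrite <- pair_plus. apply Hphm. have E := word_relation a w [GT; GS; GT] [GS; GU; GS] c Ha HS.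
  assert (E' : forall z, uhp z -> wz [GT; GS; GT] z = wz [GS; GU; GS] z).
  { intros z Hz. have Hz0 := H_neq0 z Hz. have Hz1 := H_neq0 _ (uhp_shift z 1 Hz). cbn [wz fold_right gz].
    change (-1)%Z with (- (1))%Z. rewrite zr_opp. change (zr 1) with (RtoC 1) in *. field. repeat split; try assumption. intros Ez. apply Hz1.
    replace (z+1)%C with (- (RtoC (-1)+RtoC (-1)*z))%C; [rewrite Ez; ring|]. fd. }
  specialize (E E'). transitivity (phiL a w (cw w [GT; GS; GT] c)); [|rewrite E]; unfold phiL; apply Csum_ext; intros i _; cbn [cw ga]; rewrite ?Z.add_0_r, ?Z.add_0_l; easy.
- intros c _. eapply c3_trans; [|apply (Hr _ (R3 c))]. apply c3_eq. unfold hecke_pairing, pair.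
  rewrite (Zsum_ext (seq 0 (S w)) _ (fun i => Zsum (seq 1 n) (fun d => h i*(if dvdb d n then Zsum (seq 0 d) (fun b => cw w (ws d b) (hact w n d b c) i) else 0))%Z)) by (intros; rewrite Zsum_scal; easy).
  rewrite Zsum_swap. apply Zsum_ext. intros d _. destruct (dvdb d n); [|symmetry; apply Zsum_zero; intros; ring].
  rewrite Zsum_swap. apply Zsum_ext. intros i _. rewrite <- Zsum_scal. lia.
Qed.

(** * Nonvanishing at good primes and at sixth powers *)

Lemma Zsum_perm {A} (l l' : list A) f : Permutation l l' -> Zsum l f = Zsum l' f.
Proof. induction 1; simpl; lia. Qed.

Lemma Zsum_filter {A} (l : list A) t f : Zsum (filter t l) f = Zsum l (fun x => if t x then f x else 0%Z).
Proof. induction l as [|x l IH]; [auto|]. simpl. destruct (t x); simpl; lia. Qed.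

Lemma Zsum_map {A B} (g : A -> B) l f : Zsum (map g l) f = Zsum l (fun x => f (g x)).
Proof. induction l as [|x l IH]; [auto|]. simpl. lia. Qed.

Lemma rp_prime p m : nprime p -> ~ Nat.divide p m -> rp p m.
Proof.
intros Hp Hm. apply prime_rel_prime; [exact Hp|]. intros [x E]. apply Hm. exists (Z.to_nat x). lia.
Qed.

Lemma divide_prime_pow p m d : nprime p -> Nat.divide d (p^m) -> exists i, (i <= m)%nat /\ d = (p^i)%nat.
Proof.
intros Hp. have H2 := nprime_ge2 p Hp. revert d. induction m as [|m IH]; intros d Hd.
- exists 0%nat. split; [lia|]. apply Nat.divide_1_r, Hd.
- destruct (excluded_middle_informative (Nat.divide p d)) as [[e He]|Hn].
  + subst d. simpl in Hd. rewrite (Nat.mul_comm e p) in Hd. apply Nat.mul_divide_cancel_l in Hd; [|lia]. destruct (IH e Hd) as (i & Hi & ->).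
    exists (S i). split; [lia|]. simpl. ring.
  + simpl in Hd. apply rp_gauss in Hd; [|apply rp_sym, rp_prime; assumption]. destruct (IH d Hd) as (i & Hi & ->). exists i. lia.
Qed.

Lemma divisor_sum_prime_pow p m : nprime p ->
  Zsum (seq 1 (p^m)) (fun d => if dvdb d (p^m) then Z.of_nat d else 0%Z) = Zsum (seq 0 (S m)) (fun i => (Z.of_nat p^Z.of_nat i)%Z).
Proof.
intros Hp. have H2 := nprime_ge2 p Hp. rewrite <- Zsum_filter. rewrite (Zsum_perm _ (map (Nat.pow p) (seq 0 (S m)))).
- rewrite Zsum_map. apply Zsum_ext. intros i _. apply Nat2Z.inj_pow.
- apply NoDup_Permutation.
  + apply NoDup_filter, seq_NoDup.
  + apply NoDup_map_NoDup_ForallPairs; [|apply seq_NoDup]. intros x y _ _ E. apply (Nat.pow_inj_r p); go.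
  + intros d. rewrite filter_In, in_map_iff, in_seq. split.
    * intros [Hd Hdv]. apply dvdb_iff in Hdv; [|lia]. destruct (divide_prime_pow p m d Hp Hdv) as (i & Hi & ->). exists i; go.
    * intros (i & <- & Hi). apply in_seq in Hi. assert (1 <= p^i)%nat by (apply Nat.neq_0_lt_0, Nat.pow_nonzero; lia).
      have D : Nat.divide (p^i) (p^m) by (exists (p^(m-i))%nat; rewrite <- Nat.pow_add_r; f_equal; lia).
      assert (1 <= p^m)%nat by (apply Nat.neq_0_lt_0, Nat.pow_nonzero; lia). split; [|apply dvdb_iff; assumption]. apply Nat.divide_pos_le in D; lia.
Qed.

(** As [p^2] is 1 modulo 3, six consecutive powers of [p] add up to [3 (1+p)], that is 0, modulo 3;
    the divisor sum of [p^(6 e)] is thus congruent to 1. *)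
Lemma eigen_prime_pow k f A (Hf : normalized_eigenform k f A) p e : nprime p -> p <> 3%nat -> A (p^(6*e))%nat <> 0.
Proof.
intros Hp Hp3. have H2 := nprime_ge2 p Hp.
have N3 : ~ (3 | Z.of_nat p)%Z.
{ intros D. apply prime_div_prime in D; [|exact prime_3|exact Hp]. lia. }
have S2 : c3 (Z.of_nat p*Z.of_nat p) 1 by (apply c3_square, N3). apply (eigen_nonzero _ _ _ Hf).
- apply Nat.neq_0_lt_0, Nat.pow_nonzero; lia.
- rewrite Nat2Z.inj_pow. replace (Z.of_nat (6*e)) with (Z.of_nat (2*(3*e))) by lia. intros D.
  have E := c3_even_pow (Z.of_nat p) (3*e) N3. apply (proj2 (c3_0 _)) in D. destruct (c3_trans _ _ _ (c3_sym _ _ E) D) as [x Ex]. lia.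
- rewrite divisor_sum_prime_pow by exact Hp. set (q := Z.of_nat p) in *.
  have H : c3 (Zsum (seq 0 (S (6*e))) (fun i => (q^Z.of_nat i)%Z)) 1.
  { induction e as [|e IH]; [apply c3_refl|]. replace (S (6*S e)) with (S (S (S (S (S (S (S (6*e)))))))) by lia.
    rewrite 6 Zsum_seq_S. cbn [Nat.add]. set (s := Zsum (seq 0 (S (6*e))) _) in *. rewrite !Zpow_S. set (r := (q^Z.of_nat (6*e))%Z).
    destruct IH as [x Ex]. destruct S2 as [y Ey]. exists (x+r*q*(1+q)*(1+3*y+3*y*y))%Z. lia. }
  intros D. apply (proj2 (c3_0 _)) in D. destruct (c3_trans _ _ _ (c3_sym _ _ H) D) as [x Ex]. lia.
Qed.

Lemma eigen_good_prime k f A (Hf : normalized_eigenform k f A) p : good p -> A p <> 0.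
Proof.
intros [Hp Hm]. have Ep : (p = 12*(p/12)+1)%nat by (rewrite <- Hm at 3; apply Nat.div_mod; lia).
rewrite <- (Nat.pow_1_r p). apply (eigen_nonzero _ _ _ Hf); rewrite ?divisor_sum_prime_pow by exact Hp.
- rewrite Nat.pow_1_r. lia.
- rewrite Nat.pow_1_r. intros [x Ex]. lia.
- cbn [Zsum seq]. change (Z.of_nat 0) with 0%Z. change (Z.of_nat 1) with 1%Z. rewrite Z.pow_0_r, Z.pow_1_r. intros [x Ex]. lia.
Qed.

Lemma prime_power_part p j : (2 <= p)%nat -> (1 <= j)%nat -> exists e m, (j = p^e*m)%nat /\ ~ Nat.divide p m.
Proof.
intros Hp. induction j as [j IH] using lt_wf_ind. intros Hj. destruct (excluded_middle_informative (Nat.divide p j)) as [[x Hx]|H].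
- destruct (IH x) as (e & m & E & H); [nia|nia|]. exists (S e), m. split; [|exact H]. rewrite Hx, E. simpl. ring.
- exists 0%nat, j. split; [simpl; ring|exact H].
Qed.

Lemma eigen_sixth_power k f A (Hf : normalized_eigenform k f A) j : (1 <= j)%nat -> (j mod 3 <> 0)%nat -> A (j^6)%nat <> 0.
Proof.
destruct (eigenform_multiplicative _ _ _ Hf) as [HA1 HAm].
induction j as [j IH] using lt_wf_ind. intros Hj Hj3. destruct (Nat.eq_dec j 1) as [->|Hj1]; [rewrite Nat.pow_1_l, HA1; lra|].
destruct (prime_divisor j ltac:(lia)) as (p & Hp & Hdv). have H2 := nprime_ge2 p Hp. destruct (prime_power_part p j H2 Hj) as (e & m & E & Hm).
have M1 : (1 <= m)%nat by lia.
have He : (2 <= p^e)%nat.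
{ destruct e as [|e]; [exfalso; apply Hm; rewrite E in Hdv; simpl in Hdv; rewrite Nat.add_0_r in Hdv; exact Hdv|].
  simpl. assert (1 <= p^e)%nat by (apply Nat.neq_0_lt_0, Nat.pow_nonzero; lia). nia. }
have Hdiv3 : forall a b, j = (a*b)%nat -> (a mod 3 <> 0)%nat.
{ intros a b Eab H. apply Hj3. apply Nat.Lcm0.mod_divide in H. destruct H as [x Hx]. apply Nat.Lcm0.mod_divide. exists (x*b)%nat. lia. }
replace (j^6)%nat with (p^(6*e)*m^6)%nat by (rewrite E, Nat.pow_mul_l, <- Nat.pow_mul_r; f_equal; f_equal; lia). rewrite HAm.
- apply Rmult_integral_contrapositive_currified.
  + apply (eigen_prime_pow _ _ _ Hf p e Hp). intros ->. destruct Hdv as [x Hx]. apply (Hdiv3 3%nat x); [lia|auto].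
  + apply IH; [nia|exact M1|]. apply (Hdiv3 m (p^e)%nat). lia.
- apply Nat.neq_0_lt_0, Nat.pow_nonzero; lia.
- apply Nat.neq_0_lt_0, Nat.pow_nonzero; lia.
- apply rp_pow_l, rp_pow_r, rp_prime; assumption.
Qed.

(** * Counting sign changes *)

Lemma count_app l1 l2 : (count_sign_changes l1+count_sign_changes l2 <= count_sign_changes (l1 ++ l2))%nat.
Proof.
induction l1 as [|u l1 IH]; [auto|]. destruct l1 as [|v l1].
- destruct l2 as [|v l2]; [easy|]. simpl. lia.
- change ((u :: v :: l1) ++ l2) with (u :: v :: l1 ++ l2).
  have E : forall l, count_sign_changes (u :: v :: l) = ((if Rlt_dec (u*v) 0 then 1 else 0)+count_sign_changes (v :: l))%nat by easy.
  rewrite !E. simpl ((v :: l1) ++ l2) in IH. lia.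
Qed.

Lemma count_zero u l : List.Forall (fun v => v <> 0) (u :: l) -> count_sign_changes (u :: l) = 0%nat -> List.Forall (fun v => 0 < u*v) (u :: l).
Proof.
revert u. induction l as [|w l IH]; intros u Hnz Hc; inversion_clear Hnz as [|? ? Hu Hl].
- constructor; [|auto]. nra.
- have E : count_sign_changes (u :: w :: l) = ((if Rlt_dec (u*w) 0 then 1 else 0)+count_sign_changes (w :: l))%nat by easy.
  rewrite E in Hc. destruct (Rlt_dec (u*w) 0) as [|Huw]; [lia|]. have Hw : w <> 0 by (inversion Hl; assumption).
  constructor; [nra|]. eapply Forall_impl; [|apply (IH w Hl Hc)]. intros v Hv. nra.
Qed.

Lemma count_positive l : List.Forall (fun v => v <> 0) l -> (exists u v, In u l /\ In v l /\ u < 0 < v) -> (1 <= count_sign_changes l)%nat.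
Proof.
intros Hnz (u & v & Hu & Hv & Huv). destruct l as [|x l]; [easy|]. destruct (count_sign_changes (x :: l)) as [|c] eqn:E; [|lia]. exfalso.
have H := count_zero x l Hnz E. rewrite Forall_forall in H. pose proof (H u Hu). pose proof (H v Hv). nra.
Qed.

(** Cutting at the indices [t j] gives [N] consecutive blocks, each containing both signs;
    concatenation never loses a sign change. *)
Lemma nb_sign_changes_ge (I : nat -> Prop) (A : nat -> R) (x y : R) (t : nat -> nat) (N : nat) :
  (forall j, (j < N)%nat -> exists m n, (I m /\ x <= INR m <= y /\ (t j <= m < t (S j))%nat) /\ (I n /\ x <= INR n <= y /\ (t j <= n < t (S j))%nat) /\ A m < 0 < A n) ->
  (t N <= Z.to_nat (up y))%nat -> (N <= nb_sign_changes I A x y)%nat.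
Proof.
intros H Hy. unfold nb_sign_changes, nonzero_terms. set (P := fun n => if excluded_middle_informative _ then true else false).
have Hcat : forall a b l, (count_sign_changes (map A (filter P (seq a b)))+count_sign_changes (map A (filter P l)) <= count_sign_changes (map A (filter P (seq a b ++ l))))%nat.
{ intros a b l. rewrite filter_app, map_app. apply count_app. }
have Hseq : forall a b, (a <= b)%nat -> seq 0 b = seq 0 a ++ seq a (b-a) by (intros a b Hab; change (seq a (b-a)) with (seq (0+a) (b-a)); rewrite <- seq_app; f_equal; lia).
apply Nat.le_trans with (count_sign_changes (map A (filter P (seq 0 (t N))))).
- clear Hy. induction N as [|N IH]; [lia|]. destruct (H N (Nat.lt_succ_diag_r N)) as (m & n & (Im & Hm & Hmt) & (In' & Hn & Hnt) & Hs).
  rewrite (Hseq (t N) (t (S N))) by lia. eapply Nat.le_trans; [|apply Hcat]. specialize (IH (fun j Hj => H j ltac:(lia))).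
  have HP : forall i, P i = true <-> I i /\ x <= INR i <= y /\ A i <> 0.
  { intros i. unfold P. destruct (excluded_middle_informative _) as [Hi|Hi]; split; intros; auto; try discriminate; go. }
  enough (1 <= count_sign_changes (map A (filter P (seq (t N) (t (S N)-t N)))))%nat by lia. apply count_positive.
  + apply Forall_forall. intros v (i & <- & Hi)%in_map_iff. apply filter_In in Hi. apply (HP i), Hi.
  + exists (A m), (A n). split; [|split; [|exact Hs]]; apply in_map, filter_In; (split; [apply in_seq; lia|apply HP]); (split; [assumption|lra]).
- rewrite (Hseq (t N) _ Hy). eapply Nat.le_trans; [|apply Hcat]. lia.
Qed.

Lemma short_interval_sign_change k f A (Hf : normalized_eigenform k f A) eps : 0 < eps <= 1/4 ->
  exists X0, forall X, X0 <= X -> has_sign_change sum_of_two_squares A X (X+Rpower X (1/2+eps)).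
Proof.
intros He. destruct (negative_square _ _ _ Hf) as (d & Hd & HA).
exact (sign_changes_of_multiplicative A (d*d) d eps (eigenform_multiplicative _ _ _ Hf) prime_sum_of_two_squares
  (eigen_good_prime _ _ _ Hf) (eigen_sixth_power _ _ _ Hf) eq_refl Hd HA prime_supply_holds He).
Qed.

Lemma up_le x y : x <= y -> (up x <= up y)%Z.
Proof.
intros H. destruct (archimed x), (archimed y). apply Z.lt_succ_r, lt_IZR. rewrite succ_IZR. lra.
Qed.

(** [N] intervals of length [L] are placed with gaps of length [L] between them. Each cut is the
    first integer beyond the end of an interval, and [L >= 1] ensures that it precedes the next
    one. *)
Lemma many_sign_changes (I : nat -> Prop) (A : nat -> R) (X L : R) (N : nat) : 1 <= L -> L <= X -> 2*INR N*L <= X ->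
  (forall Y, X <= Y <= 2*X -> has_sign_change I A Y (Y+L)) -> (N <= nb_sign_changes I A X (2*X))%nat.
Proof.
intros HL HLX HN H. set (r := fun j => X+(2*INR j-1)*L). set (t := fun j => Z.to_nat (up (r j))).
have Hr : forall j, 0 <= r j by (intros j; unfold r; pose proof (pos_INR j); nra).
have Ht : forall j, r j < INR (t j) <= r j+1.
{ intros j. destruct (archimed (r j)) as [H1 H2]. unfold t. rewrite INR_IZR_INZ, Z2Nat.id; [lra|]. apply le_IZR. specialize (Hr j). lra. }
apply (nb_sign_changes_ge _ _ _ _ t).
- intros j Hj. have HjN : INR j+1 <= INR N by (rewrite <- S_INR; apply le_INR; lia). have Hj0 := pos_INR j.
  have B : 2*INR j*L+2*L <= X by nra. have B0 : 0 <= 2*INR j*L by nra. destruct (H (X+2*INR j*L)) as (m & n & (Im & Hm) & (In' & Hn) & Hs); [lra|].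
  destruct (Ht j) as [_ T1]. destruct (Ht (S j)) as [T2 _]. unfold r in T1, T2. rewrite S_INR in T2.
  exists m, n. repeat match goal with |- _ /\ _ => split end; try assumption; try lra; try (apply INR_le; lra); try (apply INR_lt; lra).
- unfold t. apply Z2Nat.inj_le; [apply le_IZR; destruct (archimed (r N)); specialize (Hr N); lra|apply le_IZR; destruct (archimed (2*X)); lra|].
  apply up_le. unfold r. nra.
Qed.

Theorem theorem2 :
  generalized_lindelof ->
  forall (k : nat) (f : C -> C) (A : nat -> R),
    normalized_eigenform k f A ->
    forall eps : R, 0 < eps ->
      exists X0 : R, forall X : R, X0 <= X ->
        has_sign_change sum_of_two_squares A X (X + Rpower X (1 / 2 + eps)) /\
        Rpower X (1 / 2 - eps)
          <= INR (nb_sign_changes sum_of_two_squares A X (2 * X)).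
Proof.
(* Since [2 e <= eps], a factor [X^e >= 10] is left to absorb the constants of the count. *)
intros _ k f A Hf eps Heps. set (e := Rmin (eps/2) (1/4)). have He : 0 < e <= 1/4 by (split; [apply Rmin_pos; lra|apply Rmin_r]). have He2 : e <= eps/2 by apply Rmin_l.
destruct (short_interval_sign_change _ _ _ Hf e He) as [X1 H1]. destruct (ev_power 10 e (proj1 He)) as [X2 H2]. exists (Rmax X1 (Rmax X2 1)). intros X HX.
pose proof (Rmax_l X1 (Rmax X2 1)). pose proof (Rmax_r X1 (Rmax X2 1)). pose proof (Rmax_l X2 1). pose proof (Rmax_r X2 1).
have Pm : forall a b, a <= b -> Rpower X a <= Rpower X b by (intros; apply Rle_Rpower; lra). have P0 : Rpower X 0 = 1 by (apply Rpower_O; lra). split.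
- destruct (H1 X ltac:(lra)) as (m & n & (Im & Hm) & (In' & Hn) & Hs). exists m, n. assert (Rpower X (1/2+e) <= Rpower X (1/2+eps)) by (apply Pm; lra).
  split; [split; [exact Im|lra]|]. split; [split; [exact In'|lra]|exact Hs].
(* The factor 2 lets one length serve all starting points [Y <= 2 X]. *)
- set (L := 2*Rpower X (1/2+e)). have HE : 10 <= Rpower X e by (apply H2; lra). have HL1 : 1 <= Rpower X (1/2+e) by (rewrite <- P0; apply Pm; lra).
  have HS : Rpower X (1/2-eps)*(L*5) <= X.
  { unfold L. have E : Rpower X (1/2-eps)*Rpower X (1/2+e)*Rpower X e <= X.
    { rewrite <- !Rpower_plus. rewrite <- (Rpower_1 X) at 2 by lra. apply Pm. lra. }
    nra. }
  have HLX : 5*L <= X.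
  { unfold L. have E : Rpower X (1/2+e)*Rpower X e <= X.
    { rewrite <- Rpower_plus. rewrite <- (Rpower_1 X) at 2 by lra. apply Pm. lra. }
    nra. }
  destruct (nat_ceil (Rpower X (1/2-eps))) as (N & HN1 & HN2); [pos|]. via HN1. apply le_INR. apply (many_sign_changes _ _ X L); [unfold L; lra|lra| |].
  + nra.
  + intros Y HY. destruct (H1 Y ltac:(lra)) as (m & n & (Im & Hm) & (In' & Hn) & Hs). exists m, n.
    assert (Rpower Y (1/2+e) <= L).
    { unfold L. transitivity (Rpower (2*X) (1/2+e)); [apply Rle_Rpower_l; lra|].
      rewrite <- Rpower_mult_distr by lra. rmul. transitivity (Rpower 2 1); [apply Rle_Rpower; lra|rewrite Rpower_1; lra]. }
    split; [split; [exact Im|lra]|]. split; [split; [exact In'|lra]|exact Hs].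
Qed.
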